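(* Let $k$ be a fixed positive integer. Then, as $x\to\infty$ (with implied constant depending on $k$), \[ \sum_{n\le x }\Phi_k(n)= \frac{C_k}{k+1} x^{k+1} + O\big(x^k R_k(x)\big), \] where, if $k$ is odd, \[ C_k= \frac{6}{\pi^2}, \qquad R_k(x)=(\log x)^{2/3} (\log \log x)^{4/3}, \] and, if $k$ is even, \[ C_k=\frac{3}{4}\prod_{p>2} \left(1- \frac1{p^2} - \frac{(-1)^{k(p-1)/4}(p-1)}{p^{k/2+2}}\right), \qquad R_k(x)=\log x, \] the product being over all odd primes $p$.
   Context: For positive integers $k,n$, $\Phi_k(n)$ denotes the number of $k$-tuples $(x_1,\ldots,x_k)\in(\mathbb{Z}/n\mathbb{Z})^k$ such that $\gcd(x_1^2+\cdots+x_k^2,n)=1$. *)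

(* Defs.v *)
From HB Require Import structures.
From mathcomp Require Import all_boot all_order all_algebra.
From mathcomp Require Import all_classical all_reals all_analysis.
Set Implicit Arguments.
Unset Strict Implicit.
Unset Printing Implicit Defensive.
Import Order.TTheory GRing.Theory Num.Theory.
Import numFieldNormedType.Exports.
Local Open Scope classical_set_scope.
Local Open Scope ring_scope.

(* Residues mod n are represented by 'I_n, i.e., by 0, ..., n - 1 (the type
   'Z_n is the ring Z/nZ only for n > 1); the gcd condition does not depend on
   the choice of representatives. *)
Definition Phi (k n : nat) : nat :=
  #|[pred x : k.-tuple 'I_n | gcdn (\sum_(i < k) tnth x i ^ 2) n == 1]|%N.

(* Only meant for k even and p odd, where k / 2 and k * (p - 1) / 4 are exact. *)
Definition even_factor (R : realType) (k p : nat) : R :=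
  1 - 1 / p%:R ^+ 2
    - (-1) ^+ ((k * (p - 1)) %/ 4)%N * (p%:R - 1) / p%:R ^+ (k %/ 2 + 2)%N.

(* The product over all odd primes is the limit of the partial products over
   the odd primes p < N. *)
Definition C_ (R : realType) (k : nat) : R :=
  if odd k then 6 / pi ^+ 2
  else 3 / 4 * lim ((fun N : nat =>
    \prod_(0 <= p < N | prime p && (2 < p)%N) even_factor R k p) @ \oo).

Definition R_ (R : realType) (k : nat) (x : R) : R :=
  if odd k then ln x `^ (2 / 3) * ln (ln x) `^ (4 / 3) else ln x.

(* The Landau notations need the filter of neighbourhoods of +oo to be a
   canonical filter_on. *)
Canonical pinfty_filter_on (R : realType) : filter_on R :=
  FilterType (pinfty_nbhs R) _.

(* Main.v *)
Require Import Defs.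
From HB Require Import structures.
From mathcomp Require Import all_boot all_order all_algebra.
From mathcomp Require Import all_classical all_reals all_analysis.
From mathcomp Require Import complex.
From mathcomp Require Import all_fingroup all_field.
From mathcomp Require Import zify ring lra.
Set Implicit Arguments.
Unset Strict Implicit.
Unset Printing Implicit Defensive.
Import Order.TTheory GRing.Theory Num.Theory.
Import numFieldNormedType.Exports.
Import ComplexField.Normc.
Local Open Scope ring_scope.
Local Open Scope complex_scope.

(** Multiplicativity and the count of zeros of [x_1^2 + ... + x_k^2] over [F_p]
give [Phi k n = n^k \prod_(p | n) (1 - nu p)], so
[\sum_(n <= x) Phi k n = \sum_(d <= x) g(d) d^k \sum_(m <= x / d) m^k] with [g]
supported on squarefree [d] and [g p = - nu p].  Replacing the inner power sum by
[y^(k+1) / (k+1) - psi(y) y^k + O(y^(k-1))], [psi] the sawtooth and [y = x / d],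
leaves the constant [\sum g(d) / d], an Euler product, and the sum
[x^k \sum_(d <= x) g(d) psi(x / d)].

For even [k] one has [\sum_(d <= x) |g(d)| = O(log x)]: this is elementary for
[k >= 4], and for [k = 2] the function [d g(d)] is essentially the number of
representations as a sum of two squares, [1 * chi_4].

For odd [k], [g(d) = mu(d) / d] and the required bound is Walfisz's theorem.
The sawtooth is approximated by Fejer means, so that one needs
[\sum_(d ~ D) mu(d) e(h x / d)]; Vaughan's identity reduces these sums to sums
[\sum_(n ~ N) e(alpha / n)], which Vinogradov's method bounds: a Taylor expansion
of the phase turns them into bilinear Weyl sums, estimated by means of
Vinogradov's mean value theorem (proved by Linnik's p-adic argument). *)

(** * Exponential sums and power sums *)

(** Write [L = ln x] and [W = walfisz L], so that the error term for odd [k] is [x^k W]. Terms of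
    the sawtooth sum with [d <= exp W] or [d > x / exp W] are bounded trivially: the harmonic sum
    over each of these ranges is about [W], and this is the source of the error term. In between,
    every dyadic block must save a factor [L]. The saving comes from sums over [n ~ N] with
    [ln N >= W / 20] and a phase of size [F <= x^3]. Such a phase requires a Taylor degree of order
    [K = ln F / ln N <= 80 L / W], and the saving is [exp (- c ln N / K^2)], where [ln N / K^2] is
    at least of order [W^3 / L^2 = (ln L)^4]; this beats every multiple of [ln L]. The obstacle is
    that the degree is unbounded. Vinogradov's theorem is therefore proved with explicit dependence
    on the degree [r]: constant [exp (C0 r^4)], exponent within [r^2 / 1000] of the ideal one, and
    only [12 r^2] variables on each side. A gain of order [K^2 ln N] in the logarithm of a moment of
    order [(24 r^2)^2] is what becomes [ln N / K^2]. *)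

Lemma power_mean (R : realDomainType) (I : finType) (f : I -> R) (m : nat) :
  (forall i, 0 <= f i) ->
  (\sum_i f i) ^+ m.+1 <= #|I|%:R ^+ m * \sum_i f i ^+ m.+1.
Proof.
move=> f0; elim: m => [|m IH]; first by rewrite expr0 mul1r !expr1.
have S0 : 0 <= \sum_i f i by apply: sumr_ge0.
rewrite exprS; apply: (le_trans (ler_wpM2l S0 IH)).
rewrite mulrCA [X in _ <= X * _]exprSr -mulrA.
apply: ler_wpM2l; first by rewrite exprn_ge0.
(* Chebyshev's sum inequality: [f] and its powers are ordered alike, so each pair contributes [(f i
   - f j) * (f i ^+ m.+1 - f j ^+ m.+1) >= 0], and summing over all pairs gives the induction
   step. *)
have cheb i j : f i * f j ^+ m.+1 + f j * f i ^+ m.+1 <= f i ^+ m.+2 + f j ^+ m.+2.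
  rewrite -subr_ge0.
  have -> : f i ^+ m.+2 + f j ^+ m.+2 - (f i * f j ^+ m.+1 + f j * f i ^+ m.+1)
     = (f i - f j) * (f i ^+ m.+1 - f j ^+ m.+1) by rewrite ![_ ^+ m.+2]exprS; ring.
  have [le_ij|/ltW le_ji] := leP (f i) (f j).
    by rewrite mulr_le0 ?subr_le0 // lerXn2r ?nnegrE.
  by rewrite mulr_ge0 ?subr_ge0 // lerXn2r ?nnegrE.
have H : \sum_i \sum_j (f i * f j ^+ m.+1 + f j * f i ^+ m.+1)
   <= \sum_i \sum_j (f i ^+ m.+2 + f j ^+ m.+2).
  by apply: ler_sum => i _; apply: ler_sum => j _; exact: cheb.
have E1 : \sum_i \sum_j (f i * f j ^+ m.+1 + f j * f i ^+ m.+1)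
   = ((\sum_i f i) * (\sum_i f i ^+ m.+1)) *+ 2.
  under eq_bigr do rewrite big_split /=.
  rewrite big_split /= mulr2n; congr (_ + _); first by rewrite big_distrlr.
  by rewrite exchange_big big_distrlr.
have E2 : \sum_i \sum_j (f i ^+ m.+2 + f j ^+ m.+2)
   = (#|I|%:R * \sum_i f i ^+ m.+2) *+ 2.
  under eq_bigr do rewrite big_split /= sumr_const.
  rewrite big_split /= sumr_const mulr2n; congr (_ + _).
    by rewrite sumrMnl mulr_natl.
  by rewrite mulr_natl.
by rewrite E1 E2 lerMn2r in H.
Qed.

(** The character [e(t) = exp (2 pi i t)], of period 1. *)
Definition cis (R : realType) (t : R) : R[i] :=
  cos (2 * pi * t) +i* sin (2 * pi * t).

Lemma cisD (R : realType) (s t : R) : cis (s + t) = cis s * cis t.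
Proof.
rewrite /cis mulrDr cosD sinD; apply/eqP; rewrite eq_complex /=; apply/andP; split.
- by rewrite eqxx.
- by apply/eqP; ring.
Qed.

Lemma cis0 (R : realType) : cis (0 : R) = 1.
Proof. by rewrite /cis mulr0 cos0 sin0. Qed.

Lemma cisN (R : realType) (t : R) : cis (- t) = (cis t)^*.
Proof. by rewrite /cis mulrN cosN sinN. Qed.

Lemma cis1 (R : realType) : cis (1 : R) = 1.
Proof.
by rewrite /cis mulr1 mulr_natl cos2pi sin2pi.
Qed.

Lemma cisMn (R : realType) (t : R) (n : nat) : cis (t *+ n) = cis t ^+ n.
Proof.
elim: n => [|n IH]; first by rewrite mulr0n cis0.
by rewrite mulrS cisD IH exprS.
Qed.

Lemma cis_nat (R : realType) (n : nat) : cis (n%:R : R) = 1.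
Proof. by rewrite cisMn cis1 expr1n. Qed.

Lemma cis_sum (R : realType) (I : Type) (r : seq I) (P : pred I) (F : I -> R) :
  cis (\sum_(i <- r | P i) F i) = \prod_(i <- r | P i) cis (F i).
Proof. exact: (big_morph _ (@cisD R) (@cis0 R)). Qed.

Lemma normc_cis (R : realType) (t : R) : normc (cis t) = 1.
Proof. by rewrite /normc /cis cos2Dsin2 sqrtr1. Qed.

Lemma normc_ge0 (R : realType) (z : R[i]) : 0 <= normc z.
Proof. by case: z => a b; rewrite sqrtr_ge0. Qed.

Lemma normc_sum (R : realType) (I : Type) (r : seq I) (P : pred I) (F : I -> R[i]) :
  normc (\sum_(i <- r | P i) F i) <= \sum_(i <- r | P i) normc (F i).
Proof.
elim/big_rec2: _ => [|i x y _ H]; first by rewrite normc0.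
by apply: le_trans (le_normcD _ _) _; rewrite lerD2l.
Qed.

Lemma normcX (R : realType) (z : R[i]) (n : nat) : normc (z ^+ n) = normc z ^+ n.
Proof. by elim: n => [|n IH]; rewrite ?expr0 ?normc1 // !exprS normcM IH. Qed.

Lemma normc_real (R : realType) (x : R) : normc x%:C = `|x|.
Proof. by rewrite /normc /= expr0n /= addr0 sqrtr_sqr. Qed.

Lemma normc_conj (R : realType) (z : R[i]) : normc z^* = normc z.
Proof. by case: z => a b; rewrite /normc /= sqrrN. Qed.

Lemma normc_sq (R : realType) (z : R[i]) : ((normc z) ^+ 2)%:C = z * z^*.
Proof.
case: z => a b; rewrite /normc sqr_sqrtr ?addr_ge0 ?sqr_ge0 //.
by apply/eqP; rewrite eq_complex /=; apply/andP; split; apply/eqP; ring.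
Qed.

Lemma sum_normc_cis_le (R : realType) (I : finType) (P : pred I) (F : I -> R) :
  normc (\sum_(i | P i) cis (F i)) <= #|P|%:R.
Proof.
apply: le_trans (normc_sum _ _ _) _.
by under eq_bigr do rewrite normc_cis; rewrite sumr_const.
Qed.

Lemma sin_le_id (R : realType) (y : R) : 0 <= y -> sin y <= y.
Proof.
rewrite le_eqVlt => /orP[/eqP<-|y0]; first by rewrite sin0.
have [] := @MVT R (@sin R) (@cos R) 0 y y0.
- by apply: continuous_subspaceT => z; exact: continuous_sin.
move=> c _; rewrite sin0 !subr0 => ->.
by rewrite ler_piMl ?(ltW y0) // cos_le1.
Qed.

Lemma norm_sin_le (R : realType) (y : R) : `|sin y| <= `|y|.
Proof.
wlog y0 : y / 0 <= y.
  move=> H; case: (leP 0 y) => [/H //|/ltW y0].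
  by rewrite -normrN -sinN -[`|y|]normrN; apply: H; rewrite oppr_ge0.
rewrite [`|y|]ger0_norm //; have [y1|y1] := leP y 1.
  rewrite ger0_norm ?sin_le_id // sin_ge0_pi // y0 /=.
  by rewrite (le_trans y1) // (le_trans _ (pi_ge2 R)) // ler1n.
by rewrite (le_trans (sin_max _)) // ltW.
Qed.

Lemma cos_ge_1B (R : realType) (y : R) : 0 <= y -> 1 - y <= cos y.
Proof.
rewrite le_eqVlt => /orP[/eqP<-|y0]; first by rewrite cos0 subr0.
have [] := @MVT R (@cos R) (fun x => - sin x) 0 y y0.
- by apply: continuous_subspaceT => z; exact: continuous_cos.
move=> c _; rewrite cos0 subr0 => H.
have := sin_le1 c; nra.
Qed.

Lemma sin_ge_half (R : realType) (y : R) : 0 <= y <= 1 / 2 -> y / 2 <= sin y.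
Proof.
move=> /andP[]; rewrite le_eqVlt => /orP[/eqP<-|y0] y2; first by rewrite sin0 mul0r.
have [] := @MVT R (@sin R) (@cos R) 0 y y0.
- by apply: continuous_subspaceT => z; exact: continuous_sin.
move=> c; rewrite in_itv /= => /andP[c0 cy]; rewrite sin0 !subr0 => ->.
have := cos_ge_1B (ltW c0); nra.
Qed.

Lemma normc_1Bcis (R : realType) (t : R) : normc (1 - cis t) = 2 * `|sin (pi * t)|.
Proof.
rewrite /cis /normc /=.
have -> : 2 * pi * t = (pi * t) *+ 2 by rewrite -mulr_natl; ring.
rewrite cos_mulr2n sin_mulr2n.
have -> : (1 + - (cos (pi * t) ^+ 2 *+ 2 - 1)) ^+ 2
   + (0 + - ((cos (pi * t) * sin (pi * t)) *+ 2)) ^+ 2 = (2 * sin (pi * t)) ^+ 2.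
  have := cos2Dsin2 (pi * t); set c := cos _; set s := sin _ => H.
  have C : c ^+ 2 = 1 - s ^+ 2 by rewrite -H; ring.
  transitivity ((2 - 2 * c ^+ 2) ^+ 2 + 4 * c ^+ 2 * s ^+ 2); first by ring.
  by rewrite C; ring.
by rewrite sqrtr_sqr normrM ger0_norm.
Qed.

Lemma cis_lipschitz (R : realType) (s t : R) : normc (cis s - cis t) <= 8 * `|s - t|.
Proof.
have -> : cis s - cis t = cis s * (1 - cis (t - s)).
  by rewrite mulrBr mulr1 -cisD [s + _]addrC subrK.
rewrite normcM normc_cis mul1r normc_1Bcis.
have := norm_sin_le (pi * (t - s)); rewrite normrM.
have := pihalf_lt2 R; have := pi_gt0 R => p0 p4.
rewrite (ger0_norm (ltW p0)) (distrC t s).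
have := normr_ge0 (s - t); nra.
Qed.

(** The sharp constant would be 4. The constant 1 needs only [sin y >= y / 2] for [y <= 1/2], and
    beyond that the monotonicity of [sin] up to [pi / 2]. *)
Lemma normc_1Bcis_ge (R : realType) (t : R) : `|t| <= 1 / 2 -> `|t| <= normc (1 - cis t).
Proof.
rewrite normc_1Bcis => t2.
have -> : `|sin (pi * t)| = sin (pi * `|t|).
  have [t0|t0] := leP 0 t.
    rewrite ger0_norm // ?(ger0_norm t0) // sin_ge0_pi // mulr_ge0 ?pi_ge0 //=.
    by rewrite -[leRHS]mulr1 ler_wpM2l ?pi_ge0 // -(ger0_norm t0) (le_trans t2) //; lra.
  rewrite (ltr0_norm t0) mulrN sinN -normrN ger0_norm // -sinN sin_ge0_pi //.
  rewrite -mulrN mulr_ge0 ?pi_ge0 //= ?oppr_ge0 ?(ltW t0) //.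
  rewrite -[leRHS]mulr1 ler_wpM2l ?pi_ge0 //; move: t2; rewrite ltr0_norm // => t2; lra.
move: t2 (normr_ge0 t); move: `|t| => u u2 u0.
have p2 := pi_ge2 R; have p4 := pihalf_lt2 R.
have [y2|y2] := leP (pi * u) (1 / 2).
  have : pi * u / 2 <= sin (pi * u) by apply: sin_ge_half; rewrite y2 andbT; nra.
  nra.
have h1 : (1/2) / 2 <= sin (1 / 2 : R) by apply: sin_ge_half; rewrite lexx andbT; lra.
have h2 : sin (1 / 2) < sin (pi * u).
  by rewrite ltr_sin // in_itv /=; nra.
lra.
Qed.

Lemma geometric_cis (R : realType) (t : R) (n : nat) :
  normc (\sum_(i < n) cis (i%:R * t)) * normc (1 - cis t) <= 2.
Proof.
rewrite -normcM mulrC; under eq_bigr do rewrite mulr_natl cisMn.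
have -> : (1 - cis t) * \sum_(i < n) cis t ^+ i = 1 - cis t ^+ n.
  by rewrite -[LHS]opprK -mulNr opprB -subrX1 opprB.
apply: le_trans (le_normcD _ _) _.
by rewrite normcN normcX normc_cis expr1n normc1.
Qed.

Lemma cis_orthogonality (R : realType) (M a b : nat) : (a < M)%N -> (b < M)%N ->
  \sum_(t < M) cis (t%:R * (a%:R - b%:R) / M%:R : R) = (M * (a == b))%:R.
Proof.
move=> aM bM; have M0 : (0 < M)%N by exact: leq_ltn_trans aM.
have MR : 0 < M%:R :> R by rewrite ltr0n.
have [->|ab] := eqVneq a b.
  by under eq_bigr do rewrite subrr mulr0 mul0r cis0; rewrite sumr_const card_ord muln1.
rewrite muln0; set u := (a%:R - b%:R) / M%:R : R.
have nu : `|u| < 1.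
  rewrite normrM normfV (gtr0_norm MR) ltr_pdivrMr // mul1r.
  have : a%:R < M%:R :> R by rewrite ltr_nat.
  have : b%:R < M%:R :> R by rewrite ltr_nat.
  have : 0 <= a%:R :> R by []. have : 0 <= b%:R :> R by [].
  by move=> *; rewrite ltr_norml; lra.
have w1 : normc (1 - cis u) != 0.
  rewrite normc_1Bcis mulf_neq0 // ?pnatr_eq0 // normr_eq0.
  have sgt v : 0 < v < 1 -> sin (pi * v) != 0.
    move=> /andP[v0 v1]; rewrite gt_eqF // sin_gt0_pi // mulr_gt0 ?pi_gt0 //=.
    by rewrite gtr_pMr ?pi_gt0.
  have u0 : u != 0.
    by rewrite mulf_neq0 // ?invr_eq0 ?(gt_eqF MR) // subr_eq0 eqr_nat.
  move: nu; rewrite ltr_norml => /andP[n1 n2].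
  have [up|um|u00] := ltgtP 0 u; first by apply: sgt; rewrite up.
    by rewrite -oppr_eq0 -sinN -mulrN; apply: sgt; rewrite oppr_gt0 um /= ltrNl.
  by rewrite -u00 eqxx in u0.
have key : (cis u - 1) * (\sum_(t < M) cis u ^+ t) = 0.
  rewrite -subrX1 -cisMn -mulr_natr /u divfK ?gt_eqF // cisD cisN !cis_nat.
  by rewrite rmorph1 mulr1 subrr.
have : normc (\sum_(t < M) cis u ^+ t) = 0.
  have := congr1 (@normc R) key; rewrite normc0 normcM -opprB normcN => /eqP.
  by rewrite mulf_eq0 (negPf w1) /= => /eqP.
move=> /eq0_normc H; rewrite -[RHS]H; apply: eq_bigr => t _.
by rewrite -mulrA mulr_natl cisMn.
Qed.

Lemma expand_power (R : realType) (T : finType) (P : pred T) (g : T -> R) (b : nat) :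
  (\sum_(v | P v) cis (g v)) ^+ b
  = \sum_(f : {ffun 'I_b -> T} | [forall i, P (f i)]) cis (\sum_i g (f i)).
Proof.
rewrite -[X in _ ^+ X]card_ord -prodr_const /=.
rewrite (bigA_distr_big_dep (fun _ => P) (fun _ v => cis (g v))) /=.
apply: eq_big => [f|f _]; last by rewrite cis_sum.
by apply/familyP/forallP => H i; have := H i.
Qed.

Lemma expand_normc_power (R : realType) (T : finType) (g : T -> R) (b : nat) :
  (normc (\sum_v cis (g v)) ^+ (2 * b))%:C
  = \sum_(p : {ffun 'I_b -> T} * {ffun 'I_b -> T})
      cis (\sum_i g (p.1 i) - \sum_i g (p.2 i)).
Proof.
rewrite exprM rmorphXn /= normc_sq exprMn -rmorphXn /= expand_power.
rewrite rmorph_sum big_distrlr /= pair_big.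
apply: eq_big => [p|p _].
  by rewrite /=; have -> : [forall i : 'I_b, predT (p.1 i)] by apply/forallP.
by rewrite cisD cisN.
Qed.

(** Parseval on a finite grid in place of the torus. After expanding the square, summation over [th]
    detects congruence of the two vectors modulo [M], and the bound [phi x j < M] turns congruence
    into equality. *)
Lemma count_orthogonality (R : realType) (X : finType) (A : pred X) (r M : nat)
  (phi : X -> 'I_r -> nat) : (forall x j, A x -> (phi x j < M)%N) ->
  \sum_(th : {ffun 'I_r -> 'I_M})
     normc (\sum_(x | A x) cis (\sum_j (th j)%:R * (phi x j)%:R / M%:R : R)) ^+ 2
  = (M ^ r * #|[pred p : X * X | [&& A p.1, A p.2 &
        [forall j, phi p.1 j == phi p.2 j]]]|)%:R.
Proof.
move=> HM; apply: (@complexI R); rewrite rmorph_sum /=.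
transitivity (\sum_(th : {ffun 'I_r -> 'I_M}) \sum_(p : X * X | A p.1 && A p.2)
   cis (\sum_j ((th j)%:R * (phi p.1 j)%:R / M%:R
        - (th j)%:R * (phi p.2 j)%:R / M%:R : R))).
  apply: eq_bigr => th _.
  rewrite normc_sq rmorph_sum big_distrlr /= pair_big /=.
  by apply: eq_bigr => p _; rewrite sumrB cisD cisN.
rewrite exchange_big /=.
transitivity (\sum_(p : X * X | A p.1 && A p.2)
   ((M ^ r * [forall j, phi p.1 j == phi p.2 j])%N%:R : R[i])).
  apply: eq_bigr => p /andP[A1 A2].
  transitivity (\sum_(th : {ffun 'I_r -> 'I_M}) \prod_j
     cis ((th j)%:R * ((phi p.1 j)%:R - (phi p.2 j)%:R) / M%:R : R)).
    by apply: eq_bigr => th _; rewrite cis_sum; apply: eq_bigr => j _; congr cis; ring.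
  rewrite -(bigA_distr_bigA (fun j (t : 'I_M) =>
     cis (t%:R * ((phi p.1 j)%:R - (phi p.2 j)%:R) / M%:R : R))) /=.
  under eq_bigr => j _ do rewrite cis_orthogonality ?HM //.
  rewrite -natr_prod; congr _%:R.
  rewrite big_split /= prod_nat_const card_ord; congr (_ * _)%N.
  have [/forallP H|/forallPn[j Hj]] := boolP [forall j, phi p.1 j == phi p.2 j].
    by rewrite big1 // => j _; rewrite (H j).
  by rewrite (bigD1 j) //= (negPf Hj).
rewrite rmorph_nat -natr_sum -big_distrr /=; congr (_ * _)%:R.
rewrite -sum1_card [RHS]big_mkcond [LHS]big_mkcond /=.
by apply: eq_bigr => p _; rewrite inE; case: (A p.1) => //; case: (A p.2) => //=; case: [forall j, _].
Qed.

(** * Power sums determine the roots: Newton's identities and Linnik's lemma *)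

Lemma deriv_prod_XsubC (A : comNzRingType) (I : finType) (x : I -> A) :
  (\prod_i ('X - (x i)%:P))^`() = \sum_i \prod_(k | k != i) ('X - (x k)%:P).
Proof.
have H (s : seq I) : uniq s -> (\prod_(i <- s) ('X - (x i)%:P))^`()
    = \sum_(i <- s) \prod_(k <- s | k != i) ('X - (x k)%:P).
  elim: s => [|a s IH] /=; first by rewrite !big_nil derivC.
  move=> /andP[na us]; rewrite !big_cons derivM derivB derivX derivC subr0 mul1r.
  rewrite eqxx /= IH //; congr (_ + _).
    rewrite big_seq [RHS]big_seq_cond; apply: eq_bigl => k.
    by case: (boolP (k \in s)) => //= ks; apply/esym; apply: contraNneq na => <-.
  rewrite big_distrr /= big_seq [RHS]big_seq; apply: eq_bigr => i si.
  rewrite big_cons ifT //; by apply: contraNneq na => ->.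
exact: H (index_enum_uniq I).
Qed.

(* If D is the difference of the two products, then D * G = X^(r+1) D' modulo
   polynomials of degree < r, where G has leading coefficient r; comparing
   leading coefficients gives (r - deg D) lead(D) = 0. *)
Lemma prod_XsubC_power_sums (A : comNzRingType) (r : nat) (x y : 'I_r -> A) :
  (forall (m : nat) (c : A), (0 < m <= r)%N -> m%:R * c = 0 -> c = 0) ->
  (forall j : nat, (j <= r)%N -> \sum_i x i ^+ j = \sum_i y i ^+ j) ->
  \prod_i ('X - (x i)%:P) = \prod_i ('X - (y i)%:P).
Proof.
move=> reg xy.
pose P (z : 'I_r -> A) := \prod_i ('X - (z i)%:P).
pose Q (z : 'I_r -> A) i := \prod_(k | k != i) ('X - (z k)%:P).
pose G (z : 'I_r -> A) := \sum_(j < r.+1) (\sum_i z i ^+ j)%:P * 'X^(r - j).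
pose E (z : 'I_r -> A) := \sum_i Q z i * (z i ^+ r.+1)%:P.
have sQ z i : (size (Q z i) <= r)%N.
  rewrite /Q -big_filter size_prod_XsubC -sum1_size big_filter sum1_card cardC1 card_ord.
  by rewrite prednK // (leq_ltn_trans _ (ltn_ord i)).
have PQ z i : P z = ('X - (z i)%:P) * Q z i by rewrite /P (bigD1 i).
have key z : P z * G z = 'X^(r.+1) * (P z)^`() - E z.
  rewrite deriv_prod_XsubC /E [X in _ = X - _]big_distrr /= -sumrB.
  have -> : G z = \sum_i \sum_(j < r.+1) 'X^(r - j) * (z i)%:P ^+ j.
    rewrite /G exchange_big /=; apply: eq_bigr => j _.
    rewrite rmorph_sum big_distrl /=; apply: eq_bigr => i _.
    by rewrite mulrC rmorphXn.
  rewrite big_distrr /=; apply: eq_bigr => i _.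
  rewrite (PQ z i) mulrAC -(subrXX _ _ r.+1) mulrBl rmorphXn /=; congr (_ - _).
  by rewrite mulrC.
have Gxy : G x = G y.
  by apply: eq_bigr => j _; rewrite xy // -ltnS.
pose D := P x - P y.
have DG : D * G x = 'X^(r.+1) * D^`() - (E x - E y).
  rewrite mulrBl key {1}Gxy key /D derivB mulrBr; ring.
suff: D = 0 by move=> /eqP; rewrite subr_eq0 => /eqP.
apply/eqP/contraT => D0.
have sP z : size (P z) = r.+1.
  by rewrite /P size_prod_XsubC /index_enum -enumT size_enum_ord.
have lP z : (P z)`_r = 1.
  by have := lead_coef_prod_XsubC (index_enum _) predT z; rewrite /lead_coef -/(P z) sP.
have sD : (size D <= r)%N.
  apply/leq_sizeP => j; rewrite leq_eqVlt => /orP[/eqP <-|rj].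
    by rewrite coefB !lP subrr.
  by rewrite coefB !nth_default ?subr0 // sP.
have sD0 : (0 < size D)%N by rewrite size_poly_gt0.
pose d := (size D).-1.
have dr : (d < r)%N by rewrite /d; lia.
have := congr1 (fun q : {poly A} => q`_(d + r)) DG; rewrite /=.
have -> : (D * G x)`_(d + r) = D`_d * r%:R.
  rewrite coefM (bigD1 (inord d)) //= inordK; last by lia.
  rewrite addKn big1 ?addr0.
    congr (_ * _); rewrite /G coef_sum (bigD1 ord0) //= [X in _ + X]big1 ?addr0.
      rewrite subn0 coefCM coefXn eqxx mulr1.
      by under eq_bigr do rewrite expr0; rewrite sumr_const card_ord.
    move=> j j0; rewrite coefCM coefXn.
    have : (0 < j)%N by rewrite lt0n; apply: contraNneq j0 => H; apply/eqP/val_inj.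
    by have := ltn_ord j; case: eqP => [|]; rewrite ?mulr0 //; lia.
  move=> j jd; have {jd} : (j != d :> nat).
    apply: contraNneq jd => H; apply/eqP/val_inj => /=.
    by rewrite inordK ?ltnS ?leq_addr // H.
  rewrite neq_ltn => /orP[jd|dj].
    rewrite [X in _ * X]nth_default ?mulr0 //.
    apply: (leq_trans (size_sum _ _ _)); apply/bigmax_leqP => i _.
    apply: (leq_trans (size_polyMleq _ _)).
    rewrite size_polyXn size_polyC; have := ltn_ord j; have := ltn_ord i.
    by case: (_ != 0) => /=; lia.
  by rewrite nth_default ?mul0r // -(prednK sD0).
have sE : (E x - E y)`_(d + r) = 0.
  have sEz z : (size (E z) <= r)%N.
    apply: (leq_trans (size_sum _ _ _)); apply/bigmax_leqP => i _.
    apply: (leq_trans (size_polyMleq _ _)); rewrite size_polyC.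
    by have := sQ z i; case: (_ != 0) => /=; lia.
  by rewrite coefB !nth_default ?subr0 // (leq_trans (sEz _)) // leq_addl.
rewrite (coefB ('X^(r.+1) * D^`()) (E x - E y)) sE subr0 coefXnM coef_deriv.
have -> : (if (d + r < r.+1)%N then 0 else D`_(d + r - r.+1).+1 *+ (d + r - r.+1).+1)
   = D`_d *+ d.
  case: ltnP => h.
    by have -> : d = 0%N by lia.
  by have -> : (d + r - r.+1).+1 = d by lia.
move=> H; have : (r - d)%:R * D`_d = 0.
  by rewrite natrB ?(ltnW dr) // mulrBl [r%:R * _]mulrC H mulr_natl subrr.
move/reg; rewrite subn_gt0 dr leq_subr => /(_ isT) /eqP.
by rewrite -/(lead_coef D) lead_coef_eq0 (negPf D0).
Qed.

Lemma unit_Zp_prime_power (p r : nat) (m : nat) : prime p -> (0 < r)%N ->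
  (m%:R \is a @GRing.unit 'Z_(p ^ r)) = ~~ (p %| m)%N.
Proof.
move=> pp r0; rewrite unitZpE; last by rewrite (ltn_exp2l 0) ?prime_gt1.
by rewrite coprime_pexpl // prime_coprime.
Qed.

Lemma unit_Zp_addNunit (p r : nat) (u v : 'Z_(p ^ r)) : prime p -> (0 < r)%N ->
  u \isn't a GRing.unit -> v \is a GRing.unit -> u + v \is a GRing.unit.
Proof.
move=> pp r0; rewrite -[u]natr_Zp -[v]natr_Zp -natrD !unit_Zp_prime_power //.
by move=> /negPn pu pv; rewrite dvdn_addr.
Qed.

(** At most one factor is a non-unit, because any two factors differ by a unit; the others can be
    cancelled from the product. *)
Lemma root_of_distinct_prod (p r : nat) (I : finType) (y : I -> 'Z_(p ^ r)) (t : 'Z_(p ^ r)) :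
  prime p -> (0 < r)%N -> (forall i k, i != k -> y i - y k \is a GRing.unit) ->
  \prod_i (t - y i) = 0 -> exists i, t = y i.
Proof.
move=> pp r0 uy prod0.
have [/existsP[i ni]|/existsPn allu] := boolP [exists i, t - y i \isn't a GRing.unit].
  exists i; apply/eqP; rewrite -subr_eq0; apply/eqP.
  move: prod0; rewrite (bigD1 i) //= => /eqP.
  have uprod : \prod_(k | k != i) (t - y k) \is a GRing.unit.
    rewrite rpred_prod // => k ki.
    have -> : t - y k = (t - y i) + (y i - y k) by ring.
    by apply: unit_Zp_addNunit => //; apply: uy; rewrite eq_sym.
  by rewrite -[X in _ == X](mul0r (\prod_(k | k != i) (t - y k))) => /eqP/(mulIr uprod).
have : \prod_i (t - y i) \is a GRing.unit.
  by rewrite rpred_prod // => k _; apply/negPn; exact: allu.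
by rewrite prod0 unitr0.
Qed.

Lemma leq_card_fibers (X Y : finType) (A : pred X) (B : pred Y) (f : X -> Y) (n : nat) :
  (forall x, A x -> B (f x)) ->
  (forall x0, A x0 -> (#|[pred x | A x && (f x == f x0)]| <= n)%N) ->
  (#|A| <= #|B| * n)%N.
Proof.
move=> AB fib; rewrite -sum1_card.
rewrite (partition_big f B) //= -sum_nat_const; apply: leq_sum => y By.
have [/existsP[x0 /andP[Ax0 /eqP <-]]|/existsPn H] := boolP [exists x, A x && (f x == y)].
  by rewrite sum1_card; exact: fib.
by rewrite big_pred0 // => x; apply: negbTE; exact: H.
Qed.

Definition well_spaced (A : unitRingType) (r : nat) (x : 'I_r -> A) : bool :=
  [forall i, forall k, (i != k) ==> (x i - x k \is a GRing.unit)].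

(** For [q = p] in [Z/p^r], the power sum of exponent [j + 1] is prescribed modulo [p^(j+1)] only.
    This is the information left by a system whose other variables are all multiples of [p]. *)
Definition power_sums_adic (A : finComNzRingType) (r : nat) (q : A) (c x : 'I_r -> A) : bool :=
  [forall j : 'I_r, exists t : A, \sum_i x i ^+ j.+1 == c j + q ^+ j.+1 * t].

(** A residue modulo [p^(j+1)] has [p^(r-j-1)] lifts modulo [p^r], which accounts for the product.
    Once all power sums are fixed modulo [p^r], the polynomial with roots [x i] is fixed, since
    [1, ..., r] are units for [r < p]; each entry is then one of the at most [r] entries of a
    reference solution, whence [r^r]. *)
Lemma linnik (p r : nat) (c : 'I_r -> 'Z_(p ^ r)) : prime p -> (0 < r < p)%N ->
  (#|[pred x : {ffun 'I_r -> 'Z_(p ^ r)} |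
      well_spaced x && power_sums_adic p%:R c x]|
   <= (\prod_(j < r) p ^ (r - j.+1)) * r ^ r)%N.
Proof.
move=> pp /andP[r0 rp].
have q1 : (1 < p ^ r)%N by rewrite (ltn_exp2l 0) ?prime_gt1.
pose V (j : 'I_r) : pred 'Z_(p ^ r) :=
  [pred s | [exists t : 'Z_(p ^ r), s == c j + p%:R ^+ j.+1 * t]].
have cV j : (#|V j| <= p ^ (r - j.+1))%N.
  pose h (m : 'I_(p ^ (r - j.+1))) : 'Z_(p ^ r) := c j + p%:R ^+ j.+1 * m%:R.
  have sub : V j \subset [set h m | m in 'I_(p ^ (r - j.+1))]%SET.
    apply/fintype.subsetP => s /existsP[t /eqP ->]; apply/imsetP.
    have m0 : (t %% p ^ (r - j.+1) < p ^ (r - j.+1))%N.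
      by rewrite ltn_mod expn_gt0 prime_gt0.
    exists (Ordinal m0) => //; rewrite /h /=; congr (_ + _).
    rewrite -[t in LHS]natr_Zp {1}(divn_eq t (p ^ (r - j.+1))) natrD mulrDr natrM.
    rewrite [X in X + _](_ : _ = 0) ?add0r //.
    by rewrite mulrCA natrX -exprD subnKC // -natrX pchar_Zp // mulr0.
  apply: leq_trans (subset_leq_card sub) _.
  by apply: leq_trans (leq_imset_card _ _) _; rewrite card_ord.
pose f (x : {ffun 'I_r -> 'Z_(p ^ r)}) := [ffun j : 'I_r => \sum_i x i ^+ j.+1].
apply: (@leq_trans (#|(family V : simpl_pred {ffun 'I_r -> 'Z_(p ^ r)})| * r ^ r)).
  apply: (@leq_card_fibers _ _ _ _ f) => [x /andP[_ /forallP H]|x0 /andP[/forallP u0 _]].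
    by apply/familyP => j; rewrite ffunE inE; exact: H.
  have sub : [pred x : {ffun 'I_r -> 'Z_(p ^ r)} | well_spaced x && power_sums_adic p%:R c x && (f x == f x0)]
     \subset (ffun_on (mem (codom x0)) : simpl_pred {ffun 'I_r -> 'Z_(p ^ r)}).
    apply/fintype.subsetP => x; rewrite inE => /andP[_ /eqP fx].
    apply/ffun_onP => i.
    have Hp : \prod_k ('X - (x k)%:P) = \prod_k ('X - (x0 k)%:P).
      apply: prod_XsubC_power_sums => [m a /andP[m0 mr] ma|[|j] jr].
      - have um : m%:R \is a @GRing.unit 'Z_(p ^ r).
          by rewrite unit_Zp_prime_power // gtnNdvd // (leq_ltn_trans mr).
        by apply: (mulrI um); rewrite ma mulr0.
      - by apply: eq_bigr => k _; rewrite !expr0.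
      - by have := congr1 (fun g : {ffun 'I_r -> 'Z_(p ^ r)} => g (Ordinal jr)) fx; rewrite !ffunE.
    have : \prod_k (x i - x0 k) = 0.
      have := congr1 (horner^~ (x i)) Hp; rewrite /= !horner_prod => H.
      transitivity (\prod_k ('X - (x0 k)%:P).[x i]).
        by apply: eq_bigr => k _; rewrite hornerXsubC.
      by rewrite -H (bigD1 i) //= hornerXsubC subrr mul0r.
    move/root_of_distinct_prod; case=> // [a b ab|k ->]; last exact: codom_f.
    by have /forallP/(_ b)/implyP/(_ ab) := u0 a.
  apply: leq_trans (subset_leq_card sub) _.
  rewrite card_ffun_on card_ord leq_exp2r //.
  by apply: leq_trans (card_size _) _; rewrite size_codom card_ord.
rewrite leq_mul2r; apply/orP; right.
rewrite card_family /image_mem foldrE big_map enumT.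
by apply: leq_prod => j _; exact: cV.
Qed.

(** * Vinogradov's mean value theorem *)

Lemma leq_card_inj (X Y : finType) (A : pred X) (B : pred Y) (g : X -> Y) :
  (forall x, A x -> B (g x)) -> {in A &, injective g} -> (#|A| <= #|B|)%N.
Proof.
move=> AB inj; rewrite -(card_in_imset inj); apply: subset_leq_card.
by apply/fintype.subsetP => y /imsetP[x Ax ->]; exact: AB.
Qed.

Lemma card_eq_pairs (X Y : finType) (V : eqType) (s : X -> V) (t : Y -> V) (W : seq V)
  (A : pred X) (B : pred Y) : uniq W -> (forall x, s x \in W) ->
  #|[pred p : X * Y | [&& A p.1, B p.2 & s p.1 == t p.2]]|
  = (\sum_(v <- W) #|[pred x | A x && (s x == v)]| * #|[pred y | B y && (t y == v)]|)%N.
Proof.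
move=> uW sW; rewrite -sum1_card big_mkcond /=.
transitivity (\sum_(p : X * Y) \sum_(v <- W)
    ((A p.1 && (s p.1 == v)) * (B p.2 && (t p.2 == v)))%N)%N.
  apply: eq_bigr => [[x y]] _; rewrite inE /=.
  rewrite (bigD1_seq (s x)) //= big1 => [|v vs]; last first.
    by rewrite [s x == v]eq_sym (negPf vs) andbF.
  rewrite eqxx andbT addn0 [t y == _]eq_sym.
  by case: (A x); case: (B y); case: (s x == t y).
rewrite exchange_big /=; apply: eq_bigr => v _.
rewrite -!sum1_card big_distrlr /= pair_big /= [RHS]big_mkcond /=.
apply: eq_bigr => [[x y]] _; rewrite !inE /=.
by case: (A x && _); case: (B y && _).
Qed.

(** Counted by common value, this is [2 a b <= a^2 + b^2] on each fibre. *)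
Lemma card_eq_pairs_le (X Y : finType) (V : eqType) (s : X -> V) (t : Y -> V) :
  (2 * #|[pred p : X * Y | s p.1 == t p.2]|
   <= #|[pred p : X * X | s p.1 == s p.2]| + #|[pred p : Y * Y | t p.1 == t p.2]|)%N.
Proof.
pose W := undup (codom s ++ codom t).
have uW : uniq W := undup_uniq _.
have sW x : s x \in W by rewrite mem_undup mem_cat codom_f.
have tW x : t x \in W by rewrite mem_undup mem_cat codom_f orbT.
rewrite (@card_eq_pairs _ _ _ s t _ predT predT uW sW) (@card_eq_pairs _ _ _ s s _ predT predT uW sW).
rewrite (@card_eq_pairs _ _ _ t t _ predT predT uW tW) /= big_distrr -big_split /=.
apply: leq_sum => v _; rewrite !mulnn; exact: nat_Cauchy.
Qed.

Definition psum (b P : nat) (x : {ffun 'I_b -> 'I_P}) (j : nat) : nat :=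
  (\sum_i x i ^ j)%N.

(* The number of solutions of Vinogradov's system of degree [r] in [2 b]
   variables ranging over [0, ..., P - 1]. *)
Definition vinogradov_J (r b P : nat) : nat :=
  #|[pred p : {ffun 'I_b -> 'I_P} * {ffun 'I_b -> 'I_P} |
      [forall j : 'I_r, psum p.1 j.+1 == psum p.2 j.+1]]|.

(** An inhomogeneous system has no more solutions than the homogeneous one. In place of the usual
    Fourier integral, the power sums are compared with their translates by [d]: both diagonal counts
    equal [vinogradov_J], and [card_eq_pairs_le] bounds the mixed count. *)
Lemma vinogradov_J_shift (r b P : nat) (d : 'I_r -> int) :
  (#|[pred p : {ffun 'I_b -> 'I_P} * {ffun 'I_b -> 'I_P} |
      [forall j : 'I_r, ((psum p.1 j.+1)%:Z - (psum p.2 j.+1)%:Z == d j)%R]]|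
   <= vinogradov_J r b P)%N.
Proof.
pose s (x : {ffun 'I_b -> 'I_P}) : {ffun 'I_r -> int} := [ffun j : 'I_r => (psum x j.+1)%:Z].
pose t (x : {ffun 'I_b -> 'I_P}) : {ffun 'I_r -> int} := [ffun j : 'I_r => (psum x j.+1)%:Z + d j].
have := card_eq_pairs_le s t.
have E1 : #|[pred p | s p.1 == s p.2]| = vinogradov_J r b P.
  apply: eq_card => [[x y]]; rewrite !inE /=; apply/eqP/forallP => [H j|H].
    by have := congr1 (fun f : {ffun 'I_r -> int} => f j) H; rewrite !ffunE => -[->].
  by apply/ffunP => j; rewrite !ffunE (eqP (H j)).
have E2 : #|[pred p | t p.1 == t p.2]| = vinogradov_J r b P.
  apply: eq_card => [[x y]]; rewrite !inE /=; apply/eqP/forallP => [H j|H].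
    by have := congr1 (fun f : {ffun 'I_r -> int} => f j) H; rewrite !ffunE => /addIr[->].
  by apply/ffunP => j; rewrite !ffunE (eqP (H j)).
rewrite E1 E2 addnn -mul2n leq_mul2l /=; apply: leq_trans.
apply: subset_leq_card; apply/fintype.subsetP => [[x y]]; rewrite !inE /= => /forallP H.
by apply/eqP/ffunP => j; rewrite !ffunE -(eqP (H j)) addrC subrK.
Qed.

Definition distinct_mod (p r : nat) (z : 'I_r -> nat) : bool :=
  [forall i, forall k, (i != k) ==> (z i != z k %[mod p])].

(** Linnik's conditioned system. On each side, [r] variables are distinct modulo [p], ready for
    [linnik], and [b] further ones lie in [B], which will be either everything or one residue class
    modulo [p]. *)
Definition K_count (r b P p : nat) (B : pred 'I_P) : nat :=
  #|[pred q : ({ffun 'I_r -> 'I_P} * {ffun 'I_b -> 'I_P})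
            * ({ffun 'I_r -> 'I_P} * {ffun 'I_b -> 'I_P}) |
     [&& distinct_mod p (fun i => q.1.1 i) && [forall i, B (q.1.2 i)],
         distinct_mod p (fun i => q.2.1 i) && [forall i, B (q.2.2 i)] &
         [forall j : 'I_r, psum q.1.1 j.+1 + psum q.1.2 j.+1
                        == psum q.2.1 j.+1 + psum q.2.2 j.+1]%N]]|.

Lemma psum_le (b P j : nat) (x : {ffun 'I_b -> 'I_P}) : (psum x j <= b * P ^ j)%N.
Proof.
rewrite -[X in (X * _)%N]card_ord -sum_nat_const; apply: leq_sum => i _.
by case: j => // j; rewrite leq_exp2r // ltnW.
Qed.

(** The modulus [M] is one more than the largest possible power sum of degree at most [r] in [r + b]
    variables, so orthogonality modulo [M] detects genuine equality. *)
Lemma K_count_fourier (R : realType) (r b P p M : nat) (B : pred 'I_P) :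
  (0 < P)%N -> M = ((r + b) * P ^ r).+1 ->
  \sum_(th : {ffun 'I_r -> 'I_M})
     normc (\sum_(z : {ffun 'I_r -> 'I_P} | distinct_mod p (fun i => z i))
              cis (\sum_j (th j)%:R * (psum z j.+1)%:R / M%:R : R)) ^+ 2
     * normc (\sum_(v : 'I_P | B v) cis (\sum_j (th j)%:R * (v ^ j.+1)%:R / M%:R : R)) ^+ (2 * b)
  = (M ^ r * K_count r b p B)%:R.
Proof.
move=> P0 ME.
pose phi (q : {ffun 'I_r -> 'I_P} * {ffun 'I_b -> 'I_P}) (j : 'I_r) : nat :=
  (psum q.1 j.+1 + psum q.2 j.+1)%N.
pose A (q : {ffun 'I_r -> 'I_P} * {ffun 'I_b -> 'I_P}) :=
  distinct_mod p (fun i => q.1 i) && [forall i, B (q.2 i)].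
rewrite -(@count_orthogonality R _ A _ _ phi) => [|q j _]; last first.
  rewrite ME ltnS /phi mulnDl leq_add // (leq_trans (psum_le _ _)) //.
    by rewrite leq_mul2l leq_pexp2l // orbT.
  by rewrite leq_mul2l leq_pexp2l // orbT.
apply: eq_bigr => th _; rewrite mulnC exprM -exprMn -normcX -normcM; congr (normc _ ^+ 2).
rewrite expand_power big_distrlr /= pair_big /=; apply: eq_bigr => [[z u]] _ /=.
rewrite -cisD; congr cis; rewrite exchange_big /= -big_split /=; apply: eq_bigr => j _.
rewrite natrD mulrDr mulrDl; congr (_ + _).
by rewrite -mulr_suml -mulr_sumr natr_sum.
Qed.

(** The sum over the [b] free variables is split by residue class modulo [p]. Holder's inequality
    for the power [2 b] forces all [2 b] free variables into the same class at the cost of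
    [p^(2b-1)]. *)
Lemma K_count_residues (R : realType) (r b P p : nat) :
  (0 < P)%N -> (0 < b)%N -> (0 < p)%N ->
  (K_count r b p (predT : pred 'I_P)
   <= p ^ (2 * b).-1 * \sum_(a < p) K_count r b p (fun v : 'I_P => v %% p == a)%N)%N.
Proof.
move=> P0 b0 p0; pose M := ((r + b) * P ^ r).+1.
have Mr0 : (0 < M ^ r)%N by rewrite expn_gt0.
rewrite -(leq_pmul2l Mr0) -(ler_nat R) -(@K_count_fourier R) //.
rewrite mulnCA natrM big_distrr /= natr_sum.
under [X in _ <= _ * X]eq_bigr => a _ do rewrite -(@K_count_fourier R) //.
rewrite exchange_big /= mulr_sumr; apply: ler_sum => th _.
rewrite -mulr_sumr mulrCA; apply: ler_wpM2l; first by rewrite exprn_ge0 ?normc_ge0.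
pose f (v : 'I_P) : R[i] := cis (\sum_j (th j)%:R * (v ^ j.+1)%:R / M%:R).
change (normc (\sum_(v : 'I_P) f v) ^+ (2 * b) <= (p ^ (2 * b).-1)%:R
  * \sum_(i < p) normc (\sum_(v : 'I_P | (v %% p == i)%N) f v) ^+ (2 * b)).
have -> : \sum_(v : 'I_P) f v = \sum_(a < p) \sum_(v : 'I_P | (v %% p == a)%N) f v.
  by rewrite (partition_big (fun v : 'I_P => Ordinal (ltn_pmod v p0)) predT).
have e2 : (2 * b = ((2 * b).-1).+1)%N by lia.
rewrite e2; apply: (@le_trans _ _ ((\sum_(a < p) normc (\sum_(v : 'I_P | (v %% p == a)%N) f v)) ^+ (2 * b).-1.+1)).
  by rewrite lerXn2r ?nnegrE ?normc_ge0 ?sumr_ge0 // => [*|]; rewrite ?normc_ge0 ?normc_sum.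
apply: le_trans (power_mean _ _) _ => [a|]; first exact: normc_ge0.
by rewrite card_ord natrX.
Qed.

(** This gives the translation invariance of the system, by taking [q = (X - a)^j]. In degree 0 the
    two sides agree because each has [a + b] terms. *)
Lemma power_sums_poly (A : comNzRingType) (r a b : nat) (z z' : 'I_a -> A) (u u' : 'I_b -> A) :
  (forall j : 'I_r, \sum_i z i ^+ j.+1 + \sum_i u i ^+ j.+1
                  = \sum_i z' i ^+ j.+1 + \sum_i u' i ^+ j.+1) ->
  forall q : {poly A}, (size q <= r.+1)%N ->
  \sum_i q.[z i] + \sum_i q.[u i] = \sum_i q.[z' i] + \sum_i q.[u' i].
Proof.
move=> H q sq; rewrite !(eq_bigr _ (fun i _ => horner_coef_wide _ sq)).
rewrite ![\sum_(i < _) \sum_(j < r.+1) _]exchange_big -!big_split /=.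
apply: eq_bigr => [[[|j] hj] _] /=; rewrite -!mulr_sumr -!mulrDr; congr (_ * _).
by have /= := H (@Ordinal r j hj).
Qed.

Lemma distinct_mod_well_spaced (p r n : nat) (z : 'I_n -> nat) (a : 'Z_(p ^ r)) :
  prime p -> (0 < r)%N -> distinct_mod p z ->
  well_spaced (fun i => (z i)%:R - a : 'Z_(p ^ r)).
Proof.
move=> pp r0 /forallP dz; apply/forallP => i; apply/forallP => k; apply/implyP => ik.
have /forallP/(_ k)/implyP/(_ ik) := dz i.
have -> : (z i)%:R - a - ((z k)%:R - a) = (z i)%:R - (z k)%:R :> 'Z_(p ^ r) by ring.
have [le|/ltnW le] := leqP (z k) (z i).
  by rewrite -natrB // unit_Zp_prime_power // eqn_mod_dvd.
by rewrite -unitrN opprB -natrB // unit_Zp_prime_power // eq_sym eqn_mod_dvd.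
Qed.

(** Translate by [a] and write the free variables as [a + p w]. The equation of exponent [j] becomes
    a congruence modulo [p^j] between the power sums of [z - a] and [z' - a]: [z'] has at most [P^r]
    values, and [linnik] bounds [z] for each of them, where [P <= p^r] lets [z] be recovered from
    its residues. The quotients [w] then solve a Vinogradov system of length about [P / p]. *)
Lemma K_count_class (r b P p a : nat) : prime p -> (0 < r < p)%N -> (P <= p ^ r)%N ->
  (K_count r b p (fun v : 'I_P => v %% p == a)%N
   <= P ^ r * ((\prod_(j < r) p ^ (r - j.+1)) * r ^ r) * vinogradov_J r b (P %/ p).+1)%N.
Proof.
move=> pp /andP[r0 rp] Pp.
have q1 : (1 < p ^ r)%N by rewrite (ltn_exp2l 0) ?prime_gt1.
pose c (z' : {ffun 'I_r -> 'I_P}) (j : 'I_r) : 'Z_(p ^ r) :=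
  \sum_i ((z' i)%:R - a%:R) ^+ j.+1.
pose sh (z : {ffun 'I_r -> 'I_P}) : {ffun 'I_r -> 'Z_(p ^ r)} :=
  [ffun i => (z i)%:R - a%:R].
pose B (zz : {ffun 'I_r -> 'I_P} * {ffun 'I_r -> 'I_P}) :=
  well_spaced (sh zz.1) && power_sums_adic p%:R (c zz.2) (sh zz.1).
have dv (v : 'I_P) : (v %/ p < (P %/ p).+1)%N.
  by rewrite ltnS leq_div2r // ltnW.
pose w (u : {ffun 'I_b -> 'I_P}) : {ffun 'I_b -> 'I_(P %/ p).+1} :=
  [ffun i => Ordinal (dv (u i))].
(* Translating by a, the u-part becomes p times the quotients. *)
have transl (A : comNzRingType) (z z' : {ffun 'I_r -> 'I_P}) (u u' : {ffun 'I_b -> 'I_P}) :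
  [forall i, (u i %% p == a)%N] -> [forall i, (u' i %% p == a)%N] ->
  [forall j : 'I_r, psum z j.+1 + psum u j.+1 == psum z' j.+1 + psum u' j.+1]%N ->
  forall j : 'I_r, \sum_i ((z i)%:R - a%:R) ^+ j.+1 + p%:R ^+ j.+1 * (psum (w u) j.+1)%:R
     = \sum_i ((z' i)%:R - a%:R) ^+ j.+1 + p%:R ^+ j.+1 * (psum (w u') j.+1)%:R :> A.
  move=> /forallP ua /forallP ua' /forallP H j.
  have H' (j0 : 'I_r) : \sum_i ((z i)%:R : A) ^+ j0.+1 + \sum_i ((u i)%:R : A) ^+ j0.+1
                  = \sum_i (z' i)%:R ^+ j0.+1 + \sum_i (u' i)%:R ^+ j0.+1.
    have := congr1 (fun n : nat => n%:R : A) (eqP (H j0)).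
    by rewrite /psum !natrD !natr_sum; rewrite !(eq_bigr _ (fun i _ => natrX _ _ _)).
  have sq : (size (('X - a%:R%:P) ^+ j.+1 : {poly A}) <= r.+1)%N.
    apply: leq_trans (size_poly_exp_leq _ _) _.
    by rewrite size_XsubC /= mul1n ltnS.
  have := power_sums_poly H' sq.
  have hz (y : {ffun 'I_r -> 'I_P}) : \sum_i (('X - a%:R%:P) ^+ j.+1).[(y i)%:R]
     = \sum_i ((y i)%:R - a%:R) ^+ j.+1 :> A.
    by apply: eq_bigr => i _; rewrite horner_exp hornerXsubC.
  have hu (y : {ffun 'I_b -> 'I_P}) : (forall i, y i %% p == a)%N ->
     \sum_i (('X - a%:R%:P) ^+ j.+1).[(y i)%:R] = p%:R ^+ j.+1 * (psum (w y) j.+1)%:R :> A.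
    move=> ya; rewrite /psum natr_sum mulr_sumr; apply: eq_bigr => i _.
    rewrite horner_exp hornerXsubC ffunE /= natrX -exprMn; congr (_ ^+ _).
    by rewrite {1}(divn_eq (y i) p) (eqP (ya i)) natrD addrK natrM mulrC.
  by rewrite !hz !hu.
apply: (@leq_trans (#|B| * vinogradov_J r b (P %/ p).+1)); last first.
  rewrite leq_mul2r; apply/orP; right.
  apply: (@leq_trans (#|{: {ffun 'I_r -> 'I_P}}| * ((\prod_(j < r) p ^ (r - j.+1)) * r ^ r))); last first.
    by rewrite card_ffun !card_ord.
  apply: (@leq_card_fibers _ _ _ predT snd) => // [[z0 z0']] _ /=.
  apply: leq_trans (linnik (c z0') pp _); last by rewrite r0.
  apply: (@leq_card_inj _ _ _ _ (fun zz => sh zz.1)) => [[z z'] /andP[Bz /eqP /= <-] //|].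
  move=> [z z'] [y y'] /andP[_ /eqP /= ->] /andP[_ /eqP /= ->] H; congr (_, _).
  apply/ffunP => i; apply: val_inj => /=.
  have := congr1 (fun f : {ffun 'I_r -> 'Z_(p ^ r)} => f i) H.
  rewrite !ffunE => /addIr /(congr1 (fun x : 'Z_(p ^ r) => (x : nat))) /=.
  by rewrite !val_Zp_nat // !modn_small // (leq_trans _ Pp).
apply: (@leq_card_fibers _ _ _ _ (fun q => (q.1.1, q.2.1))).
  move=> [[z u] [z' u']] /and3P[/andP[dz ua] /andP[dz' ua'] H] /=.
  apply/andP; split => /=.
    have := @distinct_mod_well_spaced p r r (fun i => z i) a%:R pp r0 dz.
    by apply: etrans; apply: eq_forallb => i; apply: eq_forallb => k; rewrite !ffunE.
  apply/forallP => j; apply/existsP.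
  exists ((psum (w u') j.+1)%:R - (psum (w u) j.+1)%:R); apply/eqP.
  have := transl _ _ _ _ _ ua ua' H j => E.
  rewrite /c mulrBr addrA -E addrK; apply: eq_bigr => i _; by rewrite ffunE.
move=> [[z0 u0] [z0' u0']] /and3P[/andP[_ ua] /andP[_ ua'] H].
(* With [z] and [z'] fixed, the differences of the power sums of the quotients are those of the
   reference solution [u0, u0'], because [p^j] can be cancelled in the integers. *)
apply: leq_trans (vinogradov_J_shift b (P %/ p).+1 (fun j : 'I_r =>
    (psum (w u0) j.+1)%:Z - (psum (w u0') j.+1)%:Z)).
apply: (@leq_card_inj _ _ _ _ (fun q => (w q.1.2, w q.2.2))).
  move=> [[z u] [z' u']] /andP[/and3P[/andP[_ va] /andP[_ va'] H1]].
  rewrite /= xpair_eqE => /andP[/eqP E1 /eqP E2]; subst z z'.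
  apply/forallP => j /=; apply/eqP.
  have := transl int _ _ _ _ va va' H1 j; have := transl int _ _ _ _ ua ua' H j.
  rewrite !natz; set S := \sum_i _; set S' := \sum_i _ => e0 e1.
  have pj : p%:Z ^+ j.+1 != 0 by rewrite expf_neq0 // -lt0n prime_gt0.
  apply: (mulfI pj); rewrite !mulrBr.
  have h (s s' x y : int) : s + x = s' + y -> x - y = s' - s by lia.
  by rewrite (h _ _ _ _ e0) (h _ _ _ _ e1).
move=> [[z u] [z' u']] [[y v] [y' v']] /andP[/and3P[/andP[_ va] /andP[_ va'] _]].
rewrite /= xpair_eqE => /andP[/eqP E1 /eqP E2].
move=> /andP[/and3P[/andP[_ vb] /andP[_ vb'] _]].
rewrite /= xpair_eqE => /andP[/eqP E3 /eqP E4] [H1 H2]; subst.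
have winj (x1 x2 : {ffun 'I_b -> 'I_P}) : [forall i, (x1 i %% p == a)%N] ->
   [forall i, (x2 i %% p == a)%N] -> w x1 = w x2 -> x1 = x2.
  move=> /forallP a1 /forallP a2 E; apply/ffunP => i; apply: val_inj => /=.
  have := congr1 (fun f : {ffun 'I_b -> 'I_(P %/ p).+1} => val (f i)) E.
  rewrite /= !ffunE /= => E'.
  by rewrite (divn_eq (x1 i) p) (divn_eq (x2 i) p) E' (eqP (a1 i)) (eqP (a2 i)).
by rewrite (winj u v va vb H1) (winj u' v' va' vb' H2).
Qed.

(** Such a tuple is a list of [r] values followed by a choice of index at each place; [P^r * r^n]
    counts these pairs, with repetitions. *)
Lemma few_values_card (r n P : nat) : (0 < n)%N -> (0 < r)%N ->
  (#|[pred x : {ffun 'I_n -> 'I_P} | (size (undup (codom x)) <= r)%N]| <= P ^ r * r ^ n)%N.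
Proof.
move=> n0 r0.
pose h (vs : {ffun 'I_r -> 'I_P} * {ffun 'I_n -> 'I_r}) : {ffun 'I_n -> 'I_P} :=
  [ffun i => vs.1 (vs.2 i)].
apply: (@leq_trans #|[set h vs | vs in {: {ffun 'I_r -> 'I_P} * {ffun 'I_n -> 'I_r}}]%SET|); last first.
  apply: leq_trans (leq_imset_card _ _) _.
  by rewrite card_prod !card_ffun !card_ord.
apply: subset_leq_card; apply/fintype.subsetP => x; rewrite inE => sx.
apply/imsetP; pose U := undup (codom x); pose d := x (Ordinal n0).
have ix i : (index (x i) U < r)%N.
  by apply: leq_trans sx; rewrite index_mem mem_undup codom_f.
exists ([ffun k : 'I_r => nth d U k], [ffun i => Ordinal (ix i)]) => //.
by apply/ffunP => i; rewrite !ffunE /= nth_index // mem_undup codom_f.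
Qed.

Lemma many_values_perm (r b P : nat) (x : {ffun 'I_(r + b) -> 'I_P}) :
  (r <= size (undup (codom x)))%N ->
  exists s : 'S_(r + b), injective (fun k : 'I_r => x (s (lshift b k))).
Proof.
move=> sx; set t := take r (undup (codom x)).
have st : size t = r by rewrite size_takel.
have ut : uniq t by rewrite take_uniq // undup_uniq.
have [s3 pe] : {s3 | perm_eq (codom x) (t ++ s3)}.
  by apply: perm_to_subseq; apply: subseq_trans (take_subseq _ _) (undup_subseq _).
have sz : size (t ++ s3) == (r + b)%N by rewrite -(perm_size pe) size_codom card_ord.
have sc : size (codom x) == (r + b)%N by rewrite size_codom card_ord.
have := @tuple_permP _ _ (Tuple sz) (Tuple sc); rewrite perm_sym => /elimT /(_ pe) [s Es].
exists s => k l /= kl.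
have nthE (m : 'I_r) : x (s (lshift b m)) = nth (x (s (lshift b m))) t m.
  have := congr1 (fun u : seq _ => nth (x (s (lshift b m))) u m) Es => /=.
  rewrite nth_cat st ltn_ord => ->.
  rewrite (nth_map (lshift b m)) ?size_enum_ord ?(ltn_addr _ (ltn_ord m)) //.
  rewrite (_ : nth _ (enum _) m = lshift b m); last first.
    by apply: val_inj; rewrite /= nth_enum_ord // ltn_addr.
  rewrite (tnth_nth (x (s (lshift b m)))) /= codomE (nth_map (lshift b m)) ?size_enum_ord //.
  by congr (x _); apply: val_inj; rewrite /= nth_enum_ord.
apply: val_inj; apply/eqP; rewrite -(nth_uniq (x (s (lshift b k))) _ _ ut) ?st ?ltn_ord //.
apply/eqP; rewrite -(nthE k) kl (nthE l); apply: set_nth_default; by rewrite st.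
Qed.

(** [vinogradov_J] is the sum over [v] of the squared number of tuples with power sums [v]. Tuples
    with at most [r] distinct values are few. In any other tuple some permutation brings [r]
    distinct values to the front, and one of the [m] primes keeps these distinct; hence the factor
    [(r + b)!] and the sum over [i]. Cauchy's inequality over [i] costs [m], and each remaining sum
    of squares is at most a [K_count]. *)
Lemma vinogradov_step (R : realType) (r b P m : nat) (pr : 'I_m -> nat) :
  (0 < r)%N -> (0 < b)%N -> (0 < P)%N ->
  (forall i, [&& prime (pr i), r < pr i & P <= pr i ^ r]%N) ->
  (forall z : 'I_r -> 'I_P, injective z -> exists i, distinct_mod (pr i) (fun k => z k)) ->
  (vinogradov_J r (r + b) P <= 2 * (P ^ r * r ^ (r + b)) ^ 2
     + 2 * (((r + b)`!) ^ 2 * (m * \sum_i (pr i ^ (2 * b)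
          * (P ^ r * ((\prod_(j < r) pr i ^ (r - j.+1)) * r ^ r) * vinogradov_J r b (P %/ pr i).+1)))))%N.
Proof.
move=> r0 b0 P0 hpr sep.
pose X := {ffun 'I_(r + b) -> 'I_P}.
pose s (x : X) : {ffun 'I_r -> nat} := [ffun j : 'I_r => psum x j.+1].
pose W := undup (codom s).
have uW : uniq W := undup_uniq _.
have sW x : s x \in W by rewrite mem_undup codom_f.
pose bad (x : X) := (size (undup (codom x)) <= r)%N.
pose D i (x : X) := distinct_mod (pr i) (fun k => x (lshift b k)).
pose nb v := #|[pred x | bad x && (s x == v)]|.
pose ng v := #|[pred x | ~~ bad x && (s x == v)]|.
pose n i v := #|[pred x | D i x && (s x == v)]|.
have JE : vinogradov_J r (r + b) P = (\sum_(v <- W) #|[pred x | s x == v]| ^ 2)%N.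
  under eq_bigr do rewrite -mulnn.
  rewrite -(@card_eq_pairs _ _ _ s s _ predT predT uW sW) /=.
  apply: eq_card => [[x y]]; rewrite !inE /=; apply/forallP/eqP => [H|H j].
    by apply/ffunP => j; rewrite !ffunE (eqP (H j)).
  by have := congr1 (fun f : {ffun 'I_r -> nat} => f j) H; rewrite !ffunE => ->.
have ngle v : (ng v <= (r + b)`! * \sum_i n i v)%N.
  have -> : ((r + b)`! * \sum_i n i v = \sum_(t : 'S_(r + b)) \sum_i n i v)%N.
    by rewrite sum_nat_const card_Sn.
  pose Dt (t : 'S_(r + b)) i (x : X) := distinct_mod (pr i) (fun k => x (t (lshift b k))).
  apply: (@leq_trans (\sum_(x : X | s x == v) \sum_(t : 'S_(r + b)) \sum_i Dt t i x)%N).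
    rewrite /ng -sum1_card big_mkcond [leqRHS]big_mkcond /=.
    apply: leq_sum => x _; rewrite !inE; case: (boolP (bad x)) => //= /negP nbad.
    case: (s x == v) => //.
    have [t tinj] : exists t : 'S_(r + b), injective (fun k : 'I_r => x (t (lshift b k))).
      by apply: many_values_perm; rewrite leqNgt; apply/negP => h; apply: nbad; exact: ltnW.
    have [i Hi] := sep _ tinj.
    rewrite (bigD1 t) //= (bigD1 i) //= [Dt t i x](_ : _ = true) //.
  rewrite exchange_big /=; apply: leq_sum => t _; rewrite exchange_big /=.
  apply: leq_sum => i _; rewrite /n -sum1_card -big_mkcondr /=.
  pose g (x : X) : X := [ffun k => x (t k)].
  have ginj : injective g.
    move=> x y /ffunP H; apply/ffunP => k; have := H ((t^-1)%g k).
    by rewrite !ffunE permKV.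
  have gs x : s (g x) = s x.
    apply/ffunP => j; rewrite !ffunE /psum [RHS](reindex_inj (@perm_inj _ t)).
    by apply: eq_bigr => k _; rewrite ffunE.
  rewrite [leqRHS](reindex_inj ginj) /=; apply: eq_leq; apply: eq_bigl => x.
  rewrite inE gs andbC; congr (_ && _).
  by apply: eq_forallb => k; apply: eq_forallb => l; rewrite !ffunE.
have nK i : (\sum_(v <- W) n i v ^ 2 <= K_count r b (pr i) (predT : pred 'I_P))%N.
  under eq_bigr do rewrite -mulnn.
  rewrite -(@card_eq_pairs _ _ _ s s _ (D i) (D i) uW sW) /=.
  pose f (x : X) := ([ffun k : 'I_r => x (lshift b k)], [ffun k : 'I_b => x (rshift r k)]).
  have finj : injective f.
    move=> x y [/ffunP H1 /ffunP H2]; apply/ffunP => k; rewrite -(splitK k).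
    by case: (fintype.split k) => l /=; [have := H1 l | have := H2 l]; rewrite !ffunE.
  apply: (@leq_card_inj _ _ _ _ (fun q => (f q.1, f q.2))); last first.
    by move=> [x y] [x' y'] _ _ /eqP; rewrite /= xpair_eqE => /andP[/eqP/finj -> /eqP/finj ->].
  move=> [x y] /and3P[/= dx dy /eqP sxy].
  have fD z : distinct_mod (pr i) (fun k => (f z).1 k) = D i z.
    by apply: eq_forallb => k; apply: eq_forallb => l; rewrite !ffunE.
  apply/and3P; split.
  - by apply/andP; split; [exact: (etrans (fD x) dx) | apply/forallP].
  - by apply/andP; split; [exact: (etrans (fD y) dy) | apply/forallP].
  apply/forallP => j.
  have fs (z : X) : (psum (f z).1 j.+1 + psum (f z).2 j.+1 = psum z j.+1)%N.
    rewrite /psum big_split_ord /=; congr (_ + _)%N; by apply: eq_bigr => k _; rewrite ffunE.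
  have := congr1 (fun h : {ffun 'I_r -> nat} => h j) sxy; rewrite !ffunE -!fs /= => ->.
  by [].
have Kle i : (K_count r b (pr i) (predT : pred 'I_P) <= pr i ^ (2 * b)
      * (P ^ r * ((\prod_(j < r) pr i ^ (r - j.+1)) * r ^ r) * vinogradov_J r b (P %/ pr i).+1))%N.
  have /and3P[pp rp Pp] := hpr i.
  apply: leq_trans (K_count_residues R r P0 b0 (prime_gt0 pp)) _.
  have -> : (2 * b = (2 * b).-1.+1)%N by lia.
  rewrite expnSr -[in leqRHS]mulnA leq_mul2l; apply/orP; right.
  rewrite -[X in (_ <= X * _)%N]card_ord -sum_nat_const; apply: leq_sum => a _.
  by apply: K_count_class => //; rewrite r0.
rewrite JE; apply: (@leq_trans (\sum_(v <- W) (2 * nb v ^ 2 + 2 * ng v ^ 2))%N).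
  apply: leq_sum => v _.
  have -> : #|[pred x | s x == v]| = (nb v + ng v)%N.
    rewrite -(cardID [pred x | bad x]); congr (_ + _)%N; apply: eq_card => x.
      by rewrite !inE andbC.
  move: (nb v) (ng v) => x y; have := (nat_Cauchy x y).1; rewrite sqrnD.
  by move: (2 * (x * y))%N (x ^ 2)%N (y ^ 2)%N => *; lia.
rewrite big_split /= -!big_distrr /= leq_add //.
  rewrite leq_mul2l /=.
  apply: (@leq_trans ((\sum_(v <- W) nb v) ^ 2)%N).
    elim: (W) => [|v w IH]; first by rewrite !big_nil.
    rewrite !big_cons sqrnD; lia.
  rewrite leq_exp2r //; apply: leq_trans (few_values_card _ _ r0); last by rewrite addn_gt0 r0.
  rewrite -sum1_card; under eq_bigr do rewrite /nb -sum1_card.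
  rewrite (exchange_big_dep bad) /=; last by move=> v x _; rewrite inE => /andP[].
  apply: leq_sum => x bx; rewrite -big_filter sum1_size.
  apply: (@leq_trans (size [:: s x])) => //; apply: uniq_leq_size; first exact: filter_uniq.
  by move=> v; rewrite mem_filter !inE => /andP[/andP[_ /eqP->] _].
rewrite leq_mul2l /=.
apply: (@leq_trans (\sum_(v <- W) ((r + b)`! ^ 2 * (m * \sum_i n i v ^ 2)))%N).
  apply: leq_sum => v _; apply: (@leq_trans (((r + b)`! * \sum_i n i v) ^ 2)%N).
    by rewrite leq_exp2r.
  rewrite expnMn leq_mul2l; apply/orP; right.
  rewrite -(@ler_nat int) natrM !natrX !natr_sum.
  have := @power_mean int 'I_m (fun i => (n i v)%:R) 1 (fun i => ler0n _ _).
  by rewrite card_ord expr1; under [X in _ <= _ * X -> _]eq_bigr do rewrite -natrX.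
rewrite -big_distrr /= leq_mul2l; apply/orP; right.
rewrite -big_distrr /= leq_mul2l; apply/orP; right.
rewrite exchange_big /=; apply: leq_sum => i _.
exact: leq_trans (nK i) (Kle i).
Qed.

(** * Chebyshev's lower bound for the number of primes *)

Lemma central_binomial_ge (n : nat) : (2 ^ n <= 'C(n.*2, n))%N.
Proof.
elim: n => // n IH; rewrite doubleS expnS binS.
have h : 'C(n.*2.+1, n.+1) = 'C(n.*2.+1, n).
  rewrite -bin_sub; last by lia.
  by congr 'C(_, _); lia.
rewrite h addnn -mul2n leq_mul2l /=; apply: leq_trans IH _.
by case: n {h} => [|n] //; rewrite binS leq_addr.
Qed.

(** By Legendre's formula the exponent of [p] is the sum over [k] of [[2n/p^k] - 2 [n/p^k]]; each
    term is at most 1, and it vanishes once [p^k > 2n]. *)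
Lemma central_binomial_logn (p n : nat) : prime p -> (0 < n)%N ->
  (p ^ logn p 'C(n.*2, n) <= n.*2)%N.
Proof.
move=> pp n0; have p1 := prime_gt1 pp.
have h2 : (0 < n.*2)%N by rewrite double_gt0.
have := trunc_logP p1 h2; set t := trunc_log p n.*2 => Ht.
apply: leq_trans Ht; rewrite leq_exp2l //.
have := @bin_fact n.*2 n; rewrite -addnn leq_addr addKn addnn => /(_ isT) H.
have := congr1 (logn p) H; rewrite !lognM ?muln_gt0 ?fact_gt0 ?bin_gt0 //; last by lia.
rewrite !logn_fact //.
have E : (\sum_(1 <= k < n.+1) n %/ p ^ k = \sum_(1 <= k < n.*2.+1) n %/ p ^ k)%N.
  rewrite [RHS](big_cat_nat _ (n := n.+1)) //=; last by lia.
  rewrite [X in _ = addn _ X]big_nat_cond [X in _ = addn _ X]big1 ?addn0 // => k /andP[/andP[nk _] _].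
  by rewrite divn_small // (leq_trans (ltn_expl n p1)) // leq_exp2l // ltnW.
rewrite E => H2.
suff : (\sum_(1 <= k < n.*2.+1) n.*2 %/ p ^ k
   <= \sum_(1 <= k < n.*2.+1) (n %/ p ^ k + n %/ p ^ k) + t)%N.
  by rewrite big_split /=; lia.
apply: (@leq_trans (\sum_(1 <= k < n.*2.+1) (n %/ p ^ k + n %/ p ^ k + (k <= t)))%N).
  rewrite big_nat [leqRHS]big_nat; apply: leq_sum => k /andP[k1 k2].
  have [kt|tk] := leqP k t.
    have P0 : (0 < p ^ k)%N by rewrite expn_gt0 prime_gt0.
    have := divn_eq n (p ^ k); have := ltn_pmod n P0.
    set m := (n %/ p ^ k)%N => h3 h4.
    suff : (n.*2 %/ p ^ k < (m + m).+2)%N by lia.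
    by rewrite ltn_divLR //; nia.
  rewrite divn_small ?leq0n //.
  by apply: leq_trans (trunc_log_ltn n.*2 p1) _; rewrite leq_exp2l.
rewrite big_split /= leq_add2l.
have cnt m : (\sum_(1 <= k < m.+1) (k <= t) <= t)%N.
  elim: m => [|m IHm]; first by rewrite big_geq.
  have [mt|tm] := leqP m.+1 t.
    rewrite (@leq_trans (\sum_(1 <= k < m.+2) 1)%N) //.
      by apply: leq_sum => k _; case: (k <= t)%N.
    by rewrite sum_nat_const_nat muln1 subn1.
  by rewrite big_nat_recr //= [(m.+1 <= t)%N]leqNgt tm addn0.
exact: cnt.
Qed.

Definition primes_le (n : nat) : seq nat := [seq p <- iota 0 n.+1 | prime p].

(** The central binomial coefficient is at least [2^n], all its primes are at most [2 n], and each
    prime power in its factorization is at most [2 n]. *)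
Lemma chebyshev_lower (n : nat) : (0 < n)%N ->
  (2 ^ n <= n.*2 ^ size (primes_le n.*2))%N.
Proof.
move=> n0; apply: leq_trans (central_binomial_ge n) _.
have C0 : (0 < 'C(n.*2, n))%N by rewrite bin_gt0; lia.
rewrite {1}(prod_prime_decomp C0) prime_decompE big_map /=.
apply: (@leq_trans (n.*2 ^ size (primes 'C(n.*2, n)))).
  have : all prime (primes 'C(n.*2, n)).
    by apply/allP => p; rewrite mem_primes => /andP[].
  elim: (primes _) => [|p s IH] /=; first by rewrite big_nil.
  move=> /andP[pp /IH {}IH]; rewrite big_cons expnS leq_mul //.
  exact: central_binomial_logn.
rewrite leq_pexp2l ?double_gt0 // uniq_leq_size ?primes_uniq // => p.
rewrite mem_primes => /and3P[pp _ pC]; rewrite mem_filter pp mem_iota add0n ltnS /=.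
have : (p %| (n.*2)`!)%N.
  have /= := @bin_fact n.*2 n; rewrite -addnn leq_addr => /(_ isT) <-.
  by rewrite addnn dvdn_mulr.
elim: (n.*2) => [|m IH]; first by rewrite fact0 dvdn1 => /eqP p1; rewrite p1 in pp.
rewrite factS Euclid_dvdM // => /orP[/dvdn_leq->//|/IH/leq_trans]; exact.
Qed.

Lemma eq_le_trivial (d : Order.disp_t) (T : porderType d) (x y : T) : x = y -> (x <= y)%O.
Proof. by move=> ->. Qed.

(** * From the mean value to bilinear Weyl sums *)

Lemma sum_fibers_le (R : numDomainType) (X Y : finType) (B : pred Y) (f : X -> Y) (h : Y -> R)
  (n : nat) : (forall y, 0 <= h y) -> (forall x, B (f x)) ->
  (forall y, (#|[pred x | f x == y]| <= n)%N) ->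
  \sum_x h (f x) <= n%:R * \sum_(y | B y) h y.
Proof.
move=> h0 fB fib; rewrite (partition_big f B) //= mulr_sumr; apply: ler_sum => y _.
rewrite (eq_bigr (fun _ => h y)) => [|x /eqP -> //].
by rewrite sumr_const mulr_natl; apply: ler_wpMn2l => //; exact: fib.
Qed.

Definition box_radius (b Q j : nat) : nat := (b * Q ^ j.+1)%N.

(** Both variables stand for integers in [[-X, X]], shifted by [X] to become ordinals. *)
Definition box_sum (R : realType) (X : nat) (beta : R) : R :=
  \sum_(l < (2 * X).+1) normc (\sum_(m < (2 * X).+1)
     cis (beta * (m%:R - X%:R) * (l%:R - X%:R))).

Definition power_diff (R : realType) (b Q j : nat)
  (p : {ffun 'I_b -> 'I_Q} * {ffun 'I_b -> 'I_Q}) : R :=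
  (psum p.1 j.+1)%:R - (psum p.2 j.+1)%:R.

(** Encodes the vector of power differences by a vector of ordinals, each shifted by its radius, so
    that sums over boxes are finite sums. The bound on the fibres is [vinogradov_J_shift]. *)
Lemma power_diff_index (R : realType) (r b Q : nat) : exists M : nat,
  exists2 phi : {ffun 'I_b -> 'I_Q} * {ffun 'I_b -> 'I_Q} -> {ffun 'I_r -> 'I_M.+1},
  (forall j : 'I_r, (2 * box_radius b Q j <= M)%N) &
  [/\ forall p j, (phi p j <= 2 * box_radius b Q j)%N,
      forall p (j : 'I_r), (phi p j)%:R - (box_radius b Q j)%:R = power_diff R j p &
      forall y, (#|[pred p | phi p == y]| <= vinogradov_J r b Q)%N].
Proof.
pose M := (\max_(j < r) (2 * box_radius b Q j))%N.
have MB (j : 'I_r) : (2 * box_radius b Q j <= M)%N.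
  exact: (leq_bigmax_cond (F := fun j : 'I_r => (2 * box_radius b Q j)%N)).
pose v (p : {ffun 'I_b -> 'I_Q} * {ffun 'I_b -> 'I_Q}) (j : 'I_r) :=
  (psum p.1 j.+1 + (box_radius b Q j - psum p.2 j.+1))%N.
have p1 (p : {ffun 'I_b -> 'I_Q}) (j : nat) : (psum p j.+1 <= box_radius b Q j)%N := psum_le _ _.
have v2 p j : (v p j <= 2 * box_radius b Q j)%N.
  by rewrite mul2n -addnn leq_add // ?p1 // leq_subr.
have vM p j : (v p j < M.+1)%N by rewrite ltnS (leq_trans (v2 p j)).
exists M, (fun p => [ffun j => Ordinal (vM p j)]) => //; split => [p j|p j|y].
- by rewrite ffunE; exact: v2.
- by rewrite ffunE /= natrD natrB // /power_diff; ring.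
apply: leq_trans (vinogradov_J_shift b Q (fun j => (y j)%:Z - (box_radius b Q j)%:Z)).
apply: subset_leq_card; apply/fintype.subsetP => p; rewrite !inE => /eqP <-.
apply/forallP => j; rewrite ffunE /=; apply/eqP.
move: (p1 p.2 j); rewrite /v.
by move: (psum p.1 j.+1) (psum p.2 j.+1) (box_radius b Q j) => x1 x2 x3 h; lia.
Qed.

Lemma normc_real_ge0 (R : realType) (x : R) : 0 <= x -> normc x%:C = x.
Proof. by move=> x0; rewrite normc_real ger0_norm. Qed.

(** Vinogradov's double use of Holder's inequality. Raising the sum over [v] to the power [2 b]
    replaces the powers [v^j] by power differences; a second Holder inequality over these
    differences, again with exponent [2 b], does the same for the powers [u^j]. On either side a
    vector of differences arises at most [vinogradov_J] times, whence its square. Once the vectors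
    are completed to full boxes, the sum factors over [j]. *)
Lemma bilinear_bound (R : realType) (r b Q : nat) (beta : 'I_r -> R) :
  (0 < b)%N -> (0 < Q)%N ->
  normc (\sum_(u < Q) \sum_(v < Q)
     cis (\sum_j beta j * (u%:R ^+ j.+1 * v%:R ^+ j.+1))) ^+ (2 * b * (2 * b))
  <= Q%:R ^+ ((2 * b).-1 * (2 * b)) * (Q%:R ^+ (2 * b)) ^+ (2 * b).-1
     * ((vinogradov_J r b Q)%:R ^+ 2 * \prod_(j < r) box_sum (box_radius b Q j) (beta j)).
Proof.
move=> b0 Q0; have e2 : (2 * b = (2 * b).-1.+1)%N by lia.
pose T := {ffun 'I_b -> 'I_Q}.
pose Lam j (p : T * T) : R := power_diff R j p.
have [M [phi MB [phi2 phiE phif]]] := power_diff_index R r b Q.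
pose X (j : 'I_r) := box_radius b Q j.
pose B (y : {ffun 'I_r -> 'I_M.+1}) := [forall j, (y j <= 2 * X j)%N].
have phiB p : B (phi p) by apply/forallP => j; exact: phi2.
pose val (y : {ffun 'I_r -> 'I_M.+1}) (j : 'I_r) : R := (y j)%:R - (X j)%:R.
have expand (c : 'I_r -> R) :
   (normc (\sum_(u < Q) cis (\sum_j c j * u%:R ^+ j.+1)) ^+ (2 * b))%:C
   = \sum_(p : T * T) cis (\sum_j c j * Lam j p).
  rewrite expand_normc_power; apply: eq_bigr => p _; congr cis.
  rewrite ![\sum_(i < b) \sum_(j < r) _]exchange_big /= -sumrB; apply: eq_bigr => j _.
  by rewrite -!mulr_sumr -mulrBr /Lam /power_diff /psum !natr_sum;
     congr (_ * (_ - _)); apply: eq_bigr => i _; rewrite natrX.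
pose H (c : 'I_r -> R) := normc (\sum_(u < Q) cis (\sum_j c j * u%:R ^+ j.+1)).
have step1 : normc (\sum_(u < Q) \sum_(v < Q)
     cis (\sum_j beta j * (u%:R ^+ j.+1 * v%:R ^+ j.+1))) ^+ (2 * b)
   <= Q%:R ^+ (2 * b).-1 * \sum_(p : T * T) H (fun j => beta j * Lam j p).
  rewrite {1}e2; apply: (@le_trans _ _ ((\sum_(u < Q) normc (\sum_(v < Q)
     cis (\sum_j beta j * (u%:R ^+ j.+1 * v%:R ^+ j.+1)))) ^+ (2 * b).-1.+1)).
    by rewrite lerXn2r ?nnegrE ?normc_ge0 ?sumr_ge0 ?normc_sum // => *; exact: normc_ge0.
  apply: le_trans (power_mean _ _) _ => [u|]; first exact: normc_ge0.
  rewrite card_ord; apply: ler_wpM2l; first by rewrite exprn_ge0.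
  rewrite -e2.
  (* A sum of nonnegative reals is its own modulus, so the [2 b]-th powers can be expanded over [p]
     and the sum over [u] moved inside without introducing unimodular weights. *)
  have -> : \sum_(u < Q) normc (\sum_(v < Q)
     cis (\sum_j beta j * (u%:R ^+ j.+1 * v%:R ^+ j.+1))) ^+ (2 * b)
    = normc (\sum_(p : T * T) \sum_(u < Q) cis (\sum_j beta j * Lam j p * u%:R ^+ j.+1)).
    rewrite exchange_big /= -[LHS]normc_real_ge0; last first.
      by apply: sumr_ge0 => u _; rewrite exprn_ge0 ?normc_ge0.
    congr normc; rewrite rmorph_sum; apply: eq_bigr => u _ /=.
    have -> : \sum_(v < Q) cis (\sum_j beta j * (u%:R ^+ j.+1 * v%:R ^+ j.+1))
       = \sum_(v < Q) cis (\sum_j (beta j * u%:R ^+ j.+1) * v%:R ^+ j.+1).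
      by apply: eq_bigr => v _; congr cis; apply: eq_bigr => j _; rewrite mulrA.
    rewrite expand; apply: eq_bigr => p _; congr cis; apply: eq_bigr => j _; ring.
  apply: le_trans (normc_sum _ _ _) _; apply: ler_sum => p _; exact: lexx.
have H0 c : 0 <= H c by exact: normc_ge0.
have step2 : (\sum_(p : T * T) H (fun j => beta j * Lam j p)) ^+ (2 * b)
   <= (Q%:R ^+ (2 * b)) ^+ (2 * b).-1 * \sum_(p : T * T) H (fun j => beta j * Lam j p) ^+ (2 * b).
  rewrite {1 4}e2; apply: le_trans (power_mean _ _) _ => [p|]; first exact: H0.
  rewrite card_prod card_ffun !card_ord natrM natrX -exprD addnn -mul2n.
  by rewrite -e2.
have step3 : \sum_(p : T * T) H (fun j => beta j * Lam j p) ^+ (2 * b)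
   <= (vinogradov_J r b Q)%:R * \sum_(y | B y) H (fun j => beta j * val y j) ^+ (2 * b).
  apply: le_trans (sum_fibers_le (h := fun y => H (fun j => beta j * val y j) ^+ (2 * b)) _ phiB phif).
    apply: ler_sum => p _; apply: eq_le_trivial; congr (_ ^+ _); rewrite /H; congr normc.
    by apply: eq_bigr => u _; congr cis; apply: eq_bigr => j _; rewrite /val phiE.
  by move=> y; rewrite exprn_ge0.
have step4 : \sum_(y | B y) H (fun j => beta j * val y j) ^+ (2 * b)
   <= (vinogradov_J r b Q)%:R * \prod_(j < r) box_sum (box_radius b Q j) (beta j).
  have -> : \sum_(y | B y) H (fun j => beta j * val y j) ^+ (2 * b)
    = normc (\sum_(p : T * T) \sum_(y | B y) cis (\sum_j beta j * val y j * Lam j p)).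
    rewrite exchange_big /= -[LHS]normc_real_ge0; last first.
      by apply: sumr_ge0 => u _; rewrite exprn_ge0.
    by congr normc; rewrite rmorph_sum; apply: eq_bigr => y _ /=; rewrite expand.
  apply: le_trans (normc_sum _ _ _) _.
  pose h (z : {ffun 'I_r -> 'I_M.+1}) :=
    normc (\sum_(y | B y) cis (\sum_j beta j * val y j * val z j)).
  apply: (@le_trans _ _ (\sum_p h (phi p))).
    apply: ler_sum => p _; apply: eq_le_trivial; rewrite /h; congr normc.
    by apply: eq_bigr => y _; congr cis; apply: eq_bigr => j _; rewrite [val (phi p) j]phiE.
  apply: le_trans (sum_fibers_le _ phiB phif) _; first by move=> z; exact: normc_ge0.
  apply: ler_wpM2l => //; apply: eq_le_trivial.
  have famB (F : 'I_r -> 'I_M.+1 -> R) :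
     \sum_(z | B z) \prod_j F j (z j) = \prod_j \sum_(l < M.+1 | (l <= 2 * X j)%N) F j l.
    rewrite (bigA_distr_big_dep (fun j (l : 'I_M.+1) => (l <= 2 * X j)%N)) /=.
    by apply: eq_bigl => z; apply/forallP/familyP => Hz j; have := Hz j.
  have famC (F : 'I_r -> 'I_M.+1 -> R[i]) :
     \sum_(z | B z) \prod_j F j (z j) = \prod_j \sum_(l < M.+1 | (l <= 2 * X j)%N) F j l.
    rewrite (bigA_distr_big_dep (fun j (l : 'I_M.+1) => (l <= 2 * X j)%N)) /=.
    by apply: eq_bigl => z; apply/forallP/familyP => Hz j; have := Hz j.
  transitivity (\sum_(z | B z) \prod_j normc (\sum_(m < M.+1 | (m <= 2 * X j)%N)
      cis (beta j * (m%:R - (X j)%:R) * ((z j)%:R - (X j)%:R)))).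
    apply: eq_bigr => z _; rewrite /h -(big_morph _ (@normcM R) (@normc1 R)); congr normc.
    by rewrite -famC; apply: eq_bigr => y _; rewrite cis_sum.
  rewrite (famB (fun j (l : 'I_M.+1) => normc (\sum_(m < M.+1 | (m <= 2 * X j)%N)
      cis (beta j * (m%:R - (X j)%:R) * (l%:R - (X j)%:R))))).
  apply: eq_bigr => j _.
  have wid (V : nmodType) (F : nat -> V) :
    \sum_(l < M.+1 | (l <= 2 * X j)%N) F l = \sum_(l < (2 * X j).+1) F l.
    by rewrite (big_ord_widen_cond M.+1 predT F) ?ltnS ?MB //=; apply: eq_bigl => l; rewrite ltnS.
  rewrite /box_sum (wid _ (fun l => normc (\sum_(m < M.+1 | (m <= 2 * X j)%N)
      cis (beta j * (m%:R - (X j)%:R) * (l%:R - (X j)%:R))))).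
  apply: eq_bigr => l _.
  by rewrite (wid _ (fun m => cis (beta j * (m%:R - (X j)%:R) * (l%:R - (X j)%:R)))).
rewrite exprM.
apply: (@le_trans _ _ ((Q%:R ^+ (2 * b).-1 * \sum_(p : T * T) H (fun j => beta j * Lam j p)) ^+ (2 * b))).
  rewrite lerXn2r ?nnegrE ?exprn_ge0 ?normc_ge0 //.
  by rewrite mulr_ge0 ?exprn_ge0 // sumr_ge0.
rewrite exprMn -[X in X * _ <= _]exprM -[leRHS]mulrA; apply: ler_wpM2l; first by rewrite exprn_ge0.
apply: le_trans step2 _; apply: ler_wpM2l; first by rewrite !exprn_ge0.
apply: le_trans step3 _; rewrite expr2 -mulrA; apply: ler_wpM2l => //.
Qed.

(** * Primes on a logarithmic scale and the induction on the number of variables *)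

Lemma ln2_ge (R : realType) : 1 / 2 <= ln 2 :> R.
Proof.
have := @le_ln1Dx R (- (1 / 2)); have -> : 1 + - (1 / 2) = 2^-1 :> R by lra.
rewrite lnV ?posrE // => /(_ _); lra.
Qed.

(** Chebyshev's bound is applied up to [X = exp ((1 + c) y)], and the at most [exp y + 1] primes
    below [exp y] are discarded. The condition [c^2 y >= 96] makes
    [exp (c y) >= (c y)^2 / 2 >= 48 y], so that at least [exp y] primes remain. *)
Lemma primes_between (R : realType) (c y : R) (m : nat) : 0 < c -> c <= 1 ->
  96 / c ^+ 2 + 1 <= y -> m%:R <= expR y ->
  exists2 pr : 'I_m -> nat, injective pr &
    forall i, prime (pr i) /\ y <= ln (pr i)%:R <= (1 + c) * y.
Proof.
move=> c0 c1 hy my.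
have c2 : 0 < c ^+ 2 by rewrite exprn_gt0.
have y96 : 96 <= c ^+ 2 * y.
  have : 96 / c ^+ 2 <= y by lra.
  by rewrite ler_pdivrMr // mulrC.
have y0 : 0 < y by apply: lt_le_trans hy; rewrite ltr_wpDl // divr_ge0 // ltW.
have y1 : 96 <= y.
  apply: le_trans y96 _; rewrite -[leRHS]mul1r ler_wpM2r ?(ltW y0) //.
  by rewrite expr_le1 ?(ltW c0).
set E := expR y in my *; have E1 : 1 + y <= E by exact: expR_ge1Dx.
set G := expR (c * y).
have G48 : 48 * y <= G.
  have := @expR_ge1Dxn R (c * y) 1; rewrite mulr_ge0 ?(ltW c0) ?(ltW y0) //.
  have -> : (2`!)%:R = 2 :> R by [].
  move=> /(_ isT); rewrite -/G exprMn => h.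
  have h2 : 96 * y <= c ^+ 2 * y * y by rewrite ler_wpM2r // ltW.
  by rewrite (_ : c ^+ 2 * y ^+ 2 = c ^+ 2 * y * y) in h; [lra | ring].
set X := expR ((1 + c) * y).
have XE : X = E * G by rewrite /X mulrDl mul1r expRD.
have X0 : 0 < X by exact: expR_gt0.
pose n := Num.truncn (X / 2).
have nX : n%:R <= X / 2 < n%:R + 1 by rewrite natr1; apply: truncn_itv; rewrite divr_ge0 ?ltW.
have [nX1 nX2] := andP nX.
have E0 : 0 < E by exact: expR_gt0.
have X4 : 4 <= X.
  by rewrite XE; have : 1 * 4 <= E * G; [apply: ler_pM; lra | lra].
have n0 : (0 < n)%N by rewrite -(ltr_nat R); lra.
pose s := [seq p <- primes_le n.*2 | y <= ln p%:R].
have ps : {in s, forall p, prime p /\ y <= ln p%:R <= (1 + c) * y}.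
  move=> p; rewrite mem_filter mem_filter => /and3P[yp pp].
  rewrite mem_iota add0n /= ltnS => pn; split => //; rewrite yp /=.
  rewrite -ler_expR lnK ?posrE ?ltr0n ?prime_gt0 // -/X.
  apply: (@le_trans _ _ (n.*2)%:R); first by rewrite ler_nat.
  by rewrite -mul2n natrM; lra.
have us : uniq s by rewrite !filter_uniq // iota_uniq.
have sz : (m <= size s)%N.
  have cheb := chebyshev_lower n0.
  have hsplit : size (primes_le n.*2)
     = (size s + size [seq p <- primes_le n.*2 | ~~ (y <= ln p%:R :> R)])%N.
    by rewrite -[LHS](count_predC (fun p : nat => y <= ln p%:R)) -!size_filter.
  have small : (size [seq p <- primes_le n.*2 | ~~ (y <= ln p%:R :> R)] <= (Num.truncn E).+1)%N.
    rewrite -[leqRHS](size_iota 0); apply: uniq_leq_size; first by rewrite !filter_uniq // iota_uniq.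
    move=> p; rewrite mem_filter mem_filter => /and3P[yp pp _].
    rewrite mem_iota add0n /= ltnS -ltNge in yp *.
    have p0 : 0 < p%:R :> R by rewrite ltr0n prime_gt0.
    rewrite truncn_ge_nat ?expR_ge0 // ltW // -[ltLHS]lnK ?posrE //.
    by rewrite ltr_expR.
  have hln : n%:R * ln 2 <= (size (primes_le n.*2))%:R * ((1 + c) * y).
    have : ln ((2 ^ n)%:R : R) <= ln ((n.*2 ^ size (primes_le n.*2))%:R : R).
      by rewrite ler_ln ?posrE ?ltr0n ?expn_gt0 ?double_gt0 ?n0 // ler_nat.
    rewrite !natrX !lnXn ?ltr0n ?double_gt0 // -[ln 2 *+ n]mulr_natl -[X in _ <= X -> _]mulr_natl.
    move/le_trans; apply; apply: ler_wpM2l => //.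
    rewrite -ler_expR lnK ?posrE ?ltr0n ?double_gt0 // -/X.
    by rewrite -mul2n natrM; lra.
  have trE : (Num.truncn E)%:R <= E by rewrite truncn_le expR_ge0.
  rewrite -(ler_nat R); move: small; rewrite -(ler_nat R) -natr1.
  set t := (size [seq _ <- _ | ~~ _])%:R => small.
  move: hln; rewrite hsplit natrD -/t => hln.
  have l2 := ln2_ge R.
  have h1 : X / 4 * (1 / 2) <= n%:R * ln 2 by apply: ler_pM; lra.
  have cy0 : 0 < (1 + c) * y by rewrite mulr_gt0 // ltr_wpDl // ltW.
  have cy2 : (1 + c) * y <= 2 * y by rewrite ler_wpM2r ?(ltW y0) //; lra.
  have h2 : 3 * E * ((1 + c) * y) <= X / 4 * (1 / 2).
    have : E * (3 * ((1 + c) * y)) <= E * (G / 8) by rewrite ler_wpM2l ?(ltW E0) //; lra.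
    by rewrite XE; lra.
  have h3 : 3 * E * ((1 + c) * y) <= ((size s)%:R + t) * ((1 + c) * y) by lra.
  rewrite ler_pM2r // in h3; lra.
exists (fun i : 'I_m => nth 0%N s i) => [i j /eqP|i].
  by rewrite nth_uniq ?(leq_trans (ltn_ord _) sz) // => /eqP/val_inj.
by apply: ps; rewrite mem_nth // (leq_trans (ltn_ord _) sz).
Qed.

Lemma prod_primes_dvd (s : seq nat) (D : nat) : uniq s -> all prime s ->
  all (fun p => p %| D)%N s -> (\prod_(p <- s) p %| D)%N.
Proof.
elim: s => [|p s IH] /=; first by rewrite big_nil dvd1n.
move=> /andP[ps us] /andP[pp aps] /andP[pD aD]; rewrite big_cons Gauss_dvd ?pD ?IH //.
rewrite prime_coprime // Euclid_dvd_prod // big_has -all_predC.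
apply/allP => q qs /=; rewrite dvdn_prime2 //; last exact: (allP aps).
by apply: contraNneq ps => ->.
Qed.

(** If no prime separated the values, each would divide the product of all differences
    [|z k - z l|], which is nonzero and less than [P^(r^2)]. But [m >= r^3] distinct primes, each at
    least [P^(1/r)], have a product of at least [P^(r^2)]. *)
Lemma separating_primes (r P m : nat) (pr : 'I_m -> nat) : (0 < r)%N -> (1 < P)%N ->
  (r ^ 3 <= m)%N -> injective pr -> (forall i, prime (pr i) && (P <= pr i ^ r)%N) ->
  forall z : 'I_r -> 'I_P, injective z -> exists i, distinct_mod (pr i) (fun k => z k).
Proof.
move=> r0 P1 rm pinj ppr z zinj.
pose dist (a b : nat) := (a - b + (b - a))%N.
pose D := (\prod_(q : 'I_r * 'I_r | q.1 != q.2) dist (z q.1) (z q.2))%N.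
have dist0 q : q.1 != q.2 -> (0 < dist (z q.1) (z q.2))%N.
  move=> q12; have : (z q.1 : nat) != z q.2.
    by apply: contraNneq q12 => /val_inj/zinj ->.
  rewrite /dist; lia.
have D0 : (0 < D)%N by rewrite prodn_cond_gt0.
apply/existsP; apply: contraT; rewrite negb_exists => /forallP nsep.
have pD i : (pr i %| D)%N.
  have := nsep i; rewrite negb_forall => /existsP[k]; rewrite negb_forall => /existsP[l].
  rewrite negb_imply negbK => /andP[kl /eqP E].
  rewrite /D (bigD1 (k, l)) //= dvdn_mulr // /dist.
  have [le|/ltnW le] := leqP (z l) (z k).
    by rewrite (eqP (_ : z l - z k == 0)%N) ?addn0 ?subn_eq0 // -eqn_mod_dvd // E.
  by rewrite (eqP (_ : z k - z l == 0)%N) ?add0n ?subn_eq0 // -eqn_mod_dvd // E.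
have : (\prod_(p <- codom pr) p %| D)%N.
  apply: prod_primes_dvd; first by rewrite map_inj_uniq ?enum_uniq.
    by apply/allP => p /codomP[i ->]; case/andP: (ppr i).
  by apply/allP => p /codomP[i ->].
move=> /(dvdn_leq D0); rewrite big_map big_enum /= leqNgt => /negP[].
apply: (@leq_trans (P ^ (r ^ 2))).
  apply: (@leq_ltn_trans (P ^ (r * r.-1))).
    have -> : (P ^ (r * r.-1) = \prod_(q : 'I_r * 'I_r | q.1 != q.2) P)%N.
      rewrite prod_nat_const; congr (_ ^ _)%N.
      rewrite -sum1_card (eq_bigl (fun q : 'I_r * 'I_r => true && (q.1 != q.2))) //.
      rewrite -(pair_big_dep predT (fun a b : 'I_r => a != b) (fun _ _ => 1%N)) /=.
      rewrite (eq_bigr (fun _ => r.-1)) ?sum_nat_const ?card_ord // => a _.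
      by rewrite sum1_card -[RHS](congr1 predn (card_ord r)) -(cardC1 a); apply: eq_card => b; rewrite !inE eq_sym.
    apply: leq_prod => q _; rewrite /dist.
    move: (ltn_ord (z q.1)) (ltn_ord (z q.2)).
    by move: (nat_of_ord (z q.1)) (nat_of_ord (z q.2)) => x1 x2; lia.
  by rewrite ltn_exp2l // -mulnn ltn_mul2l r0 /= ltn_predL.
rewrite -(@leq_exp2r _ _ r) // -expnM.
apply: (@leq_trans (P ^ m)); first by rewrite leq_exp2l // -expnSr.
have -> : ((\prod_(i in 'I_m) pr i) ^ r = \prod_(i in 'I_m) pr i ^ r)%N.
  by elim/big_ind2: _ => [|x1 x2 y1 y2 <- <-|]; rewrite ?exp1n ?expnMn.
rewrite -[X in (_ ^ X)%N]card_ord -prod_nat_const; apply: leq_prod => i _.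
by case/andP: (ppr i).
Qed.

Lemma fact_le_exp (n : nat) : (n`! <= n ^ n)%N.
Proof.
elim: n => // n IH; rewrite factS expnS leq_mul2l /=; apply: leq_trans IH _.
by case: n => // n; rewrite leq_exp2r.
Qed.

Lemma vinogradov_J_gt0 (r b P : nat) : (0 < P)%N -> (0 < vinogradov_J r b P)%N.
Proof.
move=> P0; apply/card_gt0P; exists ([ffun => Ordinal P0], [ffun => Ordinal P0]).
by rewrite inE; apply/forallP.
Qed.

Lemma vinogradov_J_trivial (r b P : nat) : (vinogradov_J r b P <= P ^ (2 * b))%N.
Proof.
apply: leq_trans (max_card _) _.
by rewrite card_prod card_ffun !card_ord mulnC expnM mulnn -!expnM mulnC.
Qed.

Lemma ln_natX (R : realType) (a n : nat) : (0 < a)%N -> ln (a ^ n)%:R = n%:R * ln a%:R :> R.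
Proof. by move=> a0; rewrite natrX lnXn ?ltr0n // mulr_natl. Qed.

Lemma ln_natM (R : realType) (a b : nat) : (0 < a)%N -> (0 < b)%N ->
  ln (a * b)%:R = ln a%:R + ln b%:R :> R.
Proof. by move=> a0 b0; rewrite natrM lnM ?posrE ?ltr0n. Qed.

Lemma ln_nat_ge0 (R : realType) (a : nat) : 0 <= ln a%:R :> R.
Proof.
case: a => [|a]; last by apply: ln_ge0; rewrite ler1n.
by rewrite ln0.
Qed.

Lemma ln_nat_le (R : realType) (a : nat) : ln a%:R <= a%:R :> R.
Proof. by case: a => [|a]; [rewrite ln0 | rewrite ltW // ln_sublinear // ltr0n]. Qed.

Lemma ler_ln_nat (R : realType) (a b : nat) : (0 < a)%N -> (a <= b)%N ->
  ln a%:R <= ln b%:R :> R.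
Proof.
by move=> a0 ab; rewrite ler_ln ?posrE ?ltr0n ?(leq_trans a0) // ler_nat.
Qed.

Lemma nat_expR_ln (R : realType) (a : nat) (t : R) : (0 < a)%N -> ln a%:R <= t -> a%:R <= expR t.
Proof. by move=> a0 h; rewrite -[leLHS]lnK ?posrE ?ltr0n // ler_expR. Qed.

Lemma ln2_le1 (R : realType) : ln 2 <= 1 :> R.
Proof. by have := @le_ln1Dx R 1; rewrite (_ : 1 + 1 = 2) //; apply; lra. Qed.

(** One descent step in logarithms, with [L = ln P] and [q = ln p]. Since [r q >= L], replacing [P]
    by [P / p] multiplies the excess [eta] of the exponent by [1 - 1/r]; since [r q <= (1 + c) L],
    the size of [p] costs a further [c r]. *)
Lemma exponent_step (R : realType) (c rr eta b A L q l2 lr lJ X : R) :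
  0 < c -> c <= 1 -> 2 <= rr -> 0 <= eta -> rr * (rr + 1) / 2 <= b -> 0 <= l2 -> l2 <= 1 ->
  rr * q <= (1 + c) * L -> L <= rr * q -> 0 <= L ->
  lJ <= A + (2 * b - rr * (rr + 1) / 2 + eta) * (L - q + l2) ->
  X <= 2 * b * q + (rr * L + (rr * (rr - 1) / 2 * q + rr * lr)) + lJ ->
  X <= A + rr * lr + (2 * b + eta)
     + (2 * (b + rr) - rr * (rr + 1) / 2 + (eta * (1 - 1 / rr) + c * rr)) * L.
Proof.
move=> c0 c1 r2 e0 hb l20 l21 q1 q2 L0 hJ hX.
have r0 : 0 < rr by lra.
have h1 : rr * (rr * q) <= rr * ((1 + c) * L) by rewrite ler_wpM2l // ltW.
have h2 : eta / rr * L <= eta * q.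
  rewrite mulrAC ler_pdivrMr // -mulrA; apply: ler_wpM2l => //; lra.
have h3 : (2 * b - rr * (rr + 1) / 2 + eta) * l2 <= 2 * b + eta.
  have rr1 : 0 <= rr * (rr + 1) / 2 by rewrite divr_ge0 // mulr_ge0 //; lra.
  by rewrite -[leRHS]mulr1; apply: ler_pM => //; lra.
have -> : (2 * (b + rr) - rr * (rr + 1) / 2 + (eta * (1 - 1 / rr) + c * rr)) * L
  = (2 * b - rr * (rr + 1) / 2 + eta) * L + rr * L + rr * ((1 + c) * L) - eta / rr * L by ring.
move: hJ hX h1; rewrite mulrDr mulrBr.
move: h2 h3.
set D := (2 * b - rr * (rr + 1) / 2 + eta) => h2 h3 hJ hX h1.
have hq : 2 * b * q + rr * (rr - 1) / 2 * q - D * q = rr * (rr * q) - eta * q.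
  by rewrite /D; field.
lra.
Qed.

Lemma ln_divS_le (R : realType) (P p : nat) : (0 < p)%N -> (p <= P)%N ->
  ln (P %/ p).+1%:R <= ln P%:R - ln p%:R + ln 2 :> R.
Proof.
move=> p0 pP; have P0 : (0 < P)%N by exact: leq_trans pP.
rewrite -ln_div ?posrE ?ltr0n // -lnM ?posrE ?divr_gt0 ?ltr0n //.
rewrite ler_ln ?posrE ?mulr_gt0 ?invr_gt0 ?ltr0n //.
have d1 : (1 <= P %/ p)%N by rewrite divn_gt0.
apply: (@le_trans _ _ ((P %/ p)%:R * 2)); first by rewrite -natrM ler_nat; lia.
rewrite ler_pM2r // ler_pdivlMr ?ltr0n // -natrM ler_nat leq_trunc_div //.
Qed.

(** Induction on [l], each step adding [r] variables. The recursion [eta -> eta (1 - 1/r) + c r] has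
    the fixed point [c r^2], and [l = 0] is the trivial bound, whose excess [r (r + 1) / 2] is at
    most [r^2]. The range [l <= 11 r] keeps the number of variables at most [12 r^2], so that
    factorials and powers of [r] cost only a multiple of [r^3] per step. *)
Lemma vinogradov_log (R : realType) (c : R) (r l : nat) : 0 < c -> c <= 1 -> (2 <= r)%N ->
  (l <= 11 * r)%N -> forall P : nat, (0 < P)%N ->
  ln (vinogradov_J r (r ^ 2 + l * r) P)%:R
  <= r%:R ^+ 3 * (96 / c ^+ 2 + 1 + 3 * r%:R) + l%:R * (500 * r%:R ^+ 3)
   + (2 * (r ^ 2 + l * r)%:R - r%:R * (r%:R + 1) / 2
       + (c * r%:R ^+ 2 + r%:R ^+ 2 * (1 - 1 / r%:R) ^+ l)) * ln P%:R.
Proof.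
move=> c0 c1 r2.
set rr := r%:R : R; have rr2 : 2 <= rr by rewrite /rr (ler_nat R 2).
set y0 := 96 / c ^+ 2 + 1.
have y00 : 1 <= y0 by rewrite lerDr divr_ge0 // exprn_ge0 // ltW.
have rr0 : 0 < rr by lra.
have rr2_ge0 : 0 <= rr ^+ 2 by rewrite exprn_ge0 // ltW.
have rr3_ge0 : 0 <= rr ^+ 3 by rewrite exprn_ge0 // ltW.
have q01 : 0 <= 1 - 1 / rr.
  by rewrite subr_ge0 ler_pdivrMr // mul1r; lra.
have crr2 : 0 <= c * rr ^+ 2 by rewrite mulr_ge0 // ltW.
have rrr : rr * (rr + 1) / 2 <= rr ^+ 2.
  have : rr * 1 <= rr * rr by rewrite ler_wpM2l ?(ltW rr0) //; lra.
  by rewrite expr2; lra.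
have triv b P : (0 < P)%N ->
    ln (vinogradov_J r b P)%:R <= 2 * b%:R * ln P%:R :> R.
  move=> P0; rewrite -natrM -ln_natX //; apply: ler_ln_nat; last exact: vinogradov_J_trivial.
  exact: vinogradov_J_gt0.
elim: l => [|l IH] lr P P0; set L := ln P%:R; have L0 : 0 <= L := ln_nat_ge0 _ _.
  apply: le_trans (triv _ _ P0) _; rewrite -/L mul0r addr0 expr0 mulr1.
  have A0 : 0 <= rr ^+ 3 * (y0 + 3 * rr) by rewrite mulr_ge0 //; lra.
  have : 0 <= (c * rr ^+ 2 + rr ^+ 2 - rr * (rr + 1) / 2) * L by rewrite mulr_ge0 //; lra.
  by move: A0; set A := rr ^+ 3 * _ => A0 h; lra.
set b := (r ^ 2 + l * r)%N.
have bE : (r ^ 2 + l.+1 * r = r + b)%N by rewrite /b mulSn addnCA.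
rewrite bE; set bb := b%:R : R.
have bb' : (r + b)%:R = bb + rr :> R by rewrite natrD addrC.
rewrite bb'.
set eta := c * rr ^+ 2 + rr ^+ 2 * (1 - 1 / rr) ^+ l.
have eta0 : 0 <= eta by rewrite addr_ge0 // mulr_ge0 // exprn_ge0.
have etaS : c * rr ^+ 2 + rr ^+ 2 * (1 - 1 / rr) ^+ l.+1 = eta * (1 - 1 / rr) + c * rr.
  rewrite /eta (exprS (1 - 1 / rr) l); set Q := (1 - 1 / rr) ^+ l.
  by field; rewrite gt_eqF.
have eta2 : eta <= 2 * rr ^+ 2.
  have h1 : c * rr ^+ 2 <= 1 * rr ^+ 2 by rewrite ler_wpM2r.
  have h2 : rr ^+ 2 * (1 - 1 / rr) ^+ l <= rr ^+ 2 * 1.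
    apply: ler_wpM2l => //; apply: exprn_ile1 => //.
    by rewrite gerBl divr_ge0 // ltW.
  by rewrite /eta; lra.
rewrite etaS; set eta' := eta * _ + _.
have eta'0 : 0 <= eta'.
  by rewrite addr_ge0 // mulr_ge0 // ?(ltW c0) // ltW.
have bbr : rr ^+ 2 <= bb by rewrite /bb /b natrD natrX lerDl.
have bb12 : bb + rr <= 12 * rr ^+ 2.
  rewrite -bb' -bE -natrX -natrM ler_nat -mulnn.
  have : (l.+1 * r <= 11 * r * r)%N by rewrite leq_mul2r lr orbT.
  by rewrite -mulnA; move: (r * r)%N (l.+1 * r)%N => x1 x2 h; clear - h; lia.
set D' := 2 * (bb + rr) - rr * (rr + 1) / 2 + eta'.
have D'2 : 2 * rr <= D' by rewrite /D'; lra.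
(* Below this threshold the trivial bound is off by at most [r^2 L], which the constant term pays
   for; above it there are enough primes near [P^(1/r)]. *)
have [Lsmall|Lbig] := ltP L (rr * (y0 + 3 * rr)).
  apply: le_trans (triv _ _ P0) _; rewrite -/L bb'.
  have h1 : rr ^+ 2 * L <= rr ^+ 2 * (rr * (y0 + 3 * rr)) by rewrite ler_wpM2l // ltW.
  have h2 : rr ^+ 2 * (rr * (y0 + 3 * rr)) = rr ^+ 3 * (y0 + 3 * rr) by ring.
  have h3 : 0 <= l.+1%:R * (500 * rr ^+ 3) by apply: mulr_ge0; [exact: ler0n | apply: mulr_ge0; [exact: ler0n | exact: rr3_ge0]].
  have h4 : 2 * (bb + rr) * L <= (rr ^+ 2 + D') * L by rewrite ler_wpM2r // /D'; lra.
  by rewrite mulrDl in h4; lra.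
set y := L / rr.
have yy0 : y0 + 3 * rr <= y by rewrite /y ler_pdivlMr // mulrC.
(* The number [r^3] of primes is the one that [separating_primes] asks for. *)
have m3 : (r ^ 3)%:R <= expR y.
  have h : rr <= expR rr by have := expR_ge1Dx rr; lra.
  rewrite natrX -/rr; apply: (@le_trans _ _ (expR (3 * rr))); last by rewrite ler_expR; lra.
  by rewrite expRM_natl lerXn2r ?nnegrE ?expR_ge0 // ltW.
have y0y : y0 <= y by lra.
have [pr pinj prP] := primes_between c0 c1 y0y m3.
have P1 : (1 < P)%N.
  rewrite ltnNge; apply/negP => P1.
  have PE : P = 1%N by apply/eqP; rewrite eqn_leq P1 P0.
  move: Lbig; rewrite /L PE ln1 leNgt => /negP[].
  by rewrite mulr_gt0 //; lra.
have prq i : [/\ prime (pr i), L <= rr * ln (pr i)%:R & rr * ln (pr i)%:R <= (1 + c) * L].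
  have [pp /andP[h1 h2]] := prP i; split => //.
    by move: h1; rewrite /y ler_pdivrMr // mulrC.
  by move: h2; rewrite /y mulrA ler_pdivlMr // mulrC.
have Ppr i : (P <= pr i ^ r)%N.
  have [pp h1 _] := prq i; have pr0 := prime_gt0 pp.
  rewrite -(ler_nat R) -ler_ln ?posrE ?ltr0n ?expn_gt0 ?pr0 //.
  by rewrite ln_natX.
have rpr i : (r < pr i)%N.
  have [pp /andP[h1 _]] := prP i; rewrite -(ltr_nat R) -/rr.
  apply: lt_le_trans (_ : expR y <= _); last by rewrite -[leRHS]lnK ?posrE ?ltr0n ?prime_gt0 // ler_expR.
  by apply: lt_le_trans (expR_ge1Dx y); lra.
have hpr i : [&& prime (pr i), r < pr i & P <= pr i ^ r]%N.
  by have [-> _ _] := prq i; rewrite rpr Ppr.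
have r0 : (0 < r)%N by exact: ltnW.
have b0 : (0 < b)%N by rewrite /b addn_gt0 expn_gt0 r0.
have sep := separating_primes r0 P1 (leqnn _) pinj (fun i => _).
have := @vinogradov_step R r b P (r ^ 3) pr r0 b0 P0 hpr _.
have sep' : forall z : 'I_r -> 'I_P, injective z -> exists i, distinct_mod (pr i) (fun k => z k).
  apply: sep => i; by have [-> _ _] := prq i; rewrite Ppr.
move=> /(_ sep').
pose T1 := (P ^ r * r ^ (r + b))%N.
pose Xi (i : 'I_(r ^ 3)) := (pr i ^ (2 * b) * (P ^ r * ((\prod_(j < r) pr i ^ (r - j.+1)) * r ^ r)
   * vinogradov_J r b (P %/ pr i).+1))%N.
pose f := (r + b)`!.
move=> step0; have step : (vinogradov_J r (r + b) P
   <= 2 * T1 ^ 2 + 2 * (f ^ 2 * (r ^ 3 * \sum_i Xi i)))%N by exact: step0.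
clear step0.
(* Both contributions of [vinogradov_step] are shown to be at most [exp t], which uses 498 of the
   500 units of [r^3]; the last two absorb the factor [4 = 2 + 2]. *)
set t := rr ^+ 3 * (y0 + 3 * rr) + l%:R * (500 * rr ^+ 3) + 498 * rr ^+ 3 + D' * L.
have lnr : ln r%:R <= rr := ln_nat_le _ _.
have lnr0 : 0 <= ln r%:R :> R := ln_nat_ge0 _ _.
have A0 : 0 <= rr ^+ 3 * (y0 + 3 * rr) by rewrite mulr_ge0 //; move: y00 rr0; clear => *; lra.
have l0 : 0 <= l%:R * (500 * rr ^+ 3) by apply: mulr_ge0; [exact: ler0n | apply: mulr_ge0; [exact: ler0n | exact: rr3_ge0]].
have h12 : (bb + rr) * ln r%:R <= 12 * rr ^+ 3.
  have : (bb + rr) * ln r%:R <= 12 * rr ^+ 2 * rr.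
    by apply: ler_pM => //; move: bb12 bbr rr2_ge0 rr0; clear => *; lra.
  by rewrite (_ : 12 * rr ^+ 2 * rr = 12 * rr ^+ 3) //; ring.
have T1le : (T1 ^ 2)%:R <= expR t.
  have T10 : (0 < T1)%N by rewrite muln_gt0 !expn_gt0 P0 r0.
  apply: nat_expR_ln; first by rewrite expn_gt0 T10.
  rewrite ln_natX // /T1 ln_natM ?expn_gt0 ?P0 ?r0 // !ln_natX // bb' -/L -/rr.
  have : 2 * rr * L <= D' * L by rewrite ler_wpM2r.
  by rewrite /t; move: h12 A0 l0 rr3_ge0; clear => *; lra.
have Xle i : (Xi i)%:R <= expR (rr ^+ 3 * (y0 + 3 * rr) + l%:R * (500 * rr ^+ 3)
      + 30 * rr ^+ 3 + D' * L).
  have [pp q1 q2] := prq i; have p0 := prime_gt0 pp.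
  have pP : (pr i <= P)%N.
    rewrite -(ler_nat R) -ler_ln ?posrE ?ltr0n // -/L.
    have : 2 * ln (pr i)%:R <= rr * ln (pr i)%:R by rewrite ler_wpM2r // ln_nat_ge0.
    have : (1 + c) * L <= 2 * L by rewrite ler_wpM2r //; move: c1; clear => *; lra.
    by move: q1 q2; clear => *; lra.
  have J0 : (0 < vinogradov_J r b (P %/ pr i).+1)%N by exact: vinogradov_J_gt0.
  have Pr0 : (0 < \prod_(j < r) pr i ^ (r - j.+1))%N.
    by rewrite prodn_gt0 // => j; rewrite expn_gt0 p0.
  apply: nat_expR_ln; first by rewrite !muln_gt0 !expn_gt0 p0 P0 r0 Pr0 J0.
  have lnX : ln (Xi i)%:R = 2 * bb * ln (pr i)%:R + (rr * L
     + (rr * (rr - 1) / 2 * ln (pr i)%:R + rr * ln r%:R))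
     + ln (vinogradov_J r b (P %/ pr i).+1)%:R.
    rewrite /Xi !ln_natM ?muln_gt0 ?expn_gt0 ?p0 ?P0 ?r0 ?Pr0 ?J0 // !ln_natX //.
    rewrite natrM -/bb -/rr -/L.
    have -> : ln (\prod_(j < r) pr i ^ (r - j.+1))%:R = rr * (rr - 1) / 2 * ln (pr i)%:R.
      rewrite -expn_sum ln_natX //; congr (_ * _).
      have -> : (\sum_(j < r) (r - j.+1) = 'C(r, 2))%N.
        rewrite -bin2_sum big_mkord (reindex_inj rev_ord_inj) /=.
        by apply: eq_bigr => j _; have := ltn_ord j; clear; lia.
      have := congr1 (fun n : nat => n%:R : R) (mul_bin_diag r 1).
      rewrite /= bin1 [(r * _)%:R]natrM [(2 * _)%:R]natrM -/rr => h.
      have -> : rr - 1 = r.-1%:R by rewrite -subn1 natrB.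
      by rewrite h; field.
    ring.
  have rb : rr * (rr + 1) / 2 <= bb by exact: le_trans rrr bbr.
  have l20 : 0 <= ln 2 :> R by have := ln2_ge R; clear => *; lra.
  have D0 : 0 <= 2 * bb - rr * (rr + 1) / 2 + eta by move: rb eta0 bbr rr2_ge0; clear => *; lra.
  have hJ : ln (vinogradov_J r b (P %/ pr i).+1)%:R
     <= (rr ^+ 3 * (y0 + 3 * rr) + l%:R * (500 * rr ^+ 3))
        + (2 * bb - rr * (rr + 1) / 2 + eta) * (L - ln (pr i)%:R + ln 2).
    have lr' : (l <= 11 * r)%N by exact: ltnW.
    apply: le_trans (IH lr' _ (ltn0Sn _)) _; rewrite lerD2l.
    by apply: ler_wpM2l => //; exact: ln_divS_le.
  have lnX' := eq_le_trivial lnX.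
  have := exponent_step c0 c1 rr2 eta0 rb l20 (ln2_le1 R) q2 q1 L0 hJ lnX'.
  rewrite -/eta' -/D' => /le_trans; apply.
  have h1 : rr * ln r%:R <= rr * rr by rewrite ler_wpM2l // ltW.
  have h2 : rr * rr <= rr ^+ 3 by rewrite (_ : rr ^+ 3 = rr * rr * rr); [rewrite ler_peMr ?mulr_ge0 ?(ltW rr0) //; move: rr2; clear => *; lra | ring].
  have h3 : rr ^+ 2 = rr * rr by rewrite expr2.
  by move: h1 h2 h3 eta2 bb12 rr0 rr2_ge0 rr3_ge0; clear => *; lra.
have fm : (f ^ 2 * (r ^ 3 * \sum_i Xi i))%:R <= expR t.
  have f0 : (0 < f)%N by rewrite fact_gt0.
  set E := expR (_ + _ + 30 * rr ^+ 3 + D' * L) in Xle.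
  have hs : (\sum_i Xi i)%:R <= (r ^ 3)%:R * E.
    rewrite natr_sum; apply: (@le_trans _ _ (\sum_(i < r ^ 3) E)).
      by apply: ler_sum => i _; exact: Xle.
    by rewrite sumr_const card_ord -[leLHS]mulr_natl.
  rewrite [(f ^ 2 * _)%:R]natrM [(r ^ 3 * _)%:R]natrM; apply: (@le_trans _ _ ((f ^ 2)%:R * ((r ^ 3)%:R * ((r ^ 3)%:R * E)))).
    by do 2!apply: ler_wpM2l => //.
  have -> : expR t = expR (468 * rr ^+ 3) * E.
    by rewrite -expRD; congr expR; rewrite /t; ring.
  rewrite !mulrA; apply: ler_wpM2r; first exact: expR_ge0.
  have f20 : (0 < f ^ 2)%N by rewrite expn_gt0 f0.
  have r30 : (0 < r ^ 3)%N by rewrite expn_gt0 r0.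
  have fr0 : (0 < f ^ 2 * r ^ 3)%N by rewrite (muln_gt0 (f ^ 2)) f20.
  rewrite -natrM -natrM; apply: nat_expR_ln; first by rewrite (muln_gt0 (f ^ 2 * r ^ 3)) fr0.
  rewrite (ln_natM _ fr0 r30) (ln_natM _ f20 r30) ln_natX // ln_natX // -/rr.
  have lf : ln f%:R <= (bb + rr) * (12 + 2 * rr).
    apply: (@le_trans _ _ (ln ((r + b) ^ (r + b))%:R)).
      by apply: ler_ln_nat => //; exact: fact_le_exp.
    rewrite ln_natX ?addn_gt0 ?r0 // bb'; apply: ler_wpM2l; first by move: bbr rr2_ge0 rr0; clear => *; lra.
    apply: (@le_trans _ _ (ln (12 * r ^ 2)%:R)).
      rewrite -bb'; apply: ler_ln_nat; first by rewrite addn_gt0 r0.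
      by rewrite -(ler_nat R) bb' natrM natrX.
    rewrite ln_natM ?expn_gt0 ?r0 // ln_natX //; have := ln_nat_le R 12; move: lnr; clear => *; lra.
  have h1 : (bb + rr) * (12 + 2 * rr) <= 12 * rr ^+ 2 * (8 * rr).
    by apply: ler_pM; move: bb12 rr2 bbr rr2_ge0; clear => *; lra.
  have h2 : 12 * rr ^+ 2 * (8 * rr) = 96 * rr ^+ 3 by ring.
  have h3 : rr <= rr ^+ 3 by rewrite -{1}[rr]expr1 ler_weXn2l //; move: rr2; clear => *; lra.
  by move: lf h1 h2 h3 lnr rr3_ge0; clear => *; lra.
rewrite -/rr -/L -/D'.
have -> : rr ^+ 3 * (y0 + 3 * rr) + l.+1%:R * (500 * rr ^+ 3) + D' * L = t + 2 * rr ^+ 3.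
  by rewrite /t -natr1; ring.
have J0 : (0 < vinogradov_J r (r + b) P)%N by exact: vinogradov_J_gt0.
rewrite -ler_expR lnK ?posrE ?ltr0n // expRD.
apply: (@le_trans _ _ (4 * expR t)).
  move: step; rewrite -(ler_nat R) natrD [(2 * _)%:R]natrM [(2 * (f ^ 2 * _))%:R]natrM.
  by move: T1le fm; clear => *; lra.
rewrite mulrC ler_wpM2l ?expR_ge0 //.
have h3 : 8 <= rr ^+ 3.
  by rewrite (_ : 8 = 2 ^+ 3 :> R); [rewrite lerXn2r ?nnegrE //; lra | rewrite -natrX].
by have := expR_ge1Dx (2 * rr ^+ 3); move: h3; clear => *; lra.
Qed.

Theorem vinogradov_mean_value (R : realType) : exists2 C0 : R, 0 < C0 &
  forall r P : nat, (2 <= r)%N -> (0 < P)%N ->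
  ln (vinogradov_J r (12 * r ^ 2) P)%:R
  <= C0 * r%:R ^+ 4 + (24 * r%:R ^+ 2 - r%:R * (r%:R + 1) / 2 + r%:R ^+ 2 / 1000) * ln P%:R.
Proof.
(* With [l = 11 r] one has [(1 - 1/r)^l <= exp (-11) <= 1/2048], and [1/2000 + 1/2048 < 1/1000]. *)
pose c : R := 1 / 2000; pose y0 : R := 96 / c ^+ 2 + 1.
have c0 : 0 < c by rewrite /c; lra.
have c1 : c <= 1 by rewrite /c; lra.
have y00 : 0 < y0 by rewrite /y0 ltr_wpDl // divr_ge0 // exprn_ge0 // ltW.
exists (y0 + 3 + 5500); first by lra.
move=> r P r2 P0.
have := vinogradov_log c0 c1 r2 (leqnn _) P0; rewrite -/y0.
have -> : (r ^ 2 + 11 * r * r = 12 * r ^ 2)%N by rewrite -mulnn; lia.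
set rr := r%:R : R; have rr2 : 2 <= rr by rewrite /rr (ler_nat R 2).
have rr0 : 0 < rr by lra.
have L0 : 0 <= ln P%:R :> R := ln_nat_ge0 _ _.
move=> /le_trans; apply; rewrite [(12 * _)%:R]natrM natrX -/rr.
apply: lerD.
  rewrite natrM -/rr.
  have h : rr ^+ 3 * y0 <= rr ^+ 4 * y0.
    apply: ler_wpM2r; first exact: ltW.
    by apply: ler_weXn2l => //; lra.
  by rewrite (_ : rr ^+ 4 = rr ^+ 3 * rr) in h *; [lra | rewrite exprSr].
apply: ler_wpM2r => //.
have qe : (1 - 1 / rr) ^+ (11 * r) <= 1 / 2048.
  have h1 : 0 <= 1 - 1 / rr by rewrite subr_ge0 ler_pdivrMr // mul1r; lra.
  have h2 : 1 - 1 / rr <= expR (- (1 / rr)) by have := expR_ge1Dx (- (1 / rr)); lra.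
  apply: (@le_trans _ _ (expR (- (1 / rr)) ^+ (11 * r))).
    by rewrite lerXn2r ?nnegrE ?expR_ge0.
  rewrite -expRM_natl natrM -/rr (_ : 11 * rr * - (1 / rr) = 11 * - 1); last first.
    by field; rewrite gt_eqF.
  rewrite expRM_natl (_ : 1 / 2048 = (1 / 2) ^+ 11); last by rewrite expr_div_n expr1n -natrX.
  rewrite lerXn2r ?nnegrE ?expR_ge0 ?divr_ge0 //.
  rewrite expRN div1r lef_pV2 ?posrE ?expR_gt0 //.
  by have := expR_ge1Dx (1 : R); lra.
have h : rr ^+ 2 * (1 - 1 / rr) ^+ (11 * r) <= rr ^+ 2 * (1 / 2048).
  by apply: ler_wpM2l => //; rewrite exprn_ge0 // ltW.
have h2 : 0 <= rr ^+ 2 by rewrite exprn_ge0 // ltW.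
by rewrite /c; lra.
Qed.

(** * Sums of e(alpha / n) *)

Lemma harmonic_le (R : realType) (a b : nat) : (0 < a)%N -> (a <= b)%N ->
  \sum_(a.+1 <= k < b.+1) (k%:R)^-1 <= ln b%:R - ln a%:R :> R.
Proof.
move=> a0; elim: b => [|b IH] ab; first by lia.
move: ab; rewrite leq_eqVlt => /orP[/eqP <-|]; first by rewrite big_geq // subrr.
rewrite ltnS => ab; rewrite big_nat_recr //=; apply: le_trans (lerD (IH ab) (lexx _)) _.
have b0 : (0 < b)%N by exact: leq_trans ab.
have B0 : 0 < b%:R :> R by rewrite ltr0n.
have := @le_ln1Dx R (- (b.+1%:R)^-1).
have -> : 1 + - (b.+1%:R)^-1 = b%:R / b.+1%:R :> R by rewrite -natr1; field; rewrite natr1.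
rewrite ln_div ?posrE ?ltr0n // ltrN2 invf_lt1 ?ltr0n // ltr1n => /(_ b0).
by move: (b.+1%:R^-1) (ln b.+1%:R) => u v h; lra.
Qed.

Lemma box_sum_trivial (R : realType) (X : nat) (beta : R) :
  box_sum X beta <= ((2 * X).+1 ^ 2)%:R.
Proof.
apply: (@le_trans _ _ (\sum_(l < (2 * X).+1) (2 * X).+1%:R)).
  apply: ler_sum => l _; apply: le_trans (sum_normc_cis_le _ _) _.
  by rewrite card_ord.
by rewrite sumr_const card_ord -mulrnA mulnn.
Qed.

(** For [l] different from [X] the inner sum is geometric with frequency [beta (l - X)], at most
    [1/2] in absolute value, hence is at most [2 / |beta (l - X)|]; summing over [l] gives two
    harmonic sums. *)
Lemma box_sum_le (R : realType) (X : nat) (beta : R) : (0 < X)%N -> beta != 0 ->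
  `|beta| * X%:R <= 1 / 2 ->
  box_sum X beta <= (2 * X).+1%:R + 4 / `|beta| * (1 + ln X%:R).
Proof.
move=> X0 b0 bX; have nb0 : 0 < `|beta| by rewrite normr_gt0.
have term (l : nat) : (l < (2 * X).+1)%N -> l != X ->
  normc (\sum_(m < (2 * X).+1) cis (beta * (m%:R - X%:R) * (l%:R - X%:R)))
   <= 2 / `|beta| * `|l%:R - X%:R|^-1.
  move=> l2 lX; set t := beta * (l%:R - X%:R).
  have d0 : 0 < `|l%:R - X%:R : R| by rewrite normr_gt0 subr_eq0 eqr_nat.
  have dX : `|l%:R - X%:R : R| <= X%:R.
    have h1 : l%:R <= 2 * X%:R :> R by rewrite -natrM ler_nat -ltnS.
    have h2 : 0 <= l%:R :> R by [].
    by rewrite ler_norml; lra.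
  have t2 : `|t| <= 1 / 2.
    by rewrite normrM; apply: le_trans bX; apply: ler_wpM2l.
  have t0 : 0 < `|t| by rewrite normrM mulr_gt0.
  have -> : \sum_(m < (2 * X).+1) cis (beta * (m%:R - X%:R) * (l%:R - X%:R))
     = cis (- (X%:R * t)) * \sum_(m < (2 * X).+1) cis (m%:R * t).
    by rewrite mulr_sumr; apply: eq_bigr => m _; rewrite -cisD; congr cis; rewrite /t; ring.
  rewrite normcM normc_cis mul1r.
  have -> : 2 / `|beta| * `|l%:R - X%:R|^-1 = 2 / `|t| by rewrite /t normrM invfM mulrA.
  rewrite ler_pdivlMr //; apply: le_trans (geometric_cis t (2 * X).+1).
  by apply: ler_wpM2l; rewrite ?normc_ge0 // normc_1Bcis_ge.
have XX : (X < (2 * X).+1)%N by lia.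
rewrite /box_sum (bigD1 (Ordinal XX)) //=; apply: lerD.
  by apply: le_trans (sum_normc_cis_le _ _) _; rewrite card_ord.
apply: (@le_trans _ _ (\sum_(l < (2 * X).+1 | l != Ordinal XX) 2 / `|beta| * `|l%:R - X%:R|^-1)).
  by apply: ler_sum => l lX; apply: term.
rewrite -mulr_sumr (_ : 4 / `|beta| = 2 / `|beta| * 2); last by field; rewrite gt_eqF.
rewrite -[leRHS]mulrA; apply: ler_wpM2l; first by rewrite divr_ge0.
have -> : \sum_(l < (2 * X).+1 | l != Ordinal XX) `|l%:R - X%:R|^-1
   = \sum_(0 <= l < (2 * X).+1 | l != X) `|l%:R - X%:R|^-1 :> R.
  by rewrite big_mkord; apply: eq_bigl => l; rewrite -val_eqE.
have H : \sum_(1 <= k < X.+1) (k%:R)^-1 <= 1 + ln X%:R :> R.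
  rewrite big_nat_recl // invr1 lerD2l.
  have := harmonic_le R (isT : (0 < 1)%N) X0; rewrite ln1 subr0.
  by apply: le_trans; rewrite [leRHS]big_add1.
have E1 : \sum_(0 <= l < X | l != X) `|l%:R - X%:R|^-1 = \sum_(1 <= k < X.+1) (k%:R)^-1 :> R.
  rewrite big_add1 /= big_nat_rev /= add0n big_nat_cond [RHS]big_nat.
  apply: eq_big => k; rewrite ?andbT; first by case: (ltnP k X) => //= h; lia.
  move=> /andP[/andP[_ kX] _]; congr (_^-1); rewrite natrB //.
  by rewrite addrAC subrr add0r normrN ger0_norm.
have E2 : \sum_(X.+1 <= l < (2 * X).+1 | l != X) `|l%:R - X%:R|^-1 = \sum_(1 <= k < X.+1) (k%:R)^-1 :> R.
  rewrite -{1}[X.+1]add1n big_addn (_ : (2 * X).+1 - X = X.+1)%N; last by lia.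
  rewrite big_nat_cond [RHS]big_nat; apply: eq_big => k; rewrite ?andbT.
    by case: (boolP (0 < k < X.+1)%N) => //= h; lia.
  by move=> _; rewrite natrD addrK ger0_norm.
rewrite (big_cat_nat _ (n := X)) //=; last by lia.
rewrite (big_cat_nat _ (n := X.+1) (m := X)) //=.
rewrite E1 E2 [X in _ + (X + _)]big1_seq => [|k]; last first.
  by rewrite mem_index_iota => /andP[kX h]; lia.
by lra.
Qed.

(** A shift by [tau i] changes the sum only at its two ends, by at most [2 T]; averaging over the
    shifts moves the cancellation into short sums over [i]. *)
Lemma shift_average (R : realType) (I : finType) (tau : I -> nat) (T N N' : nat)
  (g : nat -> R[i]) : (N <= N')%N -> (forall i, (tau i <= T)%N) ->
  (forall n, normc (g n) <= 1) ->
  #|I|%:R * normc (\sum_(N.+1 <= n < N'.+1) g n)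
  <= \sum_(N.+1 <= n < N'.+1) normc (\sum_i g (n + tau i)%N) + #|I|%:R * (2 * T%:R).
Proof.
move=> NN' tT g1.
have len a t : normc (\sum_(a <= n < a + t) g n) <= t%:R.
  apply: le_trans (normc_sum _ _ _) _.
  apply: (@le_trans _ _ (\sum_(a <= n < a + t) 1)); first by apply: ler_sum.
  by rewrite sumr_const_nat addKn.
have sh i : \sum_(N.+1 <= n < N'.+1) g n = \sum_(N.+1 <= n < N'.+1) g (n + tau i)%N
   + (\sum_(N.+1 <= n < N.+1 + tau i) g n - \sum_(N'.+1 <= n < N'.+1 + tau i) g n).
  have -> : \sum_(N.+1 <= n < N'.+1) g (n + tau i)%N
     = \sum_(N.+1 + tau i <= n < N'.+1 + tau i) g n.
    by rewrite [RHS]big_addn addnK.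
  have e1 : \sum_(N.+1 <= n < N'.+1 + tau i) g n = \sum_(N.+1 <= n < N'.+1) g n
     + \sum_(N'.+1 <= n < N'.+1 + tau i) g n.
    by rewrite (big_cat_nat _ (n := N'.+1)) ?ltnS ?leq_addr.
  have e2 : \sum_(N.+1 <= n < N'.+1 + tau i) g n = \sum_(N.+1 <= n < N.+1 + tau i) g n
     + \sum_(N.+1 + tau i <= n < N'.+1 + tau i) g n.
    by rewrite (big_cat_nat _ (n := (N.+1 + tau i)%N)) ?leq_add2r ?ltnS ?leq_addr.
  apply: (addIr (\sum_(N'.+1 <= n < N'.+1 + tau i) g n)).
  by rewrite -addrA subrK -e1 e2 addrC.
have -> : #|I|%:R * normc (\sum_(N.+1 <= n < N'.+1) g n)
   = normc (\sum_(i : I) \sum_(N.+1 <= n < N'.+1) g n).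
  by rewrite sumr_const normcMn mulr_natl.
rewrite (eq_bigr _ (fun i _ => sh i)) big_split /= exchange_big /=.
apply: le_trans (le_normcD _ _) _; apply: lerD; first exact: normc_sum.
apply: le_trans (normc_sum _ _ _) _.
apply: (@le_trans _ _ (\sum_(i : I) 2 * T%:R)); last by rewrite sumr_const -[leLHS]mulr_natl.
apply: ler_sum => i _; apply: le_trans (le_normcD _ _) _; rewrite normcN.
have h : (tau i)%:R <= T%:R :> R by rewrite ler_nat.
by have := len N.+1 (tau i); have := len N'.+1 (tau i); lra.
Qed.

(** The range of degree one. With [F = alpha / N] and [d = F^(-1/3)], shift by [t < Y], where [Y] is
    about [N d^2]. The quadratic error of the phase is at most [F d^4 = d], and the geometric sum in
    [t] is of order [N / F = N d^3], that is [Y d]: both save the same factor [d]. *)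
Lemma linear_phase_sum (R : realType) (N N' : nat) (alpha : R) :
  (0 < N)%N -> (N <= N' <= 4 * N)%N -> N%:R <= alpha -> alpha <= N%:R ^+ 2 / 2 ->
  normc (\sum_(N.+1 <= n < N'.+1) cis (alpha / n%:R))
  <= 300 * N%:R * expR (- (ln (alpha / N%:R) / 3)).
Proof.
move=> N0 /andP[NN' N'4] aN aN2.
have NN3 : (N'.+1 - N.+1 <= 3 * N)%N by lia.
have NR : 1 <= N%:R :> R by rewrite ler1n.
have a0 : 0 < alpha by lra.
set F := alpha / N%:R; have F1 : 1 <= F by rewrite ler_pdivlMr ?mul1r //; lra.
have FN : F <= N%:R / 2.
  by rewrite ler_pdivrMr; [move: aN2; rewrite expr2; lra | lra].
set d := expR _.
have d0 : 0 < d by exact: expR_gt0.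
have d1 : d <= 1 by rewrite expR_le1 oppr_le0 divr_ge0 // ln_ge0.
have dF : d ^+ 3 * F = 1.
  rewrite /d -expRM_natl (_ : 3 * - (ln F / 3) = - ln F); last by field.
  by rewrite expRN lnK ?posrE ?mulVf ?gt_eqF //; lra.
have d20 : 0 < d ^+ 2 by rewrite exprn_gt0.
have dN : 1 <= N%:R * d ^+ 2.
  have h : F * d ^+ 3 <= N%:R / 2 * d ^+ 3 by rewrite ler_wpM2r // exprn_ge0 // ltW.
  have h2 : N%:R / 2 * d ^+ 3 <= N%:R / 2 * d ^+ 2.
    by rewrite ler_wpM2l ?ler_wiXn2l ?(ltW d0) //; lra.
  by rewrite mulrC dF in h; lra.
pose Y := Num.truncn (N%:R * d ^+ 2).
have /andP[Y1 Y2] : Y%:R <= N%:R * d ^+ 2 < Y.+1%:R by apply: truncn_itv; lra.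
have Y0 : (0 < Y)%N by rewrite truncn_gt0.
have Y0R : 1 <= Y%:R :> R by rewrite ler1n.
have Yh : N%:R * d ^+ 2 <= 2 * Y%:R by move: Y2; rewrite -natr1; lra.
have := @shift_average R 'I_Y (fun t => t) Y N N' (fun n => cis (alpha / n%:R)) NN'
  (fun i => ltnW (ltn_ord i)) (fun n => eq_le_trivial (normc_cis _)).
rewrite card_ord.
set S := normc _.
have inner (n : nat) : (N < n <= 4 * N)%N ->
   normc (\sum_(t < Y) cis (alpha / (n + t)%:R)) <= 32 * N%:R / F + Y%:R * (8 * d).
  move=> /andP[Nn n4]; have n0 : 0 < n%:R :> R by rewrite ltr0n (leq_ltn_trans _ Nn).
  have NnR : N%:R < n%:R :> R by rewrite ltr_nat.
  have n4R : n%:R <= 4 * N%:R :> R by rewrite -natrM ler_nat.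
  set b := - (alpha / n%:R ^+ 2).
  have app (t : 'I_Y) : normc (cis (alpha / (n + t)%:R) - cis (alpha / n%:R + t%:R * b)) <= 8 * d.
    apply: le_trans (cis_lipschitz _ _) _; apply: ler_wpM2l => //.
    have tR : 0 <= t%:R :> R by [].
    have tY : t%:R <= N%:R * d ^+ 2 by apply: le_trans Y1; rewrite ler_nat ltnW.
    have -> : alpha / (n + t)%:R - (alpha / n%:R + t%:R * b)
       = alpha / n%:R * (t%:R / n%:R) ^+ 2 * (n%:R / (n%:R + t%:R)).
      by rewrite natrD /b; field; rewrite !gt_eqF //; lra.
    rewrite ger0_norm; last by rewrite !mulr_ge0 ?invr_ge0 ?exprn_ge0 ?divr_ge0 //; lra.
    have h1 : n%:R / (n%:R + t%:R) <= 1 :> R by rewrite ler_pdivrMr; lra.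
    have h2 : alpha / n%:R <= F.
      by rewrite /F; apply: ler_wpM2l; [lra | rewrite lef_pV2 ?posrE; lra].
    have h3 : t%:R / n%:R <= d ^+ 2.
      rewrite ler_pdivrMr // (le_trans tY) // mulrC ler_wpM2l ?(ltW d20) //; lra.
    have h4 : (t%:R / n%:R) ^+ 2 <= (d ^+ 2) ^+ 2.
      by rewrite lerXn2r ?nnegrE ?divr_ge0 ?(ltW d20) // ltW.
    have an0 : 0 <= alpha / n%:R by rewrite divr_ge0 // ltW.
    apply: (@le_trans _ _ (F * (d ^+ 2) ^+ 2 * 1)).
      apply: ler_pM => //; rewrite ?mulr_ge0 ?exprn_ge0 ?divr_ge0 //; try by lra.
      by apply: ler_pM => //; rewrite exprn_ge0 ?divr_ge0 //; lra.
    by rewrite mulr1 -exprM (_ : F * d ^+ (2 * 2) = d * (d ^+ 3 * F)); [rewrite dF mulr1 | ring].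
  have -> : \sum_(t < Y) cis (alpha / (n + t)%:R)
     = \sum_(t < Y) cis (alpha / n%:R + t%:R * b)
       + \sum_(t < Y) (cis (alpha / (n + t)%:R) - cis (alpha / n%:R + t%:R * b)).
    by rewrite -big_split /=; apply: eq_bigr => t _; rewrite addrC subrK.
  apply: le_trans (le_normcD _ _) _; apply: lerD; last first.
    apply: le_trans (normc_sum _ _ _) _; 
    apply: (@le_trans _ _ (\sum_(t < Y) 8 * d)); first by apply: ler_sum => t _; exact: app.
    by rewrite sumr_const card_ord -[leLHS]mulr_natl.
  have -> : \sum_(t < Y) cis (alpha / n%:R + t%:R * b)
     = cis (alpha / n%:R) * \sum_(t < Y) cis (t%:R * b).
    by rewrite mulr_sumr; apply: eq_bigr => t _; rewrite cisD.
  rewrite normcM normc_cis mul1r.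
  have n20 : 0 < n%:R ^+ 2 :> R by rewrite exprn_gt0.
  have nb : `|b| = alpha / n%:R ^+ 2 by rewrite normrN ger0_norm // divr_ge0 ?ltW.
  have b2 : `|b| <= 1 / 2.
    rewrite nb ler_pdivrMr // mulrC; apply: le_trans aN2 _.
    by rewrite mul1r ler_pM2r // lerXn2r ?nnegrE //; lra.
  have b0 : 0 < `|b| by rewrite nb divr_gt0.
  apply: (@le_trans _ _ (2 / `|b|)).
    rewrite ler_pdivlMr //; apply: le_trans (geometric_cis b Y).
    by apply: ler_wpM2l; rewrite ?normc_ge0 // normc_1Bcis_ge.
  rewrite nb /F invf_div invf_div mulrA mulrA.
  rewrite mulrA ler_pM2r ?invr_gt0 //.
  have : n%:R ^+ 2 <= (4 * N%:R) ^+ 2 :> R by rewrite lerXn2r ?nnegrE //; lra.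
  by rewrite exprMn (_ : 4 ^+ 2 = 16 :> R); [rewrite expr2; lra | rewrite -natrX].
have sumle : \sum_(N.+1 <= n < N'.+1) normc (\sum_(t < Y) cis (alpha / (n + t)%:R))
   <= 3 * N%:R * (32 * N%:R / F + Y%:R * (8 * d)).
  apply: (@le_trans _ _ (\sum_(N.+1 <= n < N'.+1) (32 * N%:R / F + Y%:R * (8 * d)))).
    rewrite big_nat [leRHS]big_nat; apply: ler_sum => n /andP[n1 n2]; apply: inner.
    by rewrite n1 (leq_trans _ N'4) // -ltnS.
  rewrite sumr_const_nat -[leLHS]mulr_natl; apply: ler_wpM2r.
    by rewrite addr_ge0 ?mulr_ge0 ?invr_ge0 ?(ltW d0) //; lra.
  by rewrite -natrM ler_nat.
move=> H.
have hF : 32 * N%:R / F <= Y%:R * (64 * d).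
  have -> : 32 * N%:R / F = N%:R * d ^+ 2 * (32 * d).
    rewrite -[LHS]mulr1 -dF; field; rewrite gt_eqF //; lra.
  by have := ler_wpM2r (_ : 0 <= 32 * d) Yh; lra.
have NR0 : 0 <= N%:R :> R by [].
have hh : Y%:R * S <= Y%:R * (218 * N%:R * d).
  apply: (le_trans H); apply: (@le_trans _ _ (3 * N%:R * (Y%:R * (72 * d)) + Y%:R * (2 * (N%:R * d)))).
    apply: lerD.
      by apply: le_trans sumle _; apply: ler_wpM2l; [lra | lra].
    apply: ler_wpM2l => //; apply: ler_wpM2l => //; apply: le_trans Y1 _.
    by apply: ler_wpM2l => //; rewrite -[leRHS]expr1 ler_wiXn2l // ltW.
  lra.
rewrite ler_pM2l in hh; last by lra.
apply: le_trans hh _; have : 0 <= N%:R * d by rewrite mulr_ge0 // ltW.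
lra.
Qed.

Lemma expR_sum2_le (R : realType) (x y z : R) : x + 1 <= z -> y + 1 <= z ->
  expR x + expR y <= expR z.
Proof.
move=> xz yz; have e2 : 2 <= expR 1 :> R by have := expR_ge1Dx (1 : R); lra.
have h u : u + 1 <= z -> 2 * expR u <= expR z.
  move=> uz; apply: (@le_trans _ _ (expR (u + 1))); last by rewrite ler_expR.
  by rewrite expRD mulrC ler_wpM2l ?expR_ge0.
by have := h _ xz; have := h _ yz; lra.
Qed.

Lemma expR_ge_pow2 (R : realType) (n : nat) : (2 ^ n)%:R <= expR n%:R :> R.
Proof.
have e2 : 2 <= expR 1 :> R by have := expR_ge1Dx (1 : R); lra.
by rewrite -[n%:R]mulr1 expRM_natl natrX lerXn2r ?nnegrE ?expR_ge0.
Qed.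

Lemma box_sum_expR (R : realType) (X : nat) (beta x : R) : (0 < X)%N ->
  ln X%:R = x -> box_sum X beta <= expR (4 + 2 * x).
Proof.
move=> X0 lX; apply: le_trans (box_sum_trivial _ _) _.
have XE : X%:R = expR x by rewrite -lX lnK // posrE ltr0n.
have h : (2 * X).+1%:R <= expR (2 + x) :> R.
  rewrite expRD -XE; apply: (@le_trans _ _ (4 * X%:R)); last first.
    by rewrite ler_wpM2r //; have := expR_ge_pow2 R 2.
  by rewrite -natrM ler_nat; lia.
rewrite natrX (_ : 4 + 2 * x = 2 * (2 + x)); last by ring.
by rewrite expRM_natl lerXn2r ?nnegrE ?expR_ge0.
Qed.

(* [1 + x <= 100 exp (x / 100)] makes the logarithmic factor harmless. *)
Lemma box_sum_gain (R : realType) (X : nat) (beta x lb z : R) : (0 < X)%N -> beta != 0 ->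
  ln X%:R = x -> ln `|beta| = lb -> lb + x <= - 1 -> x + 3 <= z ->
  10 - lb + x / 100 <= z -> box_sum X beta <= expR z.
Proof.
move=> X0 b0 lX lbE hbx z1 z2.
have nb0 : 0 < `|beta| by rewrite normr_gt0.
have XE : X%:R = expR x by rewrite -lX lnK // posrE ltr0n.
have bE : `|beta| = expR lb by rewrite -lbE lnK // posrE.
have e2 : 2 <= expR 1 :> R by have := expR_ge1Dx (1 : R); lra.
have small : `|beta| * X%:R <= 1 / 2.
  rewrite bE XE -expRD; apply: (@le_trans _ _ (expR (- 1))); first by rewrite ler_expR.
  by rewrite expRN div1r lef_pV2 ?posrE ?expR_gt0.
apply: le_trans (box_sum_le X0 b0 small) _.
have x0 : 0 <= x by rewrite -lX ln_nat_ge0.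
have h1 : (2 * X).+1%:R <= expR (2 + x) :> R.
  rewrite expRD -XE; apply: (@le_trans _ _ (4 * X%:R)); last first.
    by rewrite ler_wpM2r //; have := expR_ge_pow2 R 2.
  by rewrite -natrM ler_nat; lia.
have h2 : 4 / `|beta| * (1 + ln X%:R) <= expR (9 - lb + x / 100).
  rewrite lX bE -expRN (_ : 9 - lb + x / 100 = 2 - lb + (7 + x / 100)); last by ring.
  rewrite 2!expRD; apply: ler_pM; rewrite ?mulr_ge0 ?expR_ge0 ?addr_ge0 //.
    by apply: ler_wpM2r; rewrite ?expR_ge0 //; have := expR_ge_pow2 R 2.
  rewrite expRD; apply: (@le_trans _ _ (100 * (1 + x / 100))); first by lra.
  apply: ler_pM; rewrite ?addr_ge0 ?divr_ge0 ?expR_ge1Dx //.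
  by apply: le_trans (expR_ge_pow2 R 7); rewrite ler_nat.
apply: le_trans (lerD h1 h2) _; apply: expR_sum2_le; lra.
Qed.

Lemma sum_succ_ord (R : realType) (r : nat) :
  \sum_(j < r) (j.+1%:R : R) = r%:R * (r%:R + 1) / 2.
Proof.
elim: r => [|r IH]; first by rewrite big_ord0 mul0r mul0r.
by rewrite big_ord_recr /= IH -natr1; field.
Qed.

Lemma count_middle (K r : nat) : (0 < K)%N -> (4 * K <= r)%N ->
  (K <= \sum_(j < r) (2 * K < j < 4 * K))%N.
Proof.
move=> K0 Kr; rewrite -(big_mkord predT (fun j => (2 * K < j < 4 * K)%N : nat)).
apply: (@leq_trans (\sum_((2 * K).+1 <= j < 4 * K) (2 * K < j < 4 * K))%N).
  rewrite big_nat (eq_bigr (fun _ => 1%N)) => [|j ->//].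
  by rewrite -big_nat sum_nat_const_nat muln1; lia.
rewrite [leqRHS](big_cat_nat _ (n := (2 * K).+1)) //=; last by lia.
apply: leq_trans (leq_addl _ _).
rewrite [leqRHS](big_cat_nat _ (n := (4 * K)%N)) //=; last by lia.
exact: leq_addr.
Qed.

(** The loss from the mean value theorem is at most [2 * 40 / 1000 = 0.08] times [k^2 l], below the
    gain [k^2 l / 10]. What remains, [k^2 l / 50], divided by [(2 bb)^2 = 576 r^4 <= 576 * (100 *
    100) * k^4], gives the constant in [s]. *)
Lemma bilinear_arith (R : realType) (C0 rr k l q lb lJ E bb s : R) :
  1 <= rr -> 0 < k -> rr <= 10 * k -> 0 <= l -> q <= 2 / 5 * l -> bb = 12 * rr ^+ 2 ->
  lb <= bb ->
  lJ <= C0 * rr ^+ 4 + (24 * rr ^+ 2 - rr * (rr + 1) / 2 + rr ^+ 2 / 1000) * q ->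
  E <= rr * (4 + 2 * lb) + rr * (rr + 1) * q - k * (k * l / 10) ->
  s = (2 * C0 + 28) / 576 - l / (50 * 576 * (100 * 100)) / k ^+ 2 ->
  (2 * bb - 1) * (2 * bb) * q + (2 * bb - 1) * (2 * bb * q) + (2 * lJ + E)
  <= 2 * bb * (2 * bb) * (2 * q + s).
Proof.
move=> rr1 k0 rk10 l0 q2 bbE lbb hJ hE sE.
have kk0 : 0 < k ^+ 2 by rewrite exprn_gt0.
have rr0 : 0 <= rr by lra.
have rr20 : 0 <= rr ^+ 2 by rewrite exprn_ge0.
have rr2 : rr ^+ 2 <= 100 * k ^+ 2.
  have : rr ^+ 2 <= (10 * k) ^+ 2 by rewrite lerXn2r ?nnegrE //; lra.
  by rewrite (_ : (10 * k) ^+ 2 = 100 * k ^+ 2); last by ring.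
have h1 : rr ^+ 2 * q <= 100 * k ^+ 2 * (2 / 5 * l).
  apply: (@le_trans _ _ (rr ^+ 2 * (2 / 5 * l))); first exact: ler_wpM2l.
  by apply: ler_wpM2r => //; lra.
have h2 : rr * (4 + 2 * lb) <= 28 * rr ^+ 4.
  have h21 : rr * (4 + 2 * lb) <= rr * (4 + 24 * rr ^+ 2) by apply: ler_wpM2l => //; lra.
  have h22 : rr <= rr ^+ 4 by rewrite -{1}[rr]expr1 ler_weXn2l.
  have h23 : rr * rr ^+ 2 <= rr ^+ 4 by rewrite -exprS ler_weXn2l.
  lra.
set w := l / (50 * 576 * (100 * 100)) / k ^+ 2 in sE.
have w0 : 0 <= w.
  rewrite /w; apply: divr_ge0; last exact: ltW.
  by apply: divr_ge0; [exact: l0 | do 2!apply: mulr_ge0; exact: ler0n].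
have h3 : rr ^+ 4 * w <= k ^+ 2 * l / (50 * 576).
  have h : rr ^+ 4 <= (100 * k ^+ 2) ^+ 2.
    rewrite (_ : rr ^+ 4 = (rr ^+ 2) ^+ 2); last by rewrite -exprM.
    by rewrite lerXn2r ?nnegrE //; lra.
  apply: le_trans (ler_wpM2r w0 h) _; apply: eq_le_trivial; rewrite /w; field.
  by rewrite gt_eqF.
have e1 : 2 * bb * (2 * bb) * s = (2 * C0 + 28) * rr ^+ 4 - 576 * (rr ^+ 4 * w).
  by rewrite sE bbE; field.
have e2 : (2 * bb - 1) * (2 * bb) * q + (2 * bb - 1) * (2 * bb * q) = 8 * bb ^+ 2 * q - 48 * (rr ^+ 2 * q).
  by rewrite (_ : 48 * (rr ^+ 2 * q) = 4 * bb * q); [ring | rewrite bbE; ring].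
have e3 : 2 * bb * (2 * bb) * (2 * q + s) = 8 * bb ^+ 2 * q + 2 * bb * (2 * bb) * s by ring.
rewrite e3 e1 [X in X + _ <= _]e2.
rewrite (_ : _ * q = 24 * (rr ^+ 2 * q) - rr * (rr + 1) * q / 2 + rr ^+ 2 * q / 1000) in hJ; last by field.
move: hE hJ h1 h2 h3; clear.
move: (8 * bb ^+ 2 * q) (rr ^+ 4 * w) (rr * (4 + 2 * lb)).
move: (rr ^+ 2 * q) (rr * (rr + 1) * q) => u1 u2 u4 u5 u6.
rewrite (_ : k * (k * l / 10) = k ^+ 2 * l / 10); last by field.
rewrite (_ : 100 * k ^+ 2 * (2 / 5 * l) = 40 * (k ^+ 2 * l)); last by field.
move: (k ^+ 2 * l) (rr ^+ 4) => v1 v2 *; lra.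
Qed.

(** Here [l = ln N] and [Q] is about [N^(2/5)]. With trivial box sums, the product of the squared
    radii contributes [Q^(r (r + 1))], which exactly undoes the saving contained in
    [vinogradov_J ^ 2]. The profit comes from at least [K] middle indices, each gaining
    [exp (K l / 10)]; it is set against the loss [Q^(r^2 / 500)] due to the excess in the mean value
    theorem. *)
Lemma bilinear_log (R : realType) (C0 : R) : 0 < C0 ->
  (forall r P : nat, (2 <= r)%N -> (0 < P)%N ->
    ln (vinogradov_J r (12 * r ^ 2) P)%:R
    <= C0 * r%:R ^+ 4 + (24 * r%:R ^+ 2 - r%:R * (r%:R + 1) / 2 + r%:R ^+ 2 / 1000) * ln P%:R) ->
  forall (K r Q : nat) (l : R) (beta : 'I_r -> R), (0 < K)%N -> r = (5 * K.+1)%N ->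
  (0 < Q)%N -> 400 + 13 * ln (12 * r ^ 2)%:R <= l ->
  2 / 5 * l - 1 <= ln Q%:R -> ln Q%:R <= 2 / 5 * l ->
  (forall j : 'I_r, beta j != 0) ->
  (exists2 phi : R, K%:R * l - 1 <= phi <= K.+1%:R * l &
    forall j : 'I_r, phi - j.+1%:R * l - 2 * j.+2%:R <= ln `|beta j| <= phi - j.+1%:R * l) ->
  normc (\sum_(u < Q) \sum_(v < Q)
     cis (\sum_j beta j * (u%:R ^+ j.+1 * v%:R ^+ j.+1)))
  <= Q%:R ^+ 2 * expR ((2 * C0 + 28) / 576 - l / (50 * 576 * (100 * 100)) / K%:R ^+ 2).
Proof.
move=> C00 vmvt K r Q l beta K0 rE Q0 hl q1 q2 bn0 [phi /andP[ph1 ph2] hbeta].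
have r2 : (2 <= r)%N by lia.
have Kr : (4 * K <= r)%N by lia.
set b := (12 * r ^ 2)%N in hl *; set q := ln Q%:R in q1 q2 *.
have b0 : (0 < b)%N by rewrite /b muln_gt0 expn_gt0 (ltnW r2).
set lb := ln b%:R in hl.
have lb0 : 0 <= lb := ln_nat_ge0 _ _.
set k := K%:R : R; have k1 : 1 <= k by rewrite /k ler1n.
set rr := r%:R : R.
have rk : rr = 5 * (k + 1) by rewrite /rr rE natrM /k natr1.
have l400 : 400 <= l by lra.
have rk10 : rr <= 10 * k by lra.
have rr0 : 0 < rr by lra.
pose e (j : 'I_r) : R := 4 + 2 * (lb + j.+1%:R * q) - (2 * K < j < 4 * K)%N%:R * (k * l / 10).
have lnX (j : 'I_r) : ln (box_radius b Q j)%:R = lb + j.+1%:R * q.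
  by rewrite /box_radius ln_natM ?expn_gt0 ?Q0 // ln_natX.
have X0 (j : 'I_r) : (0 < box_radius b Q j)%N by rewrite muln_gt0 b0 expn_gt0 Q0.
have Ve (j : 'I_r) : box_sum (box_radius b Q j) (beta j) <= expR (e j).
  (* In the middle range [|beta j|] times the radius is below 1, so [box_sum_gain] applies. Put
     [i = j + 1]; the logarithm of [1 / |beta j|] is about [i l - phi], against [(4/5) i l] for the
     squared radius. As [i <= 4 K], the gain [phi - i l / 5] is about [K l / 5] or more. *)
  rewrite /e; case: (boolP (2 * K < j < 4 * K)%N) => [/andP[j1 j2]|_]; last first.
    by rewrite mul0r subr0; apply: box_sum_expR.
  rewrite mul1r; apply: (box_sum_gain (X0 j) (bn0 j) (lnX j) (erefl _)).
  - have /andP[_ h] := hbeta j; set i := j.+1%:R in h *.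
    have i1 : 2 * (k + 1) <= i.
      by rewrite /i /k natr1 -natrM ler_nat; clear - j1; lia.
    have h1 : i * q <= i * (2 / 5 * l) by apply: ler_wpM2l => //; lra.
    have h2 : 2 * (k + 1) * l <= i * l by apply: ler_wpM2r => //; lra.
    have h3 : 1 * l <= k * l by apply: ler_wpM2r => //; lra.
    move: ph2; rewrite -natr1 -/k mulrDl => ph2; lra.
  - set i := j.+1%:R.
    have i1 : 2 * (k + 1) <= i.
      by rewrite /i /k natr1 -natrM ler_nat; clear - j1; lia.
    have h1 : i * (2 / 5 * l - 1) <= i * q by apply: ler_wpM2l => //; lra.
    have h2 : 2 * (k + 1) * (2 / 5 * l - 1) <= i * (2 / 5 * l - 1) by apply: ler_wpM2r => //; lra.
    have h3 : 1 * l <= k * l by apply: ler_wpM2r => //; lra.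
    have h4 : k * 400 <= k * l by apply: ler_wpM2l => //; lra.
    by lra.
  - have /andP[h _] := hbeta j; move: h; rewrite -[j.+2%:R]natr1; set i := j.+1%:R => h.
    have i4 : i <= 4 * k by rewrite /i /k -natrM ler_nat.
    have i0 : 0 <= i by [].
    have h1 : i * (2 / 5 * l - 1) <= i * q by apply: ler_wpM2l => //; lra.
    have h2 : i * l <= 4 * k * l by apply: ler_wpM2r => //; lra.
    have h4 : k * 400 <= k * l by apply: ler_wpM2l => //; lra.
    by rewrite -/k in ph1; lra.
have V0 (j : 'I_r) : 0 <= box_sum (box_radius b Q j) (beta j).
  by apply: sumr_ge0 => *; exact: normc_ge0.
have PV : \prod_(j < r) box_sum (box_radius b Q j) (beta j) <= expR (\sum_(j < r) e j).
  by rewrite expR_sum; apply: ler_prod => j _; rewrite V0 Ve.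
have sume : \sum_(j < r) e j <= rr * (4 + 2 * lb) + rr * (rr + 1) * q - k * (k * l / 10).
  rewrite /e sumrB big_split /= sumr_const card_ord -mulr_sumr big_split /= sumr_const card_ord.
  rewrite -!mulr_suml sum_succ_ord -/rr.
  have h : k <= \sum_(j < r) (2 * K < j < 4 * K)%N%:R.
    by rewrite -natr_sum ler_nat; exact: count_middle.
  have h' : k * (k * l / 10) <= (\sum_(j < r) (2 * K < j < 4 * K)%N%:R) * (k * l / 10).
    by apply: ler_wpM2r => //; rewrite divr_ge0 // mulr_ge0 //; lra.
  have e4 : 4 *+ r = rr * 4 by rewrite mulr_natl.
  have el : lb *+ r = rr * lb by rewrite mulr_natl.
  by rewrite e4 el; lra.
have := bilinear_bound beta b0 Q0.
set S := normc _ => HS.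
have J0 := @vinogradov_J_gt0 r b Q Q0.
have hJ := vmvt r Q r2 Q0; rewrite -/b -/rr -/q in hJ.
set lJ := ln _ in hJ.
have QE : Q%:R = expR q by rewrite /q lnK // posrE ltr0n.
set s := (2 * C0 + 28) / 576 - _.
have -> : Q%:R ^+ 2 * expR s = expR (2 * q + s) by rewrite QE -expRM_natl -expRD.
have b20 : (0 < 2 * b)%N by rewrite (muln_gt0 2 b) b0.
have bb0 : (0 < 2 * b * (2 * b))%N by rewrite (muln_gt0 (2 * b)) b20.
rewrite -(@ler_pXn2r _ (2 * b * (2 * b))) ?nnegrE ?normc_ge0 ?expR_ge0 //.
apply: (le_trans HS); rewrite -expRM_natl.
have JE : (vinogradov_J r b Q)%:R = expR lJ by rewrite /lJ lnK // posrE ltr0n.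
set bb := b%:R : R; have b1 : ((2 * b).-1)%:R = 2 * bb - 1 :> R.
  by rewrite -subn1 natrB // (natrM R 2 b).
rewrite QE JE -!expRM_natl.
apply: (@le_trans _ _ (expR (((2 * b).-1 * (2 * b))%:R * q)
    * expR ((2 * b).-1%:R * ((2 * b)%:R * q)) * (expR (2 * lJ) * expR (\sum_(j < r) e j)))).
  by apply: ler_wpM2l; rewrite ?mulr_ge0 ?expR_ge0 //; apply: ler_wpM2l; rewrite ?expR_ge0.
have n2b : (2 * b)%:R = 2 * bb :> R by rewrite (natrM R 2 b).
have nn1 : ((2 * b).-1 * (2 * b))%:R = (2 * bb - 1) * (2 * bb) :> R.
  by rewrite (natrM R (2 * b).-1) b1 n2b.
have nn2 : (2 * b * (2 * b))%:R = 2 * bb * (2 * bb) :> R by rewrite (natrM R (2 * b)) n2b.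
rewrite -!expRD ler_expR nn1 nn2 b1 n2b.
have bbE : bb = 12 * rr ^+ 2 by rewrite /bb /b natrM natrX.
have lbb : lb <= bb := ln_nat_le _ _.
apply: (bilinear_arith (C0 := C0) (rr := rr) (k := k) (l := l) (lb := lb) (bb := bb)) => //.
- by move: rk k1; clear => *; lra.
- by move: k1; clear => *; lra.
- by move: l400; clear => *; lra.
Qed.

Lemma inv_taylor (R : realType) (n t : R) (r : nat) : 0 < n -> 0 <= t ->
  (n + t)^-1 = n^-1 + \sum_(j < r) n^-1 * (- (t / n)) ^+ j.+1
     + n^-1 * (- (t / n)) ^+ r.+1 / (1 + t / n).
Proof.
move=> n0 t0; have nt : 0 < n + t by lra.
have d0 : 0 < 1 + t / n by rewrite ltr_pwDl // divr_ge0 // ltW.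
elim: r => [|r IH]; first by rewrite big_ord0; field; rewrite !gt_eqF.
rewrite IH big_ord_recr /= -!addrA; congr (_ + (_ + _)).
rewrite [_ ^+ r.+2]exprS; set z := (- (t / n)) ^+ r.+1.
by field; rewrite !gt_eqF //=; lra.
Qed.

(** The sum is averaged over shifts by products [u v] with [u, v < Q]; the Taylor expansion in
    [u v / n], of degree [r = 5 (K + 1)], turns the inner sum into the one of [bilinear_log]. The
    coefficient 26 is [3 * 8] from the Taylor remainder on at most [3 N] terms, plus 2 from the
    ends. *)
Lemma vinogradov_phase_sum (R : realType) : exists C1 c1 : R, 0 < c1 /\
  forall (K N N' : nat) (alpha : R), (0 < K)%N -> (0 < N)%N -> (N <= N' <= 4 * N)%N ->
  N%:R ^+ K <= 2 * (alpha / N%:R) -> 2 * (alpha / N%:R) < N%:R ^+ K.+1 ->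
  400 + 13 * ln (12 * (5 * K.+1) ^ 2)%:R <= ln N%:R :> R ->
  normc (\sum_(N.+1 <= n < N'.+1) cis (alpha / n%:R))
  <= N%:R * (3 * expR (C1 - c1 * ln N%:R / K%:R ^+ 2) + 26 * expR (- (ln N%:R / 5))).
Proof.
have [C0 C00 vmvt] := vinogradov_mean_value R.
exists ((2 * C0 + 28) / 576), ((50 * 576 * (100 * 100))^-1); split; first by rewrite invr_gt0; lra.
move=> K N N' alpha K0 N0 /andP[NN' N'4] hK1 hK2 hl.
have NN3 : (N'.+1 - N.+1 <= 3 * N)%N by lia.
pose r := (5 * K.+1)%N; rewrite -/r in hl.
have r0 : (0 < r)%N by [].
set l := ln N%:R in hl *.
have lb0 : 0 <= ln (12 * r ^ 2)%:R :> R := ln_nat_ge0 _ _.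
have l400 : 400 <= l by lra.
have NR : 1 <= N%:R :> R by rewrite ler1n.
have NE : N%:R = expR l by rewrite /l lnK // posrE; lra.
set F := alpha / N%:R in hK1 hK2.
have F0 : 0 < F.
  have : 0 < N%:R ^+ K :> R by rewrite exprn_gt0 //; lra.
  lra.
have a0 : 0 < alpha by move: F0; rewrite /F pmulr_lgt0 // invr_gt0; lra.
set phi := ln F.
have FE : F = expR phi by rewrite /phi lnK // posrE.
have NR0 : 0 < N%:R :> R by lra.
have NK0 k : 0 < N%:R ^+ k :> R by rewrite exprn_gt0.
have l21 := ln2_le1 R; have l2h := ln2_ge R.
have ph1 : K%:R * l - 1 <= phi.
  have : ln (N%:R ^+ K) <= ln (2 * F) by rewrite ler_ln ?posrE ?NK0 // mulr_gt0.
  by rewrite lnM ?posrE // lnXn ?NR0 // -/l -/phi -[l *+ _]mulr_natl; lra.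
have ph2 : phi <= K.+1%:R * l.
  have : ln (2 * F) <= ln (N%:R ^+ K.+1) by rewrite ler_ln ?posrE ?NK0 ?(ltW hK2) // mulr_gt0.
  by rewrite lnM ?posrE // lnXn ?NR0 // -/l -/phi -[l *+ _]mulr_natl; lra.
(* The choice [Q ~ N^(2/5)] keeps the shifts below [N^(4/5)], so [u v / n <= N^(-1/5)], while the
   middle coefficients still fall in the profitable range of [bilinear_log]. *)
set x := expR (2 / 5 * l); pose Q := Num.truncn x.
have x2 : 2 <= x by have := expR_ge1Dx (2 / 5 * l); rewrite -/x; move: l400; clear => *; lra.
have /andP[Q1 Q2] : Q%:R <= x < Q.+1%:R by apply: truncn_itv; move: x2; clear => *; lra.
have Q0 : (0 < Q)%N by rewrite truncn_gt0; move: x2; clear => *; lra.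
have QR : 1 <= Q%:R :> R by rewrite ler1n.
have q2 : ln Q%:R <= 2 / 5 * l by rewrite -[leRHS]expRK ler_ln ?posrE ?expR_gt0 //; lra.
have q1 : 2 / 5 * l - 1 <= ln Q%:R.
  have : x / 2 <= Q%:R by move: Q2 x2; rewrite -natr1; clear => *; lra.
  have x20 : 0 < x / 2 by move: x2; clear => *; lra.
  have Qp : 0 < Q%:R :> R by rewrite ltr0n.
  have xp : 0 < x by exact: expR_gt0.
  rewrite -ler_ln ?posrE // ln_div ?posrE //.
  by rewrite /x expRK; move: l21; clear => *; lra.
have Qx : Q%:R ^+ 2 <= N%:R * expR (- (l / 5)).
  rewrite NE -expRD; apply: (@le_trans _ _ (x ^+ 2)); first by rewrite lerXn2r ?nnegrE //; move: x2; clear => *; lra.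
  by rewrite /x -expRM_natl ler_expR; clear => *; lra.
set eps := expR (- (l / 5)) in Qx *.
have eps0 : 0 < eps by exact: expR_gt0.
set s := (2 * C0 + 28) / 576 - _.
have inner (n : nat) : (N < n <= 4 * N)%N ->
   normc (\sum_(p : 'I_Q * 'I_Q) cis (alpha / (n + p.1 * p.2)%:R))
   <= Q%:R ^+ 2 * (expR s + 8 * eps).
  move=> /andP[Nn n4].
  have NnR : N%:R < n%:R :> R by rewrite ltr_nat.
  have n0 : 0 < n%:R :> R by exact: lt_trans NnR.
  have n4R : n%:R <= 4 * N%:R :> R by rewrite -natrM ler_nat.
  pose beta (j : 'I_r) : R := alpha / n%:R * (- n%:R^-1) ^+ j.+1.
  have betaN (j : 'I_r) : `|beta j| = alpha / n%:R ^+ j.+2.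
    rewrite /beta normrM normrX normrN gtr0_norm ?divr_gt0 // gtr0_norm ?invr_gt0 //.
    by rewrite exprVn -mulrA -invfM -exprS.
  have beta0 (j : 'I_r) : beta j != 0.
    by rewrite -normr_gt0 betaN divr_gt0 // exprn_gt0.
  have ln_n1 : l <= ln n%:R by rewrite ler_ln ?posrE // ltW.
  have ln_n2 : ln n%:R <= l + 2.
    apply: (@le_trans _ _ (ln (2 * 2 * N%:R))); first by rewrite ler_ln ?posrE ?mulr_gt0 //; move: n4R; clear => *; lra.
    by rewrite !lnM ?posrE // -/l; move: l21; clear => *; lra.
  have lnbeta (j : 'I_r) : ln `|beta j| = phi + l - j.+2%:R * ln n%:R.
    rewrite betaN ln_div ?posrE ?exprn_gt0 // lnXn // mulr_natl; congr (_ - _).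
    by rewrite /phi /F ln_div ?posrE // -/l; ring.
  have hb : forall j : 'I_r, phi - j.+1%:R * l - 2 * j.+2%:R <= ln `|beta j| <= phi - j.+1%:R * l.
    move=> j; rewrite lnbeta; set i := j.+2%:R : R.
    have -> : j.+1%:R = i - 1 :> R by rewrite /i -[j.+2%:R]natr1 addrK.
    have i0 : 0 <= i by [].
    have h1 : i * l <= i * ln n%:R by apply: ler_wpM2l.
    have h2 : i * ln n%:R <= i * (l + 2) by apply: ler_wpM2l.
    by move: h1 h2; clear => *; lra.
  have hs := bilinear_log C00 vmvt K0 (erefl r) Q0 hl q1 q2 beta0
    (ex_intro2 _ _ phi (introT andP (conj ph1 ph2)) hb).
  pose tay (p : 'I_Q * 'I_Q) : R := \sum_(j < r) beta j * (p.1%:R ^+ j.+1 * p.2%:R ^+ j.+1).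
  have app (p : 'I_Q * 'I_Q) :
     normc (cis (alpha / (n + p.1 * p.2)%:R) - cis (alpha / n%:R + tay p)) <= 8 * eps.
    apply: le_trans (cis_lipschitz _ _) _; apply: ler_wpM2l => //.
    set t := (p.1 * p.2)%:R : R; have t0 : 0 <= t by [].
    have tQ : t <= Q%:R ^+ 2.
      by rewrite /t natrM expr2; apply: ler_pM => //; rewrite ler_nat ltnW.
    have tn0 : 0 <= t / n%:R by rewrite divr_ge0 // ltW.
    rewrite natrD (inv_taylor r n0 t0) !mulrDr mulr_sumr.
    have -> : \sum_(i < r) alpha * (n%:R^-1 * (- (t / n%:R)) ^+ i.+1) = tay p.
      apply: eq_bigr => j _; rewrite /beta /t natrM -exprMn -!mulrA -exprMn.
      by congr (_ * (_ * _ ^+ _)); ring.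
    rewrite [X in `|X|]addrAC subrr add0r.
    have d0' : 0 <= (1 + t / n%:R)^-1 by rewrite invr_ge0 addr_ge0.
    have -> : alpha * (n%:R^-1 * (- (t / n%:R)) ^+ r.+1 / (1 + t / n%:R))
      = alpha / n%:R * ((- (t / n%:R)) ^+ r.+1 / (1 + t / n%:R)) by rewrite -!mulrA.
    rewrite normrM (gtr0_norm (divr_gt0 a0 n0)).
    rewrite normrM normrX normrN (ger0_norm tn0) (ger0_norm d0').
    have h1 : t / n%:R <= expR (- (l / 5)).
      rewrite ler_pdivrMr //; apply: (le_trans tQ); apply: (le_trans Qx).
      by rewrite mulrC; apply: ler_wpM2l; [exact: ltW | exact: ltW].
    have h2 : (t / n%:R) ^+ r.+1 <= expR (r.+1%:R * - (l / 5)).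
      by rewrite expRM_natl lerXn2r ?nnegrE ?expR_ge0.
    have h3 : alpha / n%:R <= expR phi.
      rewrite -FE /F; apply: ler_wpM2l; first exact: ltW.
      by rewrite lef_pV2 ?posrE // ltW.
    have d1 : 1 <= 1 + t / n%:R by rewrite lerDl.
    have d0 : 0 < 1 + t / n%:R by exact: lt_le_trans d1.
    have h4 : (1 + t / n%:R)^-1 <= 1 by rewrite invf_le1.
    have z0 : 0 <= (t / n%:R) ^+ r.+1 by rewrite exprn_ge0.
    apply: (@le_trans _ _ (expR phi * (expR (r.+1%:R * - (l / 5)) * 1))).
      move: z0 h2; move: (_ ^+ r.+1) (expR (r.+1%:R * _)) => z w z0 h2.
      apply: ler_pM => //; [exact: divr_ge0 (ltW a0) (ltW n0)|exact: mulr_ge0|].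
      by apply: ler_pM.
    rewrite mulr1 -expRD ler_expR.
    (* The remainder is at most [F * N^(-(r + 1) / 5)], and [F <= N^(K+1)] with
       [(r + 1) / 5 = K + 1 + 1/5] leaves [N^(-1/5)]. *)
    have -> : r.+1%:R = 5 * K.+1%:R + 1 :> R by rewrite -natr1 /r natrM.
    by move: ph2; clear => *; lra.
  have -> : \sum_(p : 'I_Q * 'I_Q) cis (alpha / (n + p.1 * p.2)%:R)
     = \sum_p cis (alpha / n%:R + tay p)
       + \sum_(p : 'I_Q * 'I_Q) (cis (alpha / (n + p.1 * p.2)%:R) - cis (alpha / n%:R + tay p)).
    by rewrite -big_split /=; apply: eq_bigr => p _; rewrite addrC subrK.
  apply: le_trans (le_normcD _ _) _; rewrite mulrDr; apply: lerD; last first.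
    apply: le_trans (normc_sum _ _ _) _.
    apply: (@le_trans _ _ (\sum_(p : 'I_Q * 'I_Q) 8 * eps)); first by apply: ler_sum => p _; exact: app.
    by rewrite sumr_const card_prod card_ord -[leLHS]mulr_natl natrM expr2.
  have -> : \sum_p cis (alpha / n%:R + tay p) = cis (alpha / n%:R) *
     \sum_(u < Q) \sum_(v < Q) cis (\sum_j beta j * (u%:R ^+ j.+1 * v%:R ^+ j.+1)).
    by rewrite pair_big mulr_sumr; apply: eq_bigr => p _; rewrite cisD.
  rewrite normcM normc_cis mul1r; apply: (le_trans hs).
  by apply: ler_wpM2l; [rewrite exprn_ge0 | rewrite ler_expR /s; apply: eq_le_trivial; congr (_ - _); field; rewrite pnatr_eq0 -lt0n].
have tT (p : 'I_Q * 'I_Q) : (p.1 * p.2 <= Q ^ 2)%N.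
  by rewrite -mulnn leq_mul // ltnW.
have := @shift_average R ('I_Q * 'I_Q)%type (fun p => p.1 * p.2)%N (Q ^ 2)%N N N'
  (fun n => cis (alpha / n%:R)) NN' tT (fun n => eq_le_trivial (normc_cis _)).
have -> : #|{: 'I_Q * 'I_Q}|%:R = Q%:R ^+ 2 :> R by rewrite card_prod card_ord natrM expr2.
rewrite natrX.
set S := normc _ => H.
have Q20 : 0 < Q%:R ^+ 2 :> R by rewrite exprn_gt0 // ltr0n.
have sumle : \sum_(N.+1 <= n < N'.+1) normc (\sum_(p : 'I_Q * 'I_Q) cis (alpha / (n + p.1 * p.2)%:R))
   <= 3 * N%:R * (Q%:R ^+ 2 * (expR s + 8 * eps)).
  apply: (@le_trans _ _ (\sum_(N.+1 <= n < N'.+1) (Q%:R ^+ 2 * (expR s + 8 * eps)))).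
    rewrite big_nat [leRHS]big_nat; apply: ler_sum => n /andP[n1 n2]; apply: inner.
    by rewrite n1 (leq_trans _ N'4) // -ltnS.
  rewrite sumr_const_nat -[leLHS]mulr_natl; apply: ler_wpM2r.
    by rewrite mulr_ge0 ?addr_ge0 ?mulr_ge0 ?expR_ge0 ?(ltW Q20) ?(ltW eps0).
  by rewrite -natrM ler_nat.
rewrite -(ler_pM2l Q20); apply: (le_trans H).
apply: (@le_trans _ _ (3 * N%:R * (Q%:R ^+ 2 * (expR s + 8 * eps)) + Q%:R ^+ 2 * (2 * (N%:R * eps)))).
  by apply: lerD => //; apply: ler_wpM2l; [exact: ltW | apply: ler_wpM2l].
by clearbody s eps; apply: eq_le_trivial; ring.
Qed.

(** [R_k] for odd [k] as a function of [L = ln x]. It also serves as the logarithm of the smallest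
    length for which cancellation is used. *)
Definition walfisz (R : realType) (L : R) : R := L `^ (2 / 3) * ln L `^ (4 / 3).

Lemma walfisz_cube (R : realType) (L : R) : 0 <= L -> 0 <= ln L ->
  walfisz L ^+ 3 = L ^+ 2 * ln L ^+ 4.
Proof.
move=> L0 y0; rewrite /walfisz exprMn -!powR_mulrn ?powR_ge0 // -!powRrM.
by congr (powR _ _ * powR _ _); field.
Qed.

Lemma walfisz_ge0 (R : realType) (L : R) : 0 <= walfisz L.
Proof. by rewrite /walfisz mulr_ge0 ?powR_ge0. Qed.

Lemma walfisz_ge (R : realType) (L : R) : 1 <= L -> ln L ^+ 2 <= walfisz L.
Proof.
move=> L1; have L0 : 0 < L by lra.
have y0 : 0 <= ln L by rewrite ln_ge0.
have yL : ln L <= L by rewrite ltW // ln_sublinear.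
rewrite -(@ler_pXn2r _ 3) ?nnegrE ?walfisz_ge0 ?exprn_ge0 // walfisz_cube ?(ltW L0) //.
rewrite -exprM (_ : (2 * 3 = 2 + 4)%N) // exprD; apply: ler_wpM2r; first exact: exprn_ge0.
by rewrite lerXn2r ?nnegrE // ltW.
Qed.

Lemma expR_ge_id (R : realType) (a : R) : a <= expR a.
Proof. by have := expR_ge1Dx a; lra. Qed.

Lemma mul_expR_le (R : realType) (a s t : R) : a + s <= t -> a * expR s <= expR t.
Proof.
move=> h; apply: (@le_trans _ _ (expR a * expR s)).
  by apply: ler_wpM2r; [exact: expR_ge0 | exact: expR_ge_id].
by rewrite -expRD ler_expR.
Qed.

Lemma quadratic_dominates (R : realType) (b y c a : R) : 0 < c -> 0 <= a -> 1 <= y ->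
  c * (b + a) <= y -> b * y + a <= y ^+ 2 / c.
Proof.
move=> c0 a0 y1 h; rewrite ler_pdivlMr // expr2.
apply: (@le_trans _ _ (c * (b + a) * y)); last by apply: ler_wpM2r => //; lra.
have : a * 1 <= a * y by apply: ler_wpM2l.
rewrite mulr1 => h1; rewrite mulrC -mulrA; apply: ler_wpM2l; first exact: ltW.
by rewrite mulrDl; lra.
Qed.

Lemma ln_ge_expR (R : realType) (a x : R) : expR a <= x -> a <= ln x.
Proof.
by move=> h; rewrite -[leLHS]expRK ler_ln ?posrE ?expR_gt0 // (lt_le_trans (expR_gt0 a)).
Qed.

(** For length [exp l] and degree [k], the inputs [l >= W / b] and [k <= a L / W] give [l / k^2 >=
    W^3 / (a^2 b L^2) = y^4 / (a^2 b)]. The weaker [y^2] is enough to absorb [B y]. *)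
Lemma walfisz_ratio (R : realType) (a b c l k W L y : R) : 0 < c -> 1 <= y -> 0 < L -> 0 < k ->
  0 <= W -> k * W <= a * L -> W ^+ 3 = L ^+ 2 * y ^+ 4 -> W / b <= l -> 0 < a -> 0 < b ->
  c / (b * (a * a)) * y ^+ 2 <= c * l / k ^+ 2.
Proof.
move=> c0 y1 L0 k0 W0 kW W3 Wl a0 b0.
have h1 : (k * W) ^+ 2 <= (a * L) ^+ 2.
  rewrite lerXn2r ?nnegrE //; apply: mulr_ge0 => //; exact: ltW.
have h2 : W * (k * W) ^+ 2 <= W * (a * L) ^+ 2 by apply: ler_wpM2l.
have h3 : W * (k * W) ^+ 2 = k ^+ 2 * W ^+ 3 by ring.
have L20 : 0 < L ^+ 2 by rewrite exprn_gt0.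
have h4 : k ^+ 2 * y ^+ 4 <= a * a * W.
  rewrite -(ler_pM2r L20); move: h2; rewrite h3 W3.
  rewrite (_ : W * (a * L) ^+ 2 = a * a * W * L ^+ 2); last by ring.
  by rewrite (_ : k ^+ 2 * (L ^+ 2 * y ^+ 4) = k ^+ 2 * y ^+ 4 * L ^+ 2) //; ring.
have h5 : y ^+ 2 <= y ^+ 4 by rewrite ler_weXn2l.
have k20 : 0 < k ^+ 2 by rewrite exprn_gt0.
have h6 : y ^+ 2 * k ^+ 2 <= a * a * W.
  by apply: le_trans h4; rewrite mulrC; apply: ler_wpM2l => //; exact: ltW.
have aa0 : 0 < a * a by rewrite mulr_gt0.
have h7 : W <= l * b by rewrite -ler_pdivrMr.
have h8 : y ^+ 2 * k ^+ 2 <= l * (b * (a * a)).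
  apply: (le_trans h6); rewrite mulrA [leRHS]mulrC; apply: ler_wpM2l => //; exact: ltW.
rewrite ler_pdivlMr // (_ : c / (b * (a * a)) * y ^+ 2 * k ^+ 2 = c * (y ^+ 2 * k ^+ 2 / (b * (a * a)))).
  by apply: ler_wpM2l; [exact: ltW | rewrite ler_pdivrMr // mulr_gt0].
by field; rewrite !gt_eqF.
Qed.

(** For [L = ln x] the saving is [L^(-B)], an arbitrary power of the logarithm. If
    [alpha <= N^2 / 2], [linear_phase_sum] applies; otherwise the phase lies between two consecutive
    powers of [N] and [vinogradov_phase_sum] applies. *)
Lemma phase_sum_log_pos (R : realType) (B : R) : 0 <= B -> exists L0 : R,
  forall (L alpha : R) (N N' : nat), L0 <= L -> 0 < alpha -> (0 < N)%N -> (N <= N' <= 4 * N)%N ->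
  walfisz L / 20 <= ln N%:R -> walfisz L / 20 <= ln (alpha / N%:R) <= 3 * L ->
  normc (\sum_(N.+1 <= n < N'.+1) cis (alpha / n%:R)) <= N%:R * expR (- (B * ln L)).
Proof.
move=> B0; have [C1 [c1 [c10 HV]]] := vinogradov_phase_sum R.
pose c2 := c1 / (20 * (80 * 80)).
have c20 : 0 < c2 by rewrite /c2 divr_gt0 // !mulr_gt0 // ltr0n.
pose c3 := c2^-1; have c30 : 0 < c3 by rewrite invr_gt0.
pose Y0 := 1000 + 100 * (B + 300) + c3 * (B + (`|C1| + 6)).
exists (expR Y0) => L alpha N N' hL a0 N0 NN' hN /andP[hF1 hF2].
have nC1 : 0 <= `|C1| by exact: normr_ge0.
have c3B : 0 <= c3 * (B + (`|C1| + 6)) by rewrite mulr_ge0 // ?(ltW c30) //; move: B0 nC1; clear => *; lra.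
set y := ln L.
have yY : Y0 <= y by exact: ln_ge_expR.
have y1000 : 1000 <= y by move: yY B0 c3B; rewrite /Y0; move: (c3 * _); clear => *; lra.
have LE : expR y = L by rewrite lnK // posrE (lt_le_trans (expR_gt0 _) hL).
have yL : y <= L by rewrite -LE expR_ge_id.
have L1 : 1 <= L by move: y1000 yL; clear => *; lra.
set W := walfisz L in hN hF1 *.
have W2 : y ^+ 2 <= W by exact: walfisz_ge.
have W3 : W ^+ 3 = L ^+ 2 * y ^+ 4.
  by apply: walfisz_cube; [move: L1 | rewrite -/y; move: y1000]; clear => *; lra.
have W0 : 0 < W.
  by apply: lt_le_trans W2; rewrite exprn_gt0 //; move: y1000; clear => *; lra.
have NR : 1 <= N%:R :> R by rewrite ler1n.
have NR0 : 0 < N%:R :> R by rewrite ltr0n.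
set l := ln N%:R in hN.
set F := alpha / N%:R in hF1 hF2.
have F0 : 0 < F by rewrite divr_gt0.
set phi := ln F in hF1 hF2.
have y1 : 1 <= y by move: y1000; clear => *; lra.
have q60 : B * y + 300 <= W / 60.
  apply: (@le_trans _ _ (y ^+ 2 / 60)); last by move: W2; clear => *; lra.
  apply: quadratic_dominates; [by rewrite ltr0n | by rewrite ler0n | exact: y1 |].
  by move: yY B0 c3B; rewrite /Y0; move: (c3 * _); clear => *; lra.
have q100 : B * y + 52 <= W / 100.
  apply: (@le_trans _ _ (y ^+ 2 / 100)); last by move: W2; clear => *; lra.
  apply: quadratic_dominates; [by rewrite ltr0n | by rewrite ler0n | exact: y1 |].
  by move: yY B0 c3B; rewrite /Y0; move: (c3 * _); clear => *; lra.
have [aN2|aN2] := leP alpha (N%:R ^+ 2 / 2).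
  have aN : N%:R <= alpha.
    rewrite -(mul1r N%:R) -ler_pdivlMr // -/F -[leLHS]expR0 -[F]lnK ?posrE // ler_expR.
    by rewrite -/phi; move: hF1 W0; clear => *; lra.
  apply: le_trans (linear_phase_sum N0 NN' aN aN2) _.
  rewrite [300 * _]mulrC -mulrA; apply: ler_wpM2l; first exact: ltW.
  by apply: mul_expR_le; rewrite -/F -/phi; move: q60 hF1; clear => *; lra.
have FN : N%:R < 2 * F.
  by rewrite /F mulrA ltr_pdivlMr //; move: aN2; rewrite expr2; clear => *; lra.
have l0 : 0 < l by move: hN W0; clear => *; lra.
have l2 := ln2_le1 R.
have ln2F : ln (2 * F) = ln 2 + phi by rewrite lnM ?posrE.
(* The exponent with [N^K <= 2 F < N^(K+1)]; it is at least 1 because [N < 2 F], and at most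
   [80 L / W] because [ln F <= 3 L] and [l >= W / 20]. *)
pose K := Num.truncn (ln (2 * F) / l).
have F20 : 0 < 2 * F by rewrite mulr_gt0.
have lF : l <= ln (2 * F) by rewrite ler_ln ?posrE // ltW.
have r1 : 1 <= ln (2 * F) / l by rewrite ler_pdivlMr // mul1r.
have K0 : (0 < K)%N by rewrite truncn_gt0.
have /andP[K1 K2] : K%:R <= ln (2 * F) / l < K.+1%:R.
  by apply: truncn_itv; move: r1; clear => *; lra.
rewrite ler_pdivlMr // in K1; rewrite ltr_pdivrMr // in K2.
have KW : K%:R * W <= 80 * L.
  have : K%:R * (W / 20) <= K%:R * l by apply: ler_wpM2l.
  move=> h; rewrite ln2F in K1; clear - h K1 l2 hF2 L1.
  by clearbody K; clearbody l phi W; move: h K1 l2 hF2 L1; move: (ln 2) => *; lra.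
have KL : K%:R <= 80 * L.
  have : K%:R * 1 <= K%:R * W.
    apply: ler_wpM2l => //; apply: le_trans W2.
    by rewrite exprn_ege1.
  by rewrite mulr1 => h; exact: le_trans KW.
have hNK k : ln (N%:R ^+ k) = k%:R * l by rewrite lnXn // mulr_natl.
have hK1 : N%:R ^+ K <= 2 * F.
  by rewrite -ler_ln ?posrE ?exprn_gt0 // hNK.
have hK2 : 2 * F < N%:R ^+ K.+1.
  by rewrite -ltr_ln ?posrE ?exprn_gt0 // hNK.
have KR1 : 1 <= K%:R :> R by rewrite ler1n.
have hlog : 400 + 13 * ln (12 * (5 * K.+1) ^ 2)%:R <= l.
  have e1 : ln (12 * (5 * K.+1) ^ 2)%:R = ln 12%:R + 2 * (ln 5%:R + ln K.+1%:R) :> R.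
    by rewrite ln_natM // ln_natX // ln_natM.
  have e2 := ln_nat_le R 12; have e3 := ln_nat_le R 5.
  have e4 : ln K.+1%:R <= 200 + y.
    rewrite -[leRHS]expRK ler_ln ?posrE ?expR_gt0 ?ltr0n // expRD LE.
    apply: (@le_trans _ _ (200 * L)); first by rewrite -natr1; move: KL L1; clear => *; lra.
    by apply: ler_wpM2r; [move: L1; clear => *; lra | exact: expR_ge_id].
  have e5 : 1000 * y <= y ^+ 2.
    by rewrite expr2; apply: ler_wpM2r => //; move: y1; clear => *; lra.
  by rewrite e1; move: e2 e3 e4 e5 W2 hN y1000; clear => *; lra.
apply: le_trans (HV K N N' alpha K0 N0 NN' hK1 hK2 hlog) _.
apply: ler_wpM2l; first exact: ltW.
rewrite -/l.
have k20 : 0 < K%:R ^+ 2 :> R by rewrite exprn_gt0 // ltr0n.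
have lK : c2 * y ^+ 2 <= c1 * l / K%:R ^+ 2.
  have L0 : 0 < L by move: L1; clear => *; lra.
  by apply: (walfisz_ratio (W := W) c10 y1 L0 _ (ltW W0) KW W3 hN) => //; rewrite ltr0n.
have h7 : B * y + (`|C1| + 6) <= c2 * y ^+ 2.
  have -> : c2 * y ^+ 2 = y ^+ 2 / c3 by rewrite /c3 invrK mulrC.
  apply: quadratic_dominates => //.
  by move: yY B0 c3B; rewrite /Y0; move: (c3 * _); clear => *; lra.
have C1n : C1 <= `|C1| by exact: ler_norm.
have b1 : 6 * expR (C1 - c1 * l / K%:R ^+ 2) <= expR (- (B * y)).
  by apply: mul_expR_le; move: h7 lK C1n; clear => *; lra.
have b2 : 52 * expR (- (l / 5)) <= expR (- (B * y)).
  by apply: mul_expR_le; move: q100 hN; clear => *; lra.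
by move: b1 b2; clear => *; lra.
Qed.

Lemma phase_sum_log (R : realType) (B : R) : 0 <= B -> exists L0 : R,
  forall (L alpha : R) (N N' : nat), L0 <= L -> alpha != 0 -> (0 < N)%N -> (N <= N' <= 4 * N)%N ->
  walfisz L / 20 <= ln N%:R -> walfisz L / 20 <= ln (`|alpha| / N%:R) <= 3 * L ->
  normc (\sum_(N.+1 <= n < N'.+1) cis (alpha / n%:R)) <= N%:R * expR (- (B * ln L)).
Proof.
move=> /phase_sum_log_pos[L0 H]; exists L0 => L alpha N N' hL an0 N0 NN' hN.
have [a0|a0|a0] := ltgtP alpha 0; last by rewrite a0 eqxx in an0.
  move=> hF; rewrite -normc_conj rmorph_sum.
  rewrite (eq_bigr (fun n : nat => cis (- alpha / n%:R))); last first.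
    by move=> n _; rewrite mulNr cisN.
  by apply: H => //; [rewrite oppr_gt0 | rewrite -(ltr0_norm a0)].
by rewrite (gtr0_norm a0) => hF; exact: H.
Qed.

(** * The Moebius function and Vaughan's identity *)

(** The multiplicative function supported on squarefree numbers with value [v p] at each prime
    [p]. *)
Definition mulf (R : comNzRingType) (v : nat -> R) (d : nat) : R :=
  \prod_(p <- primes d) (if logn p d == 1%N then v p else 0).

Lemma mulf1 (R : comNzRingType) (v : nat -> R) : mulf v 1 = 1.
Proof. by rewrite /mulf big_nil. Qed.

Lemma mulf_pmul (R : comNzRingType) (v : nat -> R) (p d : nat) : prime p -> (0 < d)%N ->
  ~~ (p %| d)%N -> mulf v (p * d) = v p * mulf v d.
Proof.
move=> pp d0 pd; have p0 := prime_gt0 pp; rewrite /mulf.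
have lp : logn p (p * d) = 1%N.
  by rewrite lognM // (pfactorK 1 pp : logn p p = 1%N) lognE (negPf pd) !andbF.
have perm : perm_eq (primes (p * d)) (p :: primes d).
  apply: uniq_perm; first exact: primes_uniq.
    by rewrite /= primes_uniq andbT mem_primes (negPf pd) !andbF.
  by move=> q; rewrite inE primesM // (primes_prime pp) inE.
rewrite (perm_big _ perm) /= big_cons lp eqxx; congr (_ * _).
apply: eq_big_seq => q; rewrite mem_primes => /and3P[qp _ qd].
suff -> : logn q (p * d) = logn q d by [].
rewrite lognM // [logn q p]lognE; case: ifP => // /and3P[_ _].
by rewrite dvdn_prime2 // => /eqP qE; rewrite qE (negPf pd) in qd.
Qed.

Lemma mulf_sq (R : comNzRingType) (v : nat -> R) (p d : nat) : prime p -> (0 < d)%N ->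
  (p %| d)%N -> logn p d != 1%N -> mulf v d = 0.
Proof.
move=> pp d0 pd l1; rewrite /mulf (big_rem p) /=; last by rewrite mem_primes pp d0 pd.
by rewrite (negPf l1) mul0r.
Qed.

Lemma sum_mulf_divisors (R : comNzRingType) (v : nat -> R) (n : nat) : (0 < n)%N ->
  \sum_(d <- divisors n) mulf v d = \prod_(p <- primes n) (1 + v p).
Proof.
elim/ltn_ind: n => n IH n0.
have [n1|n1] := leqP n 1.
  have -> : n = 1%N by apply/eqP; rewrite eqn_leq n1 n0.
  by rewrite big_nil (_ : divisors 1 = [:: 1%N]) // big_seq1 mulf1.
have pp := pdiv_prime n1; set p := pdiv n in pp; have p0 := prime_gt0 pp.
have [m pm nE] := pfactor_coprime pp n0.
have e0 : (0 < logn p n)%N by rewrite logn_gt0 mem_primes pp n0 pdiv_dvd.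
set e := logn p n in nE e0.
have pm' : ~~ (p %| m)%N by rewrite -prime_coprime.
have m0 : (0 < m)%N by rewrite lt0n; apply: contraNneq pm' => ->; rewrite dvdn0.
have mn : (m < n)%N by rewrite nE -{1}[m]muln1 ltn_pmul2l // -(expn0 p) ltn_exp2l ?prime_gt1.
have nE' : n = (p ^ e.-1 * (p * m))%N by rewrite mulnA -expnSr prednK // mulnC.
have mdn : (m %| n)%N by rewrite nE dvdn_mulr.
have pmn : (p * m %| n)%N by rewrite nE' dvdn_mull.
have -> : \prod_(q <- primes n) (1 + v q) = (1 + v p) * \prod_(q <- primes m) (1 + v q).
  have perm : perm_eq (primes n) (p :: primes m).
    apply: uniq_perm; first exact: primes_uniq.
      by rewrite /= primes_uniq andbT mem_primes (negPf pm') !andbF.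
    by move=> q; rewrite inE nE primesM ?expn_gt0 ?p0 // primesX // (primes_prime pp) inE orbC.
  by rewrite (perm_big _ perm) /= big_cons.
rewrite -(IH m) // mulrDl mul1r (bigID (fun d => p %| d)%N) /= addrC; congr (_ + _).
  rewrite -big_filter; apply: perm_big; apply: uniq_perm; rewrite ?filter_uniq ?divisors_uniq //.
  move=> d; rewrite mem_filter -!dvdn_divisors //; apply/andP/idP.
    case=> pd dn; rewrite nE in dn.
    by rewrite -(@Gauss_dvdl d m (p ^ e)) // coprime_sym coprimeXl // prime_coprime.
  move=> dm; split; last exact: dvdn_trans mdn.
  by apply: contra pm' => pd; exact: dvdn_trans dm.
rewrite (bigID (fun d => logn p d == 1%N)) /= [X in _ + X]big1_seq ?addr0; last first.
  move=> d /andP[/andP[pd l1]]; rewrite -dvdn_divisors // => dn.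
  by apply: (mulf_sq _ pp) => //; exact: dvdn_gt0 dn.
rewrite mulr_sumr -big_filter.
rewrite (perm_big [seq (p * d)%N | d <- divisors m]) /=.
  rewrite big_map big_seq [RHS]big_seq; apply: eq_bigr => d; rewrite -dvdn_divisors // => dm.
  have d0 := dvdn_gt0 m0 dm; apply: mulf_pmul => //.
  by apply: contra pm' => pd; exact: dvdn_trans dm.
apply: uniq_perm; rewrite ?filter_uniq ?divisors_uniq //.
  rewrite map_inj_in_uniq ?divisors_uniq // => x y _ _ /eqP.
  by rewrite eqn_pmul2l // => /eqP.
move=> d; rewrite mem_filter -dvdn_divisors //; apply/idP/mapP.
  case/andP=> /andP[/dvdnP[d' dE] /eqP l1] dn.
  have d'0 : (0 < d')%N.
    by have := dvdn_gt0 n0 dn; rewrite dE muln_gt0 => /andP[].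
  have pd' : ~~ (p %| d')%N.
    apply/negP => pd'; move: l1; rewrite dE lognM // (pfactorK 1 pp : logn p p = 1%N) addn1.
    by case=> /eqP; rewrite -leqn0 leqNgt logn_gt0 mem_primes pp d'0 pd'.
  exists d'; last by rewrite dE mulnC.
  rewrite -dvdn_divisors // -(@Gauss_dvdl d' m (p ^ e)) -?nE.
    by apply: dvdn_trans dn; rewrite dE dvdn_mulr.
  by rewrite coprime_sym coprimeXl // prime_coprime.
case=> d'; rewrite -dvdn_divisors // => dm ->.
have d'0 := dvdn_gt0 m0 dm.
have pd' : ~~ (p %| d')%N by apply: contra pm' => pd; exact: dvdn_trans dm.
rewrite dvdn_mulr // lognM // (pfactorK 1 pp : logn p p = 1%N) [logn p d']lognE (negPf pd') !andbF /=.
by apply: dvdn_trans pmn; rewrite dvdn_pmul2l.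
Qed.

Lemma sum_divisors_nat (R : nmodType) (F : nat -> R) (n X : nat) : (0 < n <= X)%N ->
  \sum_(d <- divisors n) F d = \sum_(1 <= d < X.+1 | (d %| n)%N) F d.
Proof.
case/andP=> n0 nX; rewrite -[RHS]big_filter; apply: perm_big; apply: uniq_perm.
- exact: divisors_uniq.
- by rewrite filter_uniq // iota_uniq.
move=> d; rewrite -dvdn_divisors // mem_filter mem_index_iota; case dn : (d %| n)%N => //=.
by rewrite (dvdn_gt0 n0 dn) ltnS (leq_trans _ nX) // dvdn_leq.
Qed.

Definition mobius (R : comNzRingType) (d : nat) : R := mulf (fun=> -1) d.

Lemma sum_mobius (R : comNzRingType) (n X : nat) : (0 < n <= X)%N ->
  \sum_(1 <= d < X.+1 | (d %| n)%N) mobius R d = (n == 1%N)%:R.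
Proof.
move=> nX; rewrite -sum_divisors_nat // sum_mulf_divisors; last by case/andP: nX.
have [->|n1] := eqVneq n 1%N; first by rewrite big_nil.
have : (1 < n)%N by case: n nX n1 => [|[|n]].
move=> n1'; rewrite (big_rem (pdiv n)) /= ?subrr ?mul0r //.
by rewrite mem_primes pdiv_prime // pdiv_dvd; case/andP: nX => ->.
Qed.

Lemma norm_mobius_le1 (R : realType) (d : nat) : `|mobius R d| <= 1.
Proof.
rewrite /mobius /mulf; elim: (primes d) => [|p s IH]; first by rewrite big_nil normr1.
rewrite big_cons normrM mulr_ile1 //; case: ifP => _; by rewrite ?normrN ?normr1 ?normr0.
Qed.

Lemma sum_nat_mul_eq (R : pzSemiRingType) (X m d : nat) : (0 < d <= X)%N ->
  \sum_(1 <= c < X.+1) (m * c == d)%N%:R = (m %| d)%N%:R :> R.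
Proof.
case/andP=> d0 dX; case: (boolP (m %| d)%N) => [md|md]; last first.
  rewrite big1 // => c _; case: eqP => // dE; by rewrite -dE dvdn_mulr in md.
have m0 := dvdn_gt0 d0 md.
rewrite (bigD1_seq (d %/ m)%N) ?iota_uniq //=; last first.
  by rewrite mem_index_iota divn_gt0 // dvdn_leq // ltnS (leq_trans (leq_div _ _)).
rewrite [(m * _)%N]mulnC divnK // eqxx big1 ?addr0 // => c cd.
by case: eqP => // dE; rewrite -dE mulKn // eqxx in cd.
Qed.

(** The Dirichlet convolution [u * v * 1], with its variables cut at [X] to make the sum finite;
    nothing is lost for [0 < d <= X]. *)
Definition triple_conv (R : comNzRingType) (X : nat) (u v : nat -> R) (d : nat) : R :=
  \sum_(1 <= a < X.+1) \sum_(1 <= b < X.+1) \sum_(1 <= c < X.+1)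
    (a * b * c == d)%N%:R * (u a * v b).

Lemma triple_convC (R : comNzRingType) (X : nat) (u v : nat -> R) (d : nat) :
  triple_conv X u v d = triple_conv X v u d.
Proof.
rewrite /triple_conv exchange_big /=; apply: eq_bigr => b _; apply: eq_bigr => a _.
by apply: eq_bigr => c _; rewrite [(a * b)%N]mulnC [u a * _]mulrC.
Qed.

Lemma triple_convD (R : comNzRingType) (X : nat) (u u' v : nat -> R) (d : nat) :
  triple_conv X (fun n => u n + u' n) v d = triple_conv X u v d + triple_conv X u' v d.
Proof.
rewrite /triple_conv -big_split /=; apply: eq_bigr => a _.
rewrite -big_split /=; apply: eq_bigr => b _.
by rewrite -big_split /=; apply: eq_bigr => c _; rewrite mulrDl mulrDr.
Qed.

Lemma triple_conv_mobius (R : comNzRingType) (X : nat) (v : nat -> R) (d : nat) :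
  (0 < d <= X)%N -> triple_conv X (@mobius R) v d = v d.
Proof.
move=> dX; have /andP[d0 dX'] := dX; rewrite /triple_conv exchange_big /=.
transitivity (\sum_(1 <= b < X.+1) (b == d)%:R * v b).
  rewrite big_nat [RHS]big_nat; apply: eq_bigr => b /andP[b0 bX].
  transitivity (\sum_(1 <= a < X.+1) (a * b %| d)%N%:R * (mobius R a * v b)).
    apply: eq_bigr => a _; rewrite -mulr_suml; congr (_ * _).
    by rewrite -(@sum_nat_mul_eq R X (a * b)).
  case: (boolP (b %| d)%N) => [bd|bd]; last first.
    rewrite big1; last first.
      move=> a _; case: (boolP (a * b %| d)%N) => [h|]; last by rewrite mul0r.
      by rewrite (dvdn_trans (dvdn_mull _ (dvdnn b)) h) in bd.
    by case: eqP bd => [->|]; rewrite ?dvdnn ?mul0r.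
  have q0 : (0 < d %/ b <= X)%N by rewrite divn_gt0 // dvdn_leq //= (leq_trans (leq_div _ _)).
  have -> : (b == d) = (d %/ b == 1)%N.
    apply/eqP/eqP => [->|h]; first by rewrite divnn d0.
    by rewrite -(divnK bd) h mul1n.
  rewrite -(sum_mobius R q0) mulr_suml [RHS]big_mkcond /=; apply: eq_bigr => a _.
  rewrite -{1}(divnK bd) dvdn_pmul2r //; case: ifP => _; by rewrite ?mul1r ?mul0r.
rewrite (bigD1_seq d) ?iota_uniq ?mem_index_iota ?d0 ?ltnS //= eqxx mul1r big1 ?addr0 //.
by move=> b /negPf ->; rewrite mul0r.
Qed.

(* [1/zeta = 2 M - M^2 zeta + (1/zeta - M)^2 zeta], with [M] the truncation of [1/zeta] at [U]. *)
Lemma vaughan_identity (R : comNzRingType) (X U d : nat) : (0 < d <= X)%N -> (U < d)%N ->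
  mobius R d
  = triple_conv X (fun n => (U < n)%N%:R * mobius R n) (fun n => (U < n)%N%:R * mobius R n) d
  - triple_conv X (fun n => (n <= U)%N%:R * mobius R n) (fun n => (n <= U)%N%:R * mobius R n) d.
Proof.
move=> dX Ud; set lo := fun n => (n <= U)%N%:R * _; set hi := fun n => (U < n)%N%:R * _.
have E v e : (0 < e <= X)%N -> v e = triple_conv X lo v e + triple_conv X hi v e.
  move=> eX; rewrite -triple_convD -{1}(triple_conv_mobius v eX).
  congr (triple_conv X _ _ _); apply/funext => n; rewrite /lo /hi leqNgt.
  by case: (U < n)%N; rewrite ?mul0r ?mul1r ?add0r ?addr0.
have lo0 : lo d = 0 by rewrite /lo leqNgt Ud mul0r.
have hid : hi d = mobius R d by rewrite /hi Ud mul1r.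
have h1 := E lo d dX; have h2 := E hi d dX.
rewrite [triple_conv X hi lo d]triple_convC lo0 in h1.
by rewrite -hid h2; move/eqP: h1; rewrite eq_sym addr_eq0 => /eqP ->; rewrite opprK addrC.
Qed.

Lemma harmonic_le1 (R : realType) (n : nat) : (0 < n)%N ->
  \sum_(1 <= k < n.+1) (k%:R)^-1 <= 1 + ln n%:R :> R.
Proof.
move=> n0; rewrite big_ltn // invr1 lerD2l.
by have := @harmonic_le R 1 n isT n0; rewrite ln1 subr0.
Qed.

Lemma sum_nat_restrict (R : numDomainType) (f g : nat -> R) (U X M : nat) :
  (forall b, 0 <= g b) -> (forall b, (U < b)%N -> f b <= (b <= M)%N%:R * g b) ->
  \sum_(U.+1 <= b < X.+1) f b <= \sum_(1 <= b < M.+1) g b.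
Proof.
move=> g0 fg; apply: (@le_trans _ _ (\sum_(U.+1 <= b < X.+1) (b <= M)%N%:R * g b)).
  by rewrite big_nat [leRHS]big_nat; apply: ler_sum => b /andP[ub _]; exact: fg.
set h := fun b => (b <= M)%N%:R * g b; have h0 b : 0 <= h b by rewrite mulr_ge0.
pose Y := maxn X M.
apply: (@le_trans _ _ (\sum_(1 <= b < Y.+1) h b)).
  have [UX|UX] := leqP U X; last by rewrite big_geq // ?sumr_ge0 // ltnW.
  rewrite (@big_cat_nat _ _ _ U.+1 1 Y.+1) //=; last by rewrite ltnS (leq_trans UX) // leq_maxl.
  rewrite (@big_cat_nat _ _ _ X.+1 U.+1 Y.+1) //=; last by rewrite ltnS leq_maxl.
  by rewrite addrCA lerDl addr_ge0 // sumr_ge0.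
rewrite (@big_cat_nat _ _ _ M.+1 1 Y.+1) //=; last by rewrite ltnS leq_maxr.
rewrite [X in _ + X]big_nat [X in _ + X]big1; last first.
  by move=> b /andP[Mb _]; rewrite /h leqNgt Mb mul0r.
rewrite addr0 big_nat [leRHS]big_nat; apply: ler_sum => b /andP[_ bM].
by rewrite /h -ltnS bM mul1r.
Qed.

Lemma count_near (n b q : nat) :
  (\sum_(1 <= c < n.+1) ((b <= c + q) && (c <= b + q)) <= (2 * q).+1)%N.
Proof.
rewrite -big_mkcond /= sum1_count -size_filter -[leqRHS](size_iota (b - q)).
apply: uniq_leq_size; first by rewrite filter_uniq // iota_uniq.
by move=> c; rewrite mem_filter mem_iota => /andP[/andP[h1 h2] _]; lia.
Qed.

(** After Cauchy's inequality the phase is [beta / a] with [|beta| = g * dl / (b1 * b2)] and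
    [dl = |b1 - b2|]. When [dl] is at least [M / La], the ratio [|beta| / N] is still of the order
    of [g / E], up to a factor [La], which keeps it in the range of the phase sum bounds. *)
Lemma far_phase_bounds (R : realType) (g dl E A M La b1 b2 N : R) :
  0 <= g -> 0 < E -> 0 < A -> 1 <= La -> 0 < b1 -> 0 < b2 -> b1 <= M -> b2 <= M ->
  E <= 2 * A * b1 -> E <= 2 * A * b2 -> A <= N -> N <= 2 * A -> A * M <= 3 * E ->
  M <= La * dl -> dl <= M ->
  g / (6 * E * La) <= g * dl / (b1 * b2) / N <= 12 * g / E.
Proof.
move=> g0 E0 A0 La1 b10 b20 b1M b2M Eb1 Eb2 AN N2A AM Mdl dlM.
have La0 : 0 < La by lra.
have M0 : 0 < M by lra.
have N0 : 0 < N by lra.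
have dl0 : 0 <= dl.
  by rewrite -(pmulr_rge0 _ La0); apply: le_trans Mdl; exact: ltW.
have B0 : 0 < b1 * b2 by rewrite mulr_gt0.
have BN0 : 0 < b1 * b2 * N by rewrite mulr_gt0.
have EL0 : 0 < 6 * E * La by rewrite !mulr_gt0.
rewrite -[g * dl / _ / _]mulrA -invfM; apply/andP; split.
  rewrite ler_pdivlMr // mulrAC ler_pdivrMr // -!mulrA; apply: ler_wpM2l => //.
  have h1 : b1 * b2 <= M * (La * dl).
    by apply: ler_pM => //; rewrite ?(ltW b10) ?(ltW b20) //; exact: le_trans Mdl.
  have h2 : b1 * b2 * N <= M * (La * dl) * (2 * A).
    by apply: ler_pM => //; rewrite ?(ltW B0) ?(ltW N0).
  rewrite mulrA; apply: (le_trans h2).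
  have h3 : La * dl * (A * M) <= La * dl * (3 * E).
    by apply: ler_wpM2l => //; rewrite mulr_ge0 // ltW.
  rewrite (_ : M * (La * dl) * (2 * A) = 2 * (La * dl * (A * M))); last by ring.
  rewrite (_ : dl * (6 * (E * La)) = 2 * (La * dl * (3 * E))); last by ring.
  by apply: ler_wpM2l.
rewrite ler_pdivrMr // mulrAC ler_pdivlMr // [12 * g]mulrC -!mulrA; apply: ler_wpM2l => //.
have h1 : E * E <= 2 * A * b1 * (2 * A * b2) by apply: ler_pM => //; exact: ltW.
have h2 : dl * E * (A * E) <= 12 * (b1 * (b2 * N)) * (A * E).
  have h3 : E * E * (A * dl) <= 2 * A * b1 * (2 * A * b2) * (A * M).
    by apply: ler_pM => //; rewrite ?mulr_ge0 ?(ltW E0) ?(ltW A0) //; apply: ler_wpM2l => //; exact: ltW.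
  have h4 : 2 * A * b1 * (2 * A * b2) * (A * M) <= 2 * A * b1 * (2 * A * b2) * (3 * E).
    by apply: ler_wpM2l => //; rewrite !mulr_ge0 // ltW.
  have h5 : 12 * (b1 * b2) * (A * A * E) <= 12 * (b1 * b2) * (N * A * E).
    apply: ler_wpM2l; first by rewrite mulr_ge0 // ltW.
    by apply: ler_wpM2r; [exact: ltW | apply: ler_wpM2r => //; exact: ltW].
  rewrite (_ : dl * E * (A * E) = E * E * (A * dl)); last by ring.
  apply: (le_trans h3); apply: (le_trans h4).
  rewrite (_ : 2 * A * b1 * (2 * A * b2) * (3 * E) = 12 * (b1 * b2) * (A * A * E)); last by ring.
  apply: (le_trans h5); apply: eq_le_trivial; ring.
by move: h2; rewrite ler_pM2r // mulr_gt0.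
Qed.

Lemma realcM (R : realType) (x y : R) : (x * y)%:C = x%:C * y%:C.
Proof. by apply/eqP; rewrite eq_complex /= !mul0r !mulr0 subr0 addr0 !eqxx. Qed.

Lemma sq_sum_le (R : realType) (r : seq nat) (f : nat -> R) : (forall i, 0 <= f i) ->
  (\sum_(a <- r) f a) ^+ 2 <= (size r)%:R * \sum_(a <- r) f a ^+ 2.
Proof.
move=> f0; rewrite big_tnth [X in _ <= _ * X]big_tnth.
have := @power_mean R 'I_(size r) (fun i => f (tnth (in_tuple r) i)) 1.
by rewrite card_ord expr1; apply.
Qed.

Lemma sum_normc_sq_le (R : realType) (r s : seq nat) (w : nat -> nat -> R[i]) :
  \sum_(a <- r) normc (\sum_(b <- s) w a b) ^+ 2
  <= \sum_(b1 <- s) \sum_(b2 <- s) normc (\sum_(a <- r) w a b1 * conjc (w a b2)).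
Proof.
have -> : \sum_(a <- r) normc (\sum_(b <- s) w a b) ^+ 2
   = normc (\sum_(b1 <- s) \sum_(b2 <- s) \sum_(a <- r) w a b1 * conjc (w a b2)).
  rewrite -[LHS]normc_real_ge0; last by apply: sumr_ge0 => a _; rewrite exprn_ge0 // normc_ge0.
  congr normc; rewrite rmorph_sum /=.
  under [RHS]eq_bigr do rewrite exchange_big /=.
  rewrite [RHS]exchange_big /=; apply: eq_bigr => a _.
  rewrite normc_sq rmorph_sum mulr_suml; apply: eq_bigr => b1 _.
  by rewrite mulr_sumr.
apply: le_trans (normc_sum _ _ _) _; apply: ler_sum => b1 _; exact: normc_sum.
Qed.

Lemma sum_nat_itv (V : nmodType) (f : nat -> V) (P : pred nat) (A B N N' : nat) :
  (A <= N)%N -> (N' <= B)%N -> (N <= N')%N ->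
  (forall a, (A < a <= B)%N -> P a = (N < a <= N')%N) ->
  \sum_(A.+1 <= a < B.+1 | P a) f a = \sum_(N.+1 <= a < N'.+1) f a.
Proof.
move=> AN NB NN HP.
rewrite big_nat_cond (eq_bigl (fun a => (A < a < B.+1) && (N < a <= N')))%N; last first.
  by move=> a; case h : (A < a < B.+1)%N => //=; apply: HP.
rewrite -big_nat_cond (@big_cat_nat _ _ _ N.+1 A.+1 B.+1) //=; last by lia.
rewrite (@big_cat_nat _ _ _ N'.+1 N.+1 B.+1) //=.
rewrite [X in X + _]big_nat_cond [X in X + _]big1; last by move=> a; lia.
rewrite [X in _ + (_ + X)]big_nat_cond [X in _ + (_ + X)]big1; last by move=> a; lia.
rewrite add0r addr0 big_nat_cond [RHS]big_nat_cond; apply: eq_bigl => a; lia.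
Qed.

(** Cauchy's inequality in [a] removes the coefficients [u]; opening the square leaves sums over [a]
    with phase [(gamma / b1 - gamma / b2) / a]. Pairs with [|b1 - b2| <= M / La] are bounded
    trivially and produce [3 / La]; the other pairs are covered by the phase hypothesis and produce
    [2 delta]. *)
Lemma type_II_block (R : realType) (La delta gamma : R) (A U X E E' : nat) (u v : nat -> R) :
  (0 < A)%N -> (0 < E <= E')%N -> (E' <= 3 * E)%N -> 1 <= La <= U%:R -> 0 <= delta ->
  (forall n, `|u n| <= 1) -> (forall n, `|v n| <= 1) ->
  (forall (beta : R) (N N' : nat), (A <= N)%N -> (N <= N' <= 2 * A)%N ->
     `|gamma| / (6 * E%:R * La) <= `|beta| / N%:R <= 12 * `|gamma| / E%:R ->
     normc (\sum_(N.+1 <= n < N'.+1) cis (beta / n%:R)) <= N%:R * delta) ->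
  normc (\sum_(A.+1 <= a < (2 * A).+1) \sum_(U.+1 <= b < X.+1)
     ((E < a * b <= E')%N%:R * (u a * v b))%:C * cis (gamma / (a * b)%:R)) ^+ 2
  <= 9 * E%:R ^+ 2 * (2 * delta + 3 / La).
Proof.
move=> A0 /andP[E0 EE'] E'3 /andP[La1 LaU] d0 u1 v1 HP.
pose P a b := (E < a * b <= E')%N.
pose w a b : R[i] := ((P a b)%:R * v b)%:C * cis (gamma / (a * b)%:R).
have w0 a b : P a b = false -> w a b = 0.
  by move=> p; rewrite /w p mul0r (_ : (0 : R)%:C = 0) // mul0r.
have AR : 0 < A%:R :> R by rewrite ltr0n.
have ER : 0 < E%:R :> R by rewrite ltr0n.
set S := \sum_(A.+1 <= a < _) _.
have SE : S = \sum_(A.+1 <= a < (2 * A).+1) (u a)%:C * \sum_(U.+1 <= b < X.+1) w a b.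
  apply: eq_bigr => a _; rewrite mulr_sumr; apply: eq_bigr => b _.
  by rewrite /w [RHS]mulrA -realcM [u a * (_ * _)]mulrCA.
pose rA := index_iota A.+1 (2 * A).+1; pose sU := index_iota U.+1 X.+1.
have h1 : normc S <= \sum_(a <- rA) normc (\sum_(b <- sU) w a b).
  rewrite SE; apply: le_trans (normc_sum _ _ _) _; apply: ler_sum => a _.
  rewrite normcM normc_real -[leRHS]mul1r; apply: ler_wpM2r => //; exact: normc_ge0.
have h2 : normc S ^+ 2 <= A%:R * \sum_(a <- rA) normc (\sum_(b <- sU) w a b) ^+ 2.
  apply: (@le_trans _ _ ((\sum_(a <- rA) normc (\sum_(b <- sU) w a b)) ^+ 2)).
    by rewrite lerXn2r ?nnegrE ?normc_ge0 // sumr_ge0 // => a _; exact: normc_ge0.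
  have -> : A%:R = (size rA)%:R :> R by rewrite size_iota; congr (_%:R); lia.
  by apply: sq_sum_le => a; exact: normc_ge0.
have h3 := sum_normc_sq_le rA sU w.
pose M := (E' %/ A)%N.
have AM : (A * M <= E')%N by rewrite mulnC leq_trunc_div.
have AMR : A%:R * M%:R <= 3 * E%:R :> R.
  by rewrite -!natrM ler_nat (leq_trans AM).
have RHS0 : 0 <= 9 * E%:R ^+ 2 * (2 * delta + 3 / La).
  have La0 : 0 <= 3 / La by rewrite divr_ge0 //; lra.
  by rewrite !mulr_ge0 ?exprn_ge0 ?(ltW ER) // addr_ge0 // mulr_ge0.
have Pb a b : (A < a)%N -> P a b -> (b <= M)%N.
  by move=> Aa /andP[_ h]; rewrite leq_divRL // mulnC (leq_trans _ h) // leq_mul2r (ltnW Aa) orbT.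
pose T b1 b2 := normc (\sum_(a <- rA) w a b1 * conjc (w a b2)).
have T0 b1 b2 : ((M < b1) || (M < b2))%N -> T b1 b2 = 0.
  move=> h; rewrite /T big_seq big1 ?normc0 // => a; rewrite mem_index_iota => /andP[Aa _].
  have h' : P a b1 && P a b2 = false.
    by apply/negP => /andP[p1 p2]; move: h; rewrite ltnNge (Pb _ _ Aa p1) ltnNge (Pb _ _ Aa p2).
  move: h' => /negbT; rewrite negb_and => /orP[/negPf p1|/negPf p2].
    by rewrite (w0 _ _ p1) mul0r.
  by rewrite (w0 _ _ p2) conjc0 mulr0.
have [MU|UM] := leqP M U.
  apply: (@le_trans _ _ 0) => //; apply: (le_trans h2).
  rewrite pmulr_rle0 //; apply: (le_trans h3); rewrite big_seq sumr_le0 // => b1 hb1.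
  rewrite sumr_le0 // => b2 _; rewrite [normc _]T0 //.
  by move: hb1; rewrite mem_index_iota => /andP[hb1 _]; rewrite (leq_ltn_trans MU).
have M0 : 0 < M%:R :> R by rewrite ltr0n (leq_ltn_trans _ UM).
have LaM : La <= M%:R by apply: (le_trans LaU); rewrite ler_nat ltnW.
have La0 : 0 < La by lra.
(* A given [b1] has at most [2 q + 1] near partners, which is at most [3 M / La] because
   [La <= M]. *)
pose q := Num.truncn (M%:R / La).
have ML0 : 0 <= M%:R / La by rewrite divr_ge0 // ltW.
have /andP[q1 q2] : q%:R <= M%:R / La < q.+1%:R by exact: truncn_itv.
pose near b1 b2 := ((b1 <= b2 + q) && (b2 <= b1 + q))%N.
have Tb b1 b2 : (0 < b1 <= M)%N -> (0 < b2 <= M)%N ->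
   T b1 b2 <= A%:R * (near b1 b2)%:R + 2 * A%:R * delta.
  move=> /andP[b10 b1M] /andP[b20 b2M].
  have b1R : 0 < b1%:R :> R by rewrite ltr0n.
  have b2R : 0 < b2%:R :> R by rewrite ltr0n.
  pose beta := gamma / b1%:R - gamma / b2%:R.
  have wE a : w a b1 * conjc (w a b2) = ((P a b1 && P a b2)%:R * (v b1 * v b2))%:C * cis (beta / a%:R).
    have -> : conjc (w a b2) = ((P a b2)%:R * v b2)%:C * cis (- (gamma / (a * b2)%:R)).
      rewrite /w cisN rmorphM; congr (_ * _).
      by apply/eqP; rewrite eq_complex /= oppr0 !eqxx.
    rewrite /w mulrACA -cisD -realcM.
    have -> : (P a b1 && P a b2)%:R = (P a b1)%:R * (P a b2)%:R :> R by rewrite -natrM mulnb.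
    rewrite [X in X %:C * _]mulrACA; congr (_ * cis _).
    by rewrite /beta !natrM !invfM; ring.
  have TE : T b1 b2 <= normc (\sum_(A.+1 <= a < (2 * A).+1 | P a b1 && P a b2) cis (beta / a%:R)).
    rewrite /T (eq_bigr (fun a => (v b1 * v b2)%:C * (if P a b1 && P a b2 then cis (beta / a%:R) else 0))); last first.
      move=> a _; rewrite wE; case: ifP => _; last by rewrite mul0r !mulr0 mul0r.
      by rewrite mul1r.
    rewrite -mulr_sumr normcM normc_real normrM -big_mkcond /=.
    rewrite -[leRHS]mul1r; apply: ler_wpM2r; first exact: normc_ge0.
    by rewrite mulr_ile1.
  have Ttriv : T b1 b2 <= A%:R.
    apply: (le_trans TE); apply: le_trans (normc_sum _ _ _) _.
    under eq_bigr do rewrite normc_cis.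
    rewrite big_mkcond /=; apply: (@le_trans _ _ (\sum_(A.+1 <= a < (2 * A).+1) 1)).
      by apply: ler_sum => a _; case: ifP.
    by rewrite sumr_const_nat -[leLHS]mulr_natl mulr1 subSS mul2n -addnn addnK.
  have dA : 0 <= 2 * A%:R * delta by rewrite !mulr_ge0.
  case nr : (near b1 b2); first by rewrite mulr1 (le_trans Ttriv) // lerDl.
  rewrite mulr0 add0r; apply: (le_trans TE).
  (* For fixed [b1] and [b2] the two conditions [E < a b <= E'] cut out an interval of [a], so the
     sharp cutoffs do no harm. *)
  pose N := maxn A (maxn (E %/ b1) (E %/ b2)); pose N' := minn (2 * A) (minn (E' %/ b1) (E' %/ b2)).
  have HPab a : (A < a <= 2 * A)%N -> P a b1 && P a b2 = (N < a <= N')%N.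
    move=> /andP[a1 a2]; rewrite /N /N' !gtn_max !leq_min a1 a2 /= /P.
    rewrite !ltn_divLR // !leq_divRL //.
    by case: (E < a * b1)%N; case: (E < a * b2)%N; case: (a * b1 <= E')%N; case: (a * b2 <= E')%N.
  have [NN'|NN'] := leqP N' N.
    rewrite big_nat_cond big1 ?normc0 // => a /andP[/andP[a1 a2]].
    by rewrite ltnS in a2; rewrite HPab ?a1 // => /andP[h4 h5]; have := leq_trans h4 (leq_trans h5 NN'); rewrite ltnn.
  have AN : (A <= N)%N by rewrite leq_maxl.
  have NA : (N' <= 2 * A)%N by rewrite geq_minl.
  have Eb b : (0 < b)%N -> (E %/ b <= N)%N -> E%:R <= 2 * A%:R * b%:R :> R.
    move=> b0 h; rewrite -!natrM ler_nat ltnW // -ltn_divLR //.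
    by rewrite (leq_trans _ NA) // (leq_ltn_trans h).
  have Eb1 : E%:R <= 2 * A%:R * b1%:R :> R by apply: Eb => //; rewrite /N !leq_max leqnn !orbT.
  have Eb2 : E%:R <= 2 * A%:R * b2%:R :> R by apply: Eb => //; rewrite /N !leq_max leqnn !orbT.
  rewrite (sum_nat_itv _ AN NA (ltnW NN') HPab).
  have ANR : A%:R <= N%:R :> R by rewrite ler_nat.
  have NAR : N%:R <= 2 * A%:R :> R by rewrite -natrM ler_nat (leq_trans (ltnW NN')).
  apply: (@le_trans _ _ (N%:R * delta)); last exact: ler_wpM2r.
  apply: HP => //; first by rewrite (ltnW NN').
  have -> : `|beta| = `|gamma| * `|b2%:R - b1%:R| / (b1%:R * b2%:R).
    rewrite /beta (_ : _ - _ = gamma * (b2%:R - b1%:R) / (b1%:R * b2%:R)); last first.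
      by field; rewrite !gt_eqF.
    by rewrite !normrM [`|(_ * _)^-1|]gtr0_norm // invr_gt0 mulr_gt0.
  have dlE : `|b2%:R - b1%:R| = (b2 - b1 + (b1 - b2))%N%:R :> R.
    have [h|h] := leqP b1 b2.
      by rewrite (_ : (b1 - b2 = 0)%N) ?addn0 ?natrB // ?ger0_norm ?subr_ge0 ?ler_nat //; apply/eqP; rewrite subn_eq0.
    rewrite distrC (_ : (b2 - b1 = 0)%N) ?add0n ?natrB ?(ltnW h) // ?ger0_norm ?subr_ge0 ?ler_nat ?(ltnW h) //.
    by apply/eqP; rewrite subn_eq0 ltnW.
  apply: (@far_phase_bounds R _ _ _ A%:R M%:R) => //; rewrite ?ler_nat //.
  - rewrite mulrC -ler_pdivrMr //; apply: (le_trans (ltW q2)); rewrite dlE ler_nat.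
    by move: nr; rewrite /near; clear; lia.
  - by rewrite dlE ler_nat; move: b1M b2M; clear; lia.
have near0 b1 b2 : 0 <= A%:R * (near b1 b2)%:R + 2 * A%:R * delta by rewrite addr_ge0 // !mulr_ge0.
have h4 : \sum_(b1 <- sU) \sum_(b2 <- sU) T b1 b2
   <= \sum_(1 <= b1 < M.+1) \sum_(1 <= b2 < M.+1) (A%:R * (near b1 b2)%:R + 2 * A%:R * delta).
  apply: sum_nat_restrict => [b1|b1 b10]; first by rewrite sumr_ge0.
  have [b1M|b1M] := leqP b1 M; last first.
    by rewrite mul0r big1 // => b2 _; rewrite T0 // b1M.
  rewrite mul1r; apply: sum_nat_restrict => [b2 //|b2 b20].
  have [b2M|b2M] := leqP b2 M; last by rewrite mul0r T0 // b2M orbT.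
  by rewrite mul1r; apply: Tb; rewrite ?b1M ?b2M andbT (leq_ltn_trans _ b10, leq_ltn_trans _ b20).
have h5 : \sum_(1 <= b1 < M.+1) \sum_(1 <= b2 < M.+1) (A%:R * (near b1 b2)%:R + 2 * A%:R * delta)
   <= M%:R * (A%:R * (3 * M%:R / La) + M%:R * (2 * A%:R * delta)).
  apply: (@le_trans _ _ (\sum_(1 <= b1 < M.+1) (A%:R * (3 * M%:R / La) + M%:R * (2 * A%:R * delta)))); last first.
    by rewrite sumr_const_nat -[leLHS]mulr_natl subn1.
  apply: ler_sum => b1 _; rewrite big_split /=; apply: lerD; last first.
    by rewrite sumr_const_nat -[leLHS]mulr_natl subn1.
  rewrite -mulr_sumr; apply: ler_wpM2l; first exact: ltW.
  rewrite -natr_sum; apply: (@le_trans _ _ (2 * q).+1%:R); first by rewrite ler_nat; exact: count_near.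
  have ML1 : 1 <= M%:R / La by rewrite ler_pdivlMr // mul1r.
  rewrite -natr1 natrM -mulrA; move: q1 ML1; move: (M%:R / La) (q%:R : R) => *; lra.
apply: (le_trans h2); apply: (@le_trans _ _ (A%:R * (M%:R * (A%:R * (3 * M%:R / La) + M%:R * (2 * A%:R * delta))))).
  by apply: ler_wpM2l; [exact: ltW | apply: (le_trans h3); apply: (le_trans h4)].
rewrite (_ : A%:R * _ = (A%:R * M%:R) ^+ 2 * (2 * delta + 3 / La)); last by ring.
apply: ler_wpM2r; first by rewrite addr_ge0 ?mulr_ge0 // invr_ge0 ltW.
rewrite (_ : 9 * E%:R ^+ 2 = (3 * E%:R) ^+ 2); last by ring.
by rewrite lerXn2r ?nnegrE ?mulr_ge0 // ltW.
Qed.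

Lemma sum_dyadic (V : nmodType) (f : nat -> V) (U I : nat) :
  \sum_(U.+1 <= a < (U * 2 ^ I).+1) f a
  = \sum_(i < I) \sum_((U * 2 ^ i).+1 <= a < (2 * (U * 2 ^ i)).+1) f a.
Proof.
elim: I => [|I IH]; first by rewrite big_ord0 expn0 muln1 big_geq.
rewrite big_ord_recr /= -IH (@big_cat_nat _ _ _ (U * 2 ^ I).+1) //=.
- by congr (_ + \sum_(_ <= _ < _.+1) _); rewrite expnS mulnCA.
- by rewrite ltnS leq_pmulr // expn_gt0.
- by rewrite ltnS leq_mul2l leq_exp2l // leqnSn orbT.
Qed.

Lemma sum_triple_conv (R : realType) (X D D' : nat) (u v : nat -> R) (f : nat -> R[i]) :
  (D' <= X)%N ->
  \sum_(D.+1 <= d < D'.+1) (triple_conv X u v d)%:C * f d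
  = \sum_(1 <= c < X.+1) \sum_(1 <= a < X.+1) \sum_(1 <= b < X.+1)
      ((D < a * b * c <= D')%N%:R * (u a * v b))%:C * f (a * b * c)%N.
Proof.
move=> D'X.
transitivity (\sum_(D.+1 <= d < D'.+1) \sum_(1 <= a < X.+1) \sum_(1 <= b < X.+1)
   \sum_(1 <= c < X.+1) ((a * b * c == d)%N%:R * (u a * v b))%:C * f d).
  apply: eq_bigr => d _; rewrite /triple_conv rmorph_sum mulr_suml; apply: eq_bigr => a _.
  rewrite rmorph_sum mulr_suml; apply: eq_bigr => b _.
  by rewrite rmorph_sum mulr_suml.
rewrite exchange_big [RHS]exchange_big /=; apply: eq_bigr => a _.
rewrite exchange_big [RHS]exchange_big /=; apply: eq_bigr => b _.
rewrite exchange_big /=; apply: eq_bigr => c _.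
have [h|h] := boolP (D < a * b * c <= D')%N.
  rewrite (bigD1_seq (a * b * c)%N) ?iota_uniq ?mem_index_iota //= eqxx big1 ?addr0 //.
  by move=> d; rewrite eq_sym => /negPf ->; rewrite mul0r (_ : (0 : R)%:C = 0) // mul0r.
rewrite mul0r (_ : (0 : R)%:C = 0) // mul0r big_nat big1 // => d hd.
case: eqP => [dE|_]; last by rewrite mul0r (_ : (0 : R)%:C = 0) // mul0r.
by rewrite dE hd in h.
Qed.

Lemma div_itv (D D' c n : nat) : (0 < c)%N ->
  (D < n * c <= D')%N = (D %/ c < n <= D' %/ c)%N.
Proof. by move=> c0; rewrite ltn_divLR // leq_divRL. Qed.

Lemma divn_half_le (R : realType) (D m : nat) : (0 < m <= D)%N ->
  D%:R / (2 * m%:R) <= (D %/ m)%:R :> R /\ (D %/ m)%:R <= D%:R / m%:R :> R.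
Proof.
case/andP=> m0 mD; have mR : 0 < m%:R :> R by rewrite ltr0n.
have d1 : (0 < D %/ m)%N by rewrite divn_gt0.
split; last by rewrite ler_pdivlMr // -natrM ler_nat leq_trunc_div.
rewrite ler_pdivrMr ?mulr_gt0 // -!natrM ler_nat.
have := divn_eq D m; have := ltn_pmod D m0.
move: (D %/ m)%N d1 (D %% m)%N => q q0 r rm ->; rewrite mulnCA mul2n -addnn leq_add2l.
by apply: (leq_trans (ltnW rm)); rewrite leq_pmull.
Qed.

Lemma divn_double_le (D D' c : nat) : (0 < c)%N -> (c <= D)%N -> (D' <= 2 * D)%N ->
  (D' %/ c <= 3 * (D %/ c))%N.
Proof.
move=> c0 cD DD2; apply: (leq_trans (leq_div2r c DD2)); rewrite -ltnS ltn_divLR //.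
have := divn_eq D c; have := ltn_pmod D c0; have : (0 < D %/ c)%N by rewrite divn_gt0.
move: (D %/ c)%N (D %% c)%N => q r; clear; nia.
Qed.

(** * Sums of mu(d) e(alpha / d) by Vaughan's identity, given a bound for the sums without mu *)

Section PhaseSum.

Variables (R : realType) (alpha La delta : R) (D D' U : nat).
Hypotheses (U1 : (1 < U)%N) (UD : (U ^ 3 <= D)%N) (DD' : (D <= D' <= 2 * D)%N).
Hypotheses (hLa : 1 <= La <= U%:R) (delta0 : 0 <= delta).
Hypothesis HP : forall (beta : R) (N N' : nat), (U <= N)%N -> (N <= N' <= 4 * N)%N ->
  `|alpha| / (6 * D%:R * La) <= `|beta| / N%:R <= 24 * (`|alpha| / D%:R) ->
  normc (\sum_(N.+1 <= n < N'.+1) cis (beta / n%:R)) <= N%:R * delta.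

Let D0 : (0 < D)%N.
Proof. by apply: leq_trans UD; rewrite expn_gt0 ltnW. Qed.

Let DR : 0 < D%:R :> R.
Proof. by rewrite ltr0n. Qed.

(** For [a, b <= U] the sum over [c] is a phase sum of length about [D / (a b)], at least [U]
    because [U^3 <= D], hence at most [D delta / (a b)]. Summation over [a] and [b] gives the square
    of a harmonic sum. *)
Lemma type_I_sum (X : nat) : (D' <= X)%N ->
  normc (\sum_(D.+1 <= d < D'.+1) (triple_conv X (fun n => (n <= U)%N%:R * mobius R n)
     (fun n => (n <= U)%N%:R * mobius R n) d)%:C * cis (alpha / d%:R))
  <= D%:R * delta * (1 + ln U%:R) ^+ 2.
Proof.
move=> D'X; rewrite sum_triple_conv //.
have -> : \sum_(1 <= c < X.+1) \sum_(1 <= a < X.+1) \sum_(1 <= b < X.+1)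
    ((D < a * b * c <= D')%N%:R * ((a <= U)%N%:R * mobius R a * ((b <= U)%N%:R * mobius R b)))%:C
      * cis (alpha / (a * b * c)%:R)
  = \sum_(1 <= a < X.+1) \sum_(1 <= b < X.+1)
    ((a <= U)%N%:R * mobius R a * ((b <= U)%N%:R * mobius R b))%:C *
    \sum_(1 <= c < X.+1) (if (D < c * (a * b) <= D')%N then cis (alpha / (a * b)%:R / c%:R) else 0).
  rewrite exchange_big /=; apply: eq_bigr => a _; rewrite exchange_big /=; apply: eq_bigr => b _.
  rewrite mulr_sumr; apply: eq_bigr => c _; rewrite [(c * _)%N]mulnC.
  case: ifP => _; last by rewrite mul0r (_ : (0 : R)%:C = 0) // mul0r mulr0.
  by rewrite mul1r; congr (_ * cis _); rewrite [(a * b * c)%:R]natrM invfM mulrA.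
apply: le_trans (normc_sum _ _ _) _.
have m1 n : `|mobius R n| <= 1 := norm_mobius_le1 R n.
have H : forall a b, (0 < a <= U)%N -> (0 < b <= U)%N -> normc (\sum_(1 <= c < X.+1)
   (if (D < c * (a * b) <= D')%N then cis (alpha / (a * b)%:R / c%:R) else 0))
   <= D%:R * delta * ((a%:R)^-1 * (b%:R)^-1).
  move=> a b /andP[a0 aU] /andP[b0 bU].
  have m0 : (0 < a * b)%N by rewrite muln_gt0 a0.
  have mU : (a * b <= U * U)%N by rewrite leq_mul.
  have DU : (U * (a * b) <= D)%N.
    by apply: leq_trans UD; rewrite expnS leq_mul2l -mulnn mU orbT.
  rewrite -invfM -natrM; move: (a * b)%N m0 DU => m m0 DU {a b a0 aU b0 bU mU}.
  have mD : (0 < m <= D)%N.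
    by rewrite m0 (leq_trans _ DU) // leq_pmull // ltnW.
  have mR : 0 < m%:R :> R by rewrite ltr0n.
  have UN : (U <= D %/ m)%N by rewrite leq_divRL.
  have [/andP[DD1 DD2]] := (DD').
  have N1 : (D %/ m <= D' %/ m)%N by exact: leq_div2r.
  have N2 : (D' %/ m <= 4 * (D %/ m))%N.
    have h : (D' %/ m <= (2 * D) %/ m)%N by exact: leq_div2r.
    apply: (leq_trans h); rewrite -ltnS ltn_divLR //.
    have := divn_eq D m; have := ltn_pmod D m0; have : (1 < D %/ m)%N by exact: leq_trans UN.
    move: (D %/ m)%N (D %% m)%N => q r; clear; nia.
  have NX : (D' %/ m <= X)%N by exact: leq_trans (leq_div _ _) D'X.
  have [h1 h2] := @divn_half_le R D m mD.
  rewrite -big_mkcond /= (@sum_nat_itv _ _ _ 0 X (D %/ m) (D' %/ m)) //; last first.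
    by move=> c _; exact: div_itv.
  have NR : 0 < (D %/ m)%:R :> R by rewrite ltr0n (leq_trans _ UN) // ltnW.
  apply: le_trans (HP UN _ _) _; rewrite ?N1 ?N2 //; last first.
    rewrite mulrAC; apply: ler_wpM2r => //; exact: h2.
  have /andP[La1 _] := hLa; have La0 : 0 < La by lra.
  set N := (D %/ m)%:R in h1 h2 NR *.
  have -> : `|alpha / m%:R| / N = `|alpha| / (m%:R * N).
    by rewrite normrM normfV (gtr0_norm mR) invfM mulrA.
  rewrite ler_pdivrMr ?mulr_gt0 // mulrC in h1; rewrite ler_pdivlMr // in h2.
  apply/andP; split.
    apply: ler_wpM2l => //; rewrite lef_pV2 ?posrE ?mulr_gt0 //.
    apply: (@le_trans _ _ (D%:R * 1)); first by rewrite mulr1 mulrC.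
    rewrite -mulrA mulrCA; apply: ler_wpM2l; first exact: ltW.
    by rewrite -[leLHS]mulr1; apply: ler_pM => //; lra.
  rewrite mulrCA; apply: ler_wpM2l => //.
  rewrite -[leLHS]mul1r ler_pdivrMr ?mulr_gt0 // mulrAC ler_pdivlMr // mul1r.
  rewrite mulrC in h2.
  by apply: (le_trans h1); rewrite -mulrA; apply: ler_pM; rewrite ?mulr_ge0 ?(ltW mR) ?(ltW NR) //; lra.
apply: (@le_trans _ _ (\sum_(1 <= a < X.+1) \sum_(1 <= b < X.+1)
    (a <= U)%N%:R * ((b <= U)%N%:R * (D%:R * delta * ((a%:R)^-1 * (b%:R)^-1))))).
  rewrite big_nat [leRHS]big_nat; apply: ler_sum => a /andP[a0 _].
  apply: le_trans (normc_sum _ _ _) _.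
  rewrite big_nat [leRHS]big_nat; apply: ler_sum => b /andP[b0 _].
  rewrite normcM normc_real.
  have [aU|aU] := leqP a U; last by rewrite !mul0r normr0 mul0r.
  have [bU|bU] := leqP b U; last by rewrite !mul0r mulr0 normr0 !mul0r mulr0.
  rewrite !mul1r; apply: le_trans (H a b _ _); rewrite ?a0 ?b0 //.
  rewrite -[leRHS]mul1r; apply: ler_wpM2r; first exact: normc_ge0.
  by rewrite normrM mulr_ile1.
have hU : (0 < U)%N by exact: ltnW.
have inv0 (n : nat) : 0 <= (n%:R)^-1 :> R by rewrite invr_ge0.
have Hh := @harmonic_le1 R U hU; set h := \sum_(1 <= k < U.+1) _ in Hh.
have h0 : 0 <= h by apply: sumr_ge0.
have E : \sum_(1 <= a < X.+1) (a <= U)%N%:R * (a%:R)^-1 <= h.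
  apply: (@sum_nat_restrict R _ (fun a => (a%:R)^-1) 0 X U) => //.
have E0 : 0 <= \sum_(1 <= a < X.+1) (a <= U)%N%:R * (a%:R)^-1 :> R.
  by apply: sumr_ge0 => a _; rewrite mulr_ge0.
have -> : \sum_(1 <= a < X.+1) \sum_(1 <= b < X.+1)
    (a <= U)%N%:R * ((b <= U)%N%:R * (D%:R * delta * ((a%:R)^-1 * (b%:R)^-1)))
  = D%:R * delta * (\sum_(1 <= a < X.+1) (a <= U)%N%:R * (a%:R)^-1) ^+ 2.
  rewrite expr2 mulr_suml mulr_sumr; apply: eq_bigr => a _.
  by rewrite !mulr_sumr; apply: eq_bigr => b _; ring.
apply: ler_wpM2l; first by rewrite mulr_ge0.
by have H1 := le_trans E Hh; rewrite lerXn2r ?nnegrE // (le_trans E0 H1).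
Qed.

(** The smooth variable [c] is fixed, and the variable [a] is cut into [I] dyadic blocks, each
    treated by [type_II_block] with [E = D / c]. The resulting bounds [3 s D / c] sum harmonically
    over [c]. *)
Lemma type_II_sum (s : R) (I : nat) : (D' <= U * 2 ^ I)%N -> 0 <= s ->
  2 * delta + 3 / La <= s ^+ 2 ->
  normc (\sum_(D.+1 <= d < D'.+1) (triple_conv (U * 2 ^ I) (fun n => (U < n)%N%:R * mobius R n)
     (fun n => (U < n)%N%:R * mobius R n) d)%:C * cis (alpha / d%:R))
  <= 3 * s * I%:R * D%:R * (1 + ln D%:R).
Proof.
move=> D'X s0 hs; set X := (U * 2 ^ I)%N in D'X *; rewrite sum_triple_conv //.
have m1 n : `|mobius R n| <= 1 := norm_mobius_le1 R n.
have /andP[La1 LaU] := hLa; have La0 : 0 < La by lra.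
have /andP[DD1 DD2] := DD'.
have UX : (U <= X)%N by rewrite leq_pmulr // expn_gt0.
pose w a b c := ((D < a * b * c <= D')%N%:R * (mobius R a * mobius R b))%:C
   * cis (alpha / (a * b * c)%:R).
have step c : \sum_(1 <= a < X.+1) \sum_(1 <= b < X.+1)
     ((D < a * b * c <= D')%N%:R * ((U < a)%N%:R * mobius R a * ((U < b)%N%:R * mobius R b)))%:C
       * cis (alpha / (a * b * c)%:R)
   = \sum_(U.+1 <= a < X.+1) \sum_(U.+1 <= b < X.+1) w a b c.
  have cut (f : nat -> R[i]) : (forall a, (a <= U)%N -> f a = 0) ->
      \sum_(1 <= a < X.+1) f a = \sum_(U.+1 <= a < X.+1) f a.
    move=> f0; rewrite (@big_cat_nat _ _ _ U.+1) //= big_nat big1 ?add0r // => a /andP[_].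
    by rewrite ltnS; exact: f0.
  rewrite cut; last first.
    move=> a aU; rewrite big1 // => b _; rewrite [(U < a)%N]ltnNge aU !mul0r mulr0.
    by rewrite (_ : (0 : R)%:C = 0) // mul0r.
  rewrite big_nat [RHS]big_nat; apply: eq_bigr => a /andP[Ua _].
  rewrite cut; last first.
    move=> b bU; rewrite [(U < b)%N]ltnNge bU !mul0r !mulr0.
    by rewrite (_ : (0 : R)%:C = 0) // mul0r.
  rewrite big_nat [RHS]big_nat; apply: eq_bigr => b /andP[Ub _].
  by rewrite Ua Ub !mul1r.
rewrite (eq_bigr _ (fun c _ => step c)).
apply: le_trans (normc_sum _ _ _) _.
apply: (@le_trans _ _ (\sum_(1 <= c < D.+1) (I%:R * (3 * s * (D%:R / c%:R))))); last first.
  rewrite -mulr_sumr -mulr_sumr -mulr_sumr.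
  have := @harmonic_le1 R D D0; set h := \sum_(_ <= _ < _) _ => hh.
  rewrite (_ : _ * _ = 3 * s * I%:R * D%:R * h); last by ring.
  by apply: ler_wpM2l => //; rewrite !mulr_ge0.
apply: sum_nat_restrict => [c|c c0]; first by rewrite !mulr_ge0 // invr_ge0.
(* For [c > D] the sum is empty: [a, b > U >= 2] give [a b c >= 4 c > 2 D >= D']. *)
have [cD|cD] := leqP c D; last first.
  rewrite mul0r big_nat big1 ?normc0 // => a /andP[Ua _].
  rewrite big_nat big1 // => b /andP[Ub _].
  rewrite /w; have -> : (D < a * b * c <= D')%N = false.
    apply/negP => /andP[_ h].
    have h4 : (4 <= a * b)%N.
      by rewrite (_ : 4 = 2 * 2)%N // leq_mul // (leq_trans U1) // ltnW.
    have : (4 * c <= 2 * D)%N.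
      by apply: leq_trans DD2; apply: leq_trans h; rewrite leq_mul2r h4 orbT.
    by move: cD c0; clear; lia.
  by rewrite mul0r (_ : (0 : R)%:C = 0) // mul0r.
rewrite mul1r (sum_dyadic _ U I).
apply: le_trans (normc_sum _ _ _) _.
apply: (@le_trans _ _ (\sum_(i < I) 3 * s * (D%:R / c%:R))); last first.
  by rewrite sumr_const card_ord -[leLHS]mulr_natl.
apply: ler_sum => i _.
set A := (U * 2 ^ i)%N.
have UA : (U <= A)%N by rewrite leq_pmulr // expn_gt0.
have A0 : (0 < A)%N by apply: leq_trans UA; exact: ltnW.
pose E := (D %/ c)%N; pose E' := (D' %/ c)%N.
have E0 : (0 < E)%N by rewrite divn_gt0.
have EE' : (E <= E')%N by exact: leq_div2r.
have E'3 : (E' <= 3 * E)%N by exact: divn_double_le.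
have cR : 0 < c%:R :> R by rewrite ltr0n.
have ER : 0 < E%:R :> R by rewrite ltr0n.
have [h1 h2] : D%:R / (2 * c%:R) <= E%:R :> R /\ E%:R <= D%:R / c%:R :> R.
  by apply: divn_half_le; rewrite c0.
have HP' : forall (beta : R) (N N' : nat), (A <= N)%N -> (N <= N' <= 2 * A)%N ->
     `|alpha / c%:R| / (6 * E%:R * La) <= `|beta| / N%:R <= 12 * `|alpha / c%:R| / E%:R ->
     normc (\sum_(N.+1 <= n < N'.+1) cis (beta / n%:R)) <= N%:R * delta.
  move=> beta N N' AN /andP[NN' NA] /andP[b1 b2]; apply: HP; first exact: leq_trans AN.
    by rewrite NN' (leq_trans NA) // (leq_trans (_ : 2 * A <= 2 * N)%N) ?leq_mul2l ?AN ?orbT // leq_mul2r orbT.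
  rewrite normrM normfV (gtr0_norm cR) in b1 b2.
  rewrite ler_pdivrMr ?mulr_gt0 // in h1; rewrite ler_pdivlMr // in h2.
  apply/andP; split.
    apply: le_trans b1; rewrite -[leRHS]mulrA -invfM; apply: ler_wpM2l => //.
    rewrite lef_pV2 ?posrE ?mulr_gt0 // (_ : c%:R * _ = 6 * (E%:R * c%:R) * La); last by ring.
    by apply: ler_wpM2r; [exact: ltW | apply: ler_wpM2l].
  apply: (le_trans b2); rewrite -!mulrA mulrCA [leRHS]mulrCA; apply: ler_wpM2l => //.
  rewrite -invfM ler_pdivrMr ?mulr_gt0 // mulrAC ler_pdivlMr //.
  by move: h1; move: (c%:R : R) (E%:R : R) (D%:R : R) => x1 x2 x3 h; lra.
have Hc : 0 <= 3 * s * (D%:R / c%:R) by rewrite !mulr_ge0 ?invr_ge0.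
rewrite -(@ler_pXn2r _ 2) ?nnegrE ?normc_ge0 //.
have EEb : (0 < E <= E')%N by rewrite E0.
have hLaU : 1 <= La <= U%:R by [].
have := @type_II_block R La delta (alpha / c%:R) A U X E E' (@mobius R) (@mobius R) A0 EEb E'3 hLaU delta0 m1 m1 HP'.
rewrite (eq_bigr (fun a => \sum_(U.+1 <= b < X.+1) w a b c)); last first.
  move=> a _; apply: eq_bigr => b _; rewrite /w (div_itv D D' (a * b) c0).
  congr (_ * cis _); rewrite (natrM _ (a * b) c) invfM.
  by move: (_%:R^-1) (_%:R^-1) => x y; ring.
move/le_trans; apply.
apply: (@le_trans _ _ (9 * (D%:R / c%:R) ^+ 2 * s ^+ 2)); last by apply: eq_le_trivial; ring.
apply: ler_pM; last exact: hs.
- by apply: mulr_ge0; [exact: ler0n | exact: exprn_ge0].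
- by rewrite addr_ge0 ?mulr_ge0 // invr_ge0 ltW.
- apply: ler_wpM2l; first exact: ler0n.
  by rewrite lerXn2r ?nnegrE // ?divr_ge0.
Qed.

Lemma mobius_phase_bound (s : R) (I : nat) : (D' <= U * 2 ^ I)%N -> 0 <= s ->
  2 * delta + 3 / La <= s ^+ 2 ->
  normc (\sum_(D.+1 <= d < D'.+1) (mobius R d)%:C * cis (alpha / d%:R))
  <= D%:R * delta * (1 + ln U%:R) ^+ 2 + 3 * s * I%:R * D%:R * (1 + ln D%:R).
Proof.
move=> D'X s0 hs; have := type_I_sum D'X; have := type_II_sum D'X s0 hs.
set X := (U * 2 ^ I)%N; set S2 := \sum_(_ <= _ < _) _; set S1 := \sum_(_ <= _ < _) _ => h2 h1.
have -> : \sum_(D.+1 <= d < D'.+1) (mobius R d)%:C * cis (alpha / d%:R) = S2 - S1.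
  rewrite -sumrB big_nat [RHS]big_nat; apply: eq_bigr => d /andP[Dd dD'].
  rewrite (@vaughan_identity R X U d); last 2 first.
  - by rewrite (leq_ltn_trans _ Dd) // (leq_trans _ D'X).
  - by apply: leq_ltn_trans Dd; apply: leq_trans UD; rewrite expnS leq_pmulr // expn_gt0 ltnW.
  by rewrite rmorphB mulrBl.
apply: le_trans (le_normcD _ _) _; rewrite normcN addrC; exact: lerD.
Qed.

End PhaseSum.

(** Parameters: [U] is about [exp (W / 4)], so [U^3 <= D]; [La = L^B] and [delta = L^(-B)]. The
    square root taken in the bilinear part leaves [L^(-B/2)], and the logarithmic factors cost
    [L^2]; with [B = 2 A + 6] the result is [L^(-A-1)], whose spare [1 / L] absorbs the constants.
    The sum without [mobius] is needed to count the points close to a jump of the sawtooth. *)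
Lemma mobius_phase_sum (R : realType) (A : R) : 0 <= A -> exists L0 : R,
  forall (L alpha : R) (D D' : nat), L0 <= L -> (0 < D)%N -> (D <= D' <= 2 * D)%N ->
  walfisz L <= ln D%:R <= L -> walfisz L <= ln (`|alpha| / D%:R) <= 2 * L ->
  normc (\sum_(D.+1 <= d < D'.+1) (mobius R d)%:C * cis (alpha / d%:R))
    <= D%:R * expR (- (A * ln L)) /\
  normc (\sum_(D.+1 <= d < D'.+1) cis (alpha / d%:R)) <= D%:R * expR (- (A * ln L)).
Proof.
move=> A0; pose B := 2 * A + 6; have B0 : 0 <= B by rewrite /B; lra.
have [L1 HL] := phase_sum_log B0.
pose Y0 := 1000 + 4 * (B + 10).
exists (Num.max L1 (expR Y0)) => L alpha D D'; rewrite ge_max => /andP[hL1 hL] D0 DD'.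
move=> /andP[WD DL] /andP[WF FL].
set y := ln L.
have yY : Y0 <= y by exact: ln_ge_expR.
have y1000 : 1000 <= y by move: yY B0; rewrite /Y0 => *; lra.
have LE : expR y = L by rewrite lnK // posrE (lt_le_trans (expR_gt0 _) hL).
have yL : y <= L by rewrite -LE expR_ge_id.
set W := walfisz L in WD WF.
have W2 : y ^+ 2 <= W by apply: walfisz_ge; move: y1000 yL; clear => *; lra.
have W4 : B * y + 10 <= W / 4.
  apply: (@le_trans _ _ (y ^+ 2 / 4)); last by move: W2; clear => *; lra.
  by apply: quadratic_dominates => //; move: yY y1000 B0; rewrite /Y0 => *; lra.
have yy : 1000 * y <= y ^+ 2 by rewrite expr2; apply: ler_wpM2r => //; move: y1000; clear => *; lra.
have By0 : 0 <= B * y by apply: mulr_ge0 => //; move: y1000; clear => *; lra.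
have DR : 0 < D%:R :> R by rewrite ltr0n.
set P := ln (`|alpha| / D%:R) in WF FL.
have aD : `|alpha| / D%:R = expR P.
  rewrite /P lnK // posrE ltNge; apply/negP => h.
  by move: WF; rewrite /P ln0 //; move: W4 By0; clear => *; lra.
have an0 : alpha != 0.
  apply/negP => /eqP a0; move: aD; rewrite a0 normr0 mul0r => /eqP.
  by rewrite eq_sym gt_eqF // expR_gt0.
set z := expR (W / 4).
have z4 : 4 <= z by have := expR_ge_id (W / 4); rewrite -/z; move: W2 yy y1000; clear => *; lra.
pose U := Num.truncn z.
have /andP[U1 U2] : U%:R <= z < U.+1%:R by apply: truncn_itv; move: z4; clear => *; lra.
have U4 : (1 < U)%N.
  by rewrite -(ltr_nat R); move: U2; rewrite -natr1; move: z4; clear => *; lra.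
have UR : 0 < U%:R :> R by rewrite ltr0n ltnW.
have zU : z / 2 <= U%:R by move: U2; rewrite -natr1; move: z4; clear => *; lra.
have lnU1 : W / 4 - 1 <= ln U%:R.
  have : ln (z / 2) <= ln U%:R by rewrite ler_ln ?posrE //; move: z4; clear => *; lra.
  rewrite ln_div ?posrE //; last by move: z4; clear => *; lra.
  by rewrite /z expRK; have := ln2_le1 R; clear => *; lra.
have DE : D%:R = expR (ln D%:R) :> R by rewrite lnK // posrE.
have UD : (U ^ 3 <= D)%N.
  rewrite -(ler_nat R) natrX; apply: (@le_trans _ _ (z ^+ 3)).
    by rewrite lerXn2r ?nnegrE //; move: z4; clear => *; lra.
  rewrite /z -expRM_natl DE ler_expR; move: WD W4 By0; move: (ln _) (B * y); clear => *; lra.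
have L1' : 1000 <= L by exact: le_trans yL.
have HP : forall (beta : R) (N N' : nat), (U <= N)%N -> (N <= N' <= 4 * N)%N ->
  `|alpha| / (6 * D%:R * expR (B * y)) <= `|beta| / N%:R <= 24 * (`|alpha| / D%:R) ->
  normc (\sum_(N.+1 <= n < N'.+1) cis (beta / n%:R)) <= N%:R * expR (- (B * y)).
  move=> beta N N' UN NN' /andP[b1 b2].
  have N0 : (0 < N)%N by apply: leq_trans UN; exact: ltnW.
  have NR : 0 < N%:R :> R by rewrite ltr0n.
  have b1' : expR (P - 6 - B * y) <= `|beta| / N%:R.
    apply: le_trans b1; rewrite (_ : `|alpha| / _ = expR P / (6 * expR (B * y))); last first.
      by rewrite -aD; field; rewrite !gt_eqF // expR_gt0.
    rewrite ler_pdivlMr ?mulr_gt0 ?expR_gt0 // mulrCA -expRD.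
    apply: mul_expR_le; rewrite subrK; move: (P); clear => *; lra.
  have F0 : 0 < `|beta| / N%:R by exact: lt_le_trans (expR_gt0 _) b1'.
  apply: HL => //.
  - by apply/negP => /eqP b0; move: F0; rewrite b0 normr0 mul0r ltxx.
  - apply: (@le_trans _ _ (ln U%:R)); last by rewrite ler_ln ?posrE // ler_nat.
    by rewrite -/W; move: lnU1 W4 By0; move: (ln _) (B * y); clear => *; lra.
  apply/andP; split.
    apply: (@le_trans _ _ (P - 6 - B * y)); last exact: ln_ge_expR.
    by rewrite -/W; move: WF W4 By0; move: (B * y); clear => *; lra.
  have : ln (`|beta| / N%:R) <= ln (expR (24 + P)).
    rewrite ler_ln ?posrE ?expR_gt0 //; apply: (le_trans b2); rewrite aD.
    exact: mul_expR_le.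
  by rewrite expRK; move: FL L1'; clear => *; lra.
have lnUD : ln U%:R <= L.
  apply: le_trans DL; rewrite ler_ln ?posrE // ler_nat (leq_trans _ UD) //.
  by rewrite expnS leq_pmulr // expn_gt0 ltnW.
have lnU0 : 0 <= ln U%:R :> R := ln_nat_ge0 _ _.
split; last first.
  have NN : (D <= D' <= 4 * D)%N.
    by case/andP: DD' => -> h; rewrite (leq_trans h) // leq_mul2r orbT.
  have UD1 : (U <= D)%N.
    by rewrite (leq_trans _ UD) // expnS leq_pmulr // expn_gt0 ltnW.
  apply: le_trans (HP alpha D D' UD1 NN _) _.
    rewrite aD; apply/andP; split; last first.
      by rewrite -[leLHS]mul1r; apply: ler_wpM2r; [exact: expR_ge0 | clear; lra].
    rewrite -aD; apply: ler_wpM2l => //; rewrite lef_pV2 ?posrE ?mulr_gt0 ?expR_gt0 //.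
    rewrite -[leLHS]mul1r -mulrA [D%:R * _]mulrC mulrA; apply: ler_wpM2r; first exact: ltW.
    by have := expR_ge1Dx (B * y); move: By0; clear => *; lra.
  apply: ler_wpM2l; first exact: ltW.
  rewrite ler_expR lerN2 -/y; apply: ler_wpM2r; first by move: y1000; clear => *; lra.
  by rewrite /B; move: A0; clear => *; lra.
(* Enough dyadic blocks to pass [D' <= 2 exp L]: since [ln 2 >= 1/2], it suffices that
   [I >= 2 L + 4]. *)
pose I := (2 * Num.truncn L + 7)%N.
have /andP[I1 I2] : (Num.truncn L)%:R <= L < (Num.truncn L).+1%:R.
  by apply: truncn_itv; move: L1'; clear => *; lra.
have IR : I%:R = 2 * (Num.truncn L)%:R + 7 :> R by rewrite natrD natrM.
rewrite -natr1 in I2.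
have IL : I%:R <= 3 * L by rewrite IR; move: I1 L1'; clear => *; lra.
have IL2 : 2 * L + 5 <= I%:R by rewrite IR; move: I2; clear => *; lra.
have D'I : (D' <= U * 2 ^ I)%N.
  case/andP: DD' => _ h; apply: leq_trans h _.
  apply: (@leq_trans (2 ^ I)); last by rewrite leq_pmull // ltnW.
  rewrite -(ler_nat R) natrM natrX DE.
  apply: (@le_trans _ _ (expR (2 + L))).
    by apply: mul_expR_le; rewrite lerD2l.
  rewrite -[2 ^+ I](@lnK R) ?posrE ?exprn_gt0 // ler_expR lnXn // -[leRHS]mulr_natl.
  have h2 : I%:R * (1 / 2) <= I%:R * ln 2 :> R by apply: ler_wpM2l; [exact: ler0n | exact: ln2_ge].
  by apply: le_trans h2; move: IL2 L1'; move: (I%:R : R); clear => *; lra.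
have hLa : 1 <= expR (B * y) <= U%:R.
  apply/andP; split; first by rewrite -expR0 ler_expR.
  rewrite -[U%:R]lnK ?posrE // ler_expR.
  by move: lnU1 W4; move: (ln _) (B * y); clear => *; lra.
have s0 : 0 <= 3 * expR (- (B * y / 2)) by rewrite mulr_ge0 ?expR_ge0.
have hs : 2 * expR (- (B * y)) + 3 / expR (B * y) <= (3 * expR (- (B * y / 2))) ^+ 2.
  rewrite -expRN exprMn -expRM_natl (_ : 2 * - (B * y / 2) = - (B * y)); last by field.
  by rewrite (_ : 3 ^+ 2 = 9); [have := expR_ge0 (- (B * y)); clear => *; lra | ring].
apply: le_trans (mobius_phase_bound U4 UD DD' hLa (expR_ge0 _) HP D'I s0 hs) _.
set e := expR (- (B * y / 2)).
have e0 : 0 <= e by exact: expR_ge0.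
have ee : expR (- (B * y)) <= e by rewrite ler_expR; move: By0; move: (B * y); clear => *; lra.
have Lp : 0 <= L by move: L1'; clear => *; lra.
have LL : 0 <= L ^+ 2 by exact: exprn_ge0.
have h1 : (1 + ln U%:R) ^+ 2 <= (2 * L) ^+ 2.
  by rewrite lerXn2r ?nnegrE //; move: lnU0 lnUD L1'; clear => *; lra.
have h2 : D%:R * expR (- (B * y)) * (1 + ln U%:R) ^+ 2 <= D%:R * e * (2 * L) ^+ 2.
  apply: ler_pM => //.
  - by apply: exprn_ge0; move: lnU0; clear => *; lra.
  - by apply: ler_wpM2l; [exact: ltW |].
have h3 : 3 * (3 * e) * I%:R * D%:R * (1 + ln D%:R) <= 3 * (3 * e) * (3 * L) * D%:R * (2 * L).
  have lnD0 : 0 <= ln D%:R :> R := ln_nat_ge0 _ _.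
  apply: ler_pM => //; rewrite ?mulr_ge0 ?(ltW DR) //.
  - by move: lnD0; clear => *; lra.
  - apply: ler_wpM2r; first exact: ltW.
    by apply: ler_wpM2l => //; rewrite !mulr_ge0.
  - by move: DL L1'; clear => *; lra.
apply: (le_trans (lerD h2 h3)).
rewrite (_ : _ + _ = D%:R * (58 * (e * L ^+ 2))); last by ring.
apply: ler_wpM2l; first exact: ltW.
have -> : e * L ^+ 2 = expR (- (B * y / 2) + 2 * y).
  by rewrite expRD -/e expRM_natl LE.
apply: mul_expR_le; rewrite -/y /B (_ : - ((2 * A + 6) * y / 2) + 2 * y = - (A * y) - y); last by field.
by move: y1000; move: (A * y); clear => *; lra.
Qed.

(** * Fejer approximation of the sawtooth *)

(** The Fejer kernel, written as a square so that its positivity is visible. *)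
Definition fejer (R : realType) (N : nat) (u : R) : R :=
  normc (\sum_(a < N) cis (a%:R * u)) ^+ 2 / N%:R.

(** The fractional part minus [1/2]; the arguments are nonnegative throughout, where the truncation
    is the floor. *)
Definition sawtooth (R : realType) (t : R) : R := t - (Num.truncn t)%:R - 1 / 2.

(* The midpoints [(2 j + 1) / (2 Q)] make the sawtooth have zero mean over the grid. *)
Definition midpoint (R : realType) (Q j : nat) : R := (2 * j%:R + 1) / (2 * Q%:R).

Lemma fejer_ge0 (R : realType) (N : nat) (u : R) : 0 <= fejer N u.
Proof. by rewrite /fejer divr_ge0 // exprn_ge0 // normc_ge0. Qed.

Lemma fejer_expand (R : realType) (N : nat) (u : R) : (0 < N)%N ->
  (N%:R * fejer N u)%:C = \sum_(a < N) \sum_(b < N) cis ((a%:R - b%:R) * u).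
Proof.
move=> N0; have NR : N%:R != 0 :> R by rewrite pnatr_eq0 -lt0n.
rewrite /fejer mulrC divfK // normc_sq rmorph_sum mulr_suml; apply: eq_bigr => a _.
rewrite mulr_sumr; apply: eq_bigr => b _.
by rewrite mulrBl cisD cisN.
Qed.

Lemma sum_fejer_expand (R : realType) (I : Type) (r : seq I) (N : nat) (u : I -> R) : (0 < N)%N ->
  (N%:R * \sum_(i <- r) fejer N (u i))%:C
  = \sum_(a < N) \sum_(b < N) \sum_(i <- r) cis ((a%:R - b%:R) * u i).
Proof.
move=> N0; rewrite mulr_sumr rmorph_sum.
rewrite (eq_bigr (fun i => \sum_(a < N) \sum_(b < N) cis ((a%:R - b%:R) * u i))); last first.
  by move=> i _; exact: fejer_expand.
by rewrite exchange_big /=; apply: eq_bigr => a _; rewrite exchange_big.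
Qed.

Lemma fejer_int (R : realType) (N m : nat) (u : R) : fejer N (m%:R + u) = fejer N u.
Proof.
rewrite /fejer; congr (normc _ ^+ 2 / _); apply: eq_bigr => a _.
by rewrite mulrDr cisD -natrM cis_nat mul1r.
Qed.

Lemma midpoint_orthogonality (R : realType) (Q a b : nat) : (a < Q)%N -> (b < Q)%N ->
  \sum_(j < Q) cis ((a%:R - b%:R) * midpoint R Q j) = (Q * (a == b))%:R.
Proof.
move=> aQ bQ; have QR : Q%:R != 0 :> R by rewrite pnatr_eq0 -lt0n (leq_ltn_trans _ aQ).
transitivity (cis ((a%:R - b%:R) / (2 * Q%:R) : R) * (Q * (a == b))%:R).
  rewrite -(cis_orthogonality R aQ bQ) mulr_sumr; apply: eq_bigr => j _.
  by rewrite -cisD; congr cis; rewrite /midpoint; field.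
by have [->|_] := eqVneq a b; rewrite ?subrr ?mul0r ?cis0 ?mul1r // muln0 mulr0.
Qed.

Lemma sum_midpoint (R : realType) (Q : nat) : (0 < Q)%N ->
  \sum_(j < Q) (midpoint R Q j - 1 / 2) = 0.
Proof.
move=> Q0; have QR : Q%:R != 0 :> R by rewrite pnatr_eq0 -lt0n.
have E n : \sum_(j < n) (midpoint R Q j - 1 / 2) = n%:R ^+ 2 / (2 * Q%:R) - n%:R / 2.
  elim: n => [|n IH]; first by rewrite big_ord0; field.
  by rewrite big_ord_recr /= IH -natr1 /midpoint; field.
by rewrite E; field.
Qed.

Lemma midpoint_itv (R : realType) (Q j : nat) : (j < Q)%N -> 0 < midpoint R Q j < 1.
Proof.
move=> jQ; have QR : 0 < Q%:R :> R by rewrite ltr0n (leq_ltn_trans _ jQ).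
have jR : j%:R + 1 <= Q%:R :> R by rewrite natr1 ler_nat.
have j0 : 0 <= j%:R :> R by [].
rewrite /midpoint; apply/andP; split; first by rewrite divr_gt0 ?mulr_gt0 //; lra.
by rewrite ltr_pdivrMr ?mulr_gt0 //; lra.
Qed.

(** The frequencies [a - b] are smaller than [N <= Q] in absolute value, so the grid of [Q] points
    integrates the kernel exactly. *)
Lemma fejer_mean (R : realType) (N Q : nat) (t : R) : (0 < N <= Q)%N ->
  \sum_(j < Q) fejer N (t - midpoint R Q j) = Q%:R.
Proof.
case/andP=> N0 NQ; have NR : N%:R != 0 :> R by rewrite pnatr_eq0 -lt0n.
apply: (mulfI NR); apply: (@complexI R).
rewrite sum_fejer_expand //.
transitivity (\sum_(a < N) Q%:R : R[i]); last first.
  by rewrite sumr_const card_ord -[LHS]mulr_natl -!natrM rmorph_nat.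
apply: eq_bigr => a _; rewrite (bigD1 a) //= [X in _ + X]big1 ?addr0.
  by under eq_bigr do rewrite subrr mul0r cis0; rewrite sumr_const card_ord.
move=> b ba.
under eq_bigr do rewrite mulrBr cisD -mulNr opprB.
rewrite -mulr_sumr midpoint_orthogonality ?(leq_trans _ NQ) //.
by rewrite [_ == _](negPf ba) muln0 mulr0.
Qed.

(** Multiplication by [cis] raises the frequencies to [a + 1 - b], which may equal [N]; this is why
    [N < Q] is strict here. The frequency vanishes for [N - 1] pairs. *)
Lemma fejer_first_moment (R : realType) (N Q : nat) (t : R) : (0 < N < Q)%N ->
  \sum_(j < Q) (N%:R * fejer N (t - midpoint R Q j))%:C * cis (t - midpoint R Q j)
  = (Q * N.-1)%:R.
Proof.
case/andP=> N0 NQ.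
transitivity (\sum_(a < N) \sum_(b < N) \sum_(j < Q)
   cis ((a.+1%:R - b%:R) * t) * cis ((b%:R - a.+1%:R) * midpoint R Q j)).
  under eq_bigr do rewrite fejer_expand // mulr_suml.
  rewrite exchange_big /=; apply: eq_bigr => a _; rewrite [RHS]exchange_big /=.
  apply: eq_bigr => j _; rewrite mulr_suml; apply: eq_bigr => b _.
  by rewrite -!cisD; congr cis; rewrite -natr1; ring.
transitivity (\sum_(a < N) (Q * (a.+1 < N))%:R : R[i]).
  apply: eq_bigr => a _.
  under eq_bigr do rewrite -mulr_sumr midpoint_orthogonality ?(leq_ltn_trans _ NQ) ?(ltnW (ltn_ord _)) ?ltn_ord //.
  have [aN|aN] := ltnP a.+1 N; last first.
    rewrite muln0 big1 // => b _; case: eqP => [bE|_]; last by rewrite muln0 mulr0.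
    by have := ltn_ord b; rewrite bE ltnNge aN.
  rewrite (bigD1 (Ordinal aN)) //= eqxx subrr mul0r cis0 mul1r big1 ?addr0 // => b ba.
  case: eqP => [bE|_]; last by rewrite muln0 mulr0.
  by move/negP: ba; case; apply/eqP/val_inj.
rewrite -natr_sum -big_distrr /=; congr (_ * _)%:R.
case: N N0 NQ => // n _ _; rewrite big_ord_recr /= ltnn addn0.
by rewrite (eq_bigr (fun=> 1%N)) ?sum1_card ?card_ord // => i _; rewrite ltnS ltn_ord.
Qed.

Lemma normc_1Bcis_sq (R : realType) (u : R) :
  normc (1 - cis u) ^+ 2 = 2 * complex.Re (1 - cis u).
Proof.
rewrite /normc /cis /= sqr_sqrtr ?addr_ge0 ?sqr_ge0 // sub0r sqrrN.
have := cos2Dsin2 (2 * pi * u); move: (cos _) (sin _) => c s h.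
by rewrite (_ : s ^+ 2 = 1 - c ^+ 2); [ring | rewrite -h; ring].
Qed.

(** Since [|1 - e(u)|^2 = 2 Re (1 - e(u))], the value is exact and follows from the mean and the
    first moment. It says that the kernel concentrates at distance about [N^(-1/2)] in mean
    square. *)
Lemma fejer_second_moment (R : realType) (N Q : nat) (t : R) : (0 < N < Q)%N ->
  \sum_(j < Q) fejer N (t - midpoint R Q j) * normc (1 - cis (t - midpoint R Q j)) ^+ 2
  = 2 * Q%:R / N%:R.
Proof.
move=> NQ; have /andP[N0 NQ'] := NQ.
have NR : 0 < N%:R :> R by rewrite ltr0n.
have h1 : \sum_(j < Q) (N%:R * fejer N (t - midpoint R Q j))%:C
    * (1 - cis (t - midpoint R Q j)) = (Q%:R : R)%:C.
  under eq_bigr do rewrite mulrBr mulr1.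
  rewrite sumrB fejer_first_moment // -rmorph_sum -mulr_sumr fejer_mean ?N0 ?(ltnW NQ') //.
  rewrite -[(Q * N.-1)%:R](rmorph_nat (real_complex R)) -rmorphB; congr (_%:C).
  by rewrite natrM -subn1 natrB //; ring.
have h2 : \sum_(j < Q) N%:R * fejer N (t - midpoint R Q j)
    * complex.Re (1 - cis (t - midpoint R Q j)) = Q%:R.
  rewrite -[RHS]/(complex.Re (Q%:R)%:C) -h1 raddf_sum; apply: eq_bigr => j _.
  by case: (1 - _) => x y /=; rewrite mul0r subr0.
rewrite -h2 mulr_sumr mulr_suml; apply: eq_bigr => j _; rewrite normc_1Bcis_sq.
move: (fejer _ _) (complex.Re _) => x y.
by field; rewrite gt_eqF.
Qed.

(** For [|u| > 1/2] periodicity replaces [|u|] by [1 - |u|], which is at least [e]. *)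
Lemma normc_1Bcis_ge_eps (R : realType) (u e : R) : 0 <= e <= 1 -> `|u| <= 1 - e ->
  e * `|u| <= normc (1 - cis u).
Proof.
case/andP=> e0 e1 ue.
have [h|h] := leP `|u| (1 / 2).
  apply: le_trans (normc_1Bcis_ge h).
  by rewrite -[leRHS]mul1r; apply: ler_wpM2r.
have u0 : 0 <= `|u| by [].
have E : normc (1 - cis u) = normc (1 - cis (1 - `|u|)).
  rewrite cisD cis1 mul1r cisN.
  have -> : 1 - (cis `|u|)^* = (1 - cis `|u|)^* :> R[i].
    by rewrite rmorphB rmorph1.
  rewrite normc_conj; have [u1|u1] := leP 0 u; first by rewrite ger0_norm.
  by rewrite ltr0_norm // cisN -[LHS]normc_conj; congr normc; rewrite rmorphB rmorph1.
rewrite E; apply: (@le_trans _ _ (1 - `|u|)).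
  apply: (@le_trans _ _ (e * 1)); last by lra.
  by apply: ler_wpM2l => //; lra.
have h' : `|1 - `|u| | <= 1 / 2 by rewrite ger0_norm; lra.
by apply: le_trans (normc_1Bcis_ge h'); exact: ler_norm.
Qed.

(** A discrete convolution of the Fejer kernel with the sawtooth sampled on the grid: a
    trigonometric polynomial in [t] of degree less than [N]. *)
Definition saw_approx (R : realType) (N Q : nat) (t : R) : R :=
  (\sum_(j < Q) (midpoint R Q j - 1 / 2) * fejer N (t - midpoint R Q j)) / Q%:R.

Lemma sawtooth_frac (R : realType) (t : R) : 0 <= t ->
  0 <= t - (Num.truncn t)%:R < 1.
Proof. by move=> /truncn_itv/andP[h1 h2]; rewrite -natr1 in h2; apply/andP; split; lra. Qed.

(* AM-GM: [|1 - cis u| <= M |1 - cis u|^2 / 2 + 1 / (2 M)], then the two Fejer moments. *)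
Lemma saw_approx_good (R : realType) (M : nat) (t e : R) : (0 < M)%N -> 0 <= t -> 0 < e <= 1 ->
  e <= t - (Num.truncn t)%:R <= 1 - e ->
  `|sawtooth t - saw_approx (M ^ 2) (M ^ 2).+1 t| <= 3 / (2 * M%:R * e).
Proof.
move=> M0 t0 /andP[e0 e1] /andP[f1 f2].
set N := (M ^ 2)%N; set Q := N.+1.
have N0 : (0 < N)%N by rewrite expn_gt0 M0.
have NQ : (0 < N < Q)%N by rewrite N0 ltnSn.
have NQ' : (0 < N <= Q)%N by rewrite N0 leqnSn.
have MR : 0 < M%:R :> R by rewrite ltr0n.
have QR : 0 < Q%:R :> R by rewrite ltr0n.
have NR : N%:R = M%:R ^+ 2 :> R by rewrite natrX.
set f := t - _ in f1 f2.
have tE : t = (Num.truncn t)%:R + f by rewrite /f addrC subrK.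
pose s j := midpoint R Q j.
have Fe j : fejer N (t - s j) = fejer N (f - s j) by rewrite {1}tE -addrA fejer_int.
have -> : sawtooth t - saw_approx N Q t
    = (\sum_(j < Q) (f - s j) * fejer N (f - s j)) / Q%:R.
  have -> : sawtooth t = (\sum_(j < Q) (f - 1 / 2) * fejer N (f - s j)) / Q%:R.
    by rewrite -mulr_sumr fejer_mean // mulfK // gt_eqF.
  rewrite /saw_approx -mulrBl -sumrB; congr (_ / _); apply: eq_bigr => j _.
  by rewrite -/(s j) Fe; ring.
pose w j := normc (1 - cis (f - s j)).
have w0 j : 0 <= w j by exact: normc_ge0.
have fw (j : 'I_Q) : `|f - s j| <= w j / e.
  rewrite ler_pdivlMr // mulrC; apply: normc_1Bcis_ge_eps; first by rewrite (ltW e0).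
  have /andP[h1 h2] := @midpoint_itv R Q j (ltn_ord j).
  by rewrite ler_norml; apply/andP; split; rewrite /s; move: h1 h2 f1 f2; clear => *; lra.
have amgm j : w j <= M%:R / 2 * w j ^+ 2 + 1 / (2 * M%:R).
  have -> : M%:R / 2 * w j ^+ 2 + 1 / (2 * M%:R) = w j + (M%:R * w j - 1) ^+ 2 / (2 * M%:R).
    by field; rewrite gt_eqF.
  by rewrite lerDl divr_ge0 ?sqr_ge0 // mulr_ge0.
rewrite normrM [`|_^-1|]gtr0_norm ?invr_gt0 // ler_pdivrMr //.
apply: le_trans (ler_norm_sum _ _ _) _.
apply: (@le_trans _ _ (\sum_(j < Q) (M%:R / (2 * e) * (fejer N (f - s j) * w j ^+ 2)
    + 1 / (2 * M%:R * e) * fejer N (f - s j)))).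
  apply: ler_sum => j _; rewrite normrM [`|fejer _ _|]ger0_norm ?fejer_ge0 //.
  apply: (@le_trans _ _ ((M%:R / 2 * w j ^+ 2 + 1 / (2 * M%:R)) / e * fejer N (f - s j))).
    apply: ler_wpM2r; first exact: fejer_ge0.
    by apply: (le_trans (fw j)); apply: ler_wpM2r; [rewrite invr_ge0 ltW | exact: amgm].
  apply: eq_le_trivial; move: (fejer _ _) => F; field.
  by rewrite !gt_eqF.
rewrite big_split /= -!mulr_sumr fejer_second_moment // fejer_mean // NR.
apply: eq_le_trivial; field; by rewrite !gt_eqF.
Qed.

Lemma saw_approx_le (R : realType) (N Q : nat) (t : R) : (0 < N <= Q)%N ->
  `|saw_approx N Q t| <= 1 / 2.
Proof.
move=> NQ; have QR : 0 < Q%:R :> R.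
  by rewrite ltr0n; case/andP: NQ => h1 h2; exact: leq_trans h2.
rewrite /saw_approx normrM [`|_^-1|]gtr0_norm ?invr_gt0 // ler_pdivrMr //.
rewrite -(fejer_mean t NQ) mulr_sumr; apply: le_trans (ler_norm_sum _ _ _) _.
apply: ler_sum => j _; rewrite normrM [`|fejer _ _|]ger0_norm ?fejer_ge0 //.
apply: ler_wpM2r; first exact: fejer_ge0.
have /andP[h1 h2] := @midpoint_itv R Q j (ltn_ord j).
by rewrite ler_norml; apply/andP; split; lra.
Qed.

Lemma sawtooth_le (R : realType) (t : R) : 0 <= t -> `|sawtooth t| <= 1 / 2.
Proof.
by move=> /sawtooth_frac/andP[h1 h2]; rewrite /sawtooth ler_norml; apply/andP; split; lra.
Qed.

(** The diagonal [a = b] would contribute the sum of the [c d] without any cancellation; it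
    disappears because the sampled sawtooth has zero mean over the midpoints. Only nonzero
    frequencies remain, and these are controlled by [S]. *)
Lemma sum_saw_approx (R : realType) (r : seq nat) (c t : nat -> R) (N Q : nat) (S : R) :
  (0 < N <= Q)%N -> 0 <= S ->
  (forall a b : nat, (a < N)%N -> (b < N)%N -> a != b ->
     normc (\sum_(d <- r) (c d)%:C * cis ((a%:R - b%:R) * t d)) <= S) ->
  `|\sum_(d <- r) c d * saw_approx N Q (t d)| <= N%:R * S / 2.
Proof.
move=> /andP[N0 NQ] S0 HS.
have NR : 0 < N%:R :> R by rewrite ltr0n.
have QR : 0 < Q%:R :> R by rewrite ltr0n (leq_trans N0).
pose s j := midpoint R Q j.
have E : (N%:R * Q%:R * \sum_(d <- r) c d * saw_approx N Q (t d))%:C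
   = \sum_(j < Q) (s j - 1 / 2)%:C * \sum_(a < N) \sum_(b < N | b != a)
       cis ((b%:R - a%:R) * s j) * \sum_(d <- r) (c d)%:C * cis ((a%:R - b%:R) * t d).
  have -> : N%:R * Q%:R * \sum_(d <- r) c d * saw_approx N Q (t d)
     = \sum_(j < Q) (s j - 1 / 2) * \sum_(d <- r) c d * (N%:R * fejer N (t d - s j)).
    rewrite mulr_sumr; under [RHS]eq_bigr do rewrite mulr_sumr.
    rewrite [RHS]exchange_big /=; apply: eq_bigr => d _.
    rewrite /saw_approx (_ : _ * _ = c d * (N%:R * \sum_(j < Q) (s j - 1 / 2) * fejer N (t d - s j))); last first.
      by rewrite -/s; field; rewrite gt_eqF.
    by rewrite !mulr_sumr; apply: eq_bigr => j _; ring.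
  have Z : \sum_(j < Q) (s j - 1 / 2)%:C * \sum_(a < N) \sum_(d <- r) (c d)%:C = 0.
    by rewrite -mulr_suml -rmorph_sum sum_midpoint ?(leq_trans N0) // rmorph0 mul0r.
  rewrite -[RHS]addr0 -[X in _ = _ + X]Z -big_split /= rmorph_sum; apply: eq_bigr => j _.
  rewrite rmorphM -mulrDr; congr (_ * _).
  rewrite -big_split /= rmorph_sum /=.
  transitivity (\sum_(d <- r) \sum_(a < N) \sum_(b < N) (c d)%:C * cis ((a%:R - b%:R) * (t d - s j))).
    apply: eq_bigr => d _; rewrite realcM fejer_expand // mulr_sumr; apply: eq_bigr => a _.
    by rewrite mulr_sumr.
  rewrite exchange_big /=; apply: eq_bigr => a _; rewrite exchange_big /= (bigD1 a) //= addrC.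
  congr (_ + _); last by apply: eq_bigr => d _; rewrite subrr mul0r cis0 mulr1.
  apply: eq_bigr => b _; rewrite mulr_sumr; apply: eq_bigr => d _.
  by rewrite mulrCA -cisD; congr (_ * cis _); ring.
have NQ0 : 0 < N%:R * Q%:R :> R by rewrite mulr_gt0.
rewrite -(ler_pM2l NQ0) -{1}(gtr0_norm NQ0) -normrM -normc_real E.
apply: le_trans (normc_sum _ _ _) _.
apply: (@le_trans _ _ (\sum_(j < Q) 1 / 2 * (N%:R * (N%:R * S)))); last first.
  by rewrite sumr_const card_ord -[leLHS]mulr_natl; apply: eq_le_trivial; field.
apply: ler_sum => j _; rewrite normcM normc_real; apply: ler_pM => //; first exact: normc_ge0.
  have /andP[h1 h2] := @midpoint_itv R Q j (ltn_ord j).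
  by rewrite ler_norml /s; apply/andP; split; lra.
apply: le_trans (normc_sum _ _ _) _.
apply: (@le_trans _ _ (\sum_(a < N) N%:R * S)); last first.
  by rewrite sumr_const card_ord -[leLHS]mulr_natl.
apply: ler_sum => a _; apply: le_trans (normc_sum _ _ _) _.
apply: (@le_trans _ _ (\sum_(b < N) S)); last by rewrite sumr_const card_ord -[leLHS]mulr_natl.
rewrite big_mkcond /=; apply: ler_sum => b _; case: ifP => // ba.
by rewrite normcM normc_cis mul1r HS // eq_sym.
Qed.

(** Makes [4 / n] times the kernel a majorant of the indicator of the points within [1 / (16 n)] of
    an integer. *)
Lemma fejer_near_int (R : realType) (n : nat) (u : R) : (0 < n)%N ->
  16 * n%:R * `|u| <= 1 -> n%:R / 4 <= fejer n u.
Proof.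
move=> n0 hu; have nR : 0 < n%:R :> R by rewrite ltr0n.
have h : n%:R / 2 <= normc (\sum_(a < n) cis (a%:R * u)).
  have h1 : normc (\sum_(a < n) (1 - cis (a%:R * u))) <= n%:R / 2.
    apply: le_trans (normc_sum _ _ _) _.
    apply: (@le_trans _ _ (\sum_(a < n) 1 / 2)); last first.
      by rewrite sumr_const card_ord -[leLHS]mulr_natl; lra.
    apply: ler_sum => a _; rewrite -(cis0 R); apply: le_trans (cis_lipschitz _ _) _.
    rewrite sub0r normrN normrM ger0_norm //.
    have : a%:R * `|u| <= n%:R * `|u| by apply: ler_wpM2r => //; rewrite ler_nat ltnW.
    by lra.
  have E : n%:R%:C = \sum_(a < n) cis (a%:R * u) + \sum_(a < n) (1 - cis (a%:R * u)) :> R[i].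
    rewrite -big_split /= (eq_bigr (fun=> 1)); last by move=> a _; rewrite addrC subrK.
    by rewrite sumr_const card_ord rmorph_nat.
  have := le_normcD (\sum_(a < n) cis (a%:R * u)) (\sum_(a < n) (1 - cis (a%:R * u))).
  rewrite -E normc_real ger0_norm //; lra.
rewrite /fejer ler_pdivlMr //; apply: (@le_trans _ _ ((n%:R / 2) ^+ 2)).
  by apply: eq_le_trivial; field.
by rewrite lerXn2r ?nnegrE ?normc_ge0 // divr_ge0.
Qed.

Lemma sum_fejer_le (R : realType) (r : seq nat) (t : nat -> R) (n : nat) (S : R) : (0 < n)%N ->
  0 <= S ->
  (forall a b : nat, (a < n)%N -> (b < n)%N -> a != b ->
     normc (\sum_(d <- r) cis ((a%:R - b%:R) * t d)) <= S) ->
  \sum_(d <- r) fejer n (t d) <= (size r)%:R + n%:R * S.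
Proof.
move=> n0 S0 HS; have nR : 0 < n%:R :> R by rewrite ltr0n.
rewrite -(ler_pM2l nR); set X := n%:R * \sum_(d <- r) _.
have X0 : 0 <= X by rewrite mulr_ge0 // ?sumr_ge0 // => *; exact: fejer_ge0.
rewrite -(ger0_norm X0) -normc_real.
have -> : X%:C = \sum_(a < n) \sum_(b < n) \sum_(d <- r) cis ((a%:R - b%:R) * t d).
  exact: sum_fejer_expand.
apply: le_trans (normc_sum _ _ _) _.
apply: (@le_trans _ _ (\sum_(a < n) ((size r)%:R + n%:R * S))); last first.
  by rewrite sumr_const card_ord -[leLHS]mulr_natl.
apply: ler_sum => a _; apply: le_trans (normc_sum _ _ _) _.
rewrite (bigD1 a) //=; apply: lerD.
  apply: le_trans (normc_sum _ _ _) _.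
  under eq_bigr do rewrite normc_cis.
  by rewrite big_const_seq count_predT iter_addr addr0.
apply: (@le_trans _ _ (\sum_(b < n) S)); last by rewrite sumr_const card_ord -[leLHS]mulr_natl.
rewrite big_mkcond /=; apply: ler_sum => b _; case: ifP => // ba.
by apply: HS => //; rewrite eq_sym.
Qed.

(** Points within [e = 1 / (16 n)] of an integer are charged to [4 / n] times the kernel of order
    [n], which sums to [4 size / n + 4 S1]. Elsewhere [saw_approx_good] with [M = n^2] has error
    [3 / (2 M e) = 24 / n]. The approximation itself has degree below [n^4], whence the factor of
    [S]. *)
Lemma sawtooth_sum_le (R : realType) (r : seq nat) (c t : nat -> R) (n : nat) (S S1 : R) :
  (0 < n)%N -> 0 <= S -> 0 <= S1 -> (forall d, `|c d| <= 1) -> (forall d, 0 <= t d) ->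
  (forall a b : nat, (a < n ^ 4)%N -> (b < n ^ 4)%N -> a != b ->
     normc (\sum_(d <- r) (c d)%:C * cis ((a%:R - b%:R) * t d)) <= S) ->
  (forall a b : nat, (a < n)%N -> (b < n)%N -> a != b ->
     normc (\sum_(d <- r) cis ((a%:R - b%:R) * t d)) <= S1) ->
  `|\sum_(d <- r) c d * sawtooth (t d)|
  <= n%:R ^+ 4 * S / 2 + 28 * (size r)%:R / n%:R + 4 * S1.
Proof.
move=> n0 S0 S10 c1 t0 HS HS1.
have nR : 0 < n%:R :> R by rewrite ltr0n.
pose M := (n ^ 2)%N; have M0 : (0 < M)%N by rewrite expn_gt0 n0.
have MN : (M ^ 2 = n ^ 4)%N by rewrite -expnM.
pose N := (M ^ 2)%N; pose Q := N.+1.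
have N0 : (0 < N)%N by rewrite expn_gt0 M0.
have NQ : (0 < N <= Q)%N by rewrite N0 leqnSn.
pose e : R := 1 / (16 * n%:R).
have n1 : 1 <= n%:R :> R by rewrite ler1n.
have e0 : 0 < e by rewrite divr_gt0 // mulr_gt0.
have e1 : 0 < e <= 1 by rewrite e0 /e ler_pdivrMr ?mulr_gt0 //; lra.
have main : `|\sum_(d <- r) c d * saw_approx N Q (t d)| <= n%:R ^+ 4 * S / 2.
  have := @sum_saw_approx R r c t N Q S NQ S0; rewrite {1 2}/N MN => /(_ HS) h.
  by apply: (le_trans h); rewrite /N MN natrX.
have pw d : `|sawtooth (t d) - saw_approx N Q (t d)| <= 24 / n%:R + 4 / n%:R * fejer n (t d).
  have F0 := fejer_ge0 n (t d).
  have Fn0 : 0 <= 4 / n%:R * fejer n (t d) by rewrite mulr_ge0 // divr_ge0.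
  have [/andP[f0 f1]] := sawtooth_frac (t0 d); set f := _ - _ in f0 f1.
  have tE : t d = (Num.truncn (t d))%:R + f by rewrite /f addrC subrK.
  have bad : n%:R / 4 <= fejer n (t d) ->
      `|sawtooth (t d) - saw_approx N Q (t d)| <= 24 / n%:R + 4 / n%:R * fejer n (t d).
    move=> h; apply: (@le_trans _ _ 1).
      apply: le_trans (ler_normB _ _) _.
      by have := sawtooth_le (t0 d); have := saw_approx_le (t d) NQ; lra.
    apply: (@le_trans _ _ (4 / n%:R * (n%:R / 4))); first by apply: eq_le_trivial; field; rewrite gt_eqF.
    apply: (@le_trans _ _ (4 / n%:R * fejer n (t d))); last by rewrite lerDr divr_ge0.
    by apply: ler_wpM2l => //; rewrite divr_ge0.
  have ne : 16 * n%:R * e = 1 by rewrite /e; field; rewrite gt_eqF.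
  have n160 : 0 < 16 * n%:R :> R by rewrite mulr_gt0.
  have [fe|fe] := ltP f e.
    apply: bad; rewrite tE fejer_int; apply: fejer_near_int => //.
    by rewrite ger0_norm // -[leRHS]ne ler_pM2l // ltW.
  have [fe'|fe'] := ltP (1 - e) f.
    apply: bad; have -> : fejer n (t d) = fejer n (f - 1).
      rewrite {1}tE fejer_int -(fejer_int n 1 (f - 1)); congr fejer.
      by rewrite addrC subrK.
    apply: fejer_near_int => //.
    rewrite distrC ger0_norm; last by move: f1; clear => *; lra.
    by rewrite -[leRHS]ne ler_pM2l //; move: fe'; clear => *; lra.
  apply: (@le_trans _ _ (24 / n%:R)); last by rewrite lerDl.
  apply: (@le_trans _ _ (3 / (2 * M%:R * e))).
    by apply: saw_approx_good => //; rewrite fe fe'.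
  apply: eq_le_trivial; rewrite /M /e natrX; field; by rewrite gt_eqF.
have -> : \sum_(d <- r) c d * sawtooth (t d) = \sum_(d <- r) c d * saw_approx N Q (t d)
    + \sum_(d <- r) c d * (sawtooth (t d) - saw_approx N Q (t d)).
  by rewrite -big_split /=; apply: eq_bigr => d _; ring.
apply: le_trans (ler_normD _ _) _; rewrite -addrA; apply: lerD => //.
apply: le_trans (ler_norm_sum _ _ _) _.
apply: (@le_trans _ _ (\sum_(d <- r) (24 / n%:R + 4 / n%:R * fejer n (t d)))).
  apply: ler_sum => d _; rewrite normrM; apply: le_trans (pw d).
  by rewrite -[leRHS]mul1r; apply: ler_wpM2r.
rewrite big_split /= big_const_seq count_predT iter_addr addr0 -[X in X + _]mulr_natl.
rewrite -[X in _ + X]mulr_sumr.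
have h := sum_fejer_le n0 S10 HS1.
have : 4 / n%:R * \sum_(d <- r) fejer n (t d) <= 4 / n%:R * ((size r)%:R + n%:R * S1).
  by apply: ler_wpM2l => //; rewrite divr_ge0.
rewrite (_ : 4 / n%:R * ((size r)%:R + n%:R * S1) = 4 * ((size r)%:R / n%:R) + 4 * S1); last first.
  by field; rewrite gt_eqF.
rewrite (_ : (size r)%:R * (24 / n%:R) = 24 * ((size r)%:R / n%:R)); last by field; rewrite gt_eqF.
by rewrite -[28 * _ / _]mulrA; move: ((size r)%:R / n%:R) => *; lra.
Qed.

Lemma abel_sum_le (R : realType) (w c : nat -> R) (m n : nat) (P : R) : (m <= n)%N ->
  (forall d, (m <= d)%N -> w d.+1 <= w d) -> (forall d, (m <= d)%N -> 0 <= w d) ->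
  (forall k, (m <= k <= n)%N -> `|\sum_(m <= d < k) c d| <= P) ->
  `|\sum_(m <= d < n) w d * c d| <= P * w m.
Proof.
move=> mn wd w0 HP.
have H k : (m <= k <= n)%N ->
   `|\sum_(m <= d < k) w d * c d - w k * \sum_(m <= d < k) c d| <= P * (w m - w k).
  elim: k => [|k IH] /andP[mk kn].
    have -> : m = 0%N by apply/eqP; rewrite -leqn0.
    by rewrite !big_geq // mulr0 subrr normr0 subrr mulr0.
  move: (mk); rewrite leq_eqVlt => /orP[/eqP mE|]; first by rewrite -mE !big_geq // mulr0 subrr normr0 subrr mulr0.
  rewrite ltnS => mk'.
  have hS := HP k.+1 (introT andP (conj mk kn)).
  rewrite big_nat_recr //=; set S := \sum_(m <= d < k.+1) c d in hS *.
  have SE : S = \sum_(m <= d < k) c d + c k by rewrite /S big_nat_recr.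
  have /IH : (m <= k <= n)%N by rewrite mk' ltnW.
  have -> : \sum_(m <= d < k) w d * c d + w k * c k - w k.+1 * S
     = (\sum_(m <= d < k) w d * c d - w k * \sum_(m <= d < k) c d) + (w k - w k.+1) * S.
    by rewrite SE; ring.
  set A := _ - w k * _ => hA; apply: le_trans (ler_normD _ _) _.
  have wk : 0 <= w k - w k.+1 by rewrite subr_ge0 wd.
  have : `|(w k - w k.+1) * S| <= (w k - w k.+1) * P.
    by rewrite normrM (ger0_norm wk); apply: ler_wpM2l.
  by lra.
have hn : (m <= n <= n)%N by rewrite mn leqnn.
have h1 := H n hn; have h2 := HP n hn; have wn := w0 n mn.
have h3 : `|w n * \sum_(m <= d < n) c d| <= w n * P.
  by rewrite normrM (ger0_norm wn); apply: ler_wpM2l.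
set A := \sum_(m <= d < n) w d * c d in h1 *; set B := w n * _ in h1 h3.
have : `|A| <= `|A - B| + `|B| by rewrite -{1}(subrK B A); exact: ler_normD.
by lra.
Qed.

Lemma expR_ge_sq (R : realType) (y : R) : 0 <= y -> y ^+ 2 / 4 <= expR y.
Proof.
move=> y0; have -> : expR y = expR (y / 2) ^+ 2 by rewrite -expRM_natl; congr expR; field.
have -> : y ^+ 2 / 4 = (y / 2) ^+ 2 by field.
by rewrite lerXn2r ?nnegrE ?divr_ge0 ?expR_ge0 // expR_ge_id.
Qed.

Lemma walfisz_le (R : realType) (L : R) : 0 < L -> 1000 <= ln L -> walfisz L <= L / 4.
Proof.
move=> L0; set y := ln L => y1.
have LE : L = expR y by rewrite /y lnK.
have h : 64 * y ^+ 4 <= L.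
  rewrite LE (_ : expR y = expR (y / 8) ^+ 8); last by rewrite -expRM_natl; congr expR; field.
  apply: (@le_trans _ _ ((y / 8) ^+ 8)); last first.
    by rewrite lerXn2r ?nnegrE ?expR_ge0 ?expR_ge_id //; move: y1; clear => *; lra.
  apply: (@le_trans _ _ ((3 * y) ^+ 4)).
    rewrite exprMn; apply: ler_wpM2r; last by rewrite -natrX ler_nat.
    by apply: exprn_ge0; move: y1; clear => *; lra.
  rewrite (_ : (y / 8) ^+ 8 = ((y / 8) ^+ 2) ^+ 4); last by rewrite -exprM.
  have y0 : 0 <= 3 * y by move: y1; clear => *; lra.
  rewrite lerXn2r ?nnegrE ?sqr_ge0 //.
  have : 1000 * y <= y * y by apply: ler_wpM2r => //; move: y1; clear => *; lra.
  rewrite (_ : (y / 8) ^+ 2 = y * y / 64); last by field.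
  by move: (y * y) y1; clear => *; lra.
rewrite -(@ler_pXn2r _ 3) ?nnegrE ?walfisz_ge0 ?divr_ge0 ?(ltW L0) //.
rewrite walfisz_cube ?(ltW L0) // -/y; last by move: y1; clear => *; lra.
rewrite (_ : (L / 4) ^+ 3 = L ^+ 2 * (L / 64)); last by field.
apply: ler_wpM2l; first by rewrite exprn_ge0 // ltW.
by move: h; move: (y ^+ 4); clear => *; lra.
Qed.

(** [n] is about [L = ln x], so the frequencies [h] stay below [n^4] and [h x] keeps the phase
    within [mobius_phase_sum]. The saving [L^(-5)] there compensates the factor [n^4] and leaves
    [1 / L]; the three terms contribute [8 + 28 + 4]. *)
Lemma sawtooth_block (R : realType) : exists L0 : R, forall (x : R) (D D' : nat),
  0 < x -> L0 <= ln x -> (0 < D)%N -> (D <= D' <= 2 * D)%N ->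
  walfisz (ln x) <= ln D%:R -> ln D%:R + walfisz (ln x) <= ln x ->
  `|\sum_(D.+1 <= d < D'.+1) mobius R d * sawtooth (x / d%:R)| <= 40 * (D%:R / ln x).
Proof.
have [L1 H] := @mobius_phase_sum R 5 (ler0n _ _).
exists (Num.max L1 (expR 1000)) => x D D' x0; rewrite ge_max => /andP[hL1 hL] D0 DD' WD Dx.
set L := ln x in hL1 hL WD Dx *.
set y := ln L; have y1 : 1000 <= y by exact: ln_ge_expR.
have L0 : 0 < L by exact: lt_le_trans (expR_gt0 _) hL.
have LE : L = expR y by rewrite /y lnK.
have yL : y <= L by rewrite LE expR_ge_id.
have W0 : 0 <= walfisz L by exact: walfisz_ge0.
have DR : 0 < D%:R :> R by rewrite ltr0n.
pose n := (Num.truncn L).+1.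
have /andP[n1 n2] : (Num.truncn L)%:R <= L < n%:R by apply: truncn_itv; exact: ltW.
have nR : 0 < n%:R :> R by rewrite ltr0n.
have n2L : n%:R <= 2 * L by rewrite /n -[_.+1%:R]natr1; move: n1 y1 yL; clear => *; lra.
have L5 : expR (- (5 * y)) = (L ^+ 5)^-1 by rewrite expRN expRM_natl -LE.
have Hh : forall h : R, 1 <= `|h| <= n%:R ^+ 4 -> forall d : nat,
   normc (\sum_(D.+1 <= d < D'.+1) (mobius R d)%:C * cis (h * (x / d%:R))) <= D%:R / L ^+ 5 /\
   normc (\sum_(D.+1 <= d < D'.+1) cis (h * (x / d%:R))) <= D%:R / L ^+ 5.
  move=> h /andP[h1 h2] _.
  have h0 : 0 < `|h| by apply: lt_le_trans h1.
  have e d : h * (x / d%:R) = (h * x) / d%:R by rewrite mulrA.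
  rewrite -L5; under eq_bigr do rewrite e; under [X in _ /\ normc X <= _]eq_bigr do rewrite e.
  have lnE : ln (`|h * x| / D%:R) = ln `|h| + L - ln D%:R.
    by rewrite normrM (gtr0_norm x0) ln_div ?posrE ?mulr_gt0 // lnM ?posrE.
  have lh0 : 0 <= ln `|h| by rewrite ln_ge0.
  have lh1 : ln `|h| <= L.
    apply: (@le_trans _ _ (ln (expR (4 * (1 + y))))).
      rewrite ler_ln ?posrE ?expR_gt0 //; apply: (le_trans h2); rewrite expRM_natl.
      rewrite lerXn2r ?nnegrE ?expR_ge0 //; apply: (le_trans n2L); rewrite expRD -LE.
      by apply: ler_wpM2r; [exact: ltW | have := expR_ge1Dx (1 : R); clear => *; lra].
    rewrite expRK LE; apply: (@le_trans _ _ (y ^+ 2 / 4)); last by apply: expR_ge_sq; move: y1; clear => *; lra.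
    have : 1000 * y <= y * y by apply: ler_wpM2r => //; move: y1; clear => *; lra.
    by rewrite expr2; move: (y * y) y1; clear => *; lra.
  have lD0 : 0 <= ln D%:R :> R := ln_nat_ge0 _ _.
  apply: (H L (h * x) D D') => //; rewrite ?lnE.
    by apply/andP; split => //; move: Dx W0; clear => *; lra.
  by apply/andP; split; move: Dx lh0 lh1 lD0; clear => *; lra.
have diff m (a b : nat) : (a < m)%N -> (b < m)%N -> a != b -> 1 <= `|a%:R - b%:R : R| <= m%:R.
  wlog ab : a b / (b < a)%N => [hw am bm ab|].
    have [h|h|h] := ltngtP b a; [exact: hw | by rewrite distrC; apply: hw => //; rewrite eq_sym | by rewrite h eqxx in ab].
  move=> am bm _; rewrite ger0_norm ?subr_ge0 ?ler_nat ?(ltnW ab) // -natrB ?(ltnW ab) //.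
  by rewrite ler1n subn_gt0 ab ler_nat (leq_trans (leq_subr _ _)) // ltnW.
have S0 : 0 <= D%:R / L ^+ 5 by rewrite divr_ge0 // exprn_ge0 // ltW.
have n0 : (0 < n)%N by [].
have t0 d : 0 <= x / d%:R by rewrite divr_ge0 // ltW.
have := @sawtooth_sum_le R (index_iota D.+1 D'.+1) (@mobius R) (fun d => x / d%:R) n _ _ n0 S0 S0
  (norm_mobius_le1 R) t0.
have K1 : forall a b : nat, (a < n ^ 4)%N -> (b < n ^ 4)%N -> a != b ->
     normc (\sum_(D.+1 <= d < D'.+1) (mobius R d)%:C * cis ((a%:R - b%:R) * (x / d%:R))) <= D%:R / L ^+ 5.
  by move=> a b an bn ab; have := diff _ _ _ an bn ab; rewrite natrX => /Hh/(_ 0%N)[].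
have K2 : forall a b : nat, (a < n)%N -> (b < n)%N -> a != b ->
     normc (\sum_(D.+1 <= d < D'.+1) cis ((a%:R - b%:R) * (x / d%:R))) <= D%:R / L ^+ 5.
  move=> a b an bn ab; have /andP[h1 h2] := diff _ _ _ an bn ab.
  have h3 : `|a%:R - b%:R : R| <= n%:R ^+ 4.
    by apply: (le_trans h2); rewrite -{1}[n%:R]expr1 ler_weXn2l // ler1n.
  by have [] := Hh _ (introT andP (conj h1 h3)) 0%N.
move=> /(_ K1 K2) /le_trans; apply.
have sz : (size (index_iota D.+1 D'.+1))%:R <= D%:R :> R.
  by rewrite size_iota ler_nat subSS; case/andP: DD'; clear; lia.
have i1 : n%:R ^+ 4 * (D%:R / L ^+ 5) / 2 <= 8 * (D%:R / L).
  have : n%:R ^+ 4 * (D%:R / L ^+ 5) <= (2 * L) ^+ 4 * (D%:R / L ^+ 5).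
    apply: ler_wpM2r => //; rewrite lerXn2r ?nnegrE ?mulr_ge0 //; exact: ltW.
  rewrite (_ : (2 * L) ^+ 4 * (D%:R / L ^+ 5) = 16 * (D%:R / L)); last by field; rewrite gt_eqF.
  by move: (n%:R ^+ 4 * _) (D%:R / L); clear => *; lra.
have i2 : 28 * (size (index_iota D.+1 D'.+1))%:R / n%:R <= 28 * (D%:R / L).
  rewrite -mulrA; apply: ler_wpM2l; first exact: ler0n.
  by apply: ler_pM => //; rewrite ?invr_ge0 // lef_pV2 ?posrE // ltW.
have i3 : 4 * (D%:R / L ^+ 5) <= 4 * (D%:R / L).
  apply: ler_wpM2l; first exact: ler0n.
  apply: ler_wpM2l; first exact: ltW.
  rewrite lef_pV2 ?posrE ?exprn_gt0 // -{1}[L]expr1 ler_weXn2l //.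
  by move: y1 yL; clear => *; lra.
by move: i1 i2 i3; clear => *; lra.
Qed.

(** With [T = exp W], the ranges [d <= d0 ~ T] and [d >= x / T] are harmonic sums worth about
    [W / 2] each. Between them lie at most [3 L] dyadic blocks, each at most [40 / L] by Abel
    summation from [sawtooth_block], hence at most 120 in all. *)
Theorem walfisz_sum (R : realType) : exists L0 : R, forall x : R, 0 < x -> L0 <= ln x ->
  `|\sum_(1 <= d < (Num.truncn x).+1) mobius R d / d%:R * sawtooth (x / d%:R)|
  <= 122 * walfisz (ln x).
Proof.
have [L1 H] := sawtooth_block R.
exists (Num.max L1 (expR 1000)) => x x0; rewrite ge_max => /andP[hL1 hL].
set L := ln x in hL1 hL *.
set y := ln L; have y1 : 1000 <= y by exact: ln_ge_expR.
have L0 : 0 < L by exact: lt_le_trans (expR_gt0 _) hL.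
have LE : L = expR y by rewrite /y lnK.
have yL : y <= L by rewrite LE expR_ge_id.
have L1000 : 1000 <= L by exact: le_trans yL.
set W := walfisz L.
have WL : W <= L / 4 by exact: walfisz_le.
have W1 : 1000 <= W.
  apply: (@le_trans _ _ (y ^+ 2)); last by apply: walfisz_ge; move: L1000; clear => *; lra.
  apply: (le_trans y1); rewrite expr2 -{1}[y]mulr1; apply: ler_wpM2l; move: y1; clear => *; lra.
set T := expR W.
have T2 : 1 <= T by have := expR_ge1Dx W; rewrite -/T; move: W1; clear => *; lra.
have xE : x = expR L by rewrite /L lnK.
have TTx : 2 * T * T <= x.
  rewrite xE -mulrA -expRD; apply: mul_expR_le; move: WL L1000; clear => *; lra.
pose d0 := (Num.truncn T).+1.
have /andP[t1 t2] : (Num.truncn T)%:R <= T < d0%:R by apply: truncn_itv; move: T2; clear => *; lra.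
have d02 : d0%:R <= 2 * T by rewrite /d0 -[_.+1%:R]natr1; move: t1 T2; clear => *; lra.
have d0R : 0 < d0%:R :> R by rewrite ltr0n.
pose X := Num.truncn x.
have /andP[X1 X2] : X%:R <= x < X.+1%:R by apply: truncn_itv; exact: ltW.
(* The least such [I] makes every block start at some [D] with [D T <= x], while the last block ends
   beyond [x / T]. *)
have ex : exists I : nat, x < (d0 * 2 ^ I)%:R * T.
  exists X.+1; apply: (lt_le_trans X2); rewrite -[leLHS]mulr1; apply: ler_pM => //.
  by rewrite ler_nat (leq_trans (ltnW (ltn_expl _ (ltnSn 1)))) // leq_pmull.
case: (ex_minnP ex) => I hI Imin.
have Dle i : (i < I)%N -> (d0 * 2 ^ i)%:R * T <= x.
  by move=> iI; rewrite leNgt; apply/negP => /Imin; rewrite leqNgt iI.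
have IX : (d0 * 2 ^ I <= X)%N.
  rewrite truncn_ge_nat ?(ltW x0) //; case: I {hI Imin} Dle => [|I] Dle.
    rewrite expn0 muln1; apply: (le_trans d02); apply: le_trans TTx.
    by rewrite -[leLHS]mulr1; apply: ler_wpM2l => //; move: T2; clear => *; lra.
  have h := Dle I (ltnSn _); rewrite expnS mulnCA natrM.
  apply: le_trans h; rewrite mulrC; apply: ler_wpM2l => //.
  by have := expR_ge1Dx W; rewrite -/T; move: W1; clear => *; lra.
have IL : I%:R <= 3 * L.
  case: I {hI Imin IX} Dle => [|I] Dle; first by move: L1000; clear => *; lra.
  have h : (2 ^ I)%:R <= x.
    apply: le_trans (Dle I (ltnSn _)); rewrite natrM -[leLHS]mulr1; apply: ler_pM => //.
    by rewrite ler_peMl // ler1n.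
  have h1 : I%:R * ln 2 <= L.
    by rewrite -ln_natX // ler_ln ?posrE // ltr0n expn_gt0.
  have h2 : I%:R * (1 / 2) <= I%:R * ln 2 :> R by apply: ler_wpM2l; [exact: ler0n | exact: ln2_ge].
  by rewrite -[_.+1%:R]natr1; move: h1 h2 L1000; move: (ln 2) => a; clear => *; lra.
pose f d := mobius R d / d%:R * sawtooth (x / d%:R).
have fle d : `|f d| <= 1 / 2 * (d%:R)^-1.
  rewrite /f !normrM normfV [`|d%:R|]ger0_norm // mulrC; apply: ler_pM => //.
    by apply: sawtooth_le; rewrite divr_ge0 // ltW.
  by rewrite -[leRHS]mul1r; apply: ler_wpM2r; rewrite ?invr_ge0 // norm_mobius_le1.
rewrite (@big_cat_nat _ _ _ d0.+1) //=; last first.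
  by rewrite ltnS (leq_trans _ IX) // leq_pmulr // expn_gt0.
rewrite (@big_cat_nat _ _ _ (d0 * 2 ^ I).+1 d0.+1) //=; last by rewrite ltnS leq_pmulr // expn_gt0.
apply: le_trans (ler_normD _ _) _.
have p1 : `|\sum_(1 <= d < d0.+1) f d| <= 1 + W / 2.
  apply: le_trans (ler_norm_sum _ _ _) _.
  apply: (@le_trans _ _ (\sum_(1 <= d < d0.+1) 1 / 2 * (d%:R)^-1)); first by apply: ler_sum.
  rewrite -mulr_sumr; have h := @harmonic_le1 R d0 (ltn0Sn _).
  have lnd : ln d0%:R <= 1 + W.
    apply: (@le_trans _ _ (ln (2 * T))); first by rewrite ler_ln ?posrE // mulr_gt0 // expR_gt0.
    by rewrite lnM ?posrE ?expR_gt0 // /T expRK lerD2r ln2_le1.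
  by move: h lnd; move: (\sum_(_ <= _ < _) _) (ln d0%:R); clear => *; lra.
have p3 : `|\sum_((d0 * 2 ^ I).+1 <= d < X.+1) f d| <= W / 2.
  apply: le_trans (ler_norm_sum _ _ _) _.
  apply: (@le_trans _ _ (\sum_((d0 * 2 ^ I).+1 <= d < X.+1) 1 / 2 * (d%:R)^-1)); first by apply: ler_sum.
  have dI0 : (0 < d0 * 2 ^ I)%N by rewrite muln_gt0 expn_gt0.
  rewrite -mulr_sumr; have h := @harmonic_le R _ _ dI0 IX.
  have lX : ln X%:R <= L by rewrite ler_ln ?posrE // ltr0n (leq_trans dI0).
  have lI : L - W <= ln (d0 * 2 ^ I)%:R.
    have : ln x <= ln ((d0 * 2 ^ I)%:R * T) by rewrite ler_ln ?posrE ?mulr_gt0 ?ltr0n ?expR_gt0 // ltW.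
    by rewrite lnM ?posrE ?ltr0n ?expR_gt0 // /T expRK -/L; clear => *; lra.
  by move: h lX lI; move: (\sum_(_ <= _ < _) _) (ln X%:R) (ln (d0 * 2 ^ I)%:R); clear => *; lra.
have p2 : `|\sum_(d0.+1 <= d < (d0 * 2 ^ I).+1) f d| <= 120.
  rewrite sum_dyadic; apply: le_trans (ler_norm_sum _ _ _) _.
  apply: (@le_trans _ _ (\sum_(i < I) 40 / L)); last first.
    rewrite sumr_const card_ord -[leLHS]mulr_natl mulrA ler_pdivrMr //.
    by move: IL; clear => *; lra.
  apply: ler_sum => i _; set D := (d0 * 2 ^ i)%N.
  have D0 : (0 < D)%N by rewrite muln_gt0 expn_gt0.
  have DR : 0 < D%:R :> R by rewrite ltr0n.
  have hD := Dle i (ltn_ord i); rewrite -/D in hD.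
  have WD : W <= ln D%:R.
    apply: ln_ge_expR; rewrite -/T; apply: (le_trans (ltW t2)).
    by rewrite ler_nat leq_pmulr // expn_gt0.
  have Dx : ln D%:R + W <= L.
    have : ln (D%:R * T) <= ln x by rewrite ler_ln ?posrE ?mulr_gt0 ?expR_gt0.
    by rewrite lnM ?posrE ?expR_gt0 // /T expRK.
  have PS k : (D.+1 <= k <= (2 * D).+1)%N ->
     `|\sum_(D.+1 <= d < k) mobius R d * sawtooth (x / d%:R)| <= 40 * (D%:R / L).
    case: k => // k /andP[k1 k2]; apply: H => //.
    by rewrite -ltnS k1 -ltnS.
  have fE d : f d = (d%:R)^-1 * (mobius R d * sawtooth (x / d%:R)).
    by rewrite /f [_ / _]mulrC mulrA.
  rewrite (eq_bigr _ (fun d _ => fE d)).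
  apply: le_trans (@abel_sum_le R (fun d => (d%:R)^-1) _ D.+1 (2 * D).+1 (40 * (D%:R / L)) _ _ _ PS) _.
  - by rewrite ltnS leq_pmull.
  - by move=> d Dd; rewrite lef_pV2 ?posrE ?ltr0n ?ler_nat // (leq_ltn_trans _ Dd).
  - by move=> d _; rewrite invr_ge0.
  rewrite -mulrA; apply: ler_wpM2l; first exact: ler0n.
  rewrite mulrAC -[leRHS]mul1r; apply: ler_wpM2r; first by rewrite invr_ge0 ltW.
  by rewrite ler_pdivrMr ?ltr0n // mul1r ler_nat.
apply: (@le_trans _ _ (1 + W / 2 + (120 + W / 2))); last by move: W1; clear => *; lra.
by apply: lerD => //; apply: le_trans (ler_normD _ _) _; exact: lerD.
Qed.

(** * The constant 6 / pi^2 *)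

Lemma sin_ge_id_cos (R : realType) (x : R) : 0 < x <= pi -> x * cos x <= sin x.
Proof.
case/andP=> x0 xp; have [] := @MVT R (@sin R) (@cos R) 0 x x0.
- by apply: continuous_subspaceT => z; exact: continuous_sin.
move=> c; rewrite in_itv /= => /andP[c0 cx]; rewrite sin0 !subr0 => ->.
rewrite mulrC; apply: ler_wpM2r; first exact: ltW.
by rewrite ltW // ltr_cos // in_itv /= ?(ltW c0) ?(ltW x0) ?xp // (le_trans (ltW cx)).
Qed.

(** The classical squeeze of [1 / x^2] between [cot^2 x] and [1 / sin^2 x], which differ by 1. *)
Lemma inv_sin_sq_bounds (R : realType) (x : R) : 0 < x <= pi / 2 ->
  (x ^+ 2)^-1 <= (sin x ^+ 2)^-1 <= (x ^+ 2)^-1 + 1.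
Proof.
case/andP=> x0 xp; have p0 := pi_gt0 R.
have s0 : 0 < sin x.
  by apply: sin_gt0_pi; rewrite x0; move: xp p0; clear => *; lra.
have sx : sin x <= x by apply: sin_le_id; exact: ltW.
have c0 : 0 <= cos x.
  by apply: cos_ge0_pihalf; apply/andP; split => //; move: x0 p0; clear => *; lra.
have xc : x * cos x <= sin x.
  by apply: sin_ge_id_cos; rewrite x0; move: xp p0; clear => *; lra.
have s20 : 0 < sin x ^+ 2 by rewrite exprn_gt0.
have x20 : 0 < x ^+ 2 by rewrite exprn_gt0.
apply/andP; split; first by rewrite lef_pV2 ?posrE // lerXn2r ?nnegrE // ltW.
have h : x ^+ 2 * cos x ^+ 2 <= sin x ^+ 2.
  by rewrite -exprMn lerXn2r ?nnegrE ?mulr_ge0 ?(ltW x0) // ltW.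
rewrite -[(sin x ^+ 2)^-1]mul1r ler_pdivrMr // mulrDl mul1r.
rewrite -{1}(cos2Dsin2 x) lerD2r mulrC ler_pdivlMr // mulrC //.
Qed.

(** Repeated halving of the angle: [1 / sin^2 (y/2) + 1 / cos^2 (y/2) = 4 / sin^2 y], where the
    cosine is the sine of the angle advanced by [pi / 2]. *)
Lemma sum_inv_sin_sq (R : realType) (x : R) (j : nat) : sin x != 0 ->
  \sum_(k < 2 ^ j) (sin ((x + k%:R * pi) / 2 ^+ j) ^+ 2)^-1 = 4 ^+ j / sin x ^+ 2.
Proof.
move=> sx; elim: j x sx => [|j IH] x sx.
  by rewrite expn0 big_ord1 mul0r addr0 !expr0 divr1 mul1r.
rewrite expnS mul2n -addnn big_split_ord /= -big_split /=.
have p2 (n : nat) : 2 ^+ n != 0 :> R by rewrite expf_neq0 // pnatr_eq0.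
transitivity (\sum_(k < 2 ^ j) 4 * (sin ((x + k%:R * pi) / 2 ^+ j) ^+ 2)^-1); last first.
  by rewrite -mulr_sumr IH // mulrA -exprS.
apply: eq_bigr => k _.
set y := (x + k%:R * pi) / 2 ^+ j.
have -> : (x + k%:R * pi) / 2 ^+ j.+1 = y / 2 by rewrite /y exprS; field; rewrite p2.
have -> : (x + (2 ^ j + k)%:R * pi) / 2 ^+ j.+1 = y / 2 + pi / 2.
  by rewrite /y exprS natrD natrX; field; rewrite p2.
rewrite sinDpihalf.
have yE : sin y = 2 * (sin (y / 2) * cos (y / 2)).
  have -> : y = (y / 2) *+ 2 by rewrite -[RHS]mulr_natr divfK // pnatr_eq0.
  by rewrite sin_mulr2n mulr_natl -[(y / 2) *+ 2]mulr_natr divfK ?pnatr_eq0 // [cos _ * _]mulrC.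
have sy : sin y != 0.
  apply/negP => /eqP sy0; move: sx.
  have h n : sin (n%:R * y) = 0.
    elim: n => [|n IHn]; first by rewrite mul0r sin0.
    by rewrite -natr1 mulrDl mul1r sinD IHn sy0 mul0r mulr0 addr0.
  have := h (2 ^ j)%N; rewrite natrX /y mulrC divfK // => h2.
  have kp n : sin (x + n%:R * pi) = 0 -> sin x = 0.
    elim: n => [|n IHn]; first by rewrite mul0r addr0.
    by rewrite -natr1 mulrDl mul1r addrA sinDpi => /eqP; rewrite oppr_eq0 => /eqP /IHn.
  by rewrite (kp _ h2) eqxx.
have [s0 c0] : sin (y / 2) != 0 /\ cos (y / 2) != 0.
  by move: sy; rewrite yE !mulf_eq0 !negb_or => /and3P[].
rewrite yE; have := cos2Dsin2 (y / 2); move: (sin _) (cos _) s0 c0 => s c s0 c0 h.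
have -> : (s ^+ 2)^-1 + (c ^+ 2)^-1 = (c ^+ 2 + s ^+ 2) / (s ^+ 2 * c ^+ 2).
  by field; rewrite s0 c0.
by rewrite h; field; rewrite s0 c0.
Qed.

(** At [x = pi / 2] the [2^(i+1)] angles form two mirror halves, so those in the first quadrant, the
    odd multiples of [pi / 2^(i+2)], carry half of the exact value. The discrepancy of at most 1 per
    term between [1 / a^2] and [1 / sin^2 a] becomes the factor [1 - 2^(-i-1)] after scaling. *)
Lemma sum_odd_inv_sq (R : realType) (i : nat) :
  pi ^+ 2 / 8 * (1 - (2 ^+ i.+1)^-1)
   <= \sum_(k < 2 ^ i) ((2 * k%:R + 1 : R) ^+ 2)^-1 <= pi ^+ 2 / 8.
Proof.
have p0 : 0 < pi :> R := pi_gt0 R.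
have p20 : 0 < 2 ^+ i :> R by rewrite exprn_gt0.
pose a (k : nat) : R := (2 * k%:R + 1) * pi / (4 * 2 ^+ i).
have E : \sum_(k < 2 ^ i) (sin (a k) ^+ 2)^-1 = 2 * (2 ^+ i * 2 ^+ i).
  have s1 : sin (pi / 2) != 0 :> R by rewrite sin_pihalf oner_neq0.
  have := sum_inv_sin_sq i.+1 s1; rewrite sin_pihalf expr1n divr1.
  rewrite expnS mul2n -addnn big_split_ord /=.
  have e1 (k : nat) : (pi / 2 + k%:R * pi) / 2 ^+ i.+1 = a k :> R.
    by rewrite /a exprS; field; rewrite gt_eqF.
  have -> : \sum_(k < 2 ^ i) (sin ((pi / 2 + k%:R * pi) / 2 ^+ i.+1) ^+ 2)^-1
     = \sum_(k < 2 ^ i) (sin (a k) ^+ 2)^-1 :> R by apply: eq_bigr => k _; rewrite e1.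
  have -> : \sum_(k < 2 ^ i) (sin ((pi / 2 + (2 ^ i + k)%:R * pi) / 2 ^+ i.+1) ^+ 2)^-1
     = \sum_(k < 2 ^ i) (sin (a k) ^+ 2)^-1 :> R.
    rewrite (reindex_inj rev_ord_inj) /=; apply: eq_bigr => k _.
    rewrite e1 (_ : a _ = - a k + pi); first by rewrite sinDpi sinN opprK.
    rewrite /a natrD natrB ?ltn_ord // natrX -natr1; field.
    by rewrite gt_eqF.
  move=> h; have : 4 ^+ i.+1 = 4 * (2 ^+ i * 2 ^+ i) :> R by rewrite exprS -exprMn -natrM.
  by move: h => <-; lra.
have aE (k : nat) : (a k ^+ 2)^-1 = 16 * (2 ^+ i * 2 ^+ i) / pi ^+ 2 * ((2 * k%:R + 1) ^+ 2)^-1.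
  have k0 : 0 < 2 * k%:R + 1 :> R by rewrite ltr_wpDl // mulr_ge0.
  rewrite /a; move: k0 p20 p0; move: (2 * k%:R + 1) (2 ^+ i) (pi) => u v w u0 v0 w0.
  by field; rewrite !gt_eqF.
have hb (k : 'I_(2 ^ i)) : (a k ^+ 2)^-1 <= (sin (a k) ^+ 2)^-1 <= (a k ^+ 2)^-1 + 1.
  apply: inv_sin_sq_bounds.
  have k0 : 0 <= k%:R :> R by [].
  have k1 : k%:R + 1 <= 2 ^+ i :> R by rewrite natr1 -natrX ler_nat.
  rewrite /a; apply/andP; split; first by rewrite divr_gt0 ?mulr_gt0 //; move: k0; clear => *; lra.
  rewrite ler_pdivrMr ?mulr_gt0 // mulrC -mulrA; apply: ler_wpM2l; first exact: ltW.
  by move: k1; clear => *; lra.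
set O := \sum_(k < 2 ^ i) _.
have q0 : 0 < 16 * (2 ^+ i * 2 ^+ i) / pi ^+ 2 :> R by rewrite divr_gt0 ?mulr_gt0 // exprn_gt0.
have OE : \sum_(k < 2 ^ i) (a k ^+ 2)^-1 = 16 * (2 ^+ i * 2 ^+ i) / pi ^+ 2 * O.
  by rewrite /O mulr_sumr; apply: eq_bigr => k _; exact: aE.
have h1 : 16 * (2 ^+ i * 2 ^+ i) / pi ^+ 2 * O <= 2 * (2 ^+ i * 2 ^+ i).
  by rewrite -OE -E; apply: ler_sum => k _; case/andP: (hb k).
have h2 : 2 * (2 ^+ i * 2 ^+ i) <= 16 * (2 ^+ i * 2 ^+ i) / pi ^+ 2 * O + 2 ^+ i.
  rewrite -OE -E; apply: (@le_trans _ _ (\sum_(k < 2 ^ i) ((a k ^+ 2)^-1 + 1))).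
    by apply: ler_sum => k _; case/andP: (hb k).
  by rewrite big_split /= sumr_const card_ord natrX.
apply/andP; split.
  rewrite -lerBlDr in h2; rewrite -(ler_pM2l q0); apply: le_trans h2; apply: eq_le_trivial.
  have -> : (2 ^+ i.+1)^-1 = (2 * 2 ^+ i)^-1 :> R by rewrite exprS.
  by move: p20 p0; move: (2 ^+ i) (pi : R) => v w v0 w0; field; rewrite !gt_eqF.
rewrite -(ler_pM2l q0); apply: (le_trans h1); apply: eq_le_trivial.
by move: p20 p0; move: (2 ^+ i) (pi : R) => v w v0 w0; field; rewrite !gt_eqF.
Qed.

Lemma sum_inv_sq_double (R : realType) (m : nat) :
  \sum_(1 <= n < (2 * m).+1) (n%:R ^+ 2)^-1
  = \sum_(k < m) ((2 * k%:R + 1) ^+ 2)^-1 + 4^-1 * \sum_(1 <= n < m.+1) (n%:R ^+ 2)^-1 :> R.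
Proof.
elim: m => [|m IH]; first by rewrite muln0 !big_geq // big_ord0 mulr0 addr0.
rewrite (_ : (2 * m.+1)%N = (2 * m).+2); last by lia.
rewrite big_nat_recr //= big_nat_recr //= IH big_ord_recr /= [in RHS]big_nat_recr //= mulrDr.
have -> : (2 * m).+1%:R = 2 * m%:R + 1 :> R by rewrite -natr1 natrM.
have -> : (4^-1 * (m.+1%:R ^+ 2)^-1) = ((2 * m).+2%:R ^+ 2)^-1 :> R.
  rewrite -invfM (_ : (2 * m).+2 = (2 * m.+1)%N); last by lia.
  by rewrite natrM exprMn (_ : 2 ^+ 2 = 4 :> R) // -natrX.
by ring.
Qed.

Lemma pi_sq_le (R : realType) : pi ^+ 2 / 8 <= 2 :> R.
Proof.
have p0 : 0 < pi :> R := pi_gt0 R; have /andP[_ h] := pihalf_02 R; have p4 : pi <= 4 :> R by lra.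
have : pi ^+ 2 <= 4 ^+ 2 :> R by rewrite lerXn2r ?nnegrE //; lra.
by rewrite (_ : 4 ^+ 2 = 16 :> R); [lra | rewrite -natrX].
Qed.

(** The even terms give a quarter of the preceding sum, and [pi^2 / 6] is the fixed point of
    [s = pi^2 / 8 + s / 4]. Each doubling divides the old error by 4 and adds at most [2^(-i)]. *)
Lemma basel_dyadic (R : realType) (i : nat) :
  `|pi ^+ 2 / 6 - \sum_(1 <= n < (2 ^ i).+1) (n%:R ^+ 2)^-1| <= 8 / 2 ^+ i :> R.
Proof.
have pi2 := pi_sq_le R; have pp : 0 <= pi ^+ 2 :> R by exact: sqr_ge0.
elim: i => [|i IH].
  rewrite expr0 divr1 expn0 big_nat1 expr1n invr1 ler_norml.
  by apply/andP; split; move: pi2 pp; clear => *; lra.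
rewrite expnS sum_inv_sq_double.
have /andP[h1 h2] := sum_odd_inv_sq R i.
set O := \sum_(k < _) _ in h1 h2 *; set Z := \sum_(_ <= _ < _) _ in IH *.
have p20 : 0 < 2 ^+ i :> R by rewrite exprn_gt0.
have e : (2 ^+ i.+1)^-1 = (2 ^+ i)^-1 / 2 :> R by rewrite exprSr invfM.
move: h1 IH; rewrite e; set q := (2 ^+ i)^-1 => h1 IH.
have q0 : 0 <= q by rewrite invr_ge0 ltW.
have h3 : pi ^+ 2 / 8 * (q / 2) <= 2 * (q / 2) by apply: ler_wpM2r => //; rewrite divr_ge0.
rewrite mulrBr mulr1 in h1.
move: IH; rewrite !ler_norml => /andP[i1 i2]; apply/andP; split.
  by move: i1 i2 h1 h2 h3 q0; move: (pi ^+ 2 / 8 * (q / 2)); clear => *; lra.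
by move: i1 i2 h1 h2 h3 q0; move: (pi ^+ 2 / 8 * (q / 2)); clear => *; lra.
Qed.

Lemma basel (R : realType) (n : nat) : (0 < n)%N ->
  `|pi ^+ 2 / 6 - \sum_(1 <= m < n.+1) (m%:R ^+ 2)^-1| <= 16 / n%:R :> R.
Proof.
move=> n0; pose i := trunc_log 2 n.
have /andP[i1 i2] : (2 ^ i <= n < 2 ^ i.+1)%N by exact: trunc_log_bounds.
have /ler_normlP[_ h1] := basel_dyadic R i; have /ler_normlP[h2 _] := basel_dyadic R i.+1.
have mono a b : (a <= b)%N ->
    \sum_(1 <= m < a.+1) (m%:R ^+ 2)^-1 <= \sum_(1 <= m < b.+1) (m%:R ^+ 2)^-1 :> R.
  move=> ab; rewrite [leRHS](@big_cat_nat _ _ _ a.+1) //= lerDl.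
  by apply: sumr_ge0 => m _; rewrite invr_ge0 exprn_ge0.
have m1 := mono _ _ i1; have m2 := mono _ _ (ltnW i2).
have nR : 0 < n%:R :> R by rewrite ltr0n.
have p20 : 0 < 2 ^+ i :> R by rewrite exprn_gt0.
have q : 8 / 2 ^+ i <= 16 / n%:R :> R.
  rewrite ler_pdivrMr // mulrAC ler_pdivlMr //.
  have : n%:R <= 2 ^+ i.+1 :> R by rewrite -natrX ler_nat ltnW.
  by rewrite exprS; move: (2 ^+ i) (n%:R : R); clear => *; lra.
have q' : 8 / 2 ^+ i.+1 <= 8 / 2 ^+ i :> R.
  by apply: ler_wpM2l => //; rewrite lef_pV2 ?posrE ?exprn_gt0 // ler_weXn2l // ler1n.
by rewrite ler_norml; apply/andP; split; move: m1 m2 h1 h2 q q'; clear => *; lra.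
Qed.

Lemma sum_divisors_swap (V : nmodType) (F : nat -> nat -> V) (X : nat) :
  \sum_(1 <= n < X.+1) \sum_(d <- divisors n) F d (n %/ d)%N
  = \sum_(1 <= d < X.+1) \sum_(1 <= m < (X %/ d).+1) F d m.
Proof.
transitivity (\sum_(1 <= n < X.+1) \sum_(1 <= d < X.+1 | (d %| n)%N) F d (n %/ d)%N).
  by rewrite big_nat [RHS]big_nat; apply: eq_bigr => n /andP[n0 nX]; apply: sum_divisors_nat; rewrite n0.
rewrite (exchange_big_dep xpredT) //= big_nat [RHS]big_nat; apply: eq_bigr => d /andP[d0 dX].
rewrite -big_filter (perm_big [seq (m * d)%N | m <- index_iota 1 (X %/ d).+1]) /=.
  by rewrite big_map; apply: eq_bigr => m _; rewrite mulnK.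
apply: uniq_perm; first by rewrite filter_uniq // iota_uniq.
  rewrite map_inj_in_uniq ?iota_uniq // => a b _ _ /eqP.
  by rewrite eqn_pmul2r // => /eqP.
move=> n; rewrite mem_filter mem_index_iota; apply/idP/mapP.
  case/andP=> /dvdnP[m nE] /andP[n0 nX]; exists m => //; rewrite mem_index_iota.
  rewrite nE in n0 nX; rewrite ltnS in nX; rewrite ltnS leq_divRL // nX andbT.
  by move: n0; rewrite muln_gt0 => /andP[].
case=> m; rewrite mem_index_iota => /andP[m0 mX] ->.
by rewrite dvdn_mull //= muln_gt0 m0 d0 ltnS -leq_divRL // -ltnS.
Qed.

Lemma sum_inv_sq_tail (R : realType) (a b : nat) : (0 < a)%N -> (a <= b)%N ->
  \sum_(a.+1 <= n < b.+1) (n%:R ^+ 2)^-1 <= (a%:R)^-1 - (b%:R)^-1 :> R.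
Proof.
move=> a0; elim: b => [|b IH] ab; first by have := leq_trans a0 ab.
move: ab; rewrite leq_eqVlt => /orP[/eqP <-|]; first by rewrite big_geq // subrr.
rewrite ltnS => ab; rewrite big_nat_recr //=; apply: le_trans (lerD (IH ab) (lexx _)) _.
have b0 : 0 < b%:R :> R by rewrite ltr0n (leq_trans a0).
rewrite -[b.+1%:R]natr1 -addrA lerD2l.
rewrite -subr_ge0 (_ : _ - _ = (b%:R * (b%:R + 1) ^+ 2)^-1).
  by rewrite invr_ge0 mulr_ge0 ?exprn_ge0 ?addr_ge0 // ltW.
by field; rewrite !gt_eqF // ltr_wpDl // ltW.
Qed.

(** The tail between [X] and any larger [Y] is at most [1 / X] by absolute convergence; the limit is
    identified by letting [Y] grow. *)
Lemma sum_mobius_inv_sq (R : realType) (X : nat) : (0 < X)%N ->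
  `|6 / pi ^+ 2 - \sum_(1 <= d < X.+1) mobius R d / d%:R ^+ 2| <= 1 / X%:R.
Proof.
move=> X0; pose S Y : R := \sum_(1 <= d < Y.+1) mobius R d / d%:R ^+ 2.
have XR : 0 < X%:R :> R by rewrite ltr0n.
have p0 : 0 < pi ^+ 2 :> R by rewrite exprn_gt0 // pi_gt0.
have m1 n : `|mobius R n| <= 1 := norm_mobius_le1 R n.
have tl Y : (X <= Y)%N -> `|S Y - S X| <= 1 / X%:R.
  move=> XY; rewrite /S [\sum_(1 <= d < Y.+1) _](@big_cat_nat _ _ _ X.+1) //= addrAC subrr add0r.
  apply: le_trans (ler_norm_sum _ _ _) _.
  apply: (@le_trans _ _ (\sum_(X.+1 <= n < Y.+1) (n%:R ^+ 2)^-1)).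
    apply: ler_sum => n _; rewrite normrM -[leRHS]mul1r [`|_^-1|]ger0_norm ?invr_ge0 ?exprn_ge0 //.
    by apply: ler_wpM2r => //; rewrite invr_ge0 exprn_ge0.
  apply: (le_trans (sum_inv_sq_tail R X0 XY)).
  by rewrite mul1r gerBl invr_ge0.
(* The convolution [mu * 1 = delta] gives the exact value of the weighted sum below. *)
have cv Y : (0 < Y)%N -> `|pi ^+ 2 / 6 * S Y - 1| <= 32 * (1 + ln Y%:R) / Y%:R.
  move=> Y0; have YR : 0 < Y%:R :> R by rewrite ltr0n.
  have E1 : \sum_(1 <= d < Y.+1) \sum_(1 <= m < (Y %/ d).+1) mobius R d / d%:R ^+ 2 * (m%:R ^+ 2)^-1 = 1.
    rewrite -(sum_divisors_swap (fun d m => mobius R d / d%:R ^+ 2 * (m%:R ^+ 2)^-1)).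
    transitivity (\sum_(1 <= n < Y.+1) (n%:R ^+ 2)^-1 * (n == 1%N)%:R : R).
      rewrite big_nat [RHS]big_nat; apply: eq_bigr => n /andP[n0 nY].
      rewrite -(@sum_mobius R n Y) ?n0 // -sum_divisors_nat ?n0 // mulr_sumr.
      rewrite big_seq [RHS]big_seq; apply: eq_bigr => d; rewrite -dvdn_divisors // => dn.
      rewrite -mulrA mulrC -invfM -exprMn -natrM [(d * _)%N]mulnC divnK //.
    rewrite big_ltn // expr1n invr1 mul1r eqxx big_nat big1 ?addr0 // => n /andP[n2 _].
    by rewrite (_ : (n == 1)%N = false) ?mulr0 //; apply/negbTE; rewrite neq_ltn n2 orbT.
  have -> : pi ^+ 2 / 6 * S Y - 1 = \sum_(1 <= d < Y.+1) mobius R d / d%:R ^+ 2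
      * (pi ^+ 2 / 6 - \sum_(1 <= m < (Y %/ d).+1) (m%:R ^+ 2)^-1).
    rewrite -[X in _ - X = _]E1 /S mulr_sumr -sumrB; apply: eq_bigr => d _.
    by rewrite mulrBr mulr_sumr [pi ^+ 2 / 6 * _]mulrC.
  apply: le_trans (ler_norm_sum _ _ _) _.
  apply: (@le_trans _ _ (\sum_(1 <= d < Y.+1) 32 / Y%:R * (d%:R)^-1)).
    rewrite big_nat [leRHS]big_nat; apply: ler_sum => d /andP[d0 dY]; rewrite ltnS in dY.
    have dR : 0 < d%:R :> R by rewrite ltr0n.
    have q0 : (0 < Y %/ d)%N by rewrite divn_gt0.
    have [q1 _] := @divn_half_le R Y d (introT andP (conj d0 dY)).
    rewrite normrM; apply: (@le_trans _ _ ((d%:R ^+ 2)^-1 * (32 * d%:R / Y%:R))); last first.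
      by apply: eq_le_trivial; field; rewrite !gt_eqF.
    apply: ler_pM => //.
      rewrite normrM -[leRHS]mul1r [`|_^-1|]ger0_norm ?invr_ge0 ?exprn_ge0 //.
      by apply: ler_wpM2r => //; rewrite invr_ge0 exprn_ge0.
    apply: (le_trans (basel R q0)); rewrite ler_pdivrMr ?ltr0n // mulrAC ler_pdivlMr //.
    rewrite ler_pdivrMr ?mulr_gt0 // in q1.
    by move: q1; move: ((Y %/ d)%:R : R) => *; lra.
  rewrite -mulr_sumr mulrAC; apply: ler_wpM2r; first by rewrite invr_ge0 ltW.
  by apply: ler_wpM2l => //; exact: harmonic_le1.
apply/ler_addgt0Pr => e e0.
(* [(1 + ln Y) / Y <= 3 / sqrt Y] with [Y = Z^2]. *)
pose c : R := 6 / pi ^+ 2 * 32 * 3; have c0 : 0 < c by rewrite /c !mulr_gt0 ?invr_gt0.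
pose Z := maxn X (Num.truncn (c / e)).+1; pose Y := (Z ^ 2)%N.
have Z0 : (0 < Z)%N by rewrite leq_max X0.
have ZR : 0 < Z%:R :> R by rewrite ltr0n.
have XY : (X <= Y)%N.
  by apply: (@leq_trans Z); [exact: leq_maxl | rewrite /Y -mulnn leq_pmulr].
have Y0 : (0 < Y)%N by exact: leq_trans XY.
have Ze : c / Z%:R <= e.
  rewrite ler_pdivrMr // mulrC -ler_pdivrMr //.
  have /andP[_ h] : (Num.truncn (c / e))%:R <= c / e < (Num.truncn (c / e)).+1%:R.
    by apply: truncn_itv; rewrite divr_ge0 // ltW.
  by apply: (le_trans (ltW h)); rewrite ler_nat leq_maxr.
have h1 := cv Y Y0.
have h2 : 32 * (1 + ln Y%:R) / Y%:R <= 32 * 3 / Z%:R :> R.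
  rewrite /Y ln_natX // natrX.
  have lz : ln Z%:R <= Z%:R :> R := ln_nat_le _ _.
  have z1 : 1 <= Z%:R :> R by rewrite ler1n.
  rewrite ler_pdivrMr ?exprn_gt0 // (_ : 32 * 3 / Z%:R * Z%:R ^+ 2 = 32 * (3 * Z%:R)); last by field; rewrite gt_eqF.
  by move: lz z1; move: (ln Z%:R) => u; move: (Z%:R : R) => v; clear => *; lra.
have h3 : `|6 / pi ^+ 2 - S Y| <= e.
  have -> : 6 / pi ^+ 2 - S Y = - (6 / pi ^+ 2 * (pi ^+ 2 / 6 * S Y - 1)).
    have : (pi : R) != 0 by rewrite gt_eqF // pi_gt0.
    by move: (pi : R) (S Y) => w t w0; field.
  rewrite normrN normrM [`|6 / _|]gtr0_norm ?divr_gt0 //; apply: le_trans Ze.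
  rewrite (_ : c / Z%:R = 6 / pi ^+ 2 * (32 * 3 / Z%:R)); last by rewrite /c; ring.
  by apply: ler_wpM2l; [rewrite divr_ge0 // ltW | exact: le_trans h1 h2].
have -> : 6 / pi ^+ 2 - S X = (S Y - S X) + (6 / pi ^+ 2 - S Y) by ring.
apply: le_trans (ler_normD _ _) _; apply: lerD => //; exact: tl.
Qed.

(** * Sums of powers *)

Lemma power_taylor1 (R : realType) (j : nat) : exists2 c : R, 0 <= c &
  forall y h : R, 1 <= y -> 0 <= h <= 1 -> `|(y + h) ^+ j.+1 - y ^+ j.+1| <= c * y ^+ j.
Proof.
elim: j => [|j [c c0 H]].
  exists 1 => // y h y1 /andP[h0 h1]; rewrite !expr1 addrAC subrr add0r expr0 mulr1.
  by rewrite ger0_norm.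
exists (2 * c + 1); first by rewrite addr_ge0 // mulr_ge0.
move=> y h y1 h01; have /andP[h0 h1] := h01; have y0 : 0 <= y by lra.
have -> : (y + h) ^+ j.+2 - y ^+ j.+2 = (y + h) * ((y + h) ^+ j.+1 - y ^+ j.+1) + h * y ^+ j.+1.
  by rewrite (exprS (y + h) j.+1) (exprS y j.+1); ring.
apply: le_trans (ler_normD _ _) _; rewrite [leRHS]mulrDl; apply: lerD; last first.
  rewrite normrM (ger0_norm h0) ger0_norm ?exprn_ge0 //; apply: ler_wpM2r => //; exact: exprn_ge0.
rewrite normrM ger0_norm; last by lra.
rewrite (_ : 2 * c * y ^+ j.+1 = 2 * y * (c * y ^+ j)); last by rewrite exprS; ring.
by apply: ler_pM => //; [lra | lra | exact: H].
Qed.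

Lemma power_taylor2 (R : realType) (j : nat) : exists2 c : R, 0 <= c &
  forall y h : R, 1 <= y -> 0 <= h <= 1 ->
  `|(y + h) ^+ j.+2 - y ^+ j.+2 - j.+2%:R * (h * y ^+ j.+1)| <= c * y ^+ j.
Proof.
elim: j => [|j [c c0 H]].
  exists 1 => // y h y1 /andP[h0 h1]; rewrite expr0 mulr1 expr1.
  have -> : (y + h) ^+ 2 - y ^+ 2 - 2 * (h * y) = h ^+ 2 by ring.
  by rewrite ger0_norm ?exprn_ge0 // exprn_ile1.
exists (2 * c + j.+2%:R); first by rewrite addr_ge0 // mulr_ge0.
move=> y h y1 h01; have /andP[h0 h1] := h01; have y0 : 0 <= y by lra.
have -> : (y + h) ^+ j.+3 - y ^+ j.+3 - j.+3%:R * (h * y ^+ j.+2)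
  = (y + h) * ((y + h) ^+ j.+2 - y ^+ j.+2 - j.+2%:R * (h * y ^+ j.+1))
    + j.+2%:R * (h ^+ 2 * y ^+ j.+1).
  by rewrite (exprS (y + h) j.+2) (exprS y j.+2) (exprS y j.+1) -[j.+3%:R]natr1; ring.
apply: le_trans (ler_normD _ _) _; rewrite [leRHS]mulrDl; apply: lerD; last first.
  rewrite ger0_norm ?mulr_ge0 ?exprn_ge0 //; apply: ler_wpM2l => //.
  by rewrite -[leRHS]mul1r; apply: ler_wpM2r; rewrite ?exprn_ge0 // exprn_ile1.
rewrite normrM ger0_norm; last by lra.
rewrite (_ : 2 * c * y ^+ j.+1 = 2 * y * (c * y ^+ j)); last by rewrite exprS; ring.
by apply: ler_pM => //; [lra | lra | exact: H].
Qed.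

Lemma power_taylor3 (R : realType) (j : nat) : exists2 c : R, 0 <= c &
  forall y : R, 1 <= y ->
  `|(y + 1) ^+ j.+3 - y ^+ j.+3 - j.+3%:R * y ^+ j.+2 - j.+3%:R * j.+2%:R / 2 * y ^+ j.+1|
  <= c * y ^+ j.
Proof.
elim: j => [|j [c c0 H]].
  exists 1 => // y y1; rewrite expr0 mulr1 expr1.
  have -> : (y + 1) ^+ 3 - y ^+ 3 - 3 * y ^+ 2 - 3 * 2 / 2 * y = 1 by field.
  by rewrite normr1.
exists (2 * c + j.+3%:R * j.+2%:R / 2); first by rewrite addr_ge0 // ?mulr_ge0.
move=> y y1; have y0 : 0 <= y by lra.
have -> : (y + 1) ^+ j.+4 - y ^+ j.+4 - j.+4%:R * y ^+ j.+3 - j.+4%:R * j.+3%:R / 2 * y ^+ j.+2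
  = (y + 1) * ((y + 1) ^+ j.+3 - y ^+ j.+3 - j.+3%:R * y ^+ j.+2 - j.+3%:R * j.+2%:R / 2 * y ^+ j.+1)
    + j.+3%:R * j.+2%:R / 2 * y ^+ j.+1.
  rewrite (exprS (y + 1) j.+3) (exprS y j.+3) (exprS y j.+2) (exprS y j.+1).
  by rewrite -[j.+4%:R]natr1 -[j.+3%:R]natr1; field.
apply: le_trans (ler_normD _ _) _; rewrite [leRHS]mulrDl; apply: lerD; last first.
  by rewrite ger0_norm ?mulr_ge0 ?exprn_ge0.
rewrite normrM ger0_norm; last by lra.
rewrite (_ : 2 * c * y ^+ j.+1 = 2 * y * (c * y ^+ j)); last by rewrite exprS; ring.
by apply: ler_pM => //; [lra | lra | exact: H].
Qed.

(** Two terms of Euler-Maclaurin, by induction on [m]: the increment of the main terms equals the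
    new summand up to an error of order [m^j], which is summed into [m^(j+1)]. *)
Lemma power_sum_nat (R : realType) (j : nat) : exists2 c : R, 0 <= c &
  forall m : nat, (0 < m)%N ->
  `|\sum_(1 <= n < m.+1) n%:R ^+ j.+2 - m%:R ^+ j.+3 / j.+3%:R - m%:R ^+ j.+2 / 2| <= c * m%:R ^+ j.+1 :> R.
Proof.
have [c2 c20 T2] := power_taylor2 R j; have [c3 c30 T3] := power_taylor3 R j.
pose c := c2 + c3 + 1; exists c; first by rewrite /c; lra.
elim=> // m IH _; have [->|m0] := posnP m.
  rewrite big_nat1 !expr1n mulr1 mul1r.
  have : (j.+3%:R)^-1 <= 1 / 2 :> R.
    by rewrite mul1r lef_pV2 ?posrE ?ltr0n // ler_nat.
  have : 0 <= (j.+3%:R)^-1 :> R by rewrite invr_ge0.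
  move=> a1 a2; apply: (@le_trans _ _ 1); last by rewrite /c; move: c20 c30; clear => *; lra.
  by rewrite ler_norml; apply/andP; split; move: a1 a2; move: (j.+3%:R^-1) => q; clear => *; lra.
have := IH m0; set S := \sum_(1 <= n < m.+1) _; set mm := m%:R : R => HS.
have m1 : 1 <= mm by rewrite /mm ler1n.
rewrite big_nat_recr //= -/S -natr1 -/mm.
have h01 : 0 <= (1 : R) <= 1 by rewrite ler01 lexx.
have t2 := T2 mm 1 m1 h01; have t3 := T3 mm m1; rewrite mul1r in t2.
set A := (mm + 1) ^+ j.+2 in t2 *; set B := (mm + 1) ^+ j.+3 in t3 *.
set E2 := A - _ - _ in t2; set E3 := B - _ - _ - _ in t3.
have jR : 0 < j.+3%:R :> R by rewrite ltr0n.
have -> : S + A - B / j.+3%:R - A / 2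
  = (S - mm ^+ j.+3 / j.+3%:R - mm ^+ j.+2 / 2) + (E2 / 2 - E3 / j.+3%:R).
  rewrite /E2 /E3; move: jR; move: (j.+3%:R : R) (j.+2%:R : R) => J3 J2 J30.
  by field; rewrite gt_eqF.
apply: le_trans (ler_normD _ _) _.
have e : `|E2 / 2 - E3 / j.+3%:R| <= c * mm ^+ j.
  have q0 : 0 <= mm ^+ j by rewrite exprn_ge0 //; lra.
  have e2 : `|E2 / 2| <= c2 * mm ^+ j.
    rewrite normrM [`|2^-1|]ger0_norm // ?invr_ge0 //.
    by have := normr_ge0 E2; lra.
  have e3 : `|E3 / j.+3%:R| <= c3 * mm ^+ j.
    rewrite normrM [`|_^-1|]ger0_norm ?invr_ge0 // ler_pdivrMr //.
    apply: (le_trans t3); rewrite -[leLHS]mulr1; apply: ler_wpM2l; first by rewrite mulr_ge0.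
    by rewrite ler1n.
  apply: le_trans (ler_normB _ _) _; apply: le_trans (lerD e2 e3) _.
  by rewrite -mulrDl; apply: ler_wpM2r => //; rewrite /c; lra.
apply: le_trans (lerD HS e) _; rewrite -mulrDr; apply: ler_wpM2l; first by rewrite /c; lra.
rewrite exprS [leRHS]exprS -[X in _ + X]mul1r -mulrDl; apply: ler_wpM2l; first by lra.
by rewrite lerXn2r ?nnegrE //; lra.
Qed.

(** Taylor expansion from [m] to [y = m + f]: the correction [- f y^k] of the leading term joins the
    boundary term [y^k / 2] to form the sawtooth. The exponent [k = 1] lies below the range of
    [power_sum_nat] and is computed exactly. *)
Lemma power_sum_sawtooth (R : realType) (k : nat) : (0 < k)%N -> exists2 c : R, 0 <= c &
  forall y : R, 1 <= y ->
  `|\sum_(1 <= n < (Num.truncn y).+1) n%:R ^+ k - (y ^+ k.+1 / k.+1%:R - sawtooth y * y ^+ k)|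
  <= c * y ^+ k.-1.
Proof.
case: k => [//|[|j]] _.
  exists 1 => // y y1; have y0 : 0 <= y by lra.
  have /andP[f0 f1] := sawtooth_frac y0; rewrite expr0 mulr1 /sawtooth; set m := Num.truncn y in f0 f1 *.
  have -> : \sum_(1 <= n < m.+1) n%:R ^+ 1 = m%:R * (m%:R + 1) / 2 :> R.
    elim: m {f0 f1} => [|m IH]; first by rewrite big_geq // mul0r mul0r.
    by rewrite big_nat_recr //= IH expr1 -natr1; field.
  set f := y - m%:R in f0 f1 *; have -> : m%:R = y - f by rewrite /f opprB addrC subrK.
  rewrite expr1 (_ : _ - _ = (f ^+ 2 - f) / 2); last by field.
  have : f ^+ 2 <= 1 by rewrite exprn_ile1 // ltW.
  have : 0 <= f ^+ 2 by rewrite exprn_ge0.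
  by move=> *; rewrite ler_norml; apply/andP; split; lra.
have [c1 c10 T1] := power_taylor1 R j.+1; have [c2 c20 T2] := power_taylor2 R j.+1.
have [c c0 H] := power_sum_nat R j.
exists (c + c1 + c2) => [|y y1]; first by lra.
have y0 : 0 <= y by lra.
have /andP[f0 f1] := sawtooth_frac y0; rewrite /sawtooth /=; set m := Num.truncn y in f0 f1 *.
have m0 : (0 < m)%N by rewrite truncn_gt0.
have := H m m0; set S := \sum_(_ <= _ < _) _ => HS.
set f := y - m%:R in f0 f1 *; set mm := m%:R : R in HS f f0 f1 *.
have yE : y = mm + f by rewrite /f addrC subrK.
have m1 : 1 <= mm by rewrite /mm ler1n.
have f01 : 0 <= f <= 1 by rewrite f0 ltW.
have t1 := T1 mm f m1 f01; have t2 := T2 mm f m1 f01; rewrite -yE in t1 t2.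
set E1 := _ - _ in t1; set E2 := _ - _ - _ in t2.
have jR : 0 < j.+3%:R :> R by rewrite ltr0n.
have -> : S - (y ^+ j.+3 / j.+3%:R - (f - 1 / 2) * y ^+ j.+2)
  = (S - mm ^+ j.+3 / j.+3%:R - mm ^+ j.+2 / 2) + (f - 1 / 2) * E1 - E2 / j.+3%:R.
  rewrite /E1 /E2; move: jR; move: (j.+3%:R : R) => J3 J30.
  by field; rewrite gt_eqF.
have q0 : 0 <= mm ^+ j.+1 by rewrite exprn_ge0 //; lra.
have e1 : `|(f - 1 / 2) * E1| <= c1 * mm ^+ j.+1.
  rewrite normrM -[leRHS]mul1r; apply: ler_pM => //.
  by rewrite ler_norml; apply/andP; split; lra.
have e2 : `|E2 / j.+3%:R| <= c2 * mm ^+ j.+1.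
  rewrite normrM [`|_^-1|]ger0_norm ?invr_ge0 // ler_pdivrMr //.
  apply: (le_trans t2); rewrite -[leLHS]mulr1; apply: ler_wpM2l; first by rewrite mulr_ge0.
  by rewrite ler1n.
apply: le_trans (ler_normB _ _) _; apply: le_trans (lerD (ler_normD _ _) (lexx _)) _.
apply: le_trans (lerD (lerD HS e1) e2) _; rewrite -!mulrDl; apply: ler_wpM2l; first by lra.
by rewrite lerXn2r ?nnegrE //; lra.
Qed.

(** * Zeros of sums of squares *)

(** The number of representations of [c] as a sum of [k] squares (see [nsq_card]), in a recursive
    form that gives recurrences in [k] by computation. *)
Fixpoint nsq (F : finFieldType) (k : nat) (c : F) : nat :=
  if k is k'.+1 then (\sum_(u : F) @nsq F k' (c - u ^+ 2)%R)%N else (c == 0).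

Lemma card_bij_preim (X Y : finType) (h : X -> Y) (P : pred Y) : bijective h ->
  #|[pred x | P (h x)]| = #|P|.
Proof.
case=> g hg gh; rewrite -!sum1_card [RHS](reindex h) //=.
by exists g => x _; [exact: hg | exact: gh].
Qed.

Lemma nsq_card (F : finFieldType) (k : nat) (c : F) :
  #|[pred x : k.-tuple F | \sum_(y <- x) y ^+ 2 == c]| = nsq k c.
Proof.
elim: k c => [|k IH] c /=.
  have [->|c0] := eqVneq c 0.
    rewrite (eq_card (B := predT)) ?cardT ?card_tuple ?expn0 //.
      by rewrite -cardT card_tuple expn0.
    by move=> x; rewrite !inE tuple0 /= big_nil eqxx.
  rewrite (eq_card0) // => x; rewrite !inE tuple0 /= big_nil.
  by apply/negbTE; rewrite eq_sym.
under eq_bigr => u _ do rewrite -IH.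
pose h (p : F * k.-tuple F) : k.+1.-tuple F := [tuple of p.1 :: p.2].
have hinj : injective h.
  move=> [a x] [b y] /(congr1 val) /= [-> H]; congr (_, _); exact: val_inj.
have hbij : bijective h.
  by apply: inj_card_bij => //; rewrite card_prod !card_tuple expnS.
rewrite -(card_bij_preim _ hbij).
rewrite -sum1_card /=.
transitivity (\sum_(u : F) \sum_(x : k.-tuple F | (\sum_(y <- x) y ^+ 2 == c - u ^+ 2)%R) 1)%N.
  rewrite pair_big_dep /=; apply: eq_bigl => [[u x]]; rewrite !inE /= big_cons.
  by rewrite addrC eq_sym -subr_eq eq_sym.
by apply: eq_bigr => u _; rewrite sum1_card.
Qed.

Lemma sum_nsq (F : finFieldType) (k : nat) : (\sum_(c : F) nsq k c = #|F| ^ k)%N.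
Proof.
elim: k => [|k IH] /=.
  by rewrite expn0 (bigD1 0) //= eqxx big1 // => c /negbTE->.
rewrite exchange_big /= expnS -sum_nat_const; apply: eq_bigr => u _.
rewrite -IH [RHS](reindex_inj (h := fun c => c - u ^+ 2)) //.
exact: addIr.
Qed.

Definition nsq2 (F : finFieldType) (c : F) : nat :=
  #|[pred p : F * F | p.1 ^+ 2 + p.2 ^+ 2 == c]|.

Lemma nsqSS (F : finFieldType) (k : nat) (c : F) :
  (nsq k.+2 c = \sum_(w : F) nsq2 w * nsq k (c - w)%R)%N.
Proof.
rewrite /= pair_big /= (partition_big (fun p : F * F => p.1 ^+ 2 + p.2 ^+ 2) predT) //=.
apply: eq_bigr => w _; rewrite -sum_nat_const.
by apply: eq_bigr => p /eqP <-; rewrite opprD addrA.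
Qed.

Lemma sum_nsq2 (F : finFieldType) : (\sum_(w : F) nsq2 w = #|F| ^ 2)%N.
Proof.
rewrite -mulnn -card_prod -sum1_card.
rewrite (partition_big (fun p : F * F => p.1 ^+ 2 + p.2 ^+ 2) predT) //=.
by apply: eq_bigr => w _; rewrite /nsq2 -sum1_card.
Qed.

Lemma card_squares (F : finFieldType) :
  (#|F| <= 2 * #|[set x ^+ 2 | x in [set: F]]%SET|)%N.
Proof.
rewrite -cardsT mulnC cardsE.
apply: (@leq_trans (\sum_(y in [set x ^+ 2 | x in [set: F]]%SET) 2)%N); last first.
  by rewrite sum_nat_const.
rewrite -sum1_card (partition_big (fun x : F => x ^+ 2)
   (mem [set x ^+ 2 | x in [set: F]]%SET)) /=; last first.
  by move=> x _; apply: imset_f; rewrite inE.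
apply: leq_sum => y /imsetP[z _ ->]; rewrite sum1_card.
apply: (@leq_trans #|[set z; - z]%SET|); last by rewrite cards2; case: (_ != _).
apply: subset_leq_card; apply/fintype.subsetP => x; rewrite !inE /= => /eqP H.
have : (x - z) * (x + z) == 0 by rewrite -subr_sqr H subrr.
by rewrite mulf_eq0 subr_eq0 addr_eq0.
Qed.

(** Pigeonhole: the set [S] of squares and the set [c - S] each contain more than half of the field,
    since its order is odd, so they meet. *)
Lemma sum_two_squares (F : finFieldType) (c : F) : odd #|F| ->
  exists u v : F, u ^+ 2 + v ^+ 2 = c.
Proof.
move=> oF; pose S := [set x ^+ 2 | x in [set: F]]%SET.
pose T := [set c - s | s in S]%SET.
have cS := card_squares F; rewrite -/S in cS.
have cT : #|T| = #|S| by apply: card_imset => a b /= /addrI/oppr_inj.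
have : ~~ [disjoint S & T].
  apply/negP => dST; have : (#|S :|: T| <= #|F|)%N by exact: max_card.
  rewrite cardsU; have /eqP -> : #|S :&: T| == 0%N by rewrite cards_eq0 setI_eq0.
  rewrite subn0 cT; move: oF cS; set q := #|F|; set s := #|S| => oq h1 h2.
  have : q = (2 * s)%N by lia.
  by move=> E; rewrite E oddM in oq.
rewrite -setI_eq0 => /set0Pn[w]; rewrite inE => /andP[/imsetP[u _ ->] /imsetP[s /imsetP[v _ ->] E]].
by exists u, v; rewrite E subrK.
Qed.

(* Multiplication by e + f i (Brahmagupta's identity) permutes the pairs. *)
Lemma nsq2_const (F : finFieldType) (c : F) : odd #|F| -> c != 0 -> nsq2 c = nsq2 (1 : F).
Proof.
move=> oF c0; have [e [f ef]] := sum_two_squares c oF.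
pose h (p : F * F) := (e * p.1 - f * p.2, e * p.2 + f * p.1).
have hn p : (h p).1 ^+ 2 + (h p).2 ^+ 2 = c * (p.1 ^+ 2 + p.2 ^+ 2).
  by rewrite -ef /=; ring.
have hinj : injective h.
  move=> [a b] [a' b'] [H1 H2].
  have Ha : c * (a - a') = 0.
    transitivity (e * ((e * a - f * b) - (e * a' - f * b')) + f * ((e * b + f * a) - (e * b' + f * a'))).
      by rewrite -ef; ring.
    by rewrite H1 H2 !subrr !mulr0 addr0.
  have Hb : c * (b - b') = 0.
    transitivity (e * ((e * b + f * a) - (e * b' + f * a')) - f * ((e * a - f * b) - (e * a' - f * b'))).
      by rewrite -ef; ring.
    by rewrite H1 H2 !subrr !mulr0 subr0.
  move/eqP: Ha; rewrite mulf_eq0 (negPf c0) subr_eq0 /= => /eqP ->.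
  by move/eqP: Hb; rewrite mulf_eq0 (negPf c0) subr_eq0 /= => /eqP ->.
rewrite /nsq2 -(card_bij_preim [pred p : F * F | p.1 ^+ 2 + p.2 ^+ 2 == c] (injF_bij hinj)).
apply: eq_card => p; rewrite !inE hn -[X in _ == X]mulr1.
by rewrite (inj_eq (mulfI c0)).
Qed.

Lemma nsq2_0_nonsquare (F : finFieldType) :
  (forall i : F, i ^+ 2 != -1) -> nsq2 (0 : F) = 1%N.
Proof.
move=> H; rewrite /nsq2 (eq_card (B := pred1 (0, 0))) ?card1 // => [[a b]].
rewrite !inE /= xpair_eqE; have [->|b0] := eqVneq b 0.
  by rewrite expr0n addr0 sqrf_eq0 andbT.
rewrite andbF; apply/negbTE; apply: contra (H (a / b)) => /eqP E.
rewrite exprMn exprVn; move/eqP: E; rewrite addr_eq0 => /eqP ->.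
by rewrite mulNr divff // sqrf_eq0.
Qed.

Lemma nsq2_0_square (F : finFieldType) (i : F) : (2%:R : F) != 0 -> i ^+ 2 = -1 ->
  nsq2 (0 : F) = (2 * #|F|).-1.
Proof.
move=> two0 ii.
have i0 : i != 0 by rewrite -sqrf_eq0 ii oppr_eq0 oner_eq0.
have -> : nsq2 (0 : F) = #|([set (i * v, v) | v in [set: F]] :|: [set (- i * v, v) | v in [set: F]])%SET|.
  apply: eq_card => [[a b]]; rewrite !inE /=; apply/eqP/orP => [H|[]/imsetP[v _ [-> ->]]].
  - have : (a - i * b) * (a + i * b) == 0.
      by rewrite -subr_sqr exprMn ii mulN1r opprK H.
    rewrite mulf_eq0 subr_eq0 addr_eq0 => /orP[] /eqP ->.
      by left; apply/imsetP; exists b.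
    by right; apply/imsetP; exists b; rewrite ?mulNr.
  - by rewrite exprMn ii mulN1r addNr.
  - by rewrite exprMn sqrrN ii mulN1r addNr.
rewrite cardsU !card_imset ?cardsT; try by move=> a b [].
have -> : ([set (i * v, v) | v in [set: F]] :&: [set (- i * v, v) | v in [set: F]])%SET = [set (0, 0)]%SET.
  apply/setP => [[a b]]; rewrite !inE xpair_eqE.
  apply/andP/andP => [[/imsetP[v _ [-> ->]] /imsetP[w _ [H E]]]|[/eqP-> /eqP->]].
    have : (2%:R * i) * v == 0.
      by rewrite -{1}[2%:R]/(1 + 1) !mulrDl !mul1r {1}H E mulNr addNr.
    by rewrite mulf_eq0 mulf_eq0 (negPf two0) (negPf i0) /= => /eqP ->; rewrite mulr0 eqxx.
  by split; apply/imsetP; exists 0; rewrite ?inE ?mulr0.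
by rewrite cards1 addnn -mul2n subn1.
Qed.

(** For the existence part put [h = (p - 1) / 2]: [X^h - 1] has at most [h] roots, so some nonzero
    [a] has [a^h = -1], and [a^(h/2)] is the square root sought. *)
Lemma Fp_sqrtN1 (p : nat) : prime p -> (2 < p)%N ->
  (exists i : 'F_p, i ^+ 2 = -1) <-> ~~ odd (p.-1)./2.
Proof.
move=> pp p2; have op : odd p by have := even_prime pp; lia.
have ferm (a : 'F_p) : a != 0 -> a ^+ p.-1 = 1.
  move=> a0; apply: (mulfI a0); rewrite mulr1 -exprS prednK ?prime_gt0 //.
  by have := expf_card a; rewrite card_Fp.
have hp : p.-1 = (2 * (p.-1)./2)%N by lia.
have n11 : (-1 : 'F_p) != 1.
  rewrite eq_sym -addr_eq0 -mulr2n; apply/negP; rewrite -(dvdn_pcharf (pchar_Fp pp)) => /dvdn_leq; lia.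
split.
  case=> i ii; apply/negP => oh.
  have i0 : i != 0 by rewrite -sqrf_eq0 ii oppr_eq0 oner_eq0.
  have := ferm i i0; rewrite hp exprM ii -signr_odd oh expr1 => H.
  by rewrite H eqxx in n11.
move=> eh; have hq : (p.-1)./2 = (2 * (p.-1)./2./2)%N by lia.
set h := (p.-1)./2 in hp hq *.
have h0 : (0 < h)%N by lia.
have [a a0 an1] : exists2 a : 'F_p, a != 0 & a ^+ h != 1.
  have [/existsP[a /andP[]]|/existsPn H] := boolP [exists a : 'F_p, (a != 0) && (a ^+ h != 1)].
    by exists a.
  pose rs := [seq a <- enum 'F_p | a != 0].
  have rr : all (root ('X^h - 1)) rs.
    apply/allP => a; rewrite mem_filter => /andP[a0 _].
    have := H a; rewrite a0 /= negbK => /eqP ah.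
    by rewrite rootE !hornerE ah subrr.
  have := max_poly_roots _ rr (filter_uniq _ (enum_uniq _)).
  rewrite -size_poly_eq0 size_XnsubC // => /(_ isT).
  have -> : size rs = p.-1.
    rewrite -sum1_size big_filter big_enum_cond /=.
    rewrite (eq_bigl (fun a : 'F_p => a \in predC1 0)) // sum1_card cardC1.
    by rewrite card_Fp.
  lia.
exists (a ^+ h./2); rewrite -exprM mulnC -hq.
have : (a ^+ h - 1) * (a ^+ h + 1) == 0.
  by rewrite -subr_sqr expr1n -exprM mulnC -hp ferm // subrr.
by rewrite mulf_eq0 subr_eq0 (negPf an1) addr_eq0 /= => /eqP.
Qed.

Lemma nsq2_Fp (p : nat) : prime p -> (2 < p)%N ->
  (nsq2 (0 : 'F_p))%:Z = 1 + (p%:Z - 1) * (1 + (-1) ^+ (p.-1)./2).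
Proof.
move=> pp p2; have two0 : (2%:R : 'F_p) != 0.
  apply/negP; rewrite -(dvdn_pcharf (pchar_Fp pp)) => /dvdn_leq; lia.
have := Fp_sqrtN1 pp p2; rewrite -signr_odd; case: (odd _) => /= H.
  rewrite expr1 subrr mulr0 addr0 nsq2_0_nonsquare // => i.
  by apply/eqP => ii; have : ~~ true by apply/H; exists i.
have [i ii] : exists i : 'F_p, i ^+ 2 = -1 by apply/H.
rewrite (nsq2_0_square two0 ii) card_Fp // expr0; lia.
Qed.

(** Two of the variables are grouped. By [nsq2_const], every nonzero value is taken [A = p - eps]
    times, so the recursion has the coefficient [nsq2 0 - A = p eps] on [nsq k 0], and [A]
    multiplies the total count [p^k]. *)
Lemma nsq_rec (p k : nat) : prime p -> (2 < p)%N ->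
  (nsq k.+2 (0 : 'F_p))%:Z = p%:Z * (-1) ^+ (p.-1)./2 * (nsq k (0 : 'F_p))%:Z
     + p%:Z ^+ k * (p%:Z - (-1) ^+ (p.-1)./2).
Proof.
move=> pp p2; set eps := (-1) ^+ _ : int.
have op : odd p by have := even_prime pp; lia.
have oF : odd #|'F_p| by rewrite card_Fp.
have h0 := nsq2_Fp pp p2; rewrite -/eps in h0.
set A := nsq2 (1 : 'F_p).
have hA : A%:Z = p%:Z - eps.
  have := sum_nsq2 'F_p; rewrite (bigD1 0) //= card_Fp //.
  under eq_bigr => w w0 do rewrite (nsq2_const oF w0) -/A.
  rewrite sum_nat_const.
  have -> : #|[pred w : 'F_p | w != 0]| = p.-1.
    by rewrite -[in RHS](card_Fp pp) -(cardC1 (0 : 'F_p)); apply: eq_card.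
  move=> /(congr1 Posz); rewrite PoszD PoszM h0 -mulnn PoszM => H.
  apply: (mulfI (x := p%:Z - 1)); first by lia.
  have Hp : (p.-1)%:Z = p%:Z - 1 by lia.
  rewrite Hp in H; move: H; nia.
rewrite nsqSS (bigD1 0) //= subr0.
under eq_bigr => w w0 do rewrite (nsq2_const oF w0) -/A sub0r.
rewrite -big_distrr /=.
have := sum_nsq 'F_p k; rewrite (reindex_inj oppr_inj) (bigD1 0) //= oppr0 card_Fp //.
move=> /(congr1 Posz); rewrite PoszD => Hk.
rewrite PoszD !PoszM hA h0; move: Hk; set S := (\sum_(i | _) _)%N => Hk.
have -> : S%:Z = p%:Z ^+ k - (nsq k (0 : 'F_p))%:Z.
  have PE : Posz (p ^ k) = p%:Z ^+ k by rewrite -natz natrX natz.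
  by rewrite -PE -Hk; ring.
by ring.
Qed.

Lemma nsq_odd (p m : nat) : prime p -> (2 < p)%N ->
  (nsq m.*2.+1 (0 : 'F_p))%:Z = p%:Z ^+ m.*2.
Proof.
move=> pp p2; elim: m => [|m IH].
  rewrite expr0 /=; congr Posz.
  rewrite (bigD1 0) //= expr0n subr0 eqxx big1 // => u u0.
  by rewrite sub0r oppr_eq0 sqrf_eq0 (negPf u0).
rewrite doubleS nsq_rec // IH !exprS; ring.
Qed.

Lemma nsq_even (p m : nat) : prime p -> (2 < p)%N ->
  p%:Z * (nsq m.*2 (0 : 'F_p))%:Z
   = p%:Z ^+ m.*2 + (-1) ^+ (m * (p.-1)./2) * (p%:Z - 1) * p%:Z ^+ m.
Proof.
move=> pp p2; elim: m => [|m IH].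
  by rewrite mul0n !expr0 /=; ring.
rewrite doubleS nsq_rec // mulSn exprD !exprS.
set e := (-1) ^+ (p.-1)./2.
transitivity (p%:Z * e * (p%:Z * (nsq m.*2 (0 : 'F_p))%:Z)
   + p%:Z * (p%:Z ^+ m.*2 * (p%:Z - e))); first by ring.
by rewrite IH; set g := (-1) ^+ (m * _); ring.
Qed.

(** Squaring is the identity on [F_2], so the quadratic form is a linear one. *)
Lemma nsq_F2 (k : nat) (c : 'F_2) : nsq k.+1 c = (2 ^ k)%N.
Proof.
rewrite /= (eq_bigr (fun u => nsq k (c - u))) => [|u _]; last first.
  by congr (nsq k (c - _)); have := expf_card u; rewrite card_Fp.
rewrite -[X in (X ^ _)%N](card_Fp (isT : prime 2)) -sum_nsq.
by rewrite [RHS](reindex_inj (subrI c)).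
Qed.

(** * Multiplicativity of Phi and its values at prime powers *)

Lemma card_tuple_split (k n a b : nat) (f : 'I_n -> 'I_a) (g : 'I_n -> 'I_b)
  (P : pred (k.-tuple 'I_a)) (Q : pred (k.-tuple 'I_b)) :
  (a * b)%N = n -> injective (fun x => (f x, g x)) ->
  #|[pred x : k.-tuple 'I_n | P (map_tuple f x) && Q (map_tuple g x)]| = (#|P| * #|Q|)%N.
Proof.
move=> abn fg.
pose h (x : k.-tuple 'I_n) := (map_tuple f x, map_tuple g x).
have hinj : injective h.
  move=> x y [H1 H2]; apply/eq_from_tnth => i; apply: fg.
  have e1 : map_tuple f x = map_tuple f y by apply: val_inj; exact: H1.
  have e2 : map_tuple g x = map_tuple g y by apply: val_inj; exact: H2.
  have := congr1 (fun t : k.-tuple _ => tnth t i) e1.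
  have := congr1 (fun t : k.-tuple _ => tnth t i) e2.
  by rewrite !tnth_map => -> ->.
have hbij : bijective h.
  by apply: inj_card_bij => //; rewrite card_prod !card_tuple !card_ord -expnMn abn.
rewrite -cardX -(card_bij_preim _ hbij).
by apply: eq_card => x; rewrite !inE.
Qed.

Lemma sum_sq_modn (k n a : nat) (x : k.-tuple 'I_n) (f : 'I_n -> 'I_a) :
  (forall i, f i = i %% a :> nat)%N ->
  \sum_(i < k) tnth (map_tuple f x) i ^ 2 = \sum_(i < k) tnth x i ^ 2 %[mod a].
Proof.
move=> fm; elim/big_ind2: _ => // [x1 x2 y1 y2 H1 H2|i _].
  by rewrite -modnDm H1 H2 modnDm.
by rewrite tnth_map fm modnXm.
Qed.

Lemma coprime_sum_sq (k n a : nat) (x : k.-tuple 'I_n) (f : 'I_n -> 'I_a) :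
  (forall i, f i = i %% a :> nat)%N ->
  coprime (\sum_(i < k) tnth (map_tuple f x) i ^ 2) a
  = coprime (\sum_(i < k) tnth x i ^ 2) a.
Proof. by move=> fm; rewrite -coprime_modl sum_sq_modn // coprime_modl. Qed.

Lemma Phi_coprime (k a b : nat) : (0 < a)%N -> (0 < b)%N -> coprime a b ->
  Phi k (a * b) = (Phi k a * Phi k b)%N.
Proof.
move=> a0 b0 cab.
pose f (i : 'I_(a * b)) : 'I_a := Ordinal (ltn_pmod i a0).
pose g (i : 'I_(a * b)) : 'I_b := Ordinal (ltn_pmod i b0).
rewrite /Phi -(@card_tuple_split k _ _ _ f g) //.
  apply: eq_card => x; rewrite !inE /= -/(coprime _ _) -!/(coprime _ _) coprimeMr.
  by rewrite !coprime_sum_sq.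
move=> x y [H1 H2]; apply: val_inj => /=.
have := chinese_remainder cab x y; rewrite H1 H2 !eqxx /= => /eqP.
by rewrite !modn_small.
Qed.

(** Each residue modulo [p^(e+1)] splits into its remainder and quotient by [p]; the gcd condition
    sees only the remainders, and the quotients are free. *)
Lemma Phi_prime_power (k p e : nat) : prime p ->
  Phi k (p ^ e.+1) = (Phi k p * p ^ (e * k))%N.
Proof.
move=> pp; have p0 := prime_gt0 pp.
pose f (i : 'I_(p ^ e.+1)) : 'I_p := Ordinal (ltn_pmod i p0).
have glt (i : 'I_(p ^ e.+1)) : (i %/ p < p ^ e)%N.
  by rewrite ltn_divLR // -expnSr.
pose g (i : 'I_(p ^ e.+1)) : 'I_(p ^ e) := Ordinal (glt i).
have -> : (p ^ (e * k))%N = #|(predT : pred (k.-tuple 'I_(p ^ e)))|.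
  by rewrite -[LHS]/(_ ^ _)%N cardT -cardT card_tuple card_ord expnM.
rewrite /Phi -(@card_tuple_split k _ _ _ f g) ?expnS //.
  apply: eq_card => x; rewrite !inE /= andbT -/(coprime _ _) -!/(coprime _ _).
  by rewrite coprime_pexpr // coprime_sum_sq.
move=> x y [H1 H2]; apply: val_inj => /=.
by rewrite (divn_eq x p) (divn_eq y p) H1 H2.
Qed.

Lemma Phi_prime (k p : nat) : prime p -> (Phi k p + nsq k (0 : 'F_p)%R = p ^ k)%N.
Proof.
move=> pp; have p1 := prime_gt1 pp.
pose f (i : 'I_p) : 'F_p := i%:R.
have finj : injective f.
  move=> i j H; apply: val_inj => /=.
  have := congr1 (fun x : 'F_p => (x : nat)) H; rewrite /f /= !val_Fp_nat //.
  by rewrite !modn_small.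
pose h (x : k.-tuple 'I_p) : k.-tuple 'F_p := map_tuple f x.
have hinj : injective h.
  move=> x y H; apply/eq_from_tnth => i; apply: finj.
  by have := congr1 (fun t : k.-tuple _ => tnth t i) H; rewrite !tnth_map.
have hbij : bijective h.
  by apply: inj_card_bij => //; rewrite !card_tuple card_Fp // card_ord.
rewrite -nsq_card -(card_bij_preim _ hbij) /Phi.
have -> : (p ^ k)%N = #|{: k.-tuple 'I_p}| by rewrite card_tuple card_ord.
rewrite -[RHS](cardC [pred x : k.-tuple 'I_p | gcdn (\sum_(i < k) tnth x i ^ 2) p == 1%N]).
congr (_ + _)%N; apply: eq_card => x; rewrite !inE /=.
rewrite big_map big_tuple -/(coprime _ _) coprime_sym prime_coprime // negbK.
rewrite (dvdn_pcharf (pchar_Fp pp)) natr_sum; congr (_ == _).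
by apply: eq_bigr => i _; rewrite natrX.
Qed.

(* [nu R k p] is the proportion of [x] in [(Z/p)^k] with [x_1^2 + ... + x_k^2 = 0]. *)
Definition nu (R : realType) (k p : nat) : R :=
  if odd k || (p == 2) then 1 / p%:R
  else 1 / p%:R + (-1) ^+ ((k * (p - 1)) %/ 4) * (p%:R - 1) / p%:R ^+ (k %/ 2 + 1).

Lemma nu_nsq (R : realType) (k p : nat) : (0 < k)%N -> prime p ->
  (nsq k (0 : 'F_p))%:R = p%:R ^+ k * nu R k p.
Proof.
move=> k0 pp; have pR : p%:R != 0 :> R by rewrite pnatr_eq0 -lt0n prime_gt0.
rewrite /nu; have [p2|p2] := eqVneq p 2.
  rewrite orbT p2; case: k k0 => // k _; rewrite nsq_F2 natrX exprSr.
  by rewrite mulrA mulr1 mulfK // -p2.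
have {}p2 : (2 < p)%N by have := prime_gt1 pp; lia.
rewrite orbF; have [ok|ek] := boolP (odd k).
  have kE : k = (k./2).*2.+1 by lia.
  have := nsq_odd (k./2) pp p2; rewrite -kE => H.
  rewrite -[LHS]/((nsq k (0 : 'F_p))%:Z%:~R) H rmorphXn /=.
  have -> : p%:R ^+ k = p%:R ^+ k./2.*2 * p%:R :> R by rewrite -exprSr -kE.
  by rewrite mulrA mulr1 mulfK.
have kE : k = (k./2).*2 by lia.
have op : odd p by have := even_prime pp; lia.
have e1 : ((k * (p - 1)) %/ 4 = k./2 * (p.-1)./2)%N.
  rewrite {1}kE (_ : (p - 1 = (p.-1)./2.*2)%N); last by lia.
  by rewrite -!mul2n mulnACA mulKn.
have := nsq_even (k./2) pp p2; rewrite -kE -e1 => H.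
have := congr1 (fun z : int => z%:~R : R) H; rewrite /= !(rmorphD, rmorphM, rmorphXn, rmorphN) /=.
rewrite -!pmulrn ?mulr1n => H2.
apply: (mulfI pR); rewrite H2.
have -> : p%:R ^+ k = p%:R ^+ k./2 * p%:R ^+ k./2 :> R by rewrite -exprD addnn -kE.
rewrite -divn2 exprD expr1; field.
by rewrite pR expf_neq0.
Qed.

Lemma Phi_prod (R : realType) (k n : nat) : (0 < k)%N -> (0 < n)%N ->
  (Phi k n)%:R = n%:R ^+ k * \prod_(p <- primes n) (1 - nu R k p) :> R.
Proof.
move=> k0; elim/ltn_ind: n => n IH n0.
have [n1|n1] := leqP n 1.
  have -> : n = 1%N by lia.
  rewrite big_nil mulr1 expr1n /Phi.
  have -> : #|[pred x : k.-tuple 'I_1 | gcdn (\sum_(i < k) tnth x i ^ 2) 1 == 1%N]|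
     = #|{: k.-tuple 'I_1}| by apply: eq_card => x; rewrite !inE gcdn1.
  by rewrite card_tuple card_ord exp1n.
set p := pdiv n; have pp : prime p := pdiv_prime n1.
have pn : (p %| n)%N := pdiv_dvd n.
set m := (n`_p^')%N; have m0 : (0 < m)%N := part_gt0 _ _.
set e := (logn p n).-1.
have e1 : logn p n = e.+1 by rewrite prednK // logn_gt0 mem_primes pp n0.
have nE : (p ^ e.+1 * m)%N = n by rewrite -e1 -p_part partnC.
have cpm : coprime p m by rewrite prime_coprime // -p'natE // part_pnat.
have pe0 : (0 < p ^ e.+1)%N by rewrite expn_gt0 prime_gt0.
have mn : (m < n)%N.
  by rewrite -nE -{1}[m]mul1n ltn_pmul2r // (ltn_exp2l 0) ?prime_gt1.
have pr : perm_eq (primes n) (p :: primes m).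
  apply: uniq_perm; rewrite ?primes_uniq //=.
    by rewrite primes_uniq andbT mem_primes pp m0 /= -prime_coprime.
  by move=> q; rewrite -nE primesM // primesX // primes_prime // inE.
rewrite (perm_big _ pr) big_cons /=.
rewrite -{1}nE Phi_coprime ?coprimeXl // natrM Phi_prime_power // natrM (IH m) //.
have := congr1 (fun i : nat => i%:R : R) (Phi_prime k pp); rewrite /= natrD nu_nsq // => H.
have -> : (Phi k p)%:R = p%:R ^+ k * (1 - nu R k p) :> R.
  by rewrite natrX in H; rewrite mulrBr mulr1 -{1}H addrK.
rewrite -nE [in RHS]natrM exprMn [(p ^ e.+1)%:R]natrX -exprM mulSn exprD natrX; ring.
Qed.

(** * The even case *)

Lemma mulf_ind (P : nat -> Prop) : P 1%N ->
  (forall p m, prime p -> (0 < m)%N -> ~~ (p %| m)%N -> P m -> P (p * m)%N) ->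
  (forall p d, prime p -> (0 < d)%N -> (p %| d)%N -> logn p d != 1%N -> P d) ->
  forall d, (0 < d)%N -> P d.
Proof.
move=> P1 Pm Psq; elim/ltn_ind => d IH d0.
have [d1|d1] := leqP d 1; first by rewrite (_ : d = 1%N) //; apply/eqP; rewrite eqn_leq d1 d0.
have pp := pdiv_prime d1; have pd := pdiv_dvd d; set p := pdiv d in pp pd.
have [l1|l1] := eqVneq (logn p d) 1%N; last exact: Psq l1.
have [m pm dE] := pfactor_coprime pp d0; rewrite l1 expn1 in dE.
have m0 : (0 < m)%N by move: d0; rewrite dE muln_gt0 => /andP[].
rewrite dE mulnC; apply: Pm => //; first by rewrite -prime_coprime.
by apply: IH => //; rewrite dE -{1}[m]muln1 ltn_pmul2l // prime_gt1.
Qed.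

Lemma mulf_divr (R : realType) (u : nat -> R) (d : nat) : (0 < d)%N ->
  mulf (fun p => u p / p%:R) d = mulf u d / d%:R.
Proof.
move: d; apply: mulf_ind; first by rewrite !mulf1 divr1.
- by move=> p m pp m0 pm IH; rewrite !mulf_pmul // IH natrM invfM mulrACA.
- by move=> p d pp d0 pd l; rewrite !(mulf_sq _ pp d0 pd l) mul0r.
Qed.

Lemma norm_mulf (R : realType) (u : nat -> R) (d : nat) : `|mulf u d| = mulf (fun p => `|u p|) d.
Proof.
rewrite /mulf; elim: (primes d) => [|p s IH]; first by rewrite !big_nil normr1.
by rewrite !big_cons normrM IH; congr (_ * _); case: ifP; rewrite ?normr0.
Qed.

Lemma ler_mulf (R : realType) (u v : nat -> R) (d : nat) : (0 < d)%N ->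
  (forall p, prime p -> 0 <= u p <= v p) -> 0 <= mulf u d <= mulf v d.
Proof.
move=> d0 uv; move: d d0; apply: mulf_ind; first by rewrite !mulf1 ler01 lexx.
- move=> p m pp m0 pm /andP[h1 h2]; rewrite !mulf_pmul //; have /andP[u0 u1] := uv p pp.
  by rewrite mulr_ge0 //=; apply: ler_pM.
- by move=> p d pp d0 pd l; rewrite !(mulf_sq _ pp d0 pd l) lexx.
Qed.

Lemma sum_divisors_pX (V : nmodType) (F : nat -> V) (p a m : nat) : prime p -> (0 < m)%N ->
  ~~ (p %| m)%N ->
  \sum_(b <- divisors (p ^ a.+1 * m)) F b
  = \sum_(b <- divisors (p ^ a * m)) F b + \sum_(b <- divisors m) F (p ^ a.+1 * b)%N.
Proof.
move=> pp m0 pm; have p0 := prime_gt0 pp.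
have pX0 i : (0 < p ^ i)%N by rewrite expn_gt0 p0.
have n0 i : (0 < p ^ i * m)%N by rewrite muln_gt0 pX0.
rewrite (bigID (fun b => p ^ a.+1 %| b)%N) /= addrC; congr (_ + _).
  rewrite -big_filter; apply: perm_big; apply: uniq_perm; rewrite ?filter_uniq ?divisors_uniq //.
  move=> b; rewrite mem_filter -!dvdn_divisors //; apply/andP/idP.
    case=> pb bn; have b0 := dvdn_gt0 (n0 _) bn.
    have [b' pb' bE] := pfactor_coprime pp b0; set i := logn p b in bE.
    have ia : (i <= a)%N.
      by rewrite leqNgt; apply: contra pb => h; rewrite bE dvdn_mull // dvdn_exp2l.
    have b'm : (b' %| m)%N.
      rewrite -(@Gauss_dvdr b' (p ^ a.+1) m); last by rewrite coprime_sym coprimeXl.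
      by apply: dvdn_trans bn; rewrite bE dvdn_mulr.
    by rewrite bE mulnC dvdn_mul // dvdn_exp2l.
  move=> bn; split; last by apply: dvdn_trans bn _; rewrite dvdn_mul // dvdn_exp2l.
  apply: contra pm => h; have := dvdn_trans h bn; rewrite expnSr dvdn_pmul2l //.
rewrite -big_filter (perm_big [seq (p ^ a.+1 * b)%N | b <- divisors m]) /=; first by rewrite big_map.
apply: uniq_perm; rewrite ?filter_uniq ?divisors_uniq //.
  rewrite map_inj_in_uniq ?divisors_uniq // => x y _ _ /eqP.
  by rewrite eqn_pmul2l // => /eqP.
move=> b; rewrite mem_filter -dvdn_divisors //; apply/idP/mapP.
  case/andP=> /dvdnP[b' bE] bn; exists b'; last by rewrite bE mulnC.
  by rewrite -dvdn_divisors // -(@dvdn_pmul2l (p ^ a.+1)) // mulnC -bE.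
by case=> b'; rewrite -dvdn_divisors // => bm ->; rewrite dvdn_mulr // dvdn_pmul2l.
Qed.

Lemma sum_divisors_pmul (V : nmodType) (F : nat -> V) (p m : nat) : prime p -> (0 < m)%N ->
  ~~ (p %| m)%N ->
  \sum_(b <- divisors (p * m)) F b
  = \sum_(b <- divisors m) F b + \sum_(b <- divisors m) F (p * b)%N.
Proof.
by move=> pp m0 pm; have := sum_divisors_pX F 0 pp m0 pm; rewrite expn1 expn0 mul1n.
Qed.

Lemma divn_dvd_gt0 (d n : nat) : (0 < n)%N -> (d %| n)%N -> (0 < n %/ d)%N.
Proof. by move=> n0 dn; have d0 := dvdn_gt0 n0 dn; rewrite divn_gt0 //; exact: dvdn_leq. Qed.

(** Expanding the product over primes gives equality for squarefree [d]; for other [d] the left side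
    vanishes and the right side is nonnegative. *)
Lemma mulfD_le (R : realType) (u v : nat -> R) (d : nat) : (0 < d)%N ->
  (forall p, prime p -> 0 <= u p) -> (forall p, prime p -> 0 <= v p) ->
  mulf (fun p => u p + v p) d <= \sum_(c <- divisors d) mulf u (d %/ c) * mulf v c.
Proof.
move=> d0 u0 v0.
have mu0 w n : (0 < n)%N -> (forall p, prime p -> 0 <= w p) -> 0 <= mulf w n :> R.
  by move=> n0 w0; have /andP[] := @ler_mulf R w w n n0 (fun p pp => introT andP (conj (w0 p pp) (lexx _))).
move: d d0; apply: mulf_ind.
- by rewrite (_ : divisors 1 = [:: 1%N]) // big_seq1 divn1 !mulf1 mulr1.
- move=> p m pp m0 pm IH; have p0 := prime_gt0 pp.
  rewrite mulf_pmul // sum_divisors_pmul // mulrDl; apply: lerD.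
    apply: le_trans (ler_wpM2l (u0 p pp) IH) _; rewrite mulr_sumr big_seq [leRHS]big_seq.
    apply: ler_sum => c; rewrite -dvdn_divisors // => cm.
    rewrite -muln_divA // mulf_pmul ?mulrA //.
      exact: divn_dvd_gt0.
    by apply: contra pm => h; apply: dvdn_trans h _; exact: dvdn_div.
  apply: le_trans (ler_wpM2l (v0 p pp) IH) _; rewrite mulr_sumr big_seq [leRHS]big_seq.
  apply: ler_sum => c; rewrite -dvdn_divisors // => cm.
  rewrite divnMl // mulf_pmul; [by rewrite mulrCA | by [] | exact: dvdn_gt0 cm |].
  by apply: contra pm => h; exact: dvdn_trans cm.
- move=> p d pp d0 pd l; rewrite (mulf_sq _ pp d0 pd l) big_seq sumr_ge0 // => c.
  rewrite -dvdn_divisors // => cd; have c0 := dvdn_gt0 d0 cd.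
  by rewrite mulr_ge0 // mu0 // divn_dvd_gt0.
Qed.

(** The nonprincipal Dirichlet character modulo 4. *)
Definition chi4 (R : realType) (n : nat) : R := if odd n then (-1) ^+ n./2 else 0.

Lemma chi4M (R : realType) (a b : nat) : chi4 R (a * b) = chi4 R a * chi4 R b.
Proof.
rewrite /chi4 oddM; case oa : (odd a); last by rewrite mul0r.
case ob : (odd b); last by rewrite mulr0.
rewrite /= -exprD; have -> : ((a * b)./2 = a./2 + b./2 + 2 * (a./2 * b./2))%N.
  have := odd_double_half a; have := odd_double_half b; rewrite oa ob.
  move: a./2 b./2 => i j <- <-; rewrite -!muln2; nia.
by rewrite exprD [(-1) ^+ (2 * _)]exprM sqrrN !expr1n mulr1.
Qed.

Lemma chi4X (R : realType) (a n : nat) : chi4 R (a ^ n) = chi4 R a ^+ n.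
Proof. by elim: n => [|n IH]; rewrite ?expn0 // expnS chi4M IH exprS. Qed.

Lemma chi4_cases (R : realType) (n : nat) : [\/ chi4 R n = 0, chi4 R n = 1 | chi4 R n = -1].
Proof.
rewrite /chi4; case: ifP => _; last by constructor 1.
by rewrite -signr_odd; case: (odd n./2); [constructor 3 | constructor 2]; rewrite ?expr1 ?expr0.
Qed.

(** The convolution [1 * chi_4]; for [n > 0] a quarter of the number of representations of [n] as a
    sum of two squares. *)
Definition rep4 (R : realType) (n : nat) : R := \sum_(b <- divisors n) chi4 R b.

Lemma rep4_pX (R : realType) (p a m : nat) : prime p -> (0 < m)%N -> ~~ (p %| m)%N ->
  rep4 R (p ^ a * m) = (\sum_(i < a.+1) chi4 R p ^+ i) * rep4 R m.
Proof.
move=> pp m0 pm; elim: a => [|a IH]; first by rewrite expn0 mul1n big_ord1 expr0 mul1r.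
rewrite [LHS]/rep4 sum_divisors_pX // big_ord_recr /= [RHS]mulrDl -IH; congr (_ + _).
by rewrite /rep4 mulr_sumr; apply: eq_bigr => b _; rewrite chi4M chi4X.
Qed.

(** By multiplicativity it suffices to look at prime powers, where the sum is geometric with ratio
    0, 1 or -1. *)
Lemma rep4_ge0 (R : realType) (n : nat) : (0 < n)%N -> 0 <= rep4 R n.
Proof.
elim/ltn_ind: n => n IH n0.
have [n1|n1] := leqP n 1.
  rewrite (_ : n = 1%N); last by apply/eqP; rewrite eqn_leq n1 n0.
  by rewrite /rep4 (_ : divisors 1 = [:: 1%N]) // big_seq1 /chi4 /= expr0.
have pp := pdiv_prime n1; have pd := pdiv_dvd n; set p := pdiv n in pp pd.
have [m pm nE] := pfactor_coprime pp n0.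
have m0 : (0 < m)%N by move: n0; rewrite nE muln_gt0 => /andP[].
have l0 : (0 < logn p n)%N by rewrite logn_gt0 mem_primes pp n0.
rewrite nE mulnC rep4_pX //; last by rewrite -prime_coprime.
apply: mulr_ge0; last first.
  by apply: IH => //; rewrite [X in (_ < X)%N]nE -{1}[m]muln1 ltn_pmul2l // -(expn0 p) ltn_exp2l // prime_gt1.
have [->|->|->] := chi4_cases R p.
- by apply: sumr_ge0 => i _; rewrite exprn_ge0.
- by apply: sumr_ge0 => i _; rewrite expr1n.
suff E k : \sum_(i < k) (-1) ^+ i = (odd k)%:R :> R by rewrite E.
elim: k => [|k IHk]; first by rewrite big_ord0.
by rewrite big_ord_recr /= IHk -signr_odd; case: (odd k); rewrite /= ?expr1 ?expr0 ?subrr ?add0r.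
Qed.

Lemma mulf_rep4 (R : realType) (n : nat) : (0 < n)%N ->
  mulf (fun p => 1 + chi4 R p) n <= rep4 R n.
Proof.
move: n; apply: mulf_ind.
- by rewrite mulf1 /rep4 (_ : divisors 1 = [:: 1%N]) // big_seq1 /chi4 /= expr0.
- move=> p m pp m0 pm IH; rewrite mulf_pmul //.
  have := rep4_pX R 1 pp m0 pm; rewrite expn1 big_ord_recr big_ord1 /= expr0 expr1 => ->.
  by apply: ler_wpM2l => //; have [->|->|->] := chi4_cases R p; rewrite ?addr0 ?subrr.
- by move=> p d pp d0 pd l; rewrite (mulf_sq _ pp d0 pd l) rep4_ge0.
Qed.

(** Partial sums of Leibniz's series [1 - 1/3 + 1/5 - ...]. The invariant brackets them between 0
    and 1, with a margin of one term on the side towards which the next term moves. *)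
Lemma sum_chi4_le1 (R : realType) (n : nat) : \sum_(1 <= b < n.+1) chi4 R b / b%:R <= 1.
Proof.
pose T m := \sum_(1 <= b < (2 * m).+1) chi4 R b / b%:R.
have TS m : T m.+1 = T m + (-1) ^+ m / (2 * m%:R + 1).
  rewrite /T (_ : (2 * m.+1)%N = (2 * m).+2); last by lia.
  rewrite big_nat_recr //= big_nat_recr //= /chi4 /= negbK oddM /= mul0r addr0.
  rewrite (_ : uphalf (2 * m) = m); last by rewrite mul2n uphalf_double.
  by rewrite -[(2 * m).+1%:R]natr1 natrM.
have pos m : 0 < 2 * m%:R + 1 :> R by rewrite ltr_wpDl // mulr_ge0.
have dec m : (2 * m.+1%:R + 1)^-1 <= (2 * m%:R + 1)^-1 :> R.
  by rewrite lef_pV2 ?posrE // lerD2r ler_pM2l // ler_nat.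
have inv m : (if odd m then (2 * m%:R + 1)^-1 <= T m <= 1
              else 0 <= T m <= 1 - (2 * m%:R + 1)^-1).
  elim: m => [|m IH].
    by rewrite /T big_geq //= mulr0 add0r invr1 subrr lexx.
  have := dec m; move: IH; rewrite /= TS -signr_odd; case: (odd m) => /= /andP[h1 h2] h3.
    rewrite expr1 mulN1r; apply/andP; split; first by rewrite subr_ge0.
    by move: h2 h3; move: (T m) (_^-1) (_^-1) => *; lra.
  rewrite expr0 mul1r; apply/andP; split.
    by move: h1 h3; move: (T m) (_^-1) (_^-1) => *; lra.
  by move: h2; move: (T m) (_^-1) => *; lra.
have T1 m : T m <= 1.
  have := inv m; case: ifP => _ /andP[h1 h2] //; apply: le_trans h2 _.
  by rewrite gerBl invr_ge0 ltW.
have [on|en] := boolP (odd n); last first.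
  have := T1 n./2; rewrite /T mul2n even_halfK // negbTE //.
have := T1 (n./2).+1; rewrite /T; have -> : (2 * (n./2).+1)%N = n.+1.
  by have := odd_double_half n; rewrite on -muln2; lia.
by rewrite big_nat_recr //= {2}/chi4 /= on mul0r addr0.
Qed.

Lemma sum_divisors_inv (V : nmodType) (F : nat -> V) (n : nat) : (0 < n)%N ->
  \sum_(d <- divisors n) F d = \sum_(d <- divisors n) F (n %/ d)%N.
Proof.
move=> n0; have inv d : (d %| n)%N -> (n %/ (n %/ d) = d)%N.
  by move=> dn; have q0 := divn_dvd_gt0 n0 dn; rewrite -{1}(divnK dn) mulKn.
rewrite (perm_big [seq (n %/ d)%N | d <- divisors n]) /=; first by rewrite big_map.
apply: uniq_perm; rewrite ?divisors_uniq //.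
  rewrite map_inj_in_uniq ?divisors_uniq // => x y; rewrite -!dvdn_divisors // => xn yn h.
  by rewrite -(inv x xn) h inv.
move=> d; rewrite -dvdn_divisors //; apply/idP/mapP.
  by move=> dn; exists (n %/ d)%N; rewrite ?inv // -dvdn_divisors // dvdn_div.
by case=> e; rewrite -dvdn_divisors // => en ->; exact: dvdn_div.
Qed.

(** Opening the convolution, the inner sum over [chi4] is at most 1 whatever its length, so only the
    harmonic sum over the complementary divisor remains. *)
Lemma sum_rep4_le (R : realType) (X : nat) : (0 < X)%N ->
  \sum_(1 <= e < X.+1) rep4 R e / e%:R <= 1 + ln X%:R.
Proof.
move=> X0; have -> : \sum_(1 <= e < X.+1) rep4 R e / e%:R
   = \sum_(1 <= e < X.+1) \sum_(a <- divisors e) (a%:R)^-1 * (chi4 R (e %/ a) / (e %/ a)%:R).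
  rewrite big_nat [RHS]big_nat; apply: eq_bigr => e /andP[e0 _].
  rewrite /rep4 sum_divisors_inv // mulr_suml big_seq [RHS]big_seq; apply: eq_bigr => a.
  rewrite -dvdn_divisors // => ae; rewrite mulrCA -invfM -natrM mulnC divnK //.
rewrite (sum_divisors_swap (fun a b => (a%:R)^-1 * (chi4 R b / b%:R))).
apply: le_trans (harmonic_le1 R X0); apply: ler_sum => a _; rewrite -mulr_sumr -[leRHS]mulr1.
by apply: ler_wpM2l; [rewrite invr_ge0 | exact: sum_chi4_le1].
Qed.

Lemma sum_inv_sq_le2 (R : realType) (X : nat) : \sum_(1 <= c < X.+1) (c%:R ^+ 2)^-1 <= 2 :> R.
Proof.
case: X => [|X]; first by rewrite big_geq.
rewrite big_ltn // expr1n invr1; have := @sum_inv_sq_tail R 1 X.+1 isT isT; rewrite invr1.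
have : 0 <= (X.+1%:R)^-1 :> R by rewrite invr_ge0.
by move: (\sum_(_ <= _ < _) _) (X.+1%:R^-1) => a b *; lra.
Qed.

(** The hypothesis on [w] makes [d |mulf w d|] at most the convolution of [r] with [1 / c]. Dividing
    by [d] turns the second factor into [1 / c^2], whose sum is at most 2, and the first is summed
    by hypothesis. *)
Lemma sum_abs_mulf_le (R : realType) (w u r : nat -> R) (X : nat) : (0 < X)%N ->
  (forall p, prime p -> 0 <= u p) -> (forall p, prime p -> `|w p| <= (u p + (p%:R)^-1) / p%:R) ->
  (forall n, (0 < n)%N -> mulf u n <= r n) -> (forall n, (0 < n)%N -> 0 <= r n) ->
  (forall Y, (0 < Y)%N -> \sum_(1 <= e < Y.+1) r e / e%:R <= 1 + ln Y%:R) ->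
  \sum_(1 <= d < X.+1) `|mulf w d| <= 2 * (1 + ln X%:R).
Proof.
move=> X0 u0 wu ur r0 sr.
have lX : 0 <= ln X%:R :> R := ln_nat_ge0 _ _.
apply: (@le_trans _ _ (\sum_(1 <= d < X.+1) \sum_(c <- divisors d)
   (c%:R ^+ 2)^-1 * (r (d %/ c)%N / (d %/ c)%:R))).
  rewrite big_nat [leRHS]big_nat; apply: ler_sum => d /andP[d0 _].
  have dR : 0 < d%:R :> R by rewrite ltr0n.
  rewrite norm_mulf.
  have /andP[_ h] := @ler_mulf R (fun p => `|w p|) (fun p => (u p + (p%:R)^-1) / p%:R) d d0
    (fun p pp => introT andP (conj (normr_ge0 _) (wu p pp))).
  apply: (le_trans h); rewrite (mulf_divr (fun p => u p + (p%:R)^-1)) // ler_pdivrMr //.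
  apply: le_trans (mulfD_le d0 u0 _) _; first by move=> p _; rewrite invr_ge0.
  rewrite mulr_suml big_seq [leRHS]big_seq; apply: ler_sum => c; rewrite -dvdn_divisors // => cd.
  have c0 := dvdn_gt0 d0 cd; have cR : 0 < c%:R :> R by rewrite ltr0n.
  have q0 : (0 < d %/ c)%N by rewrite divn_gt0 // dvdn_leq.
  have qR : 0 < (d %/ c)%:R :> R by rewrite ltr0n.
  have /andP[m0 m1] : 0 <= mulf (fun p => (p%:R)^-1 : R) c <= (c%:R)^-1.
    have -> : (fun p => (p%:R)^-1 : R) = (fun p => 1 / p%:R) by apply/funext => p; rewrite mul1r.
    rewrite (mulf_divr (fun=> 1)) //.
    have -> : mulf (fun=> 1 : R) c = `|mobius R c|.
      by rewrite norm_mulf; congr (mulf _ c); apply/funext => p; rewrite normrN normr1.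
    rewrite divr_ge0 ?(ltW cR) //= -[leRHS]mul1r; apply: ler_wpM2r; last exact: norm_mobius_le1.
    by rewrite invr_ge0 ltW.
  have /andP[u1 _] := @ler_mulf R u u (d %/ c) q0 (fun p pp => introT andP (conj (u0 p pp) (lexx _))).
  apply: le_trans (ler_pM u1 m0 (ur _ q0) m1) _; apply: eq_le_trivial.
  have -> : d%:R = (d %/ c)%:R * c%:R :> R by rewrite -natrM divnK.
  by field; rewrite !gt_eqF.
rewrite (sum_divisors_swap (fun c e => (c%:R ^+ 2)^-1 * (r e / e%:R))).
apply: (@le_trans _ _ (\sum_(1 <= c < X.+1) (c%:R ^+ 2)^-1 * (1 + ln X%:R))); last first.
  by rewrite -mulr_suml; apply: ler_wpM2r; [lra | exact: sum_inv_sq_le2].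
rewrite big_nat [leRHS]big_nat; apply: ler_sum => c /andP[c0 cX]; rewrite -mulr_sumr.
rewrite ltnS in cX; apply: ler_wpM2l; first by rewrite invr_ge0 exprn_ge0.
have q0 : (0 < X %/ c)%N by rewrite divn_gt0.
by apply: le_trans (sr _ q0) _; rewrite lerD2l ler_ln_nat // leq_div.
Qed.

(** For [k = 2] and odd [p] the sign is [chi4 p], and [nu] equals [(1 + chi4 p) / p - chi4 p / p^2];
    the factor [1 + chi4 p] must be kept, since bounding it by 2 would cost a further logarithm. For
    [k >= 4] the second term of [nu] is at most [p^(-2)]. *)
Lemma norm_nu_even (R : realType) (k p : nat) : ~~ odd k -> (0 < k)%N -> prime p ->
  `|nu R k p| <= ((if k == 2 then 1 + chi4 R p else 1) + (p%:R)^-1) / p%:R.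
Proof.
move=> ek k0 pp; have pR : 0 < p%:R :> R by rewrite ltr0n prime_gt0.
have p1 : 1 <= p%:R :> R by rewrite ler1n prime_gt0.
set q := (p%:R)^-1 : R; have q0 : 0 < q by rewrite invr_gt0.
have pq : p%:R * q = 1 by rewrite divff // gt_eqF.
rewrite /nu (negPf ek) /= mul1r -/q; have [p2|p2] := eqVneq p 2.
  have -> : (if k == 2 then 1 + chi4 R p else 1) = 1 by rewrite p2 /chi4 /= addr0; case: ifP.
  by rewrite gtr0_norm // mulrDl mul1r lerDl mulr_ge0 // ltW.
have op : odd p by case: (even_prime pp) p2 => // ->.
set e := (-1) ^+ _; have e1 : `|e| = 1 by rewrite /e normrX normrN normr1 expr1n.
have /andP[e2 e3] : -1 <= e <= 1 by rewrite -ler_norml e1.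
have [k2|k2] := eqVneq k 2.
  have eE : e = chi4 R p.
    rewrite /e /chi4 op k2; congr (_ ^+ _); have := odd_double_half p; rewrite op -muln2.
    by move: p./2 => h; lia.
  have -> : e * (p%:R - 1) / p%:R ^+ (k %/ 2 + 1) = e * q - e * q ^+ 2.
    by rewrite k2 (_ : (2 %/ 2 + 1 = 2)%N) // /q; field; rewrite gt_eqF.
  rewrite -eE mulrDl mulrDl mul1r -expr2.
  have h1 : - q ^+ 2 <= e * q ^+ 2 <= q ^+ 2.
    have q20 : 0 <= q ^+ 2 by rewrite exprn_ge0 // ltW.
    apply/andP; split; first by rewrite -mulN1r; apply: ler_wpM2r.
    by rewrite -[leRHS]mul1r; apply: ler_wpM2r.
  have h2 : 0 <= q + e * q by rewrite -{1}[q]mul1r -mulrDl mulr_ge0 ?(ltW q0) //; lra.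
  by case/andP: h1 => *; rewrite ler_norml; apply/andP; split; lra.
have k4 : (2 <= k %/ 2)%N by move: k0 ek k2; lia.
rewrite mulrDl mul1r; apply: le_trans (ler_normD _ _) _; rewrite gtr0_norm // lerD2l.
rewrite normrM normrM e1 mul1r normfV normrX (gtr0_norm pR) ger0_norm ?subr_ge0 //.
rewrite addn1 exprS invfM mulrA.
apply: (@le_trans _ _ (1 * (p%:R ^+ (k %/ 2))^-1)).
  by apply: ler_wpM2r; [rewrite invr_ge0 exprn_ge0 // ltW | rewrite ler_pdivrMr // mul1r gerBl].
rewrite mul1r -invfM -expr2 lef_pV2 ?posrE ?exprn_gt0 // ler_weXn2l //.
Qed.

Lemma sum_abs_even (R : realType) (k X : nat) : ~~ odd k -> (0 < k)%N -> (0 < X)%N ->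
  \sum_(1 <= d < X.+1) `|mulf (fun p => - nu R k p) d| <= 2 * (1 + ln X%:R).
Proof.
move=> ek k0 X0.
have hw p : prime p -> `|- nu R k p| <= ((if k == 2 then 1 + chi4 R p else 1) + (p%:R)^-1) / p%:R.
  by rewrite normrN; exact: norm_nu_even.
have [k2|k2] := eqVneq k 2.
  rewrite k2 eqxx in hw; rewrite k2.
  apply: (@sum_abs_mulf_le R _ (fun p => 1 + chi4 R p) (rep4 R)) => //.
  - by move=> p _; have [->|->|->] := chi4_cases R p; rewrite ?addr0 ?subrr.
  - exact: mulf_rep4.
  - exact: rep4_ge0.
  - exact: sum_rep4_le.
rewrite (negPf k2) in hw.
apply: (@sum_abs_mulf_le R _ (fun=> 1) (fun=> 1)) => //.
- move=> n n0; have -> : mulf (fun=> 1 : R) n = `|mobius R n|.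
    by rewrite norm_mulf; congr (mulf _ n); apply/funext => p; rewrite normrN normr1.
  exact: norm_mobius_le1.
- move=> Y Y0; under eq_bigr do rewrite mul1r; exact: harmonic_le1.
Qed.

(** On the block from [D = 2^i X] to [2 D] the sum is at most [C (1 + ln (2 D)) / D]; the constant 6
    is the sum of the series [(i + 2) / 2^i]. *)
Lemma dyadic_tail (R : realType) (f : nat -> R) (C : R) : 0 <= C -> (forall n, 0 <= f n) ->
  (forall X, (0 < X)%N -> \sum_(1 <= d < X.+1) f d <= C * (1 + ln X%:R)) ->
  forall X Y, (0 < X)%N -> \sum_(X.+1 <= d < Y.+1) f d / d%:R <= 6 * C * (1 + ln X%:R) / X%:R.
Proof.
move=> C0 f0 H X Y X0; have XR : 0 < X%:R :> R by rewrite ltr0n.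
have lX : 0 <= ln X%:R :> R := ln_nat_ge0 _ _.
have fd n : 0 <= f n / n%:R by rewrite divr_ge0.
have YI : (Y <= X * 2 ^ Y)%N by rewrite (leq_trans (ltnW (ltn_expl Y (ltnSn 1)))) // leq_pmull.
apply: (@le_trans _ _ (\sum_(X.+1 <= d < (X * 2 ^ Y).+1) f d / d%:R)).
  have [XY|XY] := leqP X Y; last by rewrite big_geq ?sumr_ge0 // ltnW.
  rewrite [leRHS](@big_cat_nat _ _ _ Y.+1) //= ?ltnS // lerDl sumr_ge0 //.
rewrite sum_dyadic.
set K := C * (1 + ln X%:R) / X%:R.
have K0 : 0 <= K by rewrite divr_ge0 ?mulr_ge0 //; lra.
apply: (@le_trans _ _ (\sum_(i < Y) K * (i.+2%:R / 2 ^+ i))).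
  apply: ler_sum => i _; set D := (X * 2 ^ i)%N.
  have D0 : (0 < D)%N by rewrite muln_gt0 X0 expn_gt0.
  have DR : 0 < D%:R :> R by rewrite ltr0n.
  have pR : 0 < 2 ^+ i :> R by rewrite exprn_gt0.
  apply: (@le_trans _ _ (\sum_(D.+1 <= d < (2 * D).+1) f d * (D%:R)^-1)).
    rewrite big_nat [leRHS]big_nat; apply: ler_sum => d /andP[Dd _]; apply: ler_wpM2l => //.
    by rewrite lef_pV2 ?posrE ?ltr0n ?(leq_ltn_trans _ Dd) // ler_nat ltnW.
  rewrite -mulr_suml; apply: (@le_trans _ _ (C * (1 + ln (2 * D)%:R) / D%:R)).
    apply: ler_wpM2r; first by rewrite invr_ge0 ltW.
    apply: le_trans (H (2 * D)%N _); last by rewrite muln_gt0.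
    by rewrite [leRHS](@big_cat_nat _ _ _ D.+1) //= ?ltnS ?leq_pmull // lerDr sumr_ge0.
  rewrite /K -!mulrA; apply: ler_wpM2l => //.
  have DE : D%:R = X%:R * 2 ^+ i :> R by rewrite /D natrM natrX.
  have -> : ln (2 * D)%:R = i.+1%:R * ln 2 + ln X%:R :> R.
    have -> : (2 * D)%N = (2 ^ i.+1 * X)%N by rewrite /D expnS mulnCA mulnC -mulnA.
    by rewrite ln_natM ?expn_gt0 // ln_natX.
  rewrite DE invfM; rewrite mulrA [leRHS]mulrA mulrA; apply: ler_wpM2r; first by rewrite invr_ge0 ltW.
  rewrite [leRHS]mulrAC; apply: ler_wpM2r; first by rewrite invr_ge0 ltW.
  have h1 : i.+1%:R * ln 2 <= i.+1%:R * 1 :> R by apply: ler_wpM2l => //; exact: ln2_le1.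
  have h2 : 0 <= i.+1%:R * ln X%:R :> R by rewrite mulr_ge0.
  by rewrite -[i.+2%:R]natr1; move: h1 h2; move: (i.+1%:R : R) => *; lra.
rewrite -mulr_sumr.
have E I : \sum_(i < I) (i.+2%:R / 2 ^+ i) = 6 - (2 * I%:R + 6) / 2 ^+ I :> R.
  elim: I => [|I IH]; first by rewrite big_ord0 mulr0 add0r expr0 divr1 subrr.
  have pR : 0 < 2 ^+ I :> R by rewrite exprn_gt0.
  rewrite big_ord_recr /= IH exprS -[I.+2%:R]natr1 -[I.+1%:R]natr1.
  by field; rewrite gt_eqF.
have h : \sum_(i < Y) (i.+2%:R / 2 ^+ i) <= 6 :> R.
  by rewrite E gerBl divr_ge0 ?addr_ge0 ?mulr_ge0 // exprn_ge0.
apply: le_trans (ler_wpM2l K0 h) _; apply: eq_le_trivial; rewrite /K; ring.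
Qed.

Lemma primes_fact (X q : nat) : (q \in primes X`!) = prime q && (q <= X)%N.
Proof.
rewrite mem_primes fact_gt0 /=; case pq : (prime q) => //=.
apply/idP/idP => [|qX]; last by rewrite dvdn_fact // prime_gt0.
elim: X => [|X IH]; first by rewrite fact0 dvdn1 => /eqP q1; rewrite q1 in pq.
rewrite factS Euclid_dvdM // => /orP[h|/IH h]; first exact: dvdn_leq.
exact: leq_trans h _.
Qed.

Lemma prod_primes_mulf (R : realType) (w : nat -> R) (X : nat) :
  \prod_(0 <= p < X.+1 | prime p) (1 + w p) = \sum_(d <- divisors X`!) mulf w d.
Proof.
rewrite sum_mulf_divisors ?fact_gt0 // -big_filter; apply: perm_big; apply: uniq_perm.
- by rewrite filter_uniq // iota_uniq.
- exact: primes_uniq.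
by move=> q; rewrite mem_filter mem_index_iota primes_fact ltnS.
Qed.

Lemma nu_itv (R : realType) (k p : nat) : (0 < k)%N -> prime p -> 0 <= nu R k p <= 1.
Proof.
move=> k0 pp; have pR : 0 < p%:R ^+ k :> R by rewrite exprn_gt0 // ltr0n prime_gt0.
have h := nu_nsq R k0 pp.
apply/andP; split; first by rewrite -(pmulr_rge0 _ pR) -h.
rewrite -(ler_pM2l pR) -h mulr1 -natrX ler_nat.
have := congr1 (fun i : nat => i%:R : R) (Phi_prime k pp).
by have := Phi_prime k pp; move=> hh _; rewrite -hh leq_addl.
Qed.

(** * The asymptotic formula *)

(** The Euler product over [p <= Y] is the finite sum over the divisors of [Y!]. These include every
    [d <= X] once [Y >= X], and the remaining divisors are controlled by [dyadic_tail], uniformly in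
    [Y]. The limit defining [C_] exists because all factors lie in [[0, 1]]. *)
Lemma C_even_sum (R : realType) (k X : nat) : ~~ odd k -> (0 < k)%N -> (0 < X)%N ->
  `|C_ R k - \sum_(1 <= d < X.+1) mulf (fun p => - nu R k p) d / d%:R|
  <= 6 * 2 * (1 + ln X%:R) / X%:R.
Proof.
move=> ek k0 X0; pose g := mulf (fun p => - nu R k p); pose w p := - nu R k p / p%:R.
set S := \sum_(1 <= d < X.+1) _; set T := 6 * 2 * _ / _.
have wg d : (0 < d)%N -> mulf w d = g d / d%:R.
  by move=> d0; rewrite /w (mulf_divr (fun p => - nu R k p)).
pose P N := \prod_(0 <= p < N | prime p) (1 + w p).
pose Q N := \prod_(0 <= p < N | prime p && (2 < p)%N) even_factor R k p.
have PS Y : (X <= Y)%N -> `|P Y.+1 - S| <= T.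
  move=> XY; rewrite /P prod_primes_mulf.
  have XYf : (X <= Y`!)%N by apply: dvdn_leq; rewrite ?fact_gt0 // dvdn_fact // X0.
  rewrite (@sum_divisors_nat _ _ _ Y`!) ?fact_gt0 ?leqnn //.
  rewrite (@big_cat_nat _ _ _ X.+1) //=.
  have -> : \sum_(1 <= d < X.+1 | (d %| Y`!)%N) mulf w d = S.
    rewrite big_mkcond /S big_nat [RHS]big_nat; apply: eq_bigr => d /andP[d0 dX].
    by rewrite dvdn_fact ?wg // d0 (leq_trans _ XY).
  rewrite addrAC subrr add0r; apply: le_trans (ler_norm_sum _ _ _) _.
  apply: (@le_trans _ _ (\sum_(X.+1 <= d < Y`!.+1) `|g d| / d%:R)).
    rewrite big_mkcond big_nat [leRHS]big_nat; apply: ler_sum => d /andP[d0 _].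
    have dp : (0 < d)%N by exact: leq_ltn_trans d0.
    have n0 : 0 <= `|g d| / d%:R by rewrite divr_ge0.
    by case: ifP => // _; rewrite wg // normrM normfV [`|d%:R|]ger0_norm.
  apply: (@dyadic_tail R (fun d => `|g d|) 2) => // Z Z0; exact: sum_abs_even.
have factor p : prime p -> (2 < p)%N -> even_factor R k p = 1 + w p.
  move=> pp p2; have pR : 0 < p%:R :> R by rewrite ltr0n prime_gt0.
  rewrite /even_factor /w /nu (negPf ek) /= (_ : (p == 2) = false); last by case: p p2 {pp pR} => [|[|[|]]].
  rewrite (exprD _ _ 2) (exprD _ _ 1) expr1; move: (exprn_gt0 (k %/ 2) pR).
  by move: (p%:R ^+ (k %/ 2)) ((-1) ^+ _) => z s z0; field; rewrite !gt_eqF.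
have f01 p : prime p -> (2 < p)%N -> 0 <= even_factor R k p <= 1.
  move=> pp p2; rewrite factor // /w; have /andP[n0 n1] := nu_itv R k0 pp.
  have p1 : 1 <= p%:R :> R by rewrite ler1n prime_gt0.
  have pR : 0 < p%:R :> R by exact: lt_le_trans p1.
  have a0 : 0 <= nu R k p / p%:R by rewrite divr_ge0 // ltW.
  have a1 : nu R k p / p%:R <= 1 by rewrite ler_pdivrMr // mul1r (le_trans n1).
  by rewrite mulNr; apply/andP; split; lra.
(* The prime 2 contributes [1 - nu 2 / 2 = 1 - 1/4], the constant [3/4] of [C_]. *)
have PQ N : (2 < N)%N -> P N = 3 / 4 * Q N.
  move=> N2; rewrite /P big_mkcond (bigD1_seq 2) ?iota_uniq ?mem_index_iota //=; congr (_ * _).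
    by rewrite /w /nu orbT; field.
  rewrite /Q big_mkcond [RHS]big_mkcond; apply: eq_bigr => p _.
  case pp : (prime p); last by rewrite if_same.
  have -> : (2 < p)%N = (p != 2) by rewrite ltn_neqAle eq_sym prime_gt1 // andbT.
  by case: ifP => // p2; rewrite factor // ltn_neqAle eq_sym p2 prime_gt1.
have Q0 N : 0 <= Q N by apply: prodr_ge0 => p /andP[pp p2]; case/andP: (f01 p pp p2).
have Qdec : nonincreasing_seq Q.
  apply/nonincreasing_seqP => N; rewrite /Q big_mkcond [leRHS]big_mkcond big_nat_recr //=.
  rewrite -big_mkcond -/(Q N) -[leRHS]mulr1; apply: ler_wpM2l => //.
  by case: ifP => // /andP[pp p2]; case/andP: (f01 N pp p2).
have Qcvg : cvgn Q.
  by apply: nonincreasing_is_cvgn => //; exists 0 => _ [N _ <-].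
have CE : C_ R k = 3 / 4 * limn Q by rewrite /C_ (negPf ek).
apply/ler_addgt0Pr => e e0; rewrite CE.
move/cvgrPdist_lt: Qcvg => /(_ e e0)[N0 _ HN].
pose Y := maxn N0 (maxn X 2).
have h := HN Y.+1 (leq_trans (leq_maxl _ _) (leqnSn _)).
have XY : (X <= Y)%N by rewrite /Y !leq_max leqnn orbT.
have Y2 : (2 < Y.+1)%N by rewrite /Y ltnS !leq_max leqnn !orbT.
have h2 := PS Y XY; rewrite PQ // in h2.
have -> : 3 / 4 * limn Q - S = (3 / 4 * Q Y.+1 - S) + 3 / 4 * (limn Q - Q Y.+1) by ring.
apply: le_trans (ler_normD _ _) _; apply: lerD => //.
rewrite normrM [`|3 / 4|]ger0_norm //; have := normr_ge0 (limn Q - Q Y.+1).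
by move: h; move: (`|_|) => *; lra.
Qed.

Lemma truncn_div (R : realType) (x : R) (d : nat) : 0 <= x -> (0 < d)%N ->
  Num.truncn (x / d%:R) = (Num.truncn x %/ d)%N.
Proof.
move=> x0 d0; have dR : 0 < d%:R :> R by rewrite ltr0n.
have /andP[h1 h2] := truncn_itv x0; apply: truncn_def.
rewrite ler_pdivlMr // ltr_pdivrMr // -!natrM; apply/andP; split.
  by apply: le_trans h1; rewrite ler_nat leq_trunc_div.
by apply: (lt_le_trans h2); rewrite ler_nat -ltn_divLR.
Qed.

(** The error [(x / d)^(k-1)] of the inner power sum is weighted by [|g d| d^k], so [x^(k-1)]
    factors out and [d |g d|] is left to be summed. *)
Lemma sum_Phi_expand (R : realType) (k : nat) : (0 < k)%N -> exists2 c : R, 0 <= c &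
  forall x : R, 1 <= x ->
  `|\sum_(1 <= n < (Num.truncn x).+1) (Phi k n)%:R
    - (x ^+ k.+1 / k.+1%:R
         * (\sum_(1 <= d < (Num.truncn x).+1) mulf (fun p => - nu R k p) d / d%:R)
       - x ^+ k * \sum_(1 <= d < (Num.truncn x).+1)
           mulf (fun p => - nu R k p) d * sawtooth (x / d%:R))|
  <= c * x ^+ k.-1
      * \sum_(1 <= d < (Num.truncn x).+1) d%:R * `|mulf (fun p => - nu R k p) d|.
Proof.
move=> k0; have [c c0 H] := power_sum_sawtooth R k0; exists c => // x x1.
pose g := mulf (fun p => - nu R k p); set X := Num.truncn x.
have x0 : 0 <= x by lra.
have /andP[X1 X2] : X%:R <= x < X.+1%:R by exact: truncn_itv.
have -> : \sum_(1 <= n < X.+1) (Phi k n)%:R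
   = \sum_(1 <= d < X.+1) g d * d%:R ^+ k * \sum_(1 <= m < (X %/ d).+1) m%:R ^+ k :> R.
  under [RHS]eq_bigr do rewrite mulr_sumr.
  rewrite -(sum_divisors_swap (fun d m => g d * d%:R ^+ k * m%:R ^+ k)).
  rewrite big_nat [RHS]big_nat; apply: eq_bigr => n /andP[n0 _].
  rewrite (Phi_prod R k0 n0) -(sum_mulf_divisors (fun p => - nu R k p)) // mulr_sumr.
  rewrite big_seq [RHS]big_seq; apply: eq_bigr => d; rewrite -dvdn_divisors // => dn.
  by rewrite -mulrA -exprMn -natrM [(d * _)%N]mulnC divnK // mulrC.
rewrite !mulr_sumr -!sumrB; apply: le_trans (ler_norm_sum _ _ _) _.
rewrite big_nat [leRHS]big_nat; apply: ler_sum => d /andP[d0 dX]; rewrite ltnS in dX.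
have dR : 0 < d%:R :> R by rewrite ltr0n.
have dx : d%:R <= x by apply: le_trans X1; rewrite ler_nat.
have y1 : 1 <= x / d%:R by rewrite ler_pdivlMr // mul1r.
have := H _ y1; rewrite truncn_div // -/X; set A := \sum_(1 <= m < _) _; set E := A - _ => hE.
rewrite -/(g d).
have kp : (0 < k.+1%:R :> R) by rewrite ltr0n.
have -> : g d * d%:R ^+ k * A - (x ^+ k.+1 / k.+1%:R * (g d / d%:R) - x ^+ k * (g d * sawtooth (x / d%:R)))
  = g d * d%:R ^+ k * E.
  rewrite /E !expr_div_n [d%:R ^+ k.+1]exprS [x ^+ k.+1]exprS; move: kp (exprn_gt0 k dR).
  by move: (sawtooth _) (d%:R ^+ k) (x ^+ k) (k.+1%:R) => s z v K K0 z0; field; rewrite !gt_eqF.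
rewrite normrM normrM [`|d%:R ^+ k|]ger0_norm ?exprn_ge0 //.
apply: le_trans (ler_wpM2l _ hE) _; first by rewrite mulr_ge0 // exprn_ge0.
apply: eq_le_trivial; rewrite -{1}(prednK k0) [d%:R ^+ k.-1.+1]exprS expr_div_n.
move: (exprn_gt0 k.-1 dR); move: (`|g d|) (d%:R ^+ k.-1) (x ^+ k.-1) => s z v z0.
by field; rewrite gt_eqF.
Qed.

Lemma odd_nu_mobius (R : realType) (k d : nat) : odd k -> (0 < d)%N ->
  mulf (fun p => - nu R k p) d = mobius R d / d%:R.
Proof.
move=> ok d0; rewrite -(mulf_divr (fun=> -1)) //; congr (mulf _ d); apply/funext => p.
by rewrite /nu ok mul1r mulN1r.
Qed.

Lemma exp_div_truncn_le (R : realType) (x : R) (k : nat) : 1 <= x ->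
  x ^+ k.+1 / (Num.truncn x)%:R <= 2 * x ^+ k.
Proof.
move=> x1; have x0 : 0 <= x by lra.
have /andP[h1 h2] := truncn_itv x0; rewrite -natr1 in h2.
have X1 : 1 <= (Num.truncn x)%:R :> R by rewrite ler1n truncn_gt0.
rewrite ler_pdivrMr; last by lra.
rewrite exprSr -mulrA mulrCA; apply: ler_wpM2l; first by rewrite exprn_ge0.
lra.
Qed.

Lemma sum_Phi_odd (R : realType) (k : nat) : odd k -> (0 < k)%N -> exists C M : R,
  forall x : R, M <= x ->
  `|\sum_(1 <= n < (Num.truncn x).+1) (Phi k n)%:R - 6 / pi ^+ 2 / k.+1%:R * x ^+ k.+1|
  <= C * (x ^+ k * walfisz (ln x)).
Proof.
move=> ok k0; have [c c0 H] := sum_Phi_expand R k0; have [L0 HW] := walfisz_sum R.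
(* 2 comes from the tail of the series for [6 / pi^2], 122 from [walfisz_sum], and [c] from the
   power sums, where [d |g d| <= 1]. The bound [x >= exp (exp 1)] gives [walfisz (ln x) >= 1], so
   that terms of size [x^k] are absorbed. *)
exists (2 + 122 + c), (Num.max (expR L0) (expR (expR 1))) => x; rewrite ge_max => /andP[M1 M2].
have lnL0 : L0 <= ln x by exact: ln_ge_expR.
have lne : expR 1 <= ln x by exact: ln_ge_expR.
have e1 : 1 <= expR 1 :> R by rewrite -expR0 ler_expR.
have x1 : 1 <= x by apply: le_trans M2; apply: (le_trans e1); exact: expR_ge_id.
have x0 : 0 < x by lra.
have := H x x1; set X := Num.truncn x; set F := \sum_(1 <= n < X.+1) (Phi k n)%:R.
have X0 : (0 < X)%N by rewrite truncn_gt0.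
have /andP[h1 h2] : X%:R <= x < X.+1%:R by apply: truncn_itv; exact: ltW.
have -> : \sum_(1 <= d < X.+1) mulf (fun p => - nu R k p) d / d%:R
   = \sum_(1 <= d < X.+1) mobius R d / d%:R ^+ 2.
  rewrite big_nat [RHS]big_nat; apply: eq_bigr => d /andP[d0 _].
  by rewrite odd_nu_mobius // -mulrA -invfM -expr2.
have -> : \sum_(1 <= d < X.+1) mulf (fun p => - nu R k p) d * sawtooth (x / d%:R)
   = \sum_(1 <= d < X.+1) mobius R d / d%:R * sawtooth (x / d%:R).
  by rewrite big_nat [RHS]big_nat; apply: eq_bigr => d /andP[d0 _]; rewrite odd_nu_mobius.
set S := \sum_(1 <= d < X.+1) mobius R d / d%:R ^+ 2; set Z := \sum_(1 <= d < X.+1) _ * sawtooth _.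
set G := \sum_(1 <= d < X.+1) _ => hF.
have GX : G <= X%:R.
  apply: (@le_trans _ _ (\sum_(1 <= d < X.+1) 1)); last first.
    by rewrite sumr_const_nat subn1.
  rewrite /G big_nat [leRHS]big_nat; apply: ler_sum => d /andP[d0 _].
  have dR : 0 < d%:R :> R by rewrite ltr0n.
  rewrite odd_nu_mobius // normrM normfV (gtr0_norm dR) mulrCA divff ?gt_eqF // mulr1.
  exact: norm_mobius_le1.
have hZ : `|Z| <= 122 * walfisz (ln x) by exact: HW.
have hS := sum_mobius_inv_sq R X0; rewrite -/S in hS.
have W1 : 1 <= walfisz (ln x).
  have l1 : 1 <= ln x by exact: le_trans lne.
  apply: le_trans (walfisz_ge l1); rewrite exprn_ege1 //; exact: ln_ge_expR.
have xk : 0 < x ^+ k by rewrite exprn_gt0.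
have kR : 1 <= k.+1%:R :> R by rewrite ler1n.
have XR : 0 < X%:R :> R by rewrite ltr0n.
have t1 : `|x ^+ k.+1 / k.+1%:R * (S - 6 / pi ^+ 2)| <= 2 * x ^+ k.
  rewrite normrM distrC ger0_norm; last by rewrite divr_ge0 ?exprn_ge0 // ltW.
  apply: le_trans (exp_div_truncn_le k x1); rewrite -/X.
  apply: (@le_trans _ _ (x ^+ k.+1 * (1 / X%:R))); last by rewrite mul1r.
  apply: ler_pM => //; first by rewrite divr_ge0 ?exprn_ge0 // ltW.
  by rewrite ler_pdivrMr ?(lt_le_trans _ kR) // ler_peMr // exprn_ge0 // ltW.
have t2 : `|x ^+ k * Z| <= x ^+ k * (122 * walfisz (ln x)).
  by rewrite normrM (gtr0_norm xk); apply: ler_wpM2l => //; exact: ltW.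
have t3 : c * x ^+ k.-1 * G <= c * x ^+ k.
  rewrite -mulrA; apply: ler_wpM2l => //.
  apply: (@le_trans _ _ (x ^+ k.-1 * x)); last by rewrite -exprSr prednK.
  by apply: ler_wpM2l; [rewrite exprn_ge0 // ltW | exact: le_trans GX h1].
have -> : F - 6 / pi ^+ 2 / k.+1%:R * x ^+ k.+1
  = (F - (x ^+ k.+1 / k.+1%:R * S - x ^+ k * Z)) + x ^+ k.+1 / k.+1%:R * (S - 6 / pi ^+ 2) - x ^+ k * Z.
  by ring.
apply: le_trans (ler_normB _ _) _; apply: le_trans (lerD (ler_normD _ _) t2) _.
apply: le_trans (lerD (lerD (le_trans hF t3) t1) (lexx _)) _.
have h3 : x ^+ k <= x ^+ k * walfisz (ln x) by rewrite ler_peMr // ltW.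
have h4 : c * x ^+ k <= c * (x ^+ k * walfisz (ln x)) by apply: ler_wpM2l.
by move: h3 h4; move: (x ^+ k) (walfisz _) => a b; rewrite !mulrDl; move: (c * _) (c * _); clear => *; lra.
Qed.

Lemma sum_Phi_even (R : realType) (k : nat) : ~~ odd k -> (0 < k)%N -> exists C M : R,
  forall x : R, M <= x ->
  `|\sum_(1 <= n < (Num.truncn x).+1) (Phi k n)%:R - C_ R k / k.+1%:R * x ^+ k.+1|
  <= C * (x ^+ k * ln x).
Proof.
move=> ek k0; have [c c0 H] := sum_Phi_expand R k0.
(* The contributions are [48] from completing the Euler product, [4] from bounding the sawtooth by
   1, and [4 c] from the power sums; [x >= exp 1] turns each [1 + ln X] into at most [2 ln x]. *)
exists (2 * (24 + 2 + 2 * c)), (expR 1) => x M1.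
have L1 : 1 <= ln x by exact: ln_ge_expR.
have x1 : 1 <= x by apply: le_trans M1; rewrite -expR0 ler_expR.
have x0 : 0 < x by lra.
have := H x x1; set X := Num.truncn x; set F := \sum_(1 <= n < X.+1) (Phi k n)%:R.
have X0 : (0 < X)%N by rewrite truncn_gt0.
have /andP[h1 h2] : X%:R <= x < X.+1%:R by apply: truncn_itv; exact: ltW.
have XR : 0 < X%:R :> R by rewrite ltr0n.
have hA := sum_abs_even R ek k0 X0; have hS := C_even_sum R ek k0 X0.
set S := \sum_(1 <= d < X.+1) _ / _ in hS *; set Z := \sum_(1 <= d < X.+1) _ * sawtooth _.
set G := \sum_(1 <= d < X.+1) _ * `|_|; set A := \sum_(1 <= d < X.+1) _ in hA => hF.
have lX : ln X%:R <= ln x by rewrite ler_ln ?posrE.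
have A2 : A <= 2 * (2 * ln x) by apply: (le_trans hA); move: lX L1; clear => *; lra.
have ZA : `|Z| <= A.
  apply: le_trans (ler_norm_sum _ _ _) _; apply: ler_sum => d _.
  rewrite normrM -[leRHS]mulr1; apply: ler_wpM2l => //.
  have : `|sawtooth (x / d%:R)| <= 1 / 2 by apply: sawtooth_le; rewrite divr_ge0 // ltW.
  lra.
have GA : G <= x * A.
  rewrite /A mulr_sumr /G big_nat [leRHS]big_nat; apply: ler_sum => d /andP[_ dX].
  by apply: ler_wpM2r => //; apply: le_trans h1; rewrite ler_nat.
have xk : 0 < x ^+ k by rewrite exprn_gt0.
have kR : 1 <= k.+1%:R :> R by rewrite ler1n.
have lX0 : 0 <= ln X%:R :> R := ln_nat_ge0 _ _.
have t1 : `|x ^+ k.+1 / k.+1%:R * (S - C_ R k)| <= 24 * (x ^+ k * (2 * ln x)).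
  rewrite normrM distrC ger0_norm; last by rewrite divr_ge0 ?exprn_ge0 // ltW.
  have h3 := exp_div_truncn_le k x1; rewrite -/X in h3.
  apply: (@le_trans _ _ (x ^+ k.+1 * (6 * 2 * (1 + ln X%:R) / X%:R))).
    apply: ler_pM => //; first by rewrite divr_ge0 ?exprn_ge0 // ltW.
    by rewrite ler_pdivrMr ?(lt_le_trans _ kR) // ler_peMr // exprn_ge0 // ltW.
  rewrite (_ : _ * _ = 12 * (x ^+ k.+1 / X%:R * (1 + ln X%:R))); last by ring.
  rewrite (_ : 24 * _ = 12 * (2 * x ^+ k * (2 * ln x))); last by ring.
  apply: ler_wpM2l => //; apply: ler_pM => //; first by rewrite divr_ge0 ?exprn_ge0 // ltW.
    by move: lX0; clear => *; lra.
  by move: lX L1; clear => *; lra.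
have t2 : `|x ^+ k * Z| <= x ^+ k * (2 * (2 * ln x)).
  by rewrite normrM (gtr0_norm xk); apply: ler_wpM2l; [exact: ltW | exact: le_trans ZA A2].
have t3 : c * x ^+ k.-1 * G <= c * (x ^+ k * (2 * (2 * ln x))).
  rewrite -mulrA; apply: ler_wpM2l => //.
  have -> : x ^+ k = x ^+ k.-1 * x by rewrite -exprSr prednK.
  rewrite -mulrA; apply: ler_wpM2l; first by rewrite exprn_ge0 // ltW.
  by apply: (le_trans GA); apply: ler_wpM2l => //; exact: ltW.
have -> : F - C_ R k / k.+1%:R * x ^+ k.+1
  = (F - (x ^+ k.+1 / k.+1%:R * S - x ^+ k * Z)) + x ^+ k.+1 / k.+1%:R * (S - C_ R k) - x ^+ k * Z.
  by ring.
apply: le_trans (ler_normB _ _) _; apply: le_trans (lerD (ler_normD _ _) t2) _.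
apply: le_trans (lerD (lerD (le_trans hF t3) t1) (lexx _)) _.
have p0 : 0 <= x ^+ k * ln x by rewrite mulr_ge0 // ?(ltW xk) // (le_trans ler01).
have p1 : 0 <= c * (x ^+ k * ln x) by rewrite mulr_ge0.
rewrite (_ : x ^+ k * (2 * (2 * ln x)) = 4 * (x ^+ k * ln x)); last by ring.
rewrite (_ : x ^+ k * (2 * ln x) = 2 * (x ^+ k * ln x)); last by ring.
by move: p0 p1; move: (x ^+ k * ln x) => t; clear => *; lra.
Qed.

Local Open Scope classical_set_scope.

Theorem theorem2 (R : realType) (k : nat) (hk : (0 < k)%N) :
  (fun x : R => \sum_(1 <= n < (Num.truncn x).+1) (Phi k n)%:R : R) =
    (fun x : R => C_ R k / (k%:R + 1) * x ^+ (k + 1))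
      +O_ (pinfty_nbhs R) (fun x : R => x ^+ k * R_ k x).
Proof.
have [C [M H]] : exists C M : R, forall x : R, M <= x ->
  `|\sum_(1 <= n < (Num.truncn x).+1) (Phi k n)%:R - C_ R k / (k%:R + 1) * x ^+ (k + 1)|
  <= C * (x ^+ k * R_ k x).
  rewrite natr1 addn1; have [ok|ek] := boolP (odd k).
    have [C [M H]] := sum_Phi_odd R ok hk; exists C, M => x Mx.
    by rewrite /C_ /R_ ok; exact: H.
  have [C [M H]] := sum_Phi_even R ek hk; exists C, M => x Mx.
  by rewrite /R_ (negPf ek); exact: H.
apply/eqaddOP/bigO_exP; exists (`|C| + 1); first by rewrite ltr_wpDl.
exists M; split; first exact: num_real.
move=> x Mx; apply: (le_trans (H x (ltW Mx))).
apply: (@le_trans _ _ (`|C| * `|x ^+ k * R_ k x|)).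
  by rewrite -normrM ler_norm.
by apply: ler_wpM2r => //; rewrite lerDl.
Qed.
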